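(* Let $q\ge 1$ be an integer and $T>0$. For every bounded measurable symmetric function $F:\mathbb{D}([0,T],\mathbb{R}^d)^q\to\mathbb{R}$, every integer $l_0\ge 1$ and every $N\ge\max(q,2)$, $$\mathbb{E}\big((\eta^N_{0:T})^{\odot q}(F)\big)=\sum_{0\le l\le l_0}\frac{1}{(N-1)^l}\Delta^{N,l}_{q,T}(F)+\frac{1}{(N-1)^{l_0+1}}\overline{\Delta}^{N,l_0+1}_{q,T}(F),$$ where $\Delta^{N,l}_{q,T}$ and $\overline{\Delta}^{N,l_0+1}_{q,T}$ are the nonnegative measures defined (using the backward system with $p=q$ roots) by $$\Delta^{N,l}_{q,T}(F)=(N-1)^l\,\mathbb{E}\big(F(Z^1_{0:T},\dots,Z^q_{0:T})\mid L_T=l\big)\,\mathbb{P}(L_T=l),$$ $$\overline{\Delta}^{N,l}_{q,T}(F)=(N-1)^l\,\mathbb{E}\big(F(Z^1_{0:T},\dots,Z^q_{0:T})\mid L_T\ge l\big)\,\mathbb{P}(L_T\ge l)$$ (a product being $0$ when the conditioning event has probability $0$), and these measures are uniformly bounded in $N$.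
   Context: **Setting.** $d\ge1$ and $0<\Lambda<\infty$ are fixed; $[n]=\{1,\dots,n\}$; $\mathbb{D}([0,T],\mathbb{R}^d)$ is the Skorohod space. $L$ is the generator of a Markov process on $\mathbb{R}^d$ with paths in $\mathbb{D}(\mathbb{R}_+,\mathbb{R}^d)$, acting on a domain $\mathcal{D}(L)\subset L^\infty(\mathbb{R}^d)$. $\widehat\mu(v,w,dh,dk)$ is a nonnegative kernel from $\mathbb{R}^{2d}$ to $\mathbb{R}^{2d}$, symmetric in the sense $\widehat\mu(v,w,dh,dk)=\widehat\mu(w,v,dk,dh)$, with $\sup_{x,a}\widehat\mu(x,a,\mathbb{R}^d\times\mathbb{R}^d)\le\Lambda$. $\widetilde P_0$ is a probability law on $\mathbb{R}^d$. **Particle system.** For $N\ge2$, $\overline Z_t=(\overline Z^i_t)_{1\le i\le N}$, $t\ge 0$, is the system of $N$ particles in $\mathbb{R}^d$ such that: the $\overline Z^i_0$ are i.i.d. with law $\widetilde P_0$; between interaction times the particles evolve independently according to $L$; to each pair $i<j$ is attached a Poisson process of parameter $\Lambda/(N-1)$ (all independent), whose jump times are the interaction times between $i$ and $j$; at an interaction time $t$ between $i$ and $j$, with probability $\widehat\mu(\overline Z^i_{t-},\overline Z^j_{t-},\mathbb{R}^{2d})/\Lambda$ the particles jump: $\overline Z^i_t=\overline Z^i_{t-}+H$, $\overline Z^j_t=\overline Z^j_{t-}+K$, the others unchanged, with $(H,K)$ of law $\widehat\mu(\overline Z^i_{t-},\overline Z^j_{t-},\cdot)/\widehat\mu(\overline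 Z^i_{t-},\overline Z^j_{t-},\mathbb{R}^{2d})$ independent of everything else; with the complementary probability there is no jump. For a process $X$, $X_{0:T}=(X_s)_{0\le s\le T}$. **Empirical measures.** With $(N)_q=N!/(N-q)!$, $$(\eta^N_{0:T})^{\odot q}=\frac{1}{(N)_q}\sum_{a:[q]\to[N]\text{ injective}}\delta_{(\overline Z^{a(1)}_{0:T},\dots,\overline Z^{a(q)}_{0:T})}.$$ $F$ is symmetric if it is invariant under permutations of its $q$ arguments. **Backward system with $p$ roots.** Let $1\le p\le N$, $N\ge2$. Set $C^i_0=\{i\}$ for $i\in[p]$; write $C_t=C^1_t\cup\dots\cup C^p_t$, $K^i_t=\#C^i_t$, $K_t=\#C_t$. Let $(U_k)_{k\ge1},(V_k)_{k\ge1}$ be i.i.d. exponential variables of parameter $1$. Put $T_0=0$ and recursively (with $\inf\emptyset=+\infty$) $$T'_k=\inf\Big\{T_{k-1}\le s\le T:(s-T_{k-1})\tfrac{\Lambda K_{T_{k-1}}(N-K_{T_{k-1}})_+}{N-1}\ge U_k\Big\},$$ $$T''_k=\inf\Big\{T_{k-1}\le s\le T:(s-T_{k-1})\tfrac{\Lambda K_{T_{k-1}}(K_{T_{k-1}}-1)}{2(N-1)}\ge V_k\Big\},\qquad T_k=\inf(T'_k,T''_k).$$ The sets $C^i$ are constant between these times. If $T_k=T'_k<\infty$, draw $r(k)$ uniformly in $C_{T_k-}$ and $j(k)$ uniformly in $[N]\setminus C_{T_k-}$, and add $j(k)$ to each $C^i$ with $r(k)\in C^i_{T_k-}$. If $T_k=T''_k<\infty$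 draw $r(k)$ uniformly in $C_{T_k-}$ and $j(k)$ uniformly in $C_{T_k-}\setminus\{r(k)\}$; the sets do not change. Let $L_t=\#\{k\ge1:T_k\le t,\ T_k=T''_k\}$. The system $(Z^i_s)_{0\le s\le T,1\le i\le N}$ has $Z^i_0$ i.i.d. of law $\widetilde P_0$; its interaction times are the $T-T_k$ with $T_k<\infty$; between them the particles evolve independently according to $L$; at time $T-T_k$ particles $r(k)$ and $j(k)$ undergo an interaction by the same rule as in the definition of $\overline Z$ with $(i,j)$ replaced by $(r(k),j(k))$. *)

(* Defs.v *)
From HB Require Import structures.
From mathcomp Require Import all_boot all_order all_fingroup all_algebra.
From mathcomp Require Import all_classical all_reals all_analysis.
From mathcomp Require Import measurable_realfun.

Set Implicit Arguments.
Unset Strict Implicit.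
Unset Printing Implicit Defensive.

Import Order.TTheory GRing.Theory Num.Theory.
Import numFieldNormedType.Exports.

Local Open Scope classical_set_scope.
Local Open Scope ring_scope.

(* Borel sigma-algebra of R^d, as the product sigma-algebra *)
Definition borel_rV_display : measure_display. Proof. exact. Qed.

Section borel_rV.
Variables (R : realType) (d : nat).

Definition borel_rV : set (set 'rV[R]_d) :=
  <<s [set A | exists i (B : set R),
         measurable B /\ A = [set x : 'rV[R]_d | B (x ord0 i)]] >>.

Let borel_rV0 : borel_rV set0. Proof. exact: sigma_algebra0. Qed.
Let borel_rVC A : borel_rV A -> borel_rV (~` A).
Proof. exact: sigma_algebraC. Qed.
Let borel_rV_bigcup (F : (set 'rV[R]_d)^nat) :
  (forall i, borel_rV (F i)) -> borel_rV (\bigcup_i (F i)).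
Proof. exact: sigma_algebra_bigcup. Qed.

HB.instance Definition _ := @isMeasurable.Build borel_rV_display 'rV[R]_d
  borel_rV borel_rV0 borel_rVC borel_rV_bigcup.
End borel_rV.

(* The Skorohod space D(J, R^d) over an interval J of the real line. To have
   one element per function on J, a path is a total function that vanishes
   outside J. The topologies at a point t of J are those induced on J, so
   that for J = [0, T] nothing is asked on the right of T or on the left
   of 0. *)
Section skorohod.
Variables (R : realType) (d : nat) (J : set R).

Definition cadlag (w : R -> 'rV[R]_d) := forall t, J t ->
  (w @ within J (at_right t) --> w t) /\ cvg (w @ within J (at_left t)).

Record skorohod := Skorohod {
  path_of :> R -> 'rV[R]_d ;
  path_cadlag : cadlag path_of ;
  path_out : forall t, ~ J t -> path_of t = 0 }.

Lemma cadlag0 : cadlag (fun=> 0).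
Proof.
by move=> t _; split; [exact: cvg_cst | apply/cvg_ex; exists 0; exact: cvg_cst].
Qed.

Definition skorohod0 : skorohod := Skorohod cadlag0 (fun _ _ => erefl).

HB.instance Definition _ := gen_eqMixin skorohod.
HB.instance Definition _ := gen_choiceMixin skorohod.
HB.instance Definition _ := isPointed.Build skorohod skorohod0.

Definition skorohod_display : measure_display. Proof. exact. Qed.

(* The Borel sigma-algebra of the Skorohod topology is the one generated by
   the evaluations. *)
Definition skorohod_measurable : set (set skorohod) :=
  <<s [set A | exists t (B : set 'rV[R]_d),
         [/\ J t, measurable B & A = [set w : skorohod | B (w t)]]] >>.

Let skorohod_measurable0 : skorohod_measurable set0.
Proof. exact: sigma_algebra0. Qed.
Let skorohod_measurableC A :
  skorohod_measurable A -> skorohod_measurable (~` A).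
Proof. exact: sigma_algebraC. Qed.
Let skorohod_measurable_bigcup (F : (set skorohod)^nat) :
  (forall i, skorohod_measurable (F i)) -> skorohod_measurable (\bigcup_i (F i)).
Proof. exact: sigma_algebra_bigcup. Qed.

HB.instance Definition _ := @isMeasurable.Build skorohod_display skorohod
  skorohod_measurable skorohod_measurable0 skorohod_measurableC
  skorohod_measurable_bigcup.

(* w_{t-}; meaningful for t in J other than its left end point *)
Definition left_lim (w : skorohod) (t : R) : 'rV[R]_d := lim (w @ at_left t).

End skorohod.

(* D(R_+, R^d) and D([0, T], R^d) *)
Notation Dinf R d := (@skorohod R d [set` `[(0%R : R), +oo[%R ]).
Notation Dhor d T := (@skorohod _ d [set` `[0%R, T]%R ]).

Section restriction_shift.
Variables (R : realType) (d : nat).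
Local Notation E := 'rV[R]_d.

Lemma within_sub_patch (J : set R) (w : R -> E) (F : set_system R) (l : E) :
  Filter F -> w @ within J F --> l -> (patch (cst 0) J w) @ within J F --> l.
Proof.
move=> FF wl A /wl; rewrite /nbhs /= /within /= => h.
apply: filterS h => x h Jx; move: (h Jx).
by rewrite patchT// inE.
Qed.

Lemma within_subset_cvg (J J' : set R) (w : R -> E) (F : set_system R) (l : E) :
  Filter F -> J' `<=` J -> w @ within J F --> l -> w @ within J' F --> l.
Proof.
move=> FF JJ' wl A /wl; rewrite /nbhs /= /within /= => h.
by apply: filterS h => x h /JJ'.
Qed.

Lemma cadlag_restr (J J' : set R) (w : R -> E) :
  J' `<=` J -> cadlag J w -> cadlag J' (patch (cst 0) J' w).
Proof.
move=> JJ' cw t J't; have [rc /cvg_ex[l lc]] := cw _ (JJ' _ J't); split.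
- have -> : (patch (cst 0) J' w) t = w t by rewrite patchT// inE.
  by apply: within_sub_patch; exact: within_subset_cvg JJ' _.
- apply/cvg_ex; exists l; by apply: within_sub_patch; exact: within_subset_cvg JJ' _.
Qed.

Lemma patch_out (J : set R) (w : R -> E) t : ~ J t -> (patch (cst 0) J w) t = 0.
Proof. by move=> nJt; rewrite /patch; case: ifPn => // /set_mem. Qed.

Lemma sub_itv0T T : [set` `[(0 : R), T]] `<=` [set` `[(0 : R), +oo[].
Proof. by move=> x /=; rewrite !in_itv/= => /andP[->]. Qed.

(* X_{0:T} *)
Definition restr (T : R) (w : Dinf R d) : Dhor d T :=
  Skorohod (cadlag_restr (@sub_itv0T T) (@path_cadlag _ _ _ w)) (@patch_out _ _).

Lemma cadlag_shift (t : R) (w : R -> E) : 0 <= t ->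
  cadlag [set` `[(0 : R), +oo[] w ->
  cadlag [set` `[(0 : R), +oo[] (fun s => w (t + s)).
Proof.
move=> t0 cw s /= Js.
have s0 : 0 <= s by move: Js; rewrite in_itv/= andbT.
have Jts : [set` `[(0 : R), +oo[] (t + s) by rewrite /= in_itv/= addr_ge0.
have [rc /cvg_ex[l lc]] := cw _ Jts.
have shift_cvg (P : R -> R -> bool) (l0 : E) :
    (forall a b, P (t + a) (t + b) = P a b) ->
    w @ within [set` `[(0 : R), +oo[] (within (P (t + s)) (nbhs (t + s))) --> l0 ->
    (fun u => w (t + u)) @ within [set` `[(0 : R), +oo[] (within (P s) (nbhs s))
      --> l0.
  move=> hP wl A /wl; rewrite /nbhs /= /within /= => h.
  have : (t + u : R) @[u --> s] --> (t + s : R).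
    by apply: (@cvgD R R); [exact: cvg_cst|exact: cvg_id].
  move=> /(_ _ h) h'.
  have {}h' : nbhs s (fun u =>
    P (t + s) (t + u) -> t + u \in `[0, +oo[ -> A (w (t + u))) := h'.
  suff : nbhs s (fun u => P s u -> u \in `[0, +oo[ -> A (w (t + u))) by [].
  apply: filterS h' => u /= h1 Psu Ju.
  apply: h1; first by rewrite hP.
  by move: Ju; rewrite !in_itv/= !andbT => u0; rewrite addr_ge0.
split; last apply/cvg_ex; last exists l.
- exact: (shift_cvg (fun a b => a < b) _ (fun a b => ltrD2l t a b) rc).
- exact: (shift_cvg (fun a b => b < a) _ (fun a b => ltrD2l t b a) lc).
Qed.

Lemma cadlag_shift_max (t : R) (w : R -> E) :
  cadlag [set` `[(0 : R), +oo[] w ->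
  cadlag [set` `[(0 : R), +oo[]
    (patch (cst 0) [set` `[(0 : R), +oo[] (fun s => w (Num.max 0 t + s))).
Proof.
by move=> cw; apply: cadlag_restr (cadlag_shift _ cw); rewrite // le_max lexx.
Qed.

(* the shifted path s |-> w (t + s), for t >= 0 *)
Definition shift_path (t : R) (w : Dinf R d) : Dinf R d :=
  Skorohod (cadlag_shift_max t (@path_cadlag _ _ _ w)) (@patch_out _ _).

End restriction_shift.

Section markov.
Variables (R : realType) (d : nat).
Local Notation E := 'rV[R]_d.

Definition evals_upto (t : R) : set (set (Dinf R d)) :=
  <<s [set A | exists s (B : set E),
         [/\ 0 <= s <= t, measurable B & A = [set w : Dinf R d | B (w s)]]] >>.

(* [Pi x] is the law on D(R_+, R^d) of the process started at x *)
Definition markov_process (Pi : R.-pker E ~> Dinf R d) : Prop :=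
  (forall x, Pi x [set w : Dinf R d | w 0 = x] = 1%E) /\
  (forall x t (A B : set (Dinf R d)),
     0 <= t -> evals_upto t A -> measurable B ->
     Pi x (A `&` shift_path t @^-1` B) = (\int[Pi x]_(w in A) Pi (w t) B)%E).

Definition bounded_measurable {dT} {T : measurableType dT} (f : T -> R) : Prop :=
  measurable_fun setT f /\ exists M, forall x, `|f x| <= M.

Definition semigroup (Pi : R.-pker E ~> Dinf R d) (t : R) (f : E -> R) (x : E) : R :=
  \int[Pi x]_w f (w t).

(* [L], with domain [DL], is the generator of the semigroup of the process on
   the space of bounded measurable functions with the supremum norm. *)
Definition is_generator (Pi : R.-pker E ~> Dinf R d)
    (DL : set (E -> R)) (L : (E -> R) -> E -> R) : Prop :=
  let limit f g := forall e, 0 < e -> \forall t \near (0 : R)^'+,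
    forall x, `|t^-1 * (semigroup Pi t f x - f x) - g x| <= e in
  DL = [set f | bounded_measurable f /\
                exists2 g, bounded_measurable g & limit f g] /\
  (forall f, DL f -> limit f (L f)).

End markov.

Section interaction_kernel.
Variables (R : realType) (d : nat).
Local Notation E := 'rV[R]_d.

Definition symmetric_kernel (mu : R.-ker (E * E) ~> (E * E)%type) : Prop :=
  forall v w (A : set (E * E)), measurable A ->
    mu (v, w) A = mu (w, v) ((fun hk => (hk.2, hk.1)) @^-1` A).

End interaction_kernel.

Section exponential_family.
Context {dO : measure_display} {O : measurableType dO} {R : realType}.
Variable P : probability O R.

Definition iid_exponential (I : eqType) (rate : R) (X : I -> O -> R) : Prop :=
  [/\ forall i, measurable_fun setT (X i),
      forall i (B : set R), measurable B ->
        P (X i @^-1` B) = exponential_prob rate B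
    & forall (s : seq I) (B : I -> set R), uniq s ->
        (forall i, measurable (B i)) ->
        P [set w | forall i, i \in s -> B i (X i w)] =
        (\prod_(i <- s) P (X i @^-1` B i))%E].

End exponential_family.

(* classes of subsets generating the sigma-algebra of a family of random
   variables; the second one is for variables with finitely many values *)
Definition gen_by {dO dT} {O : measurableType dO} {T : measurableType dT} {K : Type}
    (X : K -> O -> T) : set (set O) :=
  \bigcup_k preimage_set_system setT (X k) measurable.

Definition gen_by_fin {dO} {O : measurableType dO} {T : finType} {K : Type}
    (X : K -> O -> T) : set (set O) :=
  \bigcup_k preimage_set_system setT (X k) setT.

Definition fin_measurable {dO} {O : measurableType dO} {T : finType}
    (X : O -> T) : Prop :=
  forall x, measurable (X @^-1` [set x]).

Section dynamics.
Variables (R : realType) (d N : nat) (Lambda : R).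
Local Notation E := 'rV[R]_d.
Variables (Pi : R.-pker E ~> Dinf R d) (mu : R.-ker (E * E) ~> (E * E)%type).
Variable (P0 : probability E R).
Context {dO : measure_display} {O : measurableType dO}.
Variable P : probability O R.

(* [tau 0 = 0], and [(tau m.+1, I m)], for m such that [tau m.+1 < +oo], lists
   the marked points [pts] by increasing times *)
Definition enumerates (tau : nat -> \bar R) (I : nat -> 'I_N * 'I_N)
    (pts : set (R * ('I_N * 'I_N))) : Prop :=
  [/\ tau 0%N = 0%E,
      forall m, (tau m <= tau m.+1)%E,
      forall m, (tau m < +oo)%E -> (tau m < tau m.+1)%E
    & pts = [set p | exists m, tau m.+1 = p.1%:E /\ I m = p.2]].

Section pieces.
Variables (J : set R) (G : set (set O)).
Variables (tau : nat -> O -> \bar R) (I : nat -> O -> 'I_N * 'I_N).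
Variable Z : 'I_N -> O -> @skorohod R d J.
(* [Y m i] is the free path followed by particle i from time [tau m] on *)
Variable Y : nat -> 'I_N -> O -> Dinf R d.
(* does the interaction at [tau m.+1] make the particles jump, and the
   amplitudes (H, K) *)
Variables (acc : nat -> O -> bool) (HK : nat -> O -> E * E).

(* sigma-algebra of the interaction times and partners (all of them), of the
   initial values, of the first [a] families of free paths, and of the first [b]
   jump decisions and amplitudes *)
Definition past (a b : nat) : set (set O) :=
  <<s G `|` gen_by tau `|` gen_by_fin I `|` gen_by (fun i w => Z i w 0) `|`
      gen_by (fun k : 'I_a * 'I_N => Y k.1 k.2) `|`
      gen_by_fin (fun k : 'I_b => acc k) `|` gen_by (fun k : 'I_b => HK k) >>.

(* the position just before the interaction at [tau m.+1] *)
Definition before (m : nat) (i : 'I_N) (w : O) : E :=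
  left_lim (Z i w) (fine (tau m.+1 w)).

Definition jump (m : nat) (i : 'I_N) (w : O) : E :=
  if ~~ acc m w then 0
  else if i == (I m w).1 then (HK m w).1
  else if i == (I m w).2 then (HK m w).2
  else 0.

(* the position at time [tau m]: particles that do not jump keep the value
   they had just before it *)
Definition start (m : nat) (i : 'I_N) (w : O) : E :=
  if m is m'.+1 then before m' i w + jump m' i w else Z i w 0.

Definition collision_mu (m : nat) (w : O) : {measure set (E * E) -> \bar R} :=
  mu (before m (I m w).1 w, before m (I m w).2 w).

Definition pieces_measurable : Prop :=
  [/\ forall m, measurable_fun setT (tau m),
      forall m, fin_measurable (I m),
      forall i, measurable_fun setT (Z i)
    & [/\ forall m i, measurable_fun setT (Y m i),
      forall m, fin_measurable (acc m)
    & forall m, measurable_fun setT (HK m)]].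

Definition initial_iid : Prop :=
  forall (A : set O) (B : 'I_N -> set E),
    <<s G `|` gen_by tau `|` gen_by_fin I >> A -> (forall i, measurable (B i)) ->
    P (A `&` [set w | forall i, B i (Z i w 0)]) = (P A * \prod_i P0 (B i))%E.

Definition free_evolution : Prop :=
  forall m (A : set O) (B : 'I_N -> set (Dinf R d)),
    past m m A -> A `<=` [set w | (tau m w < +oo)%E] ->
    (forall i, measurable (B i)) ->
    P (A `&` [set w | forall i, B i (Y m i w)]) =
    (\int[P]_(w in A) \prod_i Pi (start m i w) (B i))%E.

Definition jump_decision : Prop :=
  forall m (A : set O),
    past m.+1 m A -> A `<=` [set w | (tau m.+1 w < +oo)%E] ->
    P (A `&` [set w | acc m w]) =
    (\int[P]_(w in A) (fine (collision_mu m w setT) / Lambda)%:E)%E.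

Definition jump_amplitudes : Prop :=
  forall m (A : set O) (B : set (E * E)),
    past m.+1 m A -> A `<=` [set w | (tau m.+1 w < +oo)%E] -> measurable B ->
    P (A `&` [set w | acc m w] `&` HK m @^-1` B) =
    (\int[P]_(w in A `&` [set w | acc m w])
       (fine (collision_mu m w B) / fine (collision_mu m w setT))%:E)%E.

Definition piecewise_paths : Prop :=
  {ae P, forall w, forall m i s, J s -> (tau m w <= s%:E < tau m.+1 w)%E ->
     Z i w s = Y m i w (s - fine (tau m w))}.

End pieces.

(* The system [Z] over the time interval [J] in which particles evolve freely
   and independently between the random interaction times [tau m.+1], at which
   the pair [I m] interacts; [G] generates the randomness from which the
   interaction times and partners are built. *)
Definition interacting_dynamics (J : set R) (G : set (set O))
    (tau : nat -> O -> \bar R) (I : nat -> O -> 'I_N * 'I_N)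
    (Z : 'I_N -> O -> @skorohod R d J) : Prop :=
  exists (Y : nat -> 'I_N -> O -> Dinf R d) (acc : nat -> O -> bool)
         (HK : nat -> O -> E * E),
  [/\ pieces_measurable tau I Z Y acc HK,
      initial_iid G tau I Z,
      free_evolution G tau I Z Y acc HK
    & [/\ jump_decision G tau I Z Y acc HK,
      jump_amplitudes G tau I Z Y acc HK
    & piecewise_paths tau Z Y]].

Definition pairs := {ij : 'I_N * 'I_N | (ij.1 < ij.2)%N}.

(* [X (c, n)] is the waiting time between the n-th and the (n+1)-th jumps of the
   Poisson process of the pair c, so that [arrival X c n] is its (n+1)-th jump
   time. *)
Definition arrival (X : pairs * nat -> O -> R) (c : pairs) (n : nat) (w : O) : R :=
  \sum_(k < n.+1) X (c, k : nat) w.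

Definition particle_system (Zbar : 'I_N -> O -> Dinf R d) : Prop :=
  exists (X : pairs * nat -> O -> R) (tau : nat -> O -> \bar R)
         (I : nat -> O -> 'I_N * 'I_N),
  [/\ iid_exponential P (Lambda / N.-1%:R) X,
      {ae P, forall w, enumerates (tau ^~ w) (I ^~ w)
         [set p | exists (c : pairs) n, p = (arrival X c n w, val c)]}
    & interacting_dynamics (gen_by X) tau I Zbar].

End dynamics.

Section backward.
Variables (R : realType) (d N p : nat) (Lambda T : R).
Local Notation E := 'rV[R]_d.

(* The backward recursion for one outcome: [u k], [v k], [r k], [j k] stand
   for U_{k+1}, V_{k+1}, r(k+1), j(k+1). *)
Section recursion.
Variables (u v : nat -> R) (r j : nat -> 'I_N).

Definition first_time (t : \bar R) (rate threshold : R) : \bar R :=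
  ereal_inf [set s%:E | s in
    [set s : R | [/\ (t <= s%:E)%E, s <= T & threshold <= (s - fine t) * rate]]].

(* C_t, from the sets C^i_t *)
Definition influence (C : 'I_p -> {set 'I_N}) : {set 'I_N} :=
  [set x | [exists i, x \in C i]]%SET.

Definition rate_new (K : nat) : R := Lambda * K%:R * (N - K)%N%:R / N.-1%:R.

Definition rate_old (K : nat) : R :=
  Lambda * K%:R * (K%:R - 1) / (2 * N.-1%:R).

(* (T_k, (C^i_{T_k})_i) *)
Fixpoint bstate (k : nat) : \bar R * ('I_p -> {set 'I_N}) :=
  if k is k'.+1 then
    let: (t, C) := bstate k' in
    let t1 := first_time t (rate_new #|influence C|) (u k') in
    let t2 := first_time t (rate_old #|influence C|) (v k') in
    (Order.min t1 t2,
     fun i => if [&& (t1 <= t2)%E, (t1 < +oo)%E & r k' \in C i]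
              then (j k' |: C i)%SET else C i)
  else (0%E, fun i => [set x : 'I_N | val x == val i]%SET).

Definition bset (k : nat) : {set 'I_N} := influence (bstate k).2.

(* T'_{k+1}, T''_{k+1} and T_k *)
Definition btime_new (k : nat) : \bar R :=
  first_time (bstate k).1 (rate_new #|bset k|) (u k).
Definition btime_old (k : nat) : \bar R :=
  first_time (bstate k).1 (rate_old #|bset k|) (v k).
Definition btime (k : nat) : \bar R := (bstate k).1.

(* L_t *)
Definition loops (t : R) : \bar R :=
  counting [set k : nat | (btime k.+1 <= t%:E)%E /\ btime k.+1 = btime_old k].

End recursion.

Context {dO : measure_display} {O : measurableType dO}.
Variable P : probability O R.
Variables (Pi : R.-pker E ~> Dinf R d) (mu : R.-ker (E * E) ~> (E * E)%type).
Variable (P0 : probability E R).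
Variables (U V : nat -> O -> R) (r j : nat -> O -> 'I_N).
Variable Z : 'I_N -> O -> Dhor d T.

Local Notation btime_ k w := (btime (U ^~ w) (V ^~ w) (r ^~ w) (j ^~ w) k).
Local Notation btime_new_ k w := (btime_new (U ^~ w) (V ^~ w) (r ^~ w) (j ^~ w) k).
Local Notation btime_old_ k w := (btime_old (U ^~ w) (V ^~ w) (r ^~ w) (j ^~ w) k).
Local Notation bset_ k w := (bset (U ^~ w) (V ^~ w) (r ^~ w) (j ^~ w) k).

(* the draws of r(k+1) and j(k+1), given (U_l), (V_l) and the earlier draws *)
Definition uniform_draws : Prop :=
  forall k (A : set O) (a b : 'I_N),
  <<s gen_by U `|` gen_by V `|` gen_by_fin (fun l : 'I_k => r l) `|`
      gen_by_fin (fun l : 'I_k => j l) >> A ->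
  (A `<=` [set w | (btime_ k.+1 w < +oo)%E /\ btime_ k.+1 w = btime_new_ k w] ->
   P (A `&` [set w | r k w = a /\ j k w = b]) =
   (\int[P]_(w in A)
      (if (a \in bset_ k w) && (b \notin bset_ k w)
       then #|bset_ k w|%:R^-1 * (N - #|bset_ k w|)%N%:R^-1 else 0)%:E)%E) /\
  (A `<=` [set w | (btime_ k.+1 w < +oo)%E /\ btime_ k.+1 w = btime_old_ k w] ->
   P (A `&` [set w | r k w = a /\ j k w = b]) =
   (\int[P]_(w in A)
      (if (a \in bset_ k w) && (b \in (bset_ k w :\ a)%SET)
       then #|bset_ k w|%:R^-1 * #|bset_ k w|.-1%:R^-1 else 0)%:E)%E).

Definition backward_system : Prop :=
  [/\ iid_exponential P 1
        (fun c : bool * nat => if c.1 then U c.2 else V c.2),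
      (forall k, fin_measurable (r k)) /\ (forall k, fin_measurable (j k)),
      uniform_draws
    & exists (tau : nat -> O -> \bar R) (I : nat -> O -> 'I_N * 'I_N),
      {ae P, forall w, enumerates (tau ^~ w) (I ^~ w)
         [set x | exists2 k, btime_ k.+1 w = (T - x.1)%:E &
                             x.2 = (r k w, j k w)]} /\
      interacting_dynamics Lambda Pi mu P0 P
        (gen_by U `|` gen_by V `|` gen_by_fin r `|` gen_by_fin j) tau I Z].

Definition loopsT (w : O) : \bar R :=
  loops (U ^~ w) (V ^~ w) (r ^~ w) (j ^~ w) T.

End backward.

Section expansion.
Variables (R : realType) (d q : nat) (T : R).

Definition symmetric_fun (D : Type) (F : q.-tuple D -> R) : Prop :=
  forall (s : {perm 'I_q}) (x : q.-tuple D), F [tuple tnth x (s i) | i < q] = F x.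

(* (eta^N_{0:T})^{.q}(F) *)
Definition empirical (N : nat) (D : Type) (Z : 'I_N -> D) (F : q.-tuple D -> R) : R :=
  (N ^_ q)%:R^-1 *
  \sum_(a : {ffun 'I_q -> 'I_N} | injectiveb a) F [tuple Z (a i) | i < q].

(* E(X | A), with value 0 when P(A) = 0 *)
Definition cond_expectation {dO} {O : measurableType dO} (P : probability O R)
    (X : O -> R) (A : set O) : \bar R :=
  ((fine (P A))^-1%:E * \int[P]_(w in A) (X w)%:E)%E.

Section terms.
Context {dO : measure_display} {O : measurableType dO}.
Variables (P : probability O R) (N : nat) (hqN : (q <= N)%N) (Lambda : R).
Variables (U V : nat -> O -> R) (r j : nat -> O -> 'I_N).
Variable Z : 'I_N -> O -> Dhor d T.

Definition term_on (l : nat) (A : set O) (F : q.-tuple (Dhor d T) -> R) : \bar R :=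
  ((N.-1%:R ^+ l)%:E *
   cond_expectation P (fun w => F [tuple Z (widen_ord hqN i) w | i < q]) A *
   P A)%E.

(* Delta^{N,l}_{q,T}(F) *)
Definition Delta (l : nat) (F : q.-tuple (Dhor d T) -> R) : \bar R :=
  term_on l [set w | loopsT q Lambda T U V r j w = l%:R%:E] F.

(* \overline{Delta}^{N,l}_{q,T}(F) *)
Definition Deltabar (l : nat) (F : q.-tuple (Dhor d T) -> R) : \bar R :=
  term_on l [set w | (l%:R%:E <= loopsT q Lambda T U V r j w)%E] F.

(* [Phi] is integration against a nonnegative measure of mass at most C *)
Definition is_measure_bounded_by (C : R)
    (Phi : (q.-tuple (Dhor d T) -> R) -> \bar R) : Prop :=
  exists m : {measure set (q.-tuple (Dhor d T)) -> \bar R},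
    (m setT <= C%:E)%E /\
    forall F, bounded_measurable F -> Phi F = (\int[m]_x (F x)%:E)%E.

End terms.
End expansion.

(* Main.v *)
(* It is enough to show that (Zbar^{a(1)}, ..., Zbar^{a(q)}) and (Z^1, ..., Z^q) have the
   same law on D([0, T], R^d)^q for every injection a: averaging over a gives
   E(F(Z^1, ..., Z^q)), which is then split according to the value of L_T.

   The laws are compared on cylinder events. Enumerating the words of successive
   interactions, one gets a renewal equation for the value, at time t, of a test function
   of the configuration of the forward system, in terms of its last interaction before t.
   When the test function depends only on the particles of a set C, the interactions that
   do not touch C are invisible, and solving for their contribution leaves the same
   equation restricted to the pairs that touch C. Iterating it from the time T downwards,
   the waiting times, the pairs and the growing sets C are those of the backward chain
   T_k, (r(k), j(k)), C_{T_k}, so that the forward value is the sum over n of the backward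
   value on the event of exactly n backward interactions.

   For the bounds, let K = K_{T_k} and i = l - L_{T_k}. Up to the l-th loop,
   e^{a (T - T_k)} K (K + 1) ... (K + 2 i - 1) / (N - 1)^i is a supermartingale if
   a = (4 l + 1) Lambda, whence
   P(L_T >= l) <= e^{a T} q (q + 1) ... (q + 2 l - 1) / (N - 1)^l. *)
Require Import Defs.
From HB Require Import structures.
From mathcomp Require Import all_boot all_order all_fingroup all_algebra.
From mathcomp Require Import all_classical all_reals all_analysis.
From mathcomp Require Import measurable_realfun.
From mathcomp Require Import ring lra zify.

Set Implicit Arguments.
Unset Strict Implicit.
Unset Printing Implicit Defensive.

Import Order.TTheory GRing.Theory Num.Theory.
Import numFieldNormedType.Exports.

Local Open Scope classical_set_scope.
Local Open Scope ring_scope.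

(** In both systems the interaction times and partners do not depend on the motion: the kernel only
    decides whether an interaction is effective. Given all of them, the expectation of a test
    function is the same explicit composition of free flows and collision operators, [history], in
    either system, so that only the laws of the words of interactions have to be compared.

    The pairs that do not touch C cannot be deleted from the words one by one, since C depends on
    the later interactions. They are removed from the equation instead: acting trivially on
    functions of C, they reproduce the unknown at an earlier time, and solving for it only lowers
    the exponential rate. This composes flows at an intermediate time s by the Markov property,
    which concerns the value at s, while an interaction sees the value just before s; both agree for
    almost every s because a cadlag path has countably many jumps.

    After n iterations the remainder is at most P(T_n < T). It tends to 0 because the times T - T_k
    can be listed increasingly, which rules out an infinite decreasing sequence of them. *)

Local Notation meas_fun f := (measurable_fun setT f).
Local Notation sigma_of H := (g_sigma_algebraType H).

(** * Measurability and kernels *)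

(** The truth value of a proposition as an extended real: events enter the integrals as nonnegative
    factors, and conditions are regrouped by [ind_and] and [ind_iff]. *)
Definition ind {R : realType} (Q : Prop) : \bar R := (`[<Q>]%:R)%:E.

Section indicators.
Context {R : realType}.
Local Open Scope ereal_scope.
Local Notation ind := (@ind R).

Lemma ind_ge0 Q : 0 <= ind Q.
Proof. by rewrite lee_fin ler0n. Qed.

Lemma ind_le1 Q : ind Q <= 1.
Proof. by rewrite lee_fin lern1; case: asboolP. Qed.

Lemma indT Q : Q -> ind Q = 1.
Proof. by move=> q; rewrite /ind asboolT. Qed.

Lemma indF Q : ~ Q -> ind Q = 0.
Proof. by move=> q; rewrite /ind asboolF. Qed.

Lemma ind_and Q Q' : ind (Q /\ Q') = ind Q * ind Q'.
Proof.
have [q|q] := pselect Q; last by rewrite (indF q) mul0e indF// => -[].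
have [q'|q'] := pselect Q'; last by rewrite (indF q') mule0 indF// => -[].
by rewrite !indT// mule1.
Qed.

Lemma ind_iff Q Q' : (Q <-> Q') -> ind Q = ind Q'.
Proof. by move=> /propext ->. Qed.

Lemma eq_indM Q (x y : \bar R) : (Q -> x = y) -> ind Q * x = ind Q * y.
Proof.
by have [q ->//|q _] := pselect Q; rewrite indF// !mul0e.
Qed.

Lemma le_indM Q (x y : \bar R) : (Q -> x <= y) -> ind Q * x <= ind Q * y.
Proof.
have [q h|q _] := pselect Q; last by rewrite indF// !mul0e.
by rewrite indT// !mul1e h.
Qed.

Lemma ind_split Q Q' (x : \bar R) : 0 <= x ->
  ind Q * x = ind (Q /\ Q') * x + ind (Q /\ ~ Q') * x.
Proof.
move=> x0; rewrite !ind_and; have [q'|q'] := pselect Q'.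
  by rewrite (indT q') mule1 [ind (~ _)]indF// mule0 mul0e adde0.
by rewrite (indF q') mule0 mul0e [ind (~ _)]indT// mule1 add0e.
Qed.

Lemma measurable_ind d (T : measurableType d) (Q : T -> Prop) :
  measurable [set x | Q x] -> meas_fun (fun x => ind (Q x)).
Proof.
move=> mQ; apply/measurable_EFinP.
rewrite [X in measurable_fun _ X](_ : _ = \1_[set x | Q x]).
  exact: measurable_indic.
apply/funext => x; rewrite indicE; have [q|q] := pselect (Q x).
  by rewrite asboolT// mem_set.
by rewrite asboolF// memNset.
Qed.

Lemma integral_indM d (T : measurableType d) (mu : {measure set T -> \bar R})
    (A : set T) (f : T -> \bar R) : measurable A ->
  \int[mu]_x (ind (A x) * f x) = \int[mu]_(x in A) f x.
Proof.
move=> mA; rewrite [RHS]integral_mkcond; apply: eq_integral => x _.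
rewrite patchE; case: ifPn => [/set_mem ?|]; first by rewrite indT ?mul1e.
by rewrite notin_setE => ?; rewrite indF ?mul0e.
Qed.

Lemma integral_ind d (T : measurableType d) (mu : {measure set T -> \bar R})
    (A : set T) : measurable A -> \int[mu]_x ind (A x) = mu A.
Proof.
move=> mA; transitivity (\int[mu]_x (\1_A x)%:E).
  apply: eq_integral => x _; rewrite indicE /ind.
  have [q|q] := pselect (A x); first by rewrite asboolT// mem_set.
  by rewrite asboolF// memNset.
by rewrite integral_indic// setIT.
Qed.

End indicators.

#[global] Hint Extern 0 (is_true (0%R <= ind _)%E) => exact: ind_ge0 : core.

Section measurability.
Local Open Scope ereal_scope.
Context {R : realType}.

Lemma measurable_forall_fin d (T : measurableType d) (I : finType)
    (Q : I -> T -> Prop) :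
  (forall i, measurable [set x | Q i x]) ->
  measurable [set x | forall i, Q i x].
Proof.
move=> mQ; rewrite (_ : [set x | _] = \bigcap_i [set x | Q i x]).
  by apply: fin_bigcap_measurable => //; exact: finite_finset.
by apply/seteqP; split=> [x h i _|x h i] //=; exact: h.
Qed.

Lemma measurable_forall_nat d (T : measurableType d) (Q : nat -> T -> Prop) :
  (forall i, measurable [set x | Q i x]) ->
  measurable [set x | forall i, Q i x].
Proof.
move=> mQ; rewrite (_ : [set x | _] = \bigcap_i [set x | Q i x]).
  exact: bigcapT_measurable.
by apply/seteqP; split=> [x h i _|x h i] //=; exact: h.
Qed.

Lemma measurable_exists_fin d (T : measurableType d) (I : finType)
    (Q : I -> T -> Prop) :
  (forall i, measurable [set x | Q i x]) ->
  measurable [set x | exists i, Q i x].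
Proof.
move=> mQ; rewrite (_ : [set x | _] = ~` [set x | forall i, ~ Q i x]).
  by apply: measurableC; apply: measurable_forall_fin => i; exact: measurableC (mQ i).
apply/seteqP; split=> [x [i Qi] /(_ i)//|x] /=.
by move/existsNP => [i /contrapT Qi]; exists i.
Qed.

Lemma measurable_exists_nat d (T : measurableType d) (Q : nat -> T -> Prop) :
  (forall i, measurable [set x | Q i x]) ->
  measurable [set x | exists i, Q i x].
Proof.
move=> mQ; rewrite (_ : [set x | _] = \bigcup_i [set x | Q i x]).
  exact: bigcupT_measurable.
by apply/seteqP; split=> [x [i ?]|x [i _ ?]]; exists i.
Qed.

Lemma measurable_imply d (T : measurableType d) (Q Q' : T -> Prop) :
  measurable [set x | Q x] -> measurable [set x | Q' x] ->
  measurable [set x | Q x -> Q' x].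
Proof.
move=> mQ mQ'; rewrite (_ : mkset _ = ~` [set x | Q x] `|` [set x | Q' x]).
  by apply: measurableU => //; exact: measurableC.
apply/seteqP; split=> x /=; last by case.
by move=> h; have [q|q] := pselect (Q x); [right; exact: h|left].
Qed.

Lemma measurable_cond d (T : measurableType d) (Q : Prop) (Q' : T -> Prop) :
  (Q -> measurable [set x | Q' x]) -> measurable [set x | Q -> Q' x].
Proof.
have [q|q] := pselect Q => h; last first.
  by rewrite (_ : mkset _ = setT)//; apply/seteqP; split=> // x _ /=.
rewrite (_ : mkset _ = [set x | Q' x]); first exact: h.
by apply/seteqP; split=> x //=; exact.
Qed.

Lemma measurable_preim d d' (T : measurableType d) (T' : measurableType d')
    (f : T -> T') (A : set T') :
  meas_fun f -> measurable A -> measurable [set x | A (f x)].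
Proof. by move=> mf mA; rewrite -[X in measurable X]setTI; exact: mf. Qed.

Lemma measurable_le_fun d (T : measurableType d) (f g : T -> R) :
  meas_fun f -> meas_fun g ->
  measurable [set x | (f x <= g x)%R].
Proof.
by move=> mf mg; have := measurable_fun_le measurableT mf mg; rewrite setTI.
Qed.

Lemma measurable_lt_fun d (T : measurableType d) (f g : T -> R) :
  meas_fun f -> meas_fun g ->
  measurable [set x | (f x < g x)%R].
Proof.
move=> mf mg; rewrite (_ : mkset _ = ~` [set x | (g x <= f x)%R]).
  by apply: measurableC; exact: measurable_le_fun.
by apply/seteqP; split=> x /=; rewrite ltNge => /negP.
Qed.

Lemma emeasurable_le_fun d (T : measurableType d) (f g : T -> \bar R) :
  meas_fun f -> meas_fun g ->
  measurable [set x | f x <= g x].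
Proof.
by move=> mf mg; have := emeasurable_fun_le measurableT mf mg; rewrite setTI.
Qed.

Lemma emeasurable_lt_fun d (T : measurableType d) (f g : T -> \bar R) :
  meas_fun f -> meas_fun g ->
  measurable [set x | f x < g x].
Proof.
move=> mf mg; rewrite (_ : mkset _ = ~` [set x | g x <= f x]).
  by apply: measurableC; exact: emeasurable_le_fun.
by apply/seteqP; split=> x /=; rewrite ltNge => /negP.
Qed.

Lemma measurable_fin_case d d' (T : measurableType d) (T' : measurableType d')
    (I : finType) (k : T -> I) (f : I -> T -> T') :
  fin_measurable k -> (forall i, meas_fun (f i)) ->
  meas_fun (fun x => f (k x) x).
Proof.
move=> mk mf _ A mA; rewrite setTI.
rewrite (_ : _ @^-1` _ = [set x | exists i, k x = i /\ A (f i x)]).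
  apply: measurable_exists_fin => i; apply: measurableI; first exact: mk.
  exact: measurable_preim.
by apply/seteqP; split=> [x Ax|x [i [<-]]] //; exists (k x).
Qed.

Lemma fin_measurable_preim d (T : measurableType d) (I : finType) (k : T -> I)
    (A : set I) : fin_measurable k -> measurable [set x | A (k x)].
Proof.
move=> mk; rewrite (_ : mkset _ = [set x | exists i, A i /\ k x = i]).
  apply: measurable_exists_fin => i.
  have [Ai|Ai] := pselect (A i).
    rewrite (_ : mkset _ = k @^-1` [set i]); first exact: mk.
    by apply/seteqP; split=> [x []|].
  by rewrite (_ : mkset _ = set0)//; apply/seteqP; split=> [x []|].
by apply/seteqP; split=> [x Ax|x [i [? ki]]] /=; [exists (k x)|rewrite ki].
Qed.

Lemma finite_measure_unique d (T : measurableType d) (G : set (set T))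
    (m1 m2 : {measure set T -> \bar R}) :
  measurable = <<s G >> -> setI_closed G -> G setT -> m1 setT < +oo ->
  (forall A, G A -> m1 A = m2 A) -> forall A, measurable A -> m1 A = m2 A.
Proof.
move=> mG GI GT fin e A mA; apply: (measure_unique G (fun=> setT)) => //.
by apply/seteqP; split=> // x _; exists 0%N.
Qed.

End measurability.

(** * Kernels after a change of parameter, and their images *)

Section kernel_reparametrized.
Context d d0 d' (T : measurableType d) (X : measurableType d0)
  (Y : measurableType d') (R : realType).
Variables (K : R.-fker X ~> Y) (g : T -> X) (mg : meas_fun g).

(** The measurability of [g] is an argument, so that the kernel structure can be declared on this
    very term. *)
Definition kernel_reparam (mg : meas_fun g) (t : T) :
  {measure set Y -> \bar R} := K (g t).

Let kernel_reparam_measurable U : measurable U ->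
  meas_fun (kernel_reparam mg ^~ U).
Proof. by move=> mU; exact: measurableT_comp (measurable_kernel K _ mU) mg. Qed.

HB.instance Definition _ := isKernel.Build _ _ _ _ _ (kernel_reparam mg)
  kernel_reparam_measurable.

Let kernel_reparam_uub : measure_fam_uub (kernel_reparam mg).
Proof. by have [r hr] := measure_uub K; exists r => t; exact: hr. Qed.

HB.instance Definition _ := Kernel_isFinite.Build _ _ _ _ _ (kernel_reparam mg)
  kernel_reparam_uub.

Local Open Scope ereal_scope.

Lemma measurable_int_kernel (h : T -> Y -> \bar R) :
  meas_fun (fun ty : T * Y => h ty.1 ty.2) ->
  (forall t y, 0 <= h t y) ->
  meas_fun (fun t => \int[K (g t)]_y h t y).
Proof.
move=> mh h0.
by apply: (@measurable_fun_integral_finite_kernel _ _ _ _ _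
  (fun ty => h ty.1 ty.2) (kernel_reparam mg)).
Qed.

End kernel_reparametrized.

Section image_measure.
Context d d' (T1 : measurableType d) (T2 : measurableType d') (R : realType).
Variables (m : {measure set T1 -> \bar R}) (f : T1 -> T2).
Hypothesis mf : meas_fun f.
Local Open Scope ereal_scope.

Definition image_measure : {measure set T2 -> \bar R} :=
  measure_function_pushforward__canonical__measure_function_Measure m mf.

Lemma integral_image (g : T2 -> \bar R) : meas_fun g ->
  (forall y, 0 <= g y) -> \int[image_measure]_y g y = \int[m]_x g (f x).
Proof.
by move=> mg g0; rewrite [LHS](ge0_integral_pushforward mf)// preimage_setT.
Qed.

End image_measure.

Section kernel_image.
Context d d' d2 (T : measurableType d) (Y : measurableType d')
  (Z : measurableType d2) (R : realType).
Variables (K : R.-fker T ~> Y) (h : T * Y -> Z).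
Hypothesis mh : meas_fun h.

Let mht t : meas_fun (fun y => h (t, y)).
Proof. exact: measurableT_comp mh (pair1_measurable t). Qed.

Definition kernel_image (t : T) : {measure set Z -> \bar R} :=
  image_measure (K t) (mht t).

Let kernel_image_measurable U : measurable U ->
  meas_fun (kernel_image ^~ U).
Proof.
move=> mU; rewrite (_ : (fun _ => _) = (fun t => K t (xsection (h @^-1` U) t))).
  apply: measurable_fun_xsection_finite_kernel; rewrite inE.
  exact: measurable_preim mh mU.
apply/funext => t /=; rewrite /pushforward/=; congr (K t _).
by apply/seteqP; split=> y /=; rewrite /xsection/= inE.
Qed.

HB.instance Definition _ := isKernel.Build _ _ _ _ _ kernel_image
  kernel_image_measurable.

Let kernel_image_uub : measure_fam_uub kernel_image.
Proof. by have [r hr] := measure_uub K; exists r => t; exact: hr. Qed.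

HB.instance Definition _ := Kernel_isFinite.Build _ _ _ _ _ kernel_image
  kernel_image_uub.

Lemma integral_kernel_image t (g : Z -> \bar R) : meas_fun g ->
  (forall z, (0 <= g z)%E) ->
  (\int[kernel_image t]_z g z = \int[K t]_y g (h (t, y)))%E.
Proof. by move=> mg g0; rewrite integral_image. Qed.

End kernel_image.

Section kernel_at.
Context d d' (T : measurableType d) (Y : measurableType d') (R : realType).

Definition kernel_at (K : R.-fker T ~> Y) (t : T) : set Y -> \bar R := K t.

HB.instance Definition _ (K : R.-fker T ~> Y) t := Measure.on (kernel_at K t).

HB.instance Definition _ (K : R.-fker T ~> Y) t :=
  @Measure_isFinite.Build _ Y _ (kernel_at K t) (finite_kernel_measure K t).

End kernel_at.

Section constant_kernel.
Context d (T : measurableType d) (R : realType).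
Variable P : {finite_measure set T -> \bar R}.

Definition constant_kernel (u : unit) : {measure set T -> \bar R} := P.

Let constant_kernel_measurable U : measurable U ->
  meas_fun (constant_kernel ^~ U).
Proof. by move=> mU; exact: measurable_cst. Qed.

HB.instance Definition _ := isKernel.Build _ _ _ _ _ constant_kernel
  constant_kernel_measurable.

Let constant_kernel_uub : measure_fam_uub constant_kernel.
Proof.
exists (fine (P setT) + 1) => t.
rewrite EFinD fineK ?fin_num_measure//.
by rewrite /constant_kernel lteDl ?fin_num_measure// lte01.
Qed.

HB.instance Definition _ := Kernel_isFinite.Build _ _ _ _ _ constant_kernel
  constant_kernel_uub.

End constant_kernel.

Lemma integral_mrestr d (T : measurableType d) (R : realType)
    (m : {measure set T -> \bar R}) (A : set T) (mA : measurable A)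
    (f : T -> \bar R) : meas_fun f -> (forall x, (0 <= f x)%E) ->
  (\int[mrestr m mA]_x f x = \int[m]_(x in A) f x)%E.
Proof.
move=> mf f0; rewrite (@ge0_negligible_integral _ _ _ _ setT (~` A))//.
- rewrite setTD setCK; apply: eq_measure_integral => B mB BA.
  by rewrite /= /mrestr setIidl.
- exact: measurableC.
- by rewrite /= /mrestr setICl measure0.
Qed.

(** * Conditional laws given by kernels *)

Section disintegration.
Context dO dT dS (O : measurableType dO) (T : measurableType dT)
  (S : measurableType dS) (R : realType).
Variables (P : {finite_measure set O -> \bar R}).
Variables (X : O -> T) (mX : meas_fun X).
Variables (Y : O -> S) (mY : meas_fun Y).
Variables (K : R.-fker T ~> S) (A0 : set O) (D : set T).
Hypotheses (mA0 : measurable A0) (mD : measurable D).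
Variable G : set (set S).
Hypotheses (mG : measurable = <<s G >>) (GI : setI_closed G) (GT : G setT).
Local Open Scope ereal_scope.
Hypothesis PK : forall A B, measurable A -> A `<=` D -> G B ->
  P (((X @^-1` A) `&` A0) `&` Y @^-1` B) =
  \int[P]_w (ind (A (X w)) * K (X w) B).

Let mX' A : measurable A -> measurable (X @^-1` A).
Proof. exact: measurable_preim. Qed.

Let mY' B : measurable B -> measurable (Y @^-1` B).
Proof. exact: measurable_preim. Qed.

Let mXY : meas_fun (fun w => (X w, Y w)).
Proof. exact/measurable_fun_pairP. Qed.

Let mXu : meas_fun (fun u : unit * O => X u.2).
Proof. exact: (measurableT_comp mX (@measurable_snd _ _ unit O)). Qed.

Let mh : meas_fun (fun p : (unit * O) * S => (X p.1.2, p.2)).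
Proof.
apply/measurable_fun_pairP; split => /=.
  exact: (measurableT_comp mXu (@measurable_fst _ _ (unit * O)%type S)).
exact: (@measurable_snd _ _ (unit * O)%type S).
Qed.

Let m1 := image_measure (mrestr P mA0) mXY.
Let k2 := kernel_image (kernel_reparam K mXu) mh.
Let m2 := (constant_kernel P \; k2) tt.

Let m2E C : m2 C = \int[P]_w K (X w) (pair (X w) @^-1` C).
Proof. by []. Qed.

Let m2X A B : m2 (A `*` B) = \int[P]_w (ind (A (X w)) * K (X w) B).
Proof.
rewrite m2E; apply: eq_integral => w _.
have [a|a] := pselect (A (X w)).
  rewrite indT// mul1e; congr (K _ _).
  by apply/seteqP; split=> [y []|y] //=.
rewrite indF// mul0e (_ : _ @^-1` _ = set0) ?measure0//.
by apply/seteqP; split=> // y [].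
Qed.

Let step A B : measurable A -> A `<=` D -> measurable B ->
  P (((X @^-1` A) `&` A0) `&` Y @^-1` B) = m2 (A `*` B).
Proof.
move=> mA AD mB.
have mAS : measurable (A `*` setT : set (T * S)) by exact: measurableX.
have mXA : measurable (X @^-1` A `&` A0) by apply: measurableI => //; exact: mX'.
pose n1 := image_measure (mrestr P mXA) mY.
pose n2 := image_measure (mrestr m2 mAS) (@measurable_snd _ _ T S).
have n2E C : n2 C = m2 (A `*` C).
  rewrite /n2/= /pushforward /mrestr; congr (m2 _).
  by apply/seteqP; split=> -[a b] /= [] //; move=> ? [].
have n1E C : n1 C = P (((X @^-1` A) `&` A0) `&` Y @^-1` C).
  by rewrite /n1/= /pushforward /mrestr setIC.
rewrite -n1E -n2E.
apply: (finite_measure_unique mG GI GT) => //.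
  rewrite n1E (@le_lt_trans _ _ (P setT))//; last by rewrite ltey_eq fin_num_measure.
  apply: le_measure; rewrite ?inE//.
  by apply: measurableI => //; exact: mY'.
by move=> C GC; rewrite n1E n2E m2X PK.
Qed.

(** Both sides integrate [f] against a measure on [T * S]. By [step] these measures agree on
    products, [PK] being extended in the second factor for a fixed first one; uniqueness does the
    rest. With [X] the identity map into a smaller sigma-algebra, this is conditioning on that
    sigma-algebra. The mass of [K] may differ from 1: it then carries the conditional probability of
    [A0]. *)
Lemma disintegration (f : T -> S -> \bar R) :
  meas_fun (fun p : T * S => f p.1 p.2) ->
  (forall x y, 0 <= f x y) ->
  \int[P]_w (ind (D (X w) /\ A0 w) * f (X w) (Y w)) =
  \int[P]_w (ind (D (X w)) * \int[K (X w)]_y f (X w) y).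
Proof.
move=> mf f0.
have mDS : measurable (D `*` setT : set (T * S)) by exact: measurableX.
pose g (p : T * S) := ind (D p.1) * f p.1 p.2.
have mg : meas_fun g.
  apply: emeasurable_funM => //; apply: measurable_ind.
  exact: (measurable_preim (@measurable_fst _ _ T S)).
have g0 p : 0 <= g p by rewrite mule_ge0.
have m12 C : measurable C -> C `<=` D `*` setT -> m1 C = m2 C.
  move=> mC CD; pose n1 := mrestr m1 mDS; pose n2 := mrestr m2 mDS.
  rewrite -(setIidl CD); rewrite -[LHS]/(n1 C) -[RHS]/(n2 C).
  apply: (@finite_measure_unique _ _ _
    [set A `*` B | A in measurable & B in measurable] n1 n2) => //.
  - by rewrite measurable_prod_measurableType.
  - move=> _ _ [X1 mX1 [X2 mX2 <-]] [Y1 mY1 [Y2 mY2 <-]].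
    exists (X1 `&` Y1); first exact: measurableI.
    by exists (X2 `&` Y2); [exact: measurableI|rewrite setXI].
  - by exists setT => //; exists setT => //; rewrite setXTT.
  - rewrite /n1 /= /mrestr /m1/= /pushforward /mrestr.
    rewrite (@le_lt_trans _ _ (P setT))//; last by rewrite ltey_eq fin_num_measure.
    apply: le_measure; rewrite ?inE//; apply: measurableI => //.
    by apply: (measurable_preim mXY); exact: measurableI.
  - move=> _ [A mA [B mB <-]]; rewrite /n1 /n2 /= /mrestr -setXI setIT.
    rewrite -[RHS]/(m2 ((A `&` D) `*` B)) -step//; last exact: measurableI.
    rewrite /m1/= /pushforward /mrestr; congr (P _).
    by apply/seteqP; split=> w /= [] => [[[? ?] ?] ?|[[? ?] ?] ?].
transitivity (\int[P]_(w in A0) g (X w, Y w)).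
  rewrite -[RHS]integral_indM//; apply: eq_integral => w _.
  by rewrite ind_and /g/= muleCA muleA.
transitivity (\int[m1]_p g p).
  rewrite integral_image//.
  rewrite [RHS]integral_mrestr//; exact: measurableT_comp mg mXY.
transitivity (\int[m2]_p g p).
  have gD (m : {measure set (T * S) -> \bar R}) : \int[m]_p g p = \int[m]_(p in D `*` setT) f p.1 p.2.
    rewrite -[RHS]integral_indM//; apply: eq_integral => p _; congr (_ * _).
    by apply: ind_iff; split=> [|[]].
  by rewrite !gD; exact: eq_measure_integral.
rewrite /m2 [LHS]integral_kcomp//; apply: eq_integral => w _ /=.
transitivity (\int[K (X w)]_y g (X w, y)); first
  exact: (@integral_kernel_image _ _ _ _ _ _ _ (kernel_reparam K mXu) _ mh (tt, w)).
rewrite /g/= ge0_integralZl//.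
by apply: measurableT_comp mf (pair1_measurable _).
Qed.

End disintegration.

Section mixture.
Context dO dT dS (O : measurableType dO) (T : measurableType dT)
  (S : measurableType dS) (R : realType).
Variables (P : {finite_measure set O -> \bar R}).
Variables (X : O -> T) (mX : meas_fun X).
Variables (Y : O -> S) (mY : meas_fun Y).
Variables (K : R.-fker T ~> S) (A0 : set O).
Hypotheses (mA0 : measurable A0).
Variable G : set (set S).
Hypotheses (mG : measurable = <<s G >>) (GI : setI_closed G) (GT : G setT).
Local Open Scope ereal_scope.
Hypothesis PK : forall B, G B ->
  P (A0 `&` Y @^-1` B) = \int[P]_w (ind (A0 w) * K (X w) B).

Let mXu : meas_fun (fun u : unit * O => X u.2).
Proof. exact: (measurableT_comp mX (@measurable_snd _ _ unit O)). Qed.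

Let P0 : {finite_measure set O -> \bar R} := mrestr P mA0.
Let m1 := (constant_kernel P0 \; kernel_reparam K mXu) tt.

Let m1E (f : O -> \bar R) : meas_fun f -> (forall w, 0 <= f w) ->
  \int[P0]_w f w = \int[P]_w (ind (A0 w) * f w).
Proof. by move=> mf f0; rewrite integral_indM// -(integral_mrestr _ mA0). Qed.

(** The test function does not see [X], so the identity has to be known only for the law of [Y] on
    [A0]. The Markov property is used in this form. *)
Lemma mixture f : meas_fun f -> (forall y, 0 <= f y) ->
  \int[P]_w (ind (A0 w) * f (Y w)) =
  \int[P]_w (ind (A0 w) * \int[K (X w)]_y f y).
Proof.
move=> mf f0.
transitivity (\int[image_measure P0 mY]_y f y).
  by rewrite integral_image// m1E//; exact: measurableT_comp mf mY.
transitivity (\int[m1]_y f y); last first.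
  rewrite /m1 [LHS]integral_kcomp// m1E//.
    apply: (measurable_int_kernel K mX) => //.
    exact: (measurableT_comp mf measurable_snd).
  by move=> w; exact: integral_ge0.
apply: eq_measure_integral => A mA _.
apply: (finite_measure_unique mG GI GT) => //.
  by rewrite /= /pushforward preimage_setT ltey_eq fin_num_measure.
move=> B GB; have mB : measurable B by rewrite mG; exact: sub_sigma_algebra.
rewrite [RHS](_ : _ = \int[P0]_w K (X w) B)// m1E//; last first.
  exact: measurableT_comp (measurable_kernel K _ mB) mX.
by rewrite -PK// setIC.
Qed.

End mixture.

(** * Measurability of evaluations and left limits of cadlag paths *)

Section paths.
Variables (R : realType) (d : nat).
Local Notation E := 'rV[R]_d.

Lemma measurable_rV_coord (i : 'I_d) :
  meas_fun (fun x : E => x ord0 i).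
Proof.
by move=> _ B mB; rewrite setTI; apply: sub_sigma_algebra; exists i, B.
Qed.

Lemma measurable_fun_rV dT (T : measurableType dT) (f : T -> E) :
  (forall i, meas_fun (fun x => f x ord0 i)) ->
  meas_fun f.
Proof.
move=> mf; apply: (@measurability _ _ _ _ _ _
  [set A | exists i (B : set R),
         measurable B /\ A = [set x : E | B (x ord0 i)]]) => //.
move=> _ [_ [i [B [mB ->]]] <-]; rewrite setTI.
exact: measurable_preim (mf i) mB.
Qed.

Lemma measurable_rVD dT (T : measurableType dT) (f g : T -> E) :
  meas_fun f -> meas_fun g ->
  meas_fun (fun x => f x + g x).
Proof.
move=> mf mg; apply: measurable_fun_rV => i.
under eq_fun do rewrite mxE.
by apply: measurable_funD; exact: measurableT_comp (measurable_rV_coord i) _.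
Qed.

Lemma measurable_rV_cvg dT (T : measurableType dT) (f_ : nat -> T -> E)
    (f : T -> E) : (forall n, meas_fun (f_ n)) ->
  (forall x, f_ n x @[n --> \oo] --> f x) -> meas_fun f.
Proof.
move=> mf ff; apply: measurable_fun_rV => i.
apply: (@measurable_fun_cvg _ _ _ _ (fun n x => f_ n x ord0 i)).
  by move=> n; exact: measurableT_comp (measurable_rV_coord i) (mf n).
move=> x _; apply: (cvg_comp _ (fun y : E => y ord0 i) (ff x)).
exact: coord_continuous.
Qed.

Lemma measurable_eval (J : set R) t :
  meas_fun (fun w : @skorohod R d J => w t).
Proof.
have [Jt|Jt] := pselect (J t).
  by move=> _ B mB; rewrite setTI; apply: sub_sigma_algebra; exists t, B.
rewrite (_ : (fun _ => _) = cst 0); first exact: measurable_cst.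
by apply/funext => w; exact: path_out.
Qed.

(** When the evaluation time depends on [t] through an integer only, joint measurability is a
    countable union over this integer. General times are reached from such ones by a limit along
    finer and finer grids. *)
Lemma measurable_eval_grid (J : set R) (z : R -> int) (g : int -> R) :
  (forall k, measurable [set t | z t = k]) ->
  meas_fun (fun p : R * @skorohod R d J => p.2 (g (z p.1))).
Proof.
move=> mz _ B mB; rewrite setTI.
(* An integer is written [m - n], so that the union runs over natural numbers. *)
rewrite (_ : _ @^-1` _ = [set p : R * @skorohod R d J | exists m n : nat,
    z p.1 = (m%:Z - n%:Z)%R /\ B (p.2 (g (m%:Z - n%:Z)%R))]).
  apply: measurable_exists_nat => m; apply: measurable_exists_nat => n.
  apply: measurableI.
    exact: (measurable_preim (@measurable_fst _ _ R (@skorohod R d J)) (mz _)).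
  apply: (measurable_preim (f := fun p : R * @skorohod R d J => p.2 _)) mB.
  exact: measurableT_comp (measurable_eval _) measurable_snd.
apply/seteqP; split=> [[t w] /= h|[t w] /= [m [n [<-]]]] //.
case: (z t) h => k h; first by exists k, 0%N; rewrite subr0.
by exists 0%N, k.+1; rewrite sub0r -NegzE.
Qed.

(** The closest multiples of 1/(n+1) strictly to the right and strictly to the left of [t].
    Strictness matters: the one-sided neighbourhoods in which they converge do not contain [t]. *)
Definition grid_right (n : nat) (t : R) : R :=
  (Num.floor (t * n.+1%:R) + 1)%:~R / n.+1%:R.
Definition grid_left (n : nat) (t : R) : R :=
  (- Num.floor (- (t * n.+1%:R)) - 1)%:~R / n.+1%:R.

Lemma grid_right_itv n t : t < grid_right n t <= t + n.+1%:R^-1.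
Proof.
have n0 : 0 < n.+1%:R :> R by [].
rewrite /grid_right ltr_pdivlMr// ler_pdivrMr// mulrDl mulVf ?gt_eqF//.
by rewrite floorD1_gt /= intrD1 lerD2r floor_le.
Qed.

Lemma grid_left_itv n t : t - n.+1%:R^-1 <= grid_left n t < t.
Proof.
have n0 : 0 < n.+1%:R :> R by [].
rewrite /grid_left ltr_pdivrMr// ler_pdivlMr// mulrBl mulVf ?gt_eqF//.
rewrite intrB intrN lerD2r lerNr floor_le /= ltrBlDr ltrNl.
by have := floorD1_gt (- (t * n.+1%:R)); rewrite intrD1; lra.
Qed.

Lemma measurable_floor_eq (f : R -> R) k : meas_fun f ->
  measurable [set t | Num.floor (f t) = k].
Proof.
move=> mf; rewrite (_ : mkset _ = [set t | (k%:~R <= f t)%R] `&`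
    [set t | (f t < (k + 1)%:~R)%R]).
  by apply: measurableI; [exact: measurable_le_fun|exact: measurable_lt_fun].
apply/seteqP; split=> t /=.
  by move=> <-; split; [exact: floor_le|rewrite floorD1_gt].
by move=> [h1 h2]; apply: floor_def; rewrite h1.
Qed.

Lemma cvg_grid_right t : grid_right n t @[n --> \oo] --> t^'+.
Proof.
move=> A; rewrite /at_right/= => -[e /= e0 eA].
suff : \forall n \near \oo, A (grid_right n t) by [].
near=> n; apply: eA; last by have /andP[] := grid_right_itv n t.
have /andP[h1 h2] := grid_right_itv n t.
rewrite /ball/= distrC ger0_norm ?subr_ge0 ?(ltW h1)//.
apply: (@le_lt_trans _ _ n.+1%:R^-1); first by rewrite lerBlDl.
by near: n; exact: (near_infty_natSinv_lt (PosNum e0)).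
Unshelve. all: by end_near. Qed.

Lemma cvg_grid_left t : grid_left n t @[n --> \oo] --> t^'-.
Proof.
move=> A; rewrite /at_left/= => -[e /= e0 eA].
suff : \forall n \near \oo, A (grid_left n t) by [].
near=> n; apply: eA; last by have /andP[] := grid_left_itv n t.
have /andP[h1 h2] := grid_left_itv n t.
rewrite /ball/= ger0_norm ?subr_ge0 ?(ltW h2)//.
apply: (@le_lt_trans _ _ n.+1%:R^-1); first by rewrite lerBlDl -lerBlDr.
by near: n; exact: (near_infty_natSinv_lt (PosNum e0)).
Unshelve. all: by end_near. Qed.

(** On such a set a path has a left limit at every real [t]: either by the cadlag property at [t],
    or because the path vanishes on the left of [t]. *)
Definition left_regular (J : set R) := forall t,
  (J t /\ \forall u \near t^'-, J u) \/ (\forall u \near t^'-, ~ J u).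

Lemma left_regular_horizon T : left_regular [set` `[0, T]].
Proof.
move=> t; have [t0|t0] := ltP 0 t; last first.
  right; near=> u; rewrite /= in_itv/=; apply/negP; rewrite negb_and -ltNge.
  apply/orP; left; apply: lt_le_trans t0; near: u; exact: nbhs_left_lt.
have [tT|tT] := leP t T.
  left; split; first by rewrite /= in_itv/= (ltW t0).
  near=> u; rewrite /= in_itv/=; apply/andP; split.
    by near: u; exact: nbhs_left_ge.
  by apply: le_trans tT; near: u; exact: nbhs_left_le.
right; near=> u; rewrite /= in_itv/=; apply/negP; rewrite negb_and -!ltNge.
by apply/orP; right; near: u; exact: nbhs_left_gt.
Unshelve. all: by end_near. Qed.

Lemma left_regular_infinite : left_regular [set` `[(0 : R), +oo[].
Proof.
move=> t; have [t0|t0] := ltP 0 t; last first.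
  right; near=> u; rewrite /= in_itv/= andbT; apply/negP; rewrite -ltNge.
  apply: lt_le_trans t0; near: u; exact: nbhs_left_lt.
left; split; first by rewrite /= in_itv/= andbT (ltW t0).
by near=> u; rewrite /= in_itv/= andbT; near: u; exact: nbhs_left_ge.
Unshelve. all: by end_near. Qed.

Lemma left_limP (J : set R) (w : @skorohod R d J) t : left_regular J ->
  w u @[u --> t^'-] --> left_lim w t.
Proof.
move=> /(_ t) [[Jt nJ]|nJ]; last first.
  rewrite /left_lim; apply: cvgP (0 : E) _.
  apply: cvg_near_cst; near=> u; apply: path_out.
  by near: u.
have [_ /cvg_ex[l hl]] := @path_cadlag _ _ _ w t Jt.
rewrite /left_lim; apply: (cvgP l) => A /hl.
rewrite /nbhs/= /within/= => h.
have h' : \forall u \near t^'-, J u -> A (w u) := h.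
exact: filter_app h' nJ.
Unshelve. all: by end_near. Qed.

Lemma measurable_left_lim (J : set R) : left_regular J ->
  meas_fun (fun p : R * @skorohod R d J => left_lim p.2 p.1).
Proof.
move=> rJ.
apply: (measurable_rV_cvg
  (f_ := fun n (p : R * @skorohod R d J) => p.2 (grid_left n p.1))).
  move=> n; apply: (@measurable_eval_grid _
    (fun t => Num.floor (- (t * n.+1%:R))) (fun k => (- k - 1)%:~R / n.+1%:R)).
  move=> k; apply: measurable_floor_eq.
  by apply: measurableT_comp => //; exact: measurable_funM.
move=> [t w] /=.
exact: (cvg_comp (grid_left ^~ t) w (@cvg_grid_left t) (@left_limP _ w t rJ)).
Qed.

(** By right continuity the value at [t] is the limit of the values on the grids to the right of
    [t]; for [t < 0] these are eventually 0. *)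
Lemma measurable_eval_infinite :
  meas_fun (fun p : R * Dinf R d => p.2 p.1).
Proof.
apply: (measurable_rV_cvg
  (f_ := fun n (p : R * Dinf R d) => p.2 (grid_right n p.1))).
  move=> n; apply: (@measurable_eval_grid _
    (fun t => Num.floor (t * n.+1%:R)) (fun k => (k + 1)%:~R / n.+1%:R)).
  by move=> k; apply: measurable_floor_eq; exact: measurable_funM.
move=> [t w] /=.
have [t0|t0] := ltP t 0.
  rewrite (@path_out _ _ _ w t); last by rewrite /= in_itv/= andbT leNgt t0.
  apply: cvg_near_cst.
  suff : \forall u \near t^'+, w u = 0 by move/(@cvg_grid_right t).
  near=> u; apply: path_out; rewrite /= in_itv/= andbT; apply/negP.
  by rewrite -ltNge; near: u; exact: nbhs_right_lt.
have Jt : [set` `[(0 : R), +oo[] t by rewrite /= in_itv/= andbT.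
have [h _] := @path_cadlag _ _ _ w t Jt.
suff h' : w u @[u --> t^'+] --> w t by exact: (cvg_comp (grid_right ^~ t) w (@cvg_grid_right t) h').
move=> A /h; rewrite /nbhs/= /within/= => hA; near=> u.
have ut : t < u by near: u; exact: nbhs_right_gt.
have Ju : [set` `[(0 : R), +oo[] u.
  by rewrite /= in_itv/= andbT (le_trans t0)// ltW.
move: ut Ju; near: u; move: hA; apply: filterS => u h1 ut Ju.
by apply: h1.
Unshelve. all: by end_near. Qed.

End paths.

(** * Products of kernels over finitely many particles *)

Section product_kernel.
Local Open Scope ereal_scope.
Context dX dY (X : measurableType dX) (Y : measurableType dY) (R : realType).

Section successor.
Variables (n : nat) (K : R.-pker X ~> Y) (Q : R.-pker (n.-tuple X) ~> (n.-tuple Y)).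

Let mhead : meas_fun (@thead n X).
Proof. exact: measurable_tnth. Qed.

Let mbehead : meas_fun
  (fun p : n.+1.-tuple X * Y => [tuple of behead p.1]).
Proof. exact: (measurableT_comp (@measurable_behead _ X n)
  (@measurable_fst _ _ (n.+1.-tuple X) Y)). Qed.

Let mcons : meas_fun
  (fun p : (n.+1.-tuple X * Y) * n.-tuple Y => [tuple of p.1.2 :: p.2]).
Proof.
apply: measurable_cons.
  exact: (measurableT_comp measurable_snd measurable_fst).
exact: measurable_snd.
Qed.

Let kcons := kernel_image (kernel_reparam Q mbehead) mcons.

Definition kernel_cons (z : n.+1.-tuple X) :
    {measure set (n.+1.-tuple Y) -> \bar R} :=
  (kernel_reparam K mhead \; kcons) z.

Let kernel_cons_measurable U : measurable U ->
  meas_fun (kernel_cons ^~ U).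
Proof. exact: measurable_fun_mkcomp_sfinite. Qed.

HB.instance Definition _ := isKernel.Build _ _ _ _ _ kernel_cons
  kernel_cons_measurable.

Let kernel_cons1 z : kernel_cons z setT = 1.
Proof.
rewrite /kernel_cons /mkcomp/= /kcomp.
transitivity (\int[K (thead z)]_y 1); last first.
  by rewrite integral_cst// mul1e prob_kernel.
by apply: eq_integral => y _; rewrite /= /pushforward preimage_setT prob_kernel.
Qed.

HB.instance Definition _ := Kernel_isProbability.Build _ _ _ _ _ kernel_cons
  kernel_cons1.

Lemma integral_kernel_cons z f : (forall y, 0 <= f y) -> meas_fun f ->
  \int[kernel_cons z]_y f y =
  \int[K (thead z)]_y \int[Q [tuple of behead z]]_ys f [tuple of y :: ys].
Proof.
move=> f0 mf; rewrite /kernel_cons [LHS]integral_kcomp//.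
by apply: eq_integral => y _; rewrite integral_kernel_image.
Qed.

End successor.

Lemma measurable_prode dT (T : measurableType dT) n (g : 'I_n -> T -> \bar R) :
  (forall i, meas_fun (g i)) ->
  meas_fun (fun x => \prod_(i < n) g i x).
Proof.
elim: n g => [|n IH] g mg.
  by under eq_fun do rewrite big_ord0; exact: measurable_cst.
under eq_fun do rewrite big_ord_recl.
by apply: emeasurable_funM => //; apply: IH.
Qed.

(** The first coordinate is drawn from [K] and the others from the product already built. The
    formula on product integrands is carried through the induction because it determines the
    kernel. *)
Lemma product_kernel_ex (K : R.-pker X ~> Y) n :
  exists Q : R.-pker (n.-tuple X) ~> (n.-tuple Y),
    forall z (g : 'I_n -> Y -> \bar R), (forall i, meas_fun (g i)) ->
      (forall i y, 0 <= g i y) ->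
    \int[Q z]_ys \prod_i g i (tnth ys i) = \prod_i \int[K (tnth z i)]_y g i y.
Proof.
elim: n => [|n [Q hQ]].
  pose nilY : 0.-tuple X -> 0.-tuple Y := cst [tuple].
  have mnil : meas_fun nilY by exact: measurable_cst.
  exists (kdirac mnil) => z g mg g0; rewrite big_ord0.
  under eq_integral do rewrite big_ord0.
  by rewrite integral_cst// mul1e [LHS](@prob_kernel _ _ _ _ _ (kdirac mnil)).
exists (kernel_cons K Q) => z g mg g0.
have mp m (h : 'I_m -> Y -> \bar R) : (forall i, meas_fun (h i)) ->
    meas_fun (fun ys : m.-tuple Y => \prod_i h i (tnth ys i)).
  move=> mh; apply: measurable_prode => i.
  exact: (measurableT_comp (mh i) (measurable_tnth i)).
rewrite integral_kernel_cons; last 2 first.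
- by move=> y; exact: prode_ge0.
- exact: mp.
rewrite big_ord_recl -[thead z]/(tnth z ord0).
under eq_integral => y _.
  under eq_integral do rewrite big_ord_recl tnth0.
  over.
have -> : \prod_(i < n) \int[K (tnth z (lift ord0 i))]_y g (lift ord0 i) y =
    \int[Q [tuple of behead z]]_ys \prod_i g (lift ord0 i) (tnth ys i).
  rewrite (hQ _ (fun i => g (lift ord0 i)))//; apply: eq_bigr => i _.
  congr integral.
  by rewrite [in LHS](tuple_eta z) tnthS.
rewrite -ge0_integralZr//; last first.
  by apply: integral_ge0 => ys _; exact: prode_ge0.
apply: eq_integral => y _.
under eq_integral do under eq_bigr do rewrite tnthS.
rewrite ge0_integralZl//.
- by apply: (mp _ (fun i => g (lift ord0 i))).
- by move=> ys _; exact: prode_ge0.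
Qed.

End product_kernel.

Definition power_kernel dX dY (X : measurableType dX) (Y : measurableType dY)
    (R : realType) (K : R.-pker X ~> Y) n :
    R.-pker (n.-tuple X) ~> (n.-tuple Y) :=
  projT1 (cid (product_kernel_ex K n)).

Lemma prod_ind (R : realType) (I : finType) (Q : I -> Prop) :
  (\prod_i @ind R (Q i) = ind (forall i, Q i))%E.
Proof.
have [h|/existsNP[i h]] := pselect (forall i, Q i).
  by rewrite indT// big1// => i _; rewrite indT.
by rewrite indF; [rewrite (bigD1 i)//= indF// mul0e|move/(_ i)].
Qed.

Section rectangles.
Local Open Scope ereal_scope.
Context dY (Y : measurableType dY) (R : realType) (n : nat).

Definition rectangle (B : 'I_n -> set Y) : set (n.-tuple Y) :=
  [set ys | forall i, B i (tnth ys i)].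

Definition rectangles : set (set (n.-tuple Y)) :=
  [set A | exists B, (forall i, measurable (B i)) /\ A = rectangle B].

Lemma measurable_rectangle B : (forall i, measurable (B i)) ->
  measurable (rectangle B).
Proof.
move=> mB; apply: measurable_forall_fin => i.
exact: measurable_preim (measurable_tnth i) (mB i).
Qed.

Lemma rectanglesT : rectangles setT.
Proof. by exists (fun=> setT); split=> //; apply/seteqP; split. Qed.

Lemma rectanglesI : setI_closed rectangles.
Proof.
move=> _ _ [B [mB ->]] [B' [mB' ->]]; exists (fun i => B i `&` B' i); split.
  by move=> i; exact: measurableI.
apply/seteqP; split=> [ys [h h'] i|ys h]; first by split; [exact: h|exact: h'].
by split=> i; have [] := h i.
Qed.

Lemma measurable_rectangles :
  @measurable _ (n.-tuple Y) = <<s rectangles >>.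
Proof.
apply/seteqP; split; last first.
  apply: smallest_sub; first exact: sigma_algebra_measurable.
  by move=> _ [B [mB ->]]; exact: measurable_rectangle.
apply: smallest_sub; first exact: smallest_sigma_algebra.
move=> A; rewrite -bigcup_seq => -[i /= _ [B mB <-]].
apply: sub_sigma_algebra; rewrite /rectangles /=.
exists (fun j => if j == i then B else setT); split.
  by move=> j; case: ifP.
rewrite setTI; apply/seteqP; split=> [ys Bi j|ys /(_ i)]; last by rewrite eqxx.
by case: eqP => // ->.
Qed.

Lemma measure_rectangle_unique (m1 m2 : {measure set (n.-tuple Y) -> \bar R}) :
  m1 setT < +oo ->
  (forall B, (forall i, measurable (B i)) -> m1 (rectangle B) = m2 (rectangle B)) ->
  forall A, measurable A -> m1 A = m2 A.
Proof.
move=> fin e; apply: (finite_measure_unique measurable_rectangles) => //.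
- exact: rectanglesI.
- exact: rectanglesT.
- by move=> _ [B [mB ->]]; exact: e.
Qed.

Lemma measurable_fun_rectangle dT (T : measurableType dT) (f : T -> n.-tuple Y) :
  (forall i, meas_fun (fun x => tnth (f x) i)) ->
  meas_fun f.
Proof. by move=> mf; apply/measurable_fun_tnthP => i; exact: mf. Qed.

End rectangles.

Section power_kernel_theory.
Local Open Scope ereal_scope.
Context dX dY (X : measurableType dX) (Y : measurableType dY) (R : realType).
Variables (K : R.-pker X ~> Y) (n : nat).
Local Notation Q := (power_kernel K n).

Lemma integral_power_prod z (g : 'I_n -> Y -> \bar R) :
  (forall i, meas_fun (g i)) -> (forall i y, 0 <= g i y) ->
  \int[Q z]_ys \prod_i g i (tnth ys i) = \prod_i \int[K (tnth z i)]_y g i y.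
Proof. by rewrite /power_kernel; case: cid => Q' /= hQ; exact: hQ. Qed.

Lemma power_rectangle z (B : 'I_n -> set Y) : (forall i, measurable (B i)) ->
  Q z (rectangle B) = \prod_i K (tnth z i) (B i).
Proof.
move=> mB; rewrite -integral_ind; last exact: measurable_rectangle.
transitivity (\int[Q z]_ys \prod_i ind (B i (tnth ys i))).
  by apply: eq_integral => ys _; rewrite prod_ind.
rewrite (integral_power_prod _ (g := fun i y => ind (B i y)))//; last first.
  by move=> i; exact: measurable_ind (mB i).
by apply: eq_bigr => i _; rewrite integral_ind.
Qed.

Lemma eq_integral_rectangle (m1 m2 : {measure set (n.-tuple Y) -> \bar R}) :
  m1 setT < +oo ->
  (forall B, (forall i, measurable (B i)) -> m1 (rectangle B) = m2 (rectangle B)) ->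
  forall f, \int[m1]_x f x = \int[m2]_x f x.
Proof.
move=> fin e f; apply: eq_measure_integral => A mA _.
exact: measure_rectangle_unique.
Qed.

Lemma power_kernel_perm (s : 'I_n -> 'I_n) z (f : n.-tuple Y -> \bar R) :
  bijective s -> meas_fun f -> (forall y, 0 <= f y) ->
  \int[Q z]_ys f [tuple tnth ys (s i) | i < n] =
  \int[Q [tuple tnth z (s i) | i < n]]_ys f ys.
Proof.
move=> bs mf f0.
have ms : meas_fun
    (fun ys : n.-tuple Y => [tuple tnth ys (s i) | i < n]).
  apply: measurable_fun_rectangle => i; under eq_fun do rewrite tnth_mktuple.
  exact: measurable_tnth.
rewrite -(integral_image _ ms)//; apply: eq_integral_rectangle => [|B mB].
  by rewrite /= /pushforward preimage_setT prob_kernel ltry.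
have [s' ss' s's] := bs.
rewrite /= /pushforward power_rectangle//.
have -> : (fun ys : n.-tuple Y => [tuple tnth ys (s i) | i < n]) @^-1` rectangle B
    = rectangle (B \o s').
  apply/seteqP; split=> ys h i /=.
    by have := h (s' i); rewrite tnth_mktuple s's.
  by rewrite tnth_mktuple; have := h (s i); rewrite /= ss'.
rewrite power_rectangle; last by move=> i; exact: mB.
rewrite (reindex s) /=; last by exists s' => i _.
by apply: eq_bigr => i _; rewrite tnth_mktuple ss'.
Qed.

(** Replacing the coordinates outside [C] by a constant does not change [f], and the image of the
    product law under this truncation depends on [z] only through its coordinates in [C]. *)
Lemma power_kernel_dep (C : {set 'I_n}) z z' (f : n.-tuple Y -> \bar R) :
  meas_fun f -> (forall y, 0 <= f y) ->
  (forall i, i \in C -> tnth z i = tnth z' i) ->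
  (forall ys ys', (forall i, i \in C -> tnth ys i = tnth ys' i) -> f ys = f ys') ->
  \int[Q z]_ys f ys = \int[Q z']_ys f ys.
Proof.
move=> mf f0 zz' fC.
pose trunc (ys : n.-tuple Y) :=
  [tuple if i \in C then tnth ys i else point | i < n].
have mt : meas_fun trunc.
  apply: measurable_fun_rectangle => i; under eq_fun do rewrite tnth_mktuple.
  by case: (i \in C); [exact: measurable_tnth|exact: measurable_cst].
have ft z1 : \int[Q z1]_ys f ys = \int[image_measure (Q z1) mt]_ys f ys.
  rewrite integral_image//; apply: eq_integral => ys _; apply: fC => i iC.
  by rewrite tnth_mktuple iC.
rewrite !ft; apply: eq_integral_rectangle => [|B mB].
  by rewrite /= /pushforward preimage_setT prob_kernel ltry.
rewrite /= /pushforward.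
(* Outside [C] the truncated coordinate is [point], so its constraint holds always or never. *)
pose B' i := if i \in C then B i else [set y | B i point].
have mB' i : measurable (B' i).
  rewrite /B'; case: ifP => // _; have [b|b] := pselect (B i point).
    by rewrite (_ : mkset _ = setT)//; apply/seteqP; split.
  by rewrite (_ : mkset _ = set0)//; apply/seteqP; split.
have -> : trunc @^-1` rectangle B = rectangle B'.
  apply/seteqP; split=> ys h i /=; have := h i; rewrite tnth_mktuple /B';
  by case: ifP.
rewrite !power_rectangle//; apply: eq_bigr => i _; rewrite /B'.
case: ifP => [iC|_]; first by rewrite zz'.
have [b|b] := pselect (B i point).
  by rewrite (_ : mkset _ = setT) ?prob_kernel//; apply/seteqP; split.
by rewrite (_ : mkset _ = set0) ?measure0//; apply/seteqP; split.
Qed.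

End power_kernel_theory.

Section power_measure.
Context dY (Y : measurableType dY) (R : realType) (P : probability Y R) (n : nat).
Local Open Scope ereal_scope.

(** A law seen as a kernel from [unit], so that [power_kernel] also provides product measures. *)
Definition probability_kernel_cst (u : unit) : {measure set Y -> \bar R} := P.

Let mprobability_kernel_cst U : measurable U ->
  meas_fun (probability_kernel_cst ^~ U).
Proof. by move=> mU; exact: measurable_cst. Qed.

HB.instance Definition _ := isKernel.Build _ _ _ _ _ probability_kernel_cst
  mprobability_kernel_cst.

Let probability_kernel_cst1 u : probability_kernel_cst u setT = 1.
Proof. exact: probability_setT. Qed.

HB.instance Definition _ := Kernel_isProbability.Build _ _ _ _ _
  probability_kernel_cst probability_kernel_cst1.

Definition power_measure : {measure set (n.-tuple Y) -> \bar R} :=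
  power_kernel probability_kernel_cst n [tuple tt | i < n].

Lemma power_measure_rectangle B : (forall i, measurable (B i)) ->
  power_measure (rectangle B) = \prod_i P (B i).
Proof. by move=> mB; rewrite /power_measure power_rectangle. Qed.

Lemma power_measure_perm (s : 'I_n -> 'I_n) (f : n.-tuple Y -> \bar R) :
  bijective s -> meas_fun f -> (forall y, 0 <= f y) ->
  \int[power_measure]_ys f [tuple tnth ys (s i) | i < n] =
  \int[power_measure]_ys f ys.
Proof.
move=> bs mf f0; rewrite /power_measure power_kernel_perm//.
congr (integral (power_kernel _ _ _) _ _); apply: eq_from_tnth => i.
by rewrite !tnth_mktuple.
Qed.

End power_measure.

(** * Free motion and observations *)

Section evaluation.
Variables (R : realType) (d : nat).
Local Notation E := 'rV[R]_d.

(* [b] selects the value just before [t] *)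
Definition ev (J : set R) (b : bool) (w : @skorohod R d J) (t : R) : E :=
  if b then left_lim w t else w t.

Definition evs (J : set R) N b (ys : N.-tuple (@skorohod R d J)) t : N.-tuple E :=
  [tuple ev b (tnth ys i) t | i < N].

Lemma measurable_fun_skorohod (J : set R) dT (T : measurableType dT)
    (f : T -> @skorohod R d J) :
  (forall t, J t -> meas_fun (fun x => f x t)) ->
  meas_fun f.
Proof.
move=> mf; apply: (@measurability _ _ _ _ _ _
  [set A | exists t (B : set E),
         [/\ J t, measurable B & A = [set w : @skorohod R d J | B (w t)]]]) => //.
move=> _ [_ [t [B [Jt mB ->]]] <-]; rewrite setTI.
exact: measurable_preim (mf t Jt) mB.
Qed.

Lemma measurable_ev b dT (T : measurableType dT) (y : T -> Dinf R d) (t : T -> R) :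
  meas_fun y -> meas_fun t ->
  meas_fun (fun x => ev b (y x) (t x)).
Proof.
move=> my mt; have mty : meas_fun (fun x => (t x, y x)).
  exact/measurable_fun_pairP.
case: b; rewrite /ev.
  have h := @measurable_left_lim R d _ (@left_regular_infinite R).
  exact: (@measurableT_comp _ _ _ _ _ _ _ _ _ h mty).
have h := @measurable_eval_infinite R d.
exact: (@measurableT_comp _ _ _ _ _ _ _ _ _ h mty).
Qed.

Lemma measurable_evs b N dT (T : measurableType dT) (y : T -> N.-tuple (Dinf R d))
    (t : T -> R) :
  meas_fun y -> meas_fun t ->
  meas_fun (fun x => evs b (y x) (t x)).
Proof.
move=> my mt; apply: measurable_fun_rectangle => i.
under eq_fun do rewrite tnth_mktuple; apply: measurable_ev => //.
exact: (measurableT_comp (measurable_tnth i) my).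
Qed.

Lemma measurable_shift_path u : meas_fun (@shift_path R d u).
Proof.
apply: measurable_fun_skorohod => t Jt.
rewrite (_ : (fun _ => _) = fun w : Dinf R d => w (Num.max 0 u + t)).
  exact: measurable_eval.
by apply/funext => w; rewrite /= patchT// inE.
Qed.

(** The left value requires [t > 0]: at 0 the left limit of the shifted path is that of its
    extension by 0 to negative times, not that of [w] at [u]. *)
Lemma ev_shift b u (w : Dinf R d) t : 0 <= u -> (if b then 0 < t else 0 <= t) ->
  ev b (shift_path u w) t = ev b w (u + t).
Proof.
move=> u0; have vE v : 0 <= v -> shift_path u w v = w (u + v).
  move=> v0; rewrite /= patchT ?inE/= ?in_itv/= ?andbT//.
  by rewrite max_r.
case: b => t0; last exact: vE.
apply: cvg_lim => //.
have h := @left_limP _ _ _ w (u + t) (@left_regular_infinite R).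
move=> A /h; rewrite /nbhs/= /at_left /within/= => hA.
have : (u + v)%R @[v --> t] --> (u + t)%R.
  by apply: cvgD; [exact: cvg_cst|exact: cvg_id].
move=> /(_ _ hA) h2.
have {}h2 : \forall v \near t, u + v < u + t -> A (w (u + v)) := h2.
suff : \forall v \near t, v < t -> A (shift_path u w v) by [].
near=> v => vt; rewrite vE; last by apply: ltW; near: v; exact: lt_nbhsr.
have : u + v < u + t -> A (w (u + v)) by near: v.
by apply; rewrite ltrD2l.
Unshelve. all: by end_near. Qed.

Definition shift_paths N u (ys : N.-tuple (Dinf R d)) : N.-tuple (Dinf R d) :=
  [tuple shift_path u (tnth ys i) | i < N].

Lemma measurable_shift_paths N u : meas_fun (@shift_paths N u).
Proof.
apply: measurable_fun_rectangle => i.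
rewrite (_ : (fun _ => _) =
    fun ys : N.-tuple (Dinf R d) => shift_path u (tnth ys i)).
  exact: (measurableT_comp (measurable_shift_path u) (measurable_tnth i)).
by apply/funext => ys; rewrite /shift_paths tnth_mktuple.
Qed.

End evaluation.

(** A cylinder event: at each of finitely many times, every particle has to lie in a prescribed set,
    with [setT] for no constraint. Carried along the motion as a factor 0 or 1, it reduces
    finite-dimensional laws to expectations at a single time. *)
Record observation (R : realType) (d N : nat) := Observation {
  obs_size : nat;
  obs_time : 'I_obs_size -> R;
  obs_set : 'I_obs_size -> 'I_N -> set 'rV[R]_d;
  obs_measurable : forall l i, measurable (obs_set l i) }.

Section seen.
Variables (R : realType) (d N : nat) (o : observation R d N).
Local Notation E := 'rV[R]_d.

(** The path [w] starts at time [s], hence the shift of the observation times. The range is closed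
    on the left and open on the right, so that consecutive ranges concatenate; an observation at the
    final time is left to the test function. *)
Definition seen1 (i : 'I_N) (s t : R) (w : Dinf R d) : Prop :=
  forall l, s <= @obs_time _ _ _ o l < t ->
    @obs_set _ _ _ o l i (w (@obs_time _ _ _ o l - s)).

Definition seen (s t : R) (ys : N.-tuple (Dinf R d)) : Prop :=
  forall i, seen1 i s t (tnth ys i).

Lemma measurable_seen dT (T : measurableType dT) (s t : T -> R)
    (y : T -> N.-tuple (Dinf R d)) :
  meas_fun s -> meas_fun t -> meas_fun y ->
  measurable [set x | seen (s x) (t x) (y x)].
Proof.
move=> ms mt my; apply: measurable_forall_fin => i.
apply: measurable_forall_fin => l; apply: measurable_imply.
  rewrite (_ : mkset _ = [set x | s x <= @obs_time _ _ _ o l] `&`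
                         [set x | @obs_time _ _ _ o l < t x]).
    apply: measurableI; [exact: measurable_le_fun|exact: measurable_lt_fun].
  by apply/seteqP; split=> x /=; [move=> /andP[]|move=> [-> ->]].
apply: (measurable_preim (f := fun x => tnth (y x) i (obs_time l - s x)))
  (obs_measurable _ _); apply: (@measurable_ev _ _ false).
  exact: (measurableT_comp (measurable_tnth i) my).
by apply: measurable_funB.
Qed.

Lemma seen1_evals i s s' t : s' <= s -> t <= s ->
  evals_upto (s - s') [set w : Dinf R d | seen1 i s' t w].
Proof.
move=> s's ts.
set gens := [set A | exists u (B : set E),
  [/\ 0 <= u <= s - s', measurable B & A = [set w : Dinf R d | B (w u)]]].
suff : @measurable _ (sigma_of gens)
  [set w : Dinf R d | seen1 i s' t w] by [].
apply: measurable_forall_fin => l; apply: measurable_cond => /andP[h1 h2].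
apply: sub_sigma_algebra; rewrite /gens /=.
exists (obs_time l - s'), (obs_set l i); split=> //; last exact: obs_measurable.
by rewrite subr_ge0 h1/= lerD2r (le_trans (ltW h2)).
Qed.

Lemma seen_split s' s t (ys : N.-tuple (Dinf R d)) : s' <= s -> s <= t ->
  seen s' t ys <-> seen s' s ys /\ seen s t (shift_paths (s - s') ys).
Proof.
move=> s's st.
have shE i l : s <= @obs_time _ _ _ o l ->
    tnth (shift_paths (s - s') ys) i (obs_time l - s) =
    tnth ys i (@obs_time _ _ _ o l - s').
  move=> sl; rewrite tnth_mktuple.
  rewrite -[LHS]/(ev false _ _) ev_shift/= ?subr_ge0//.
  by congr (tnth ys i _); ring.
split=> [h|[h1 h2] i l /andP[l1 l2]].
  split=> i l /andP[l1 l2]; first by apply: h; rewrite l1 (lt_le_trans l2).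
  by rewrite shE//; apply: h; rewrite (le_trans s's)// l2.
have [ls|sl] := ltP (obs_time l) s; first by apply: h1; rewrite l1.
by rewrite -shE//; apply: h2; rewrite sl.
Qed.

End seen.

(** * Free motion between interactions *)

Section flow.
Local Open Scope ereal_scope.
Variables (R : realType) (d N : nat) (o : observation R d N).
Local Notation E := 'rV[R]_d.
Local Notation X := (N.-tuple E).
Variable Pi : R.-pker E ~> Dinf R d.
Local Notation Q := (power_kernel Pi N).

(* the particles move freely from [z] at time [s]; [f] is evaluated at time [t], if the
   observations made in between are as required *)
Definition flow (b : bool) (s t : R) (f : X -> \bar R) (z : X) : \bar R :=
  \int[Q z]_ys (ind (seen o s t ys) * f (evs b ys (t - s))).

Lemma flow_ge0 b s t f z : (forall x, 0 <= f x) -> 0 <= flow b s t f z.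
Proof. by move=> f0; apply: integral_ge0 => ys _; rewrite mule_ge0. Qed.

Lemma measurable_flow_integrand dT (T : measurableType dT) b (s t : T -> R)
    (y : T -> N.-tuple (Dinf R d)) (f : T -> X -> \bar R) :
  meas_fun s -> meas_fun t -> meas_fun y ->
  meas_fun (fun p => f p.1 p.2) ->
  meas_fun
    (fun x => ind (seen o (s x) (t x) (y x)) * f x (evs b (y x) (t x - s x))).
Proof.
move=> ms mt my mf; apply: emeasurable_funM.
  by apply: measurable_ind; exact: measurable_seen.
have m : meas_fun (fun x => (x, evs b (y x) (t x - s x))).
  apply/measurable_fun_pairP; split; first exact: measurable_id.
  by apply: measurable_evs => //; exact: measurable_funB.
exact: (measurableT_comp mf m).
Qed.

Lemma measurable_flow dT (T : measurableType dT) b (s t : T -> R)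
    (f : T -> X -> \bar R) :
  meas_fun s -> meas_fun t ->
  meas_fun (fun p => f p.1 p.2) -> (forall x z, 0 <= f x z) ->
  meas_fun (fun p : T * X => flow b (s p.1) (t p.1) (f p.1) p.2).
Proof.
move=> ms mt mf f0.
apply: (@measurable_int_kernel _ _ _ (T * X)%type X (N.-tuple (Dinf R d)) R Q
  snd measurable_snd (fun p ys => ind (seen o (s p.1) (t p.1) ys) *
                      f p.1 (evs b ys (t p.1 - s p.1)))); last first.
  by move=> p ys; rewrite mule_ge0.
have mp : meas_fun (fun p : (T * X) * N.-tuple (Dinf R d) => p.1.1).
  exact: (measurableT_comp measurable_fst measurable_fst).
apply: (@measurable_flow_integrand _ ((T * X) * N.-tuple (Dinf R d))%type b
  (fun p => s p.1.1) (fun p => t p.1.1) snd (fun p => f p.1.1)) => //.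
- exact: (measurableT_comp ms mp).
- exact: (measurableT_comp mt mp).
- have m : meas_fun
      (fun q : ((T * X) * N.-tuple (Dinf R d)) * X => (q.1.1.1, q.2)).
    apply/measurable_fun_pairP; split => /=.
      exact: (measurableT_comp mp measurable_fst).
    exact: measurable_snd.
  exact: (measurableT_comp mf m).
Qed.

Lemma measurable_flow1 b s t f : meas_fun f ->
  (forall x, 0 <= f x) -> meas_fun (flow b s t f).
Proof.
move=> mf f0.
have h := @measurable_flow _ unit b (cst s) (cst t) (fun=> f)
  (measurable_cst _) (measurable_cst _)
  (measurableT_comp mf measurable_snd) (fun=> f0).
exact: (measurableT_comp h (pair1_measurable tt)).
Qed.

Let mi b s t (f : X -> \bar R) : meas_fun f -> meas_fun
  (fun ys => ind (seen o s t ys) * f (evs b ys (t - s))).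
Proof.
move=> mf; apply: (@measurable_flow_integrand _ _ b (cst s) (cst t) id (fun=> f)) => //.
exact: (measurableT_comp mf measurable_snd).
Qed.

Lemma flow_le1 b s t f z : meas_fun f -> (forall x, 0 <= f x) ->
  (forall x, f x <= 1) -> flow b s t f z <= 1.
Proof.
move=> mf f0 f1; apply: (@le_trans _ _ (\int[Q z]_ys 1)).
  apply: ge0_le_integral => //.
  - by move=> ys _; rewrite mule_ge0.
  - exact: mi.
  - move=> ys _; rewrite -[leRHS]mule1; apply: lee_pmul => //.
    exact: ind_le1.
by rewrite integral_cst// mul1e prob_kernel.
Qed.

Definition depends_on (C : {set 'I_N}) (f : X -> \bar R) : Prop :=
  forall z z', (forall i, i \in C -> tnth z i = tnth z' i) -> f z = f z'.

Lemma flow_dep (C : {set 'I_N}) b s t f : meas_fun f ->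
  (forall x, 0 <= f x) ->
  (forall l i, i \notin C -> @obs_set _ _ _ o l i = setT) ->
  depends_on C f -> depends_on C (flow b s t f).
Proof.
move=> mf f0 oC fC z z' zz'; apply: (@power_kernel_dep _ _ _ _ _ Pi N C) => //.
- exact: mi.
- by move=> ys; rewrite mule_ge0.
- move=> ys ys' yy'; congr (_ * _); last first.
    by apply: fC => i iC; rewrite !tnth_mktuple yy'.
  apply: ind_iff; split=> h i.
    have [iC|iC] := boolP (i \in C); first by rewrite -yy'.
    by move=> l _; rewrite oC.
  have [iC|iC] := boolP (i \in C); first by rewrite yy'.
  by move=> l _; rewrite oC.
Qed.

Hypothesis hPi : markov_process Pi.

(** The Chapman-Kolmogorov relation. At the intermediate time [s] the value itself is taken, as in
    the Markov property; a left value at [t] can be read from the path restarted at [s] only if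
    [s < t]. *)
Lemma flow_flow b s' s t f z : meas_fun f -> (forall x, 0 <= f x) ->
  (s' <= s)%R -> (if b then (s < t)%R else (s <= t)%R) ->
  flow false s' s (flow b s t f) z = flow b s' t f z.
Proof.
move=> mf f0 s's bst; have st : (s <= t)%R by move: bst; case: b => // /ltW.
have u0 : (0 <= s - s')%R by rewrite subr_ge0.
pose g ys := ind (seen o s t ys) * f (evs b ys (t - s)).
have g0 ys : 0 <= g ys by rewrite mule_ge0.
have mg : meas_fun g by exact: mi.
pose u := (s - s')%R.
have mE : meas_fun (fun ys : N.-tuple (Dinf R d) => evs false ys u).
  by apply: measurable_evs => //; exact: measurable_id.
have mS : measurable [set ys : N.-tuple (Dinf R d) | seen o s' s ys].
  exact: (@measurable_seen _ _ _ o _ _ (cst s') (cst s) id).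
transitivity (\int[Q z]_ys (ind (seen o s' s ys) * g (shift_paths u ys))).
  (* It suffices to test rectangles of shifted paths. There the identity is the Markov property of
     each particle, with the observations made before [s] as the event of the past. *)
  apply/esym; apply: (@mixture _ _ _ _ _ _ R (kernel_at Q z) _ mE _
    (measurable_shift_paths u) Q _ mS _ (measurable_rectangles (Dinf R d) N)
    (@rectanglesI _ _ _) (rectanglesT _ _) _ g mg g0).
  move=> _ [B [mB ->]].
  have mB1 i : measurable [set w : Dinf R d |
      seen1 o i s' s w /\ B i (shift_path u w)].
    apply: measurableI.
      apply: measurable_forall_fin => l; apply: measurable_cond => _.
      exact: (measurable_preim (@measurable_eval _ _ _ _) (obs_measurable _ _)).
    exact: (measurable_preim (measurable_shift_path u) (mB i)).
  transitivity (Q z (rectangle (fun i => [set w : Dinf R d |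
      seen1 o i s' s w /\ B i (shift_path u w)]))).
    congr (Q z _); apply/seteqP; split=> [ys [h1 h2] i|ys h].
      by split; [exact: h1|have := h2 i; rewrite tnth_mktuple].
    by split=> i; have [//] := h i; rewrite tnth_mktuple.
  rewrite power_rectangle//.
  transitivity (\int[Q z]_ys \prod_i
      (ind (seen1 o i s' s (tnth ys i)) * Pi (tnth ys i u) (B i))); last first.
    apply: eq_integral => ys _; rewrite power_rectangle// -prod_ind -big_split/=.
    by apply: eq_bigr => i _; rewrite tnth_mktuple.
  have m1 i : measurable [set w : Dinf R d | seen1 o i s' s w].
    apply: measurable_forall_fin => l; apply: measurable_cond => _.
    exact: (measurable_preim (@measurable_eval _ _ _ _) (obs_measurable _ _)).
  rewrite (integral_power_prod _ _ (g := fun i w =>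
      ind (seen1 o i s' s w) * Pi (w u) (B i))); last 2 first.
  - move=> i; apply: emeasurable_funM; first exact: measurable_ind.
    exact: (measurableT_comp (measurable_kernel Pi _ (mB i)) (measurable_eval u)).
  - by move=> i w; rewrite mule_ge0.
  apply: eq_bigr => i _; rewrite integral_indM; last exact: m1.
  have := hPi.2 (tnth z i) u _ (B i) u0 (@seen1_evals _ _ _ o i s s' s s's (lexx _)) (mB i).
  by move=> <-.
rewrite /flow; apply: eq_integral => ys _.
rewrite (ind_iff (seen_split o ys s's st)) ind_and -muleA /g; congr (_ * (_ * f _)).
apply: eq_from_tnth => i; rewrite !tnth_mktuple ev_shift//; last first.
  by move: bst; case: (b); rewrite ?subr_gt0 ?subr_ge0.
by congr ev; rewrite /u; ring.
Qed.

End flow.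

Lemma flow_relabel (R : realType) (d N : nat) (Pi : R.-pker 'rV[R]_d ~> Dinf R d)
    (o o' : observation R d N) (p : 'I_N -> 'I_N) b s t
    (f : N.-tuple 'rV[R]_d -> \bar R) z :
  bijective p -> meas_fun f -> (forall x, (0 <= f x)%E) ->
  (forall s t ys, seen o s t ys <->
     seen o' s t [tuple tnth ys (p i) | i < N]) ->
  flow o Pi b s t (fun z => f [tuple tnth z (p i) | i < N]) z =
  flow o' Pi b s t f [tuple tnth z (p i) | i < N].
Proof.
move=> bp mf f0 oo'; rewrite /flow -power_kernel_perm//.
- apply: eq_integral => ys _; rewrite (ind_iff (oo' _ _ _)); congr (_ * f _)%E.
  by apply: eq_from_tnth => i; rewrite !tnth_mktuple.
- apply: (@measurable_flow_integrand _ _ _ o' _ _ b (cst s) (cst t) id (fun=> f)) => //.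
  exact: (measurableT_comp mf measurable_snd).
- by move=> ys; rewrite mule_ge0.
Qed.

(** * The collision operators *)

Section collision.
Local Open Scope ereal_scope.
Variables (R : realType) (d N : nat) (Lambda : R).
Local Notation E := 'rV[R]_d.
Local Notation X := (N.-tuple E).
Variable mu : R.-fker (E * E)%type ~> (E * E)%type.

Definition pair_at (ab : 'I_N * 'I_N) (z : X) : E * E := (tnth z ab.1, tnth z ab.2).

Definition jumped (ab : 'I_N * 'I_N) (hk : E * E) (z : X) : X :=
  [tuple (tnth z i + (if i == ab.1 then hk.1
                     else if i == ab.2 then hk.2 else 0))%R | i < N].

(** The probability of a jump times the normalised law of the amplitudes is [mu / Lambda], so that
    the total mass of [mu], which may vanish, is never divided by. *)
Definition collide (ab : 'I_N * 'I_N) (f : X -> \bar R) (z : X) : \bar R :=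
  (1 - fine (mu (pair_at ab z) setT) / Lambda)%:E * f z +
  (Lambda^-1)%:E * \int[mu (pair_at ab z)]_hk f (jumped ab hk z).

Lemma measurable_pair_at ab : meas_fun (pair_at ab).
Proof. by apply/measurable_fun_pairP; split; exact: measurable_tnth. Qed.

Lemma measurable_jumped ab dT (T : measurableType dT) (hk : T -> E * E) (z : T -> X) :
  meas_fun hk -> meas_fun z ->
  meas_fun (fun x => jumped ab (hk x) (z x)).
Proof.
move=> mhk mz; apply: measurable_fun_rectangle => i.
under eq_fun do rewrite tnth_mktuple; apply: measurable_rVD.
  exact: (measurableT_comp (measurable_tnth i) mz).
case: (i == ab.1); first exact: (measurableT_comp measurable_fst mhk).
case: (i == ab.2); first exact: (measurableT_comp measurable_snd mhk).
exact: measurable_cst.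
Qed.

Hypothesis Lambda_gt0 : (0 < Lambda)%R.
Hypothesis mu_le : forall v, mu v setT <= Lambda%:E.

Let mu_fin v : mu v setT \is a fin_num.
Proof. exact: finite_kernel_measure. Qed.

Lemma collision_proba_itv v : (0 <= fine (mu v setT) / Lambda <= 1)%R.
Proof.
apply/andP; split; first by rewrite divr_ge0 ?fine_ge0// ltW.
by rewrite ler_pdivrMr// mul1r -lee_fin fineK.
Qed.

Lemma collide_ge0 ab f z : (forall x, 0 <= f x) -> 0 <= collide ab f z.
Proof.
move=> f0; have /andP[h0 h1] := collision_proba_itv (pair_at ab z).
apply: adde_ge0; apply: mule_ge0 => //.
- by rewrite lee_fin subr_ge0.
- by rewrite lee_fin invr_ge0 ltW.
- by apply: integral_ge0.
Qed.

Lemma measurable_collide dT (T : measurableType dT) ab (f : T -> X -> \bar R) :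
  meas_fun (fun p => f p.1 p.2) -> (forall x z, 0 <= f x z) ->
  meas_fun (fun p : T * X => collide ab (f p.1) p.2).
Proof.
move=> mf f0.
have mp : meas_fun (fun p : T * X => pair_at ab p.2).
  exact: (measurableT_comp (measurable_pair_at ab) measurable_snd).
apply: emeasurable_funD; apply: emeasurable_funM.
- apply/measurable_EFinP; apply: measurable_funB => //.
  apply: measurable_funM => //; apply: measurableT_comp => //.
  exact: (measurableT_comp (measurable_kernel mu _ measurableT) mp).
- exact: mf.
- exact: measurable_cst.
- apply: (@measurable_int_kernel _ _ _ (T * X)%type _ _ R mu _ mp
    (fun p hk => f p.1 (jumped ab hk p.2))) => //.
  have m : meas_fun
      (fun q : (T * X) * (E * E) => (q.1.1, jumped ab q.2 q.1.2)).
    apply/measurable_fun_pairP; split => /=.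
      exact: (measurableT_comp measurable_fst measurable_fst).
    apply: measurable_jumped => //.
    exact: (measurableT_comp measurable_snd measurable_fst).
  exact: (measurableT_comp mf m).
Qed.

Let mj ab z (f : X -> \bar R) : meas_fun f ->
  meas_fun (fun hk => f (jumped ab hk z)).
Proof.
move=> mf; apply: (measurableT_comp mf); exact: measurable_jumped.
Qed.

Lemma collide_le1 ab f z : meas_fun f -> (forall x, 0 <= f x) ->
  (forall x, f x <= 1) -> collide ab f z <= 1.
Proof.
move=> mf f0 f1; have /andP[h0 h1] := collision_proba_itv (pair_at ab z).
have -> : 1 = (1 - fine (mu (pair_at ab z) setT) / Lambda)%:E * 1 +
    (Lambda^-1)%:E * (1 * mu (pair_at ab z) setT).
  rewrite mule1 mul1e -{2}(fineK (mu_fin _)) -EFinM -EFinD; congr (_%:E).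
  by rewrite [X in (_ + X)%R]mulrC subrK.
apply: leeD; apply: lee_pmul => //.
- by rewrite lee_fin subr_ge0.
- by rewrite lee_fin invr_ge0 ltW.
- by apply: integral_ge0.
rewrite -integral_cst//; apply: ge0_le_integral => //; exact: mj.
Qed.

Lemma collide_dep (C C' : {set 'I_N}) ab f :
  C \subset C' -> ab.1 \in C' -> ab.2 \in C' ->
  depends_on C f -> depends_on C' (collide ab f).
Proof.
move=> /fintype.subsetP CC' a b fC z z' zz'.
have pE : pair_at ab z = pair_at ab z' by rewrite /pair_at !zz'.
rewrite /collide pE; congr (_ * _ + _ * _).
  by apply: fC => i /CC'; exact: zz'.
apply: eq_integral => hk _; apply: fC => i /CC' iC.
by rewrite !tnth_mktuple zz'.
Qed.

(** The jump does not move the particles seen by [f], and the two weights add up to 1. This is what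
    makes an interaction outside [C] invisible. *)
Lemma collide_outside (C : {set 'I_N}) ab f z :
  ab.1 \notin C -> ab.2 \notin C -> (forall x, 0 <= f x) ->
  depends_on C f -> collide ab f z = f z.
Proof.
move=> a b f0 fC; have /andP[h0 h1] := collision_proba_itv (pair_at ab z).
rewrite /collide (eq_integral (cst (f z))); last first.
  move=> hk _; apply: fC => i iC; rewrite tnth_mktuple.
  case: eqP => [ia|_]; first by rewrite -ia iC in a.
  case: eqP => [ib|_]; first by rewrite -ib iC in b.
  by rewrite addr0.
rewrite integral_cst// -{2}(fineK (mu_fin _)) (muleC (f z)) muleA -EFinM.
rewrite -ge0_muleDl ?lee_fin ?subr_ge0//; last first.
  by rewrite mulr_ge0 ?invr_ge0 ?fine_ge0// ltW.
by rewrite -EFinD [X in (_ + X)%R]mulrC subrK mul1e.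
Qed.

(** The symmetry of the kernel acts here. It is wanted because the forward system lists the pairs
    with [i < j] while the backward draws come in either order. For [a = b] the definition of
    [jumped] would keep the first amplitude only. *)
Lemma collide_sym a b f z : a != b ->
  (forall v w (A : set (E * E)), measurable A ->
    mu (v, w) A = mu (w, v) ((fun hk => (hk.2, hk.1)) @^-1` A)) ->
  meas_fun f -> (forall x, 0 <= f x) ->
  collide (a, b) f z = collide (b, a) f z.
Proof.
move=> ab mus mf f0; rewrite /collide /pair_at/=.
rewrite (mus (tnth z a)) ?preimage_setT//; congr (_ + _ * _).
have mswap : meas_fun (fun hk : E * E => (hk.2, hk.1)).
  by apply/measurable_fun_pairP; split; [exact: measurable_snd|exact: measurable_fst].
rewrite (eq_measure_integral (image_measure (mu (tnth z b, tnth z a)) mswap)); last first.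
  by move=> A mA _; exact: mus.
rewrite integral_image; last 2 first.
- exact: mj.
- by [].
apply: eq_integral => -[h k] _; congr f; apply: eq_from_tnth => i.
rewrite !tnth_mktuple /=; case: (eqVneq i a) => [->|//].
by rewrite (negbTE ab).
Qed.

Lemma collide_relabel (p : 'I_N -> 'I_N) a b f z : injective p ->
  collide (p a, p b) (fun z => f [tuple tnth z (p i) | i < N]) z =
  collide (a, b) f [tuple tnth z (p i) | i < N].
Proof.
move=> ip; rewrite /collide /pair_at/= !tnth_mktuple; congr (_ + _ * _).
apply: eq_integral => hk _; congr f; apply: eq_from_tnth => i.
by rewrite !tnth_mktuple /= !(inj_eq ip).
Qed.

Variables (o : observation R d N) (Pi : R.-pker E ~> Dinf R d).
Variable P0 : probability E R.

(* the expectation of [f] at time [t] when the interactions are the [I k] at the times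
   [s k], for k < n, computed from the last interaction to the first *)
Fixpoint history (b : bool) (s : nat -> R) (I : nat -> 'I_N * 'I_N) (n : nat)
    (t : R) (f : X -> \bar R) : \bar R :=
  if n is m.+1 then
    history true s I m (s m) (collide (I m) (flow o Pi b (s m) t f))
  else \int[power_measure P0 N]_z flow o Pi b 0 t f z.

Lemma history_ge0 b s I n t f : (forall z, 0 <= f z) -> 0 <= history b s I n t f.
Proof.
elim: n b t f => [|n IH] b t f f0 /=.
  by apply: integral_ge0 => z _; exact: flow_ge0.
by apply: IH => z; apply: collide_ge0 => x; exact: flow_ge0.
Qed.

Lemma measurable_collide_flow dT (T : measurableType dT) b (s t : T -> R)
    (I : T -> 'I_N * 'I_N) (f : T -> X -> \bar R) :
  meas_fun s -> meas_fun t -> fin_measurable I ->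
  meas_fun (fun p => f p.1 p.2) -> (forall x z, 0 <= f x z) ->
  meas_fun
    (fun p : T * X => collide (I p.1) (flow o Pi b (s p.1) (t p.1) (f p.1)) p.2).
Proof.
move=> ms mt mI mf f0.
apply: (measurable_fin_case (k := fun p : T * X => I p.1)
  (f := fun i p => collide i (flow o Pi b (s p.1) (t p.1) (f p.1)) p.2)).
  by move=> i; exact: (measurable_preim (@measurable_fst _ _ T X) (mI i)).
move=> i; apply: (@measurable_collide _ _ i
  (fun x => flow o Pi b (s x) (t x) (f x))).
  exact: measurable_flow.
by move=> x z; exact: flow_ge0.
Qed.

Lemma measurable_history dT (T : measurableType dT) b (s : nat -> T -> R)
    (I : nat -> T -> 'I_N * 'I_N) n (t : T -> R) (f : T -> X -> \bar R) :
  (forall k, (k < n)%N -> meas_fun (s k)) ->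
  (forall k, (k < n)%N -> fin_measurable (I k)) ->
  meas_fun t ->
  meas_fun (fun p => f p.1 p.2) -> (forall x z, 0 <= f x z) ->
  meas_fun
    (fun x => history b (s ^~ x) (I ^~ x) n (t x) (f x)).
Proof.
elim: n b t f => [|n IH] b t f ms mI mt mf f0 /=.
  apply: (@measurable_int_kernel _ _ _ T (N.-tuple unit) X R
    (power_kernel (probability_kernel_cst P0) N) (fun=> [tuple tt | i < N])
    (measurable_cst _) (fun x z => flow o Pi b 0 (t x) (f x) z)).
    exact: (@measurable_flow _ _ _ o Pi _ T b (cst 0%R) t f (measurable_cst _) mt mf f0).
  by move=> x z; exact: flow_ge0.
apply: (IH true (s n) (fun x => collide (I n x) (flow o Pi b (s n x) (t x) (f x)))).
- by move=> k kn; exact/ms/ltnW.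
- by move=> k kn; exact/mI/ltnW.
- exact: ms.
- by apply: measurable_collide_flow => //; [exact: ms|exact: mI].
- by move=> x z; apply: collide_ge0 => y; exact: flow_ge0.
Qed.

End collision.

Section kernel_weight.
Local Open Scope ereal_scope.
Context d d' (T : measurableType d) (Y : measurableType d') (R : realType).
Variables (K : R.-fker T ~> Y) (k : T -> R) (M : R).
Hypotheses (k0 : forall t, (0 <= k t)%R) (k1 : forall t, (k t <= M)%R).
Hypothesis mk : meas_fun k.

Definition kernel_weight (k0 : forall t, (0 <= k t)%R)
    (k1 : forall t, (k t <= M)%R) (mk : meas_fun k) (t : T) :
    {measure set Y -> \bar R} :=
  mscale (NngNum (k0 t)) (K t).

Let kernel_weight_measurable U : measurable U ->
  meas_fun (kernel_weight k0 k1 mk ^~ U).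
Proof.
move=> mU; rewrite /kernel_weight /= /mscale/=.
apply: emeasurable_funM; last exact: measurable_kernel.
exact/measurable_EFinP.
Qed.

HB.instance Definition _ := isKernel.Build _ _ _ _ _
  (kernel_weight k0 k1 mk)
  kernel_weight_measurable.

Let kernel_weight_uub : measure_fam_uub (kernel_weight k0 k1 mk).
Proof.
have [r hr] := measure_uub K; exists (M * r + 1)%R => t.
rewrite /kernel_weight/= /mscale/= EFinD EFinM.
apply: (@le_lt_trans _ _ (M%:E * r%:E)); last by rewrite -EFinM -EFinD lte_fin ltrDl.
by apply: lee_pmul; rewrite ?lee_fin//; exact: ltW (hr t).
Qed.

HB.instance Definition _ := Kernel_isFinite.Build _ _ _ _ _
  (kernel_weight k0 k1 mk)
  kernel_weight_uub.

Lemma integral_kernel_weight t (f : Y -> \bar R) : meas_fun f ->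
  (forall y, 0 <= f y) ->
  \int[kernel_weight k0 k1 mk t]_y f y = (k t)%:E * \int[K t]_y f y.
Proof. by move=> mf f0; rewrite /kernel_weight [LHS]ge0_integral_mscale. Qed.

End kernel_weight.

Section density.
Local Open Scope ereal_scope.
Context dO dT (O : measurableType dO) (T : measurableType dT) (R : realType).
Variables (P : {finite_measure set O -> \bar R}).
Variables (X : O -> T) (mX : meas_fun X).
Variables (A0 : set O) (D : set T) (mA0 : measurable A0) (mD : measurable D).
Variable k : T -> R.
Hypotheses (k0 : forall t, (0 <= k t)%R) (k1 : forall t, (k t <= 1)%R).
Hypothesis mk : meas_fun k.
Hypothesis PA : forall A, measurable A -> A `<=` D ->
  P ((X @^-1` A) `&` A0) = \int[P]_w (ind (A (X w)) * (k (X w))%:E).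

(** The case of [disintegration] with a one-point target: the kernel is the Dirac mass weighted by
    [k], the conditional probability of [A0]. *)
Lemma density f : meas_fun f -> (forall t, 0 <= f t) ->
  \int[P]_w (ind (D (X w) /\ A0 w) * f (X w)) =
  \int[P]_w (ind (D (X w)) * ((k (X w))%:E * f (X w))).
Proof.
move=> mf f0.
have mtt : meas_fun (fun _ : T => tt) by exact: measurable_cst.
pose K := kernel_weight (kdirac mtt) k0 k1 mk.
have GI : setI_closed (@measurable _ unit) by move=> A B; exact: measurableI.
have mG : @measurable _ unit = <<s @measurable _ unit >>.
  by rewrite sigma_algebra_id//; exact: sigma_algebra_measurable.
rewrite (@disintegration _ _ _ O T unit R P X mX (fun=> tt) (measurable_cst _)
  K A0 D mA0 mD _ mG GI measurableT _ (fun t _ => f t))//.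
- apply: eq_integral => w _; congr (_ * _).
  rewrite integral_kernel_weight; [|exact: measurable_cst|by []].
  by rewrite integral_cst// [X in _ * (_ * X)](@prob_kernel _ _ _ _ _ (kdirac mtt)) mule1.
- move=> A B mA AD mB.
  have [b|b] := pselect (B tt); last first.
    rewrite (_ : _ @^-1` B = set0); last by apply/seteqP; split.
    rewrite setI0 measure0 integral0_eq// => w _.
    rewrite /K/= /kernel_weight/= /mscale/= /dirac indicE memNset//.
    by rewrite !mule0.
  rewrite (_ : _ @^-1` B = setT); last by apply/seteqP; split.
  rewrite setIT PA//; apply: eq_integral => w _; congr (_ * _).
  by rewrite /K/= /kernel_weight/= /mscale/= /dirac indicE mem_set// mule1.
- exact: (measurableT_comp mf measurable_fst).
Qed.

End density.

Section gen_by_measurability.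
Context dO (O : measurableType dO).

Lemma measurable_gen_by dT (T : measurableType dT) K (X : K -> O -> T)
    (H : set (set O)) k : gen_by X `<=` H ->
  measurable_fun (setT : set (sigma_of H)) (X k).
Proof.
move=> XH _ B mB; rewrite setTI; apply: sub_sigma_algebra; apply: XH.
by exists k => //; exists B => //; rewrite setTI.
Qed.

Lemma measurable_gen_by_fin (T : finType) K (X : K -> O -> T)
    (H : set (set O)) k : gen_by_fin X `<=` H ->
  @fin_measurable _ (sigma_of H) T (X k).
Proof.
move=> XH x; apply: sub_sigma_algebra; apply: XH.
by exists k => //; exists [set x] => //; rewrite setTI.
Qed.

Lemma gen_by_sub dT (T : measurableType dT) K (X : K -> O -> T) :
  (forall k, meas_fun (X k)) -> gen_by X `<=` measurable.
Proof. by move=> mX _ [k _ [B mB <-]]; exact: mX. Qed.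

Lemma gen_by_fin_sub (T : finType) K (X : K -> O -> T) :
  (forall k, fin_measurable (X k)) -> gen_by_fin X `<=` measurable.
Proof.
by move=> mX _ [k _ [B _ <-]]; rewrite setTI; exact: fin_measurable_preim.
Qed.

(** A sub-sigma-algebra is handled as a second measurable structure on [O], reached by the identity
    map. Conditioning on it is then [disintegration] or [density] along this map. *)
Lemma measurable_id_sub (H : set (set O)) : H `<=` measurable ->
  meas_fun (id : O -> sigma_of H).
Proof.
move=> Hm _ A; rewrite setTI; apply: smallest_sub => //.
exact: sigma_algebra_measurable.
Qed.

Lemma measurable_id_mono (H H' : set (set O)) : H `<=` H' ->
  meas_fun (id : sigma_of H' -> sigma_of H).
Proof.
move=> HH' _ A; rewrite setTI; move: A; apply: smallest_sub.
  exact: smallest_sigma_algebra.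
exact: (subset_trans HH' (@sub_sigma_algebra _ _ _)).
Qed.

End gen_by_measurability.

(** * The dynamics given the interactions *)

Lemma addIe (R : realType) (x y z : \bar R) : (z \is a fin_num ->
  x + z = y + z -> x = y)%E.
Proof. by move=> zf /(congr1 (fun u => u - z)%E); rewrite !addeK. Qed.

Lemma integral_ind_cst (R : realType) dT (T : measurableType dT)
    (m : {measure set T -> \bar R}) Q (g : T -> \bar R) :
  (\int[m]_x (ind Q * g x) = ind Q * \int[m]_x g x)%E.
Proof.
have [q|q] := pselect Q.
  by rewrite indT// mul1e; apply: eq_integral => x _; rewrite mul1e.
by rewrite indF// mul0e; apply: integral0_eq => x _; rewrite mul0e.
Qed.

Lemma collide_ind (R : realType) d N (Lambda : R)
    (mu : R.-fker ('rV[R]_d * 'rV[R]_d)%type ~> ('rV[R]_d * 'rV[R]_d)%type)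
    (ab : 'I_N * 'I_N) Q f z :
  (collide Lambda mu ab (fun z => ind Q * f z) z = ind Q * collide Lambda mu ab f z)%E.
Proof.
have [q|q] := pselect Q.
  by rewrite indT// mul1e; congr collide; apply/funext => x; rewrite mul1e.
rewrite indF// mul0e /collide mul0e mule0 integral0_eq ?mule0 ?adde0// => x _.
by rewrite mul0e.
Qed.

Section dynamics_history.
Local Open Scope ereal_scope.
Variables (R : realType) (d N : nat) (Lambda : R).
Local Notation E := 'rV[R]_d.
Local Notation X := (N.-tuple E).
Variable mu : R.-fker (E * E)%type ~> (E * E)%type.
Variable Pi : R.-pker E ~> Dinf R d.
Variable P0 : probability E R.
Context {dO : measure_display} {O : measurableType dO}.
Variable P : probability O R.
Variable o : observation R d N.
Variables (J : set R) (G : set (set O)).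
Variables (tau : nat -> O -> \bar R) (I : nat -> O -> 'I_N * 'I_N).
Variable Z : 'I_N -> O -> @skorohod R d J.
Hypotheses (Lambda_gt0 : (0 < Lambda)%R) (mu_le : forall v, mu v setT <= Lambda%:E).
Hypotheses (rJ : left_regular J)
  (Jdown : forall s t, (0 <= s)%R -> (s <= t)%R -> J t -> J s).
Hypothesis GM : G `<=` measurable.
Hypothesis obs_time_ge0 : forall l, (0 <= @obs_time _ _ _ o l)%R.
Hypothesis tau_ordered : {ae P, forall w, [/\ tau 0 w = 0,
  forall m, tau m w <= tau m.+1 w,
  forall m, tau m w < +oo -> tau m w < tau m.+1 w
  & forall m, tau m w < +oo -> J (fine (tau m w))]}.
Variables (Y : nat -> 'I_N -> O -> Dinf R d) (acc : nat -> O -> bool)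
  (HK : nat -> O -> E * E).
Hypothesis Hpieces : pieces_measurable tau I Z Y acc HK.
Hypothesis Hinit : initial_iid P0 P G tau I Z.
Hypothesis Hfree : free_evolution Pi P G tau I Z Y acc HK.
Hypothesis Hdec : jump_decision Lambda mu P G tau I Z Y acc HK.
Hypothesis Hamp : jump_amplitudes mu P G tau I Z Y acc HK.
Hypothesis Hpaths : piecewise_paths P tau Z Y.

(** All the interaction times and partners, the future ones included. The conditional expectations
    below are taken given [O0], while [Oab a b] is the sigma-algebra [past a b]. *)
Let gens0 : set (set O) := G `|` gen_by tau `|` gen_by_fin I.
Let gens a b : set (set O) :=
  gens0 `|` gen_by (fun i w => Z i w 0%R) `|`
      gen_by (fun k : 'I_a * 'I_N => Y k.1 k.2) `|`
      gen_by_fin (fun k : 'I_b => acc k) `|` gen_by (fun k : 'I_b => HK k).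
Local Notation O0 := (sigma_of gens0).
Local Notation Oab a b := (sigma_of (gens a b)).

(** [bef] and [st] are versions of [before] and [start] read from the free paths instead of [Z].
    They are measurable for the relevant [past], and [ae_pathwise] shows that they almost surely
    agree with the originals as long as the times are finite. *)
Let tm m w := fine (tau m w).
Let Ym m w : N.-tuple (Dinf R d) := [tuple Y m i w | i < N].
Let bef m w : X := evs true (Ym m w) (tm m.+1 w - tm m w)%R.
Let st m w : X := if m is m'.+1 then
    (if acc m' w then jumped (I m' w) (HK m' w) (bef m' w) else bef m' w)
  else [tuple Z i w 0%R | i < N].
Let obsp m w := forall k, (k < m)%N -> seen o (tm k w) (tm k.+1 w) (Ym k w).

Let mtau m : meas_fun (tau m). Proof. by case: Hpieces. Qed.
Let mI m : fin_measurable (I m). Proof. by case: Hpieces. Qed.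
Let mZ i : meas_fun (Z i). Proof. by case: Hpieces. Qed.
Let mY m i : meas_fun (Y m i). Proof. by case: Hpieces => _ _ _ []. Qed.
Let macc m : fin_measurable (acc m). Proof. by case: Hpieces => _ _ _ []. Qed.
Let mHK m : meas_fun (HK m). Proof. by case: Hpieces => _ _ _ []. Qed.

Let gens0_sub : gens0 `<=` measurable.
Proof.
by move=> A [[/GM//|]|]; [exact: gen_by_sub|exact: gen_by_fin_sub].
Qed.

Let gens_sub a b : gens a b `<=` measurable.
Proof.
move=> A [[[[/gens0_sub//|]|]|]|].
- by apply: gen_by_sub => i; exact: measurableT_comp (measurable_eval _) (mZ i).
- by apply: gen_by_sub => k.
- by apply: gen_by_fin_sub => k.
- by apply: gen_by_sub => k.
Qed.

Let gens0_gens a b : gens0 `<=` gens a b.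
Proof. by move=> A h; do 4 left. Qed.

Let id0 : meas_fun (id : O -> O0).
Proof. exact: measurable_id_sub. Qed.

Let idab a b : meas_fun (id : O -> Oab a b).
Proof. exact: measurable_id_sub. Qed.

Let idab0 a b : meas_fun (id : Oab a b -> O0).
Proof. exact: measurable_id_mono. Qed.

Let mtm0 m : measurable_fun (setT : set O0) (tm m).
Proof.
apply: measurableT_comp => //.
by apply: (@measurable_gen_by _ _ _ _ _ tau) => A h; left; right.
Qed.

Let mtau0 m : measurable_fun (setT : set O0) (tau m).
Proof. by apply: (@measurable_gen_by _ _ _ _ _ tau) => A h; left; right. Qed.

Let mI0 m : @fin_measurable _ O0 _ (I m).
Proof. by apply: (@measurable_gen_by_fin _ _ _ _ I) => A h; right. Qed.

Let mtm a b m : measurable_fun (setT : set (Oab a b)) (tm m).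
Proof. exact: (measurableT_comp (mtm0 m) (@idab0 a b)). Qed.

Let mIab a b m : @fin_measurable _ (Oab a b) _ (I m).
Proof. move=> x; exact: (measurable_preim (@idab0 a b) (mI0 m x)). Qed.

Let mYm a b m : (m < a)%N -> measurable_fun (setT : set (Oab a b)) (Ym m).
Proof.
move=> ma; apply: measurable_fun_rectangle => i.
rewrite (_ : (fun _ => _) = Y m i); last first.
  by apply/funext => w; rewrite tnth_mktuple.
apply: (@measurable_gen_by _ _ _ _ _ (fun k : 'I_a * 'I_N => Y k.1 k.2) _
  (Ordinal ma, i)).
by move=> A h; left; left; right.
Qed.

Let mbef a b m : (m < a)%N -> measurable_fun (setT : set (Oab a b)) (bef m).
Proof.
move=> ma; apply: measurable_evs; first exact: mYm.
by apply: measurable_funB; exact: mtm.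
Qed.

Let maccab a b m : (m < b)%N -> @fin_measurable _ (Oab a b) _ (acc m).
Proof.
move=> mb; apply: (@measurable_gen_by_fin _ _ _ _ (fun k : 'I_b => acc k) _
  (Ordinal mb)).
by move=> A h; left; right.
Qed.

Let mHKab a b m : (m < b)%N -> measurable_fun (setT : set (Oab a b)) (HK m).
Proof.
move=> mb; apply: (@measurable_gen_by _ _ _ _ _ (fun k : 'I_b => HK k) _
  (Ordinal mb)).
by move=> A h; right.
Qed.

Let mjump dT (T : measurableType dT) (i : T -> 'I_N * 'I_N) (hk : T -> E * E)
    (z : T -> X) : fin_measurable i -> meas_fun hk ->
  meas_fun z -> meas_fun (fun w => jumped (i w) (hk w) (z w)).
Proof.
move=> mi mhk mz.
apply: (measurable_fin_case (k := i) (f := fun i w => jumped i (hk w) (z w))) => //.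
by move=> j; exact: measurable_jumped.
Qed.

Let mst a b m : (m <= a)%N -> (m <= b)%N ->
  measurable_fun (setT : set (Oab a b)) (st m).
Proof.
case: m => [|m] ma mb /=.
  apply: measurable_fun_rectangle => i.
  rewrite (_ : (fun _ => _) = fun w => Z i w 0%R); last first.
    by apply/funext => w; rewrite tnth_mktuple.
  apply: (@measurable_gen_by _ _ _ _ _ (fun i w => Z i w 0%R)).
  by move=> A h; left; left; left; right.
pose F (c : bool) w := if c then jumped (I m w) (HK m w) (bef m w) else bef m w.
apply: (@measurable_fin_case _ _ (Oab a b) X bool (acc m) F); first exact: maccab.
case; last exact: mbef.
by apply: mjump; [exact: mIab|exact: mHKab|exact: mbef].
Qed.

Let mobsp a b m : (m <= a)%N -> measurable ([set w | obsp m w] : set (Oab a b)).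
Proof.
move=> ma; apply: measurable_forall_nat => k; apply: measurable_cond => km.
by apply: measurable_seen; [exact: mtm|exact: mtm|apply: mYm; exact: leq_trans km ma].
Qed.

(** The left limit at [t] sees only times before [t], so it can be read from the free piece even if
    [t] is the instant [c] at which that piece ends. *)
Lemma left_lim_ext (y : @skorohod R d J) (u : Dinf R d) a t c :
  (a%:E < t%:E <= c)%E -> J t ->
  (forall s, J s -> (a%:E <= s%:E < c)%E -> y s = u (s - a)%R) ->
  (0 <= a)%R -> left_lim y t = left_lim u (t - a)%R.
Proof.
move=> /andP[at_ tc] Jt yu a0; apply: cvg_lim => //.
have h := @left_limP _ _ _ u (t - a)%R (@left_regular_infinite R).
move=> A /h; rewrite /nbhs/= /at_left /within/= => hA.
have : (v - a)%R @[v --> t] --> (t - a)%R.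
  by apply: cvgB; [exact: cvg_id|exact: cvg_cst].
move=> /(_ _ hA) h2.
have {}h2 : \forall v \near t, (v - a < t - a)%R -> A (u (v - a)%R) := h2.
suff : \forall v \near t, (v < t)%R -> A (y v) by [].
near=> v => vt.
have av : (a < v)%R by near: v; apply: lt_nbhsr; rewrite -lte_fin.
rewrite yu.
- have : (v - a < t - a)%R -> A (u (v - a)%R) by near: v.
  by apply; rewrite ltrD2r.
- apply: Jdown Jt; [exact: le_trans a0 (ltW av)|exact: ltW].
- by rewrite lee_fin (ltW av)/= (lt_le_trans _ tc)// lte_fin.
Unshelve. all: by end_near. Qed.

Let before_time b (x : \bar R) (t : R) := if b then x < t%:E else x <= t%:E.

Let obsZ t w := forall i l, (@obs_time _ _ _ o l < t)%R ->
  @obs_set _ _ _ o l i (Z i w (@obs_time _ _ _ o l)).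

Let zev b w t : X := evs b [tuple Z i w | i < N] t.

Let tau_bracket w n s : tau 0 w = 0 -> (0 <= s)%R -> s%:E < tau n w ->
  exists2 k, (k < n)%N & tau k w <= s%:E < tau k.+1 w.
Proof.
move=> t0 s0; elim: n => [|n IH]; first by rewrite t0 lte_fin ltNge s0.
have [ns sn|sn _] := leP (tau n w) s%:E; first by exists n => //; rewrite ns.
by have [k kn h] := IH sn; exists k => //; exact: ltnW.
Qed.

(** The pathwise facts are gathered on one almost sure event. The last clause reads the
    configuration at [t] from the free piece in progress, and the observations before [t] from that
    piece and the completed ones; [b] decides on which side an interaction at [t] itself counts. *)
Let ae_pathwise : {ae P, forall w,
  [/\ tau 0 w = 0, forall m, tau m w <= tau m.+1 w,
      (forall m, tau m w < +oo -> (0 <= tm m w)%R /\ (tm m w)%:E = tau m w),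
      (forall m, tau m.+1 w < +oo ->
        bef m w = [tuple before tau Z m i w | i < N]) &
      (forall m, tau m w < +oo -> st m w = [tuple start tau I Z acc HK m i w | i < N]) /\
      (forall b n t, J t -> before_time b (tau n w) t ->
         ~~ before_time b (tau n.+1 w) t ->
         zev b w t = evs b (Ym n w) (t - tm n w)%R /\
         (obsZ t w <-> obsp n w /\ seen o (tm n w) t (Ym n w)))]}.
Proof.
apply: filterS2 tau_ordered Hpaths => w [t0 tle tlt tJ] hp.
have tge m : 0 <= tau m w.
  by elim: m => [|m IH]; [rewrite t0|exact: le_trans IH (tle m)].
have F1 m : tau m w < +oo -> (0 <= tm m w)%R /\ (tm m w)%:E = tau m w.
  by move=> h; rewrite /tm fine_ge0// fineK// ge0_fin_numE.
have F0 m i s : J s -> tau m w <= s%:E < tau m.+1 w ->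
    Z i w s = tnth (Ym m w) i (s - tm m w)%R.
  by move=> Js h; rewrite tnth_mktuple (hp m).
have F2 m i t : J t -> tau m w < t%:E <= tau m.+1 w ->
    left_lim (Z i w) t = left_lim (tnth (Ym m w) i) (t - tm m w)%R.
  move=> Jt /andP[h1 h2]; have [a0 aE] := F1 m (lt_trans h1 (ltry _)).
  apply: (@left_lim_ext _ _ _ _ (tau m.+1 w)) => //; first by rewrite aE h1.
  by move=> s Js; rewrite aE; exact: F0.
have F3 m : tau m.+1 w < +oo -> bef m w = [tuple before tau Z m i w | i < N].
  move=> h; have h' : tau m w < +oo := le_lt_trans (tle m) h.
  have [_ aE] := F1 _ h; apply: eq_from_tnth => i; rewrite !tnth_mktuple.
  rewrite /before -/(tm m.+1 w) (F2 m)//; first by rewrite tnth_mktuple.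
    exact: tJ.
  by rewrite aE lexx tlt.
split=> //; split.
  case=> [|m] h; apply: eq_from_tnth => i; rewrite /= ?tnth_mktuple//.
  rewrite (F3 m h) /jump; case: (acc m w) => /=; rewrite !tnth_mktuple//.
  by rewrite addr0.
move=> b n t Jt h1 h2.
have h3 : tau n w <= t%:E <= tau n.+1 w.
  move: h1 h2; rewrite /before_time; case: (b); rewrite -?leNgt -?ltNge.
    by move=> /ltW -> ->.
  by move=> -> /ltW ->.
have nfin : tau n w < +oo by case/andP: h3 => h3 _; exact: le_lt_trans h3 (ltry _).
have [n0 nE] := F1 _ nfin.
have kle k : (k < n)%N -> tau k.+1 w <= tau n w.
  elim: (n) => // m IH; rewrite leq_eqVlt => /predU1P[[->]//|/IH].
  by move=> /le_trans; apply.
split.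
  apply: eq_from_tnth => i; rewrite !tnth_mktuple /ev.
  move: h1 h2; rewrite /before_time; case: (b); rewrite -?leNgt -?ltNge => h1 h2.
    by rewrite (F2 n) ?tnth_mktuple// h1.
  by rewrite (F0 n) ?tnth_mktuple// h1.
have Jl l : (@obs_time _ _ _ o l < t)%R -> J (@obs_time _ _ _ o l).
  by move=> lt; apply: Jdown Jt => //; exact: ltW.
split=> [h|[hp1 hp2] i l lt].
  split=> [k kn|] i l /andP[l1 l2].
    have kfin1 : tau k.+1 w < +oo by exact: le_lt_trans (kle k kn) nfin.
    have [_ kE1] := F1 _ kfin1.
    have [_ kE] := F1 _ (le_lt_trans (tle k) kfin1).
    have lt : (@obs_time _ _ _ o l < t)%R.
      rewrite (lt_le_trans l2)// -lee_fin kE1 (le_trans (kle k kn))//.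
      by case/andP: h3.
    rewrite -F0; first exact: h.
      exact: Jl.
    by rewrite -kE -kE1 lee_fin lte_fin l1.
  rewrite -F0; first exact: h.
    exact: Jl.
  rewrite -nE lee_fin l1/= (lt_le_trans (y := t%:E)) ?lte_fin//.
  by case/andP: h3.
have [ln|nl] := ltP (@obs_time _ _ _ o l)%:E (tau n w).
  have [k kn /andP[k1 k2]] := tau_bracket t0 (obs_time_ge0 l) ln.
  have [_ kE] := F1 _ (le_lt_trans k1 (ltry _)).
  rewrite (F0 k) ?k1//; last exact: Jl.
  apply: hp1 => //; rewrite -lee_fin kE k1 /= -lte_fin.
  by have [_ ->] := F1 _ (le_lt_trans (kle k kn) nfin).
rewrite (F0 n); last 2 first.
- exact: Jl.
- rewrite nl /=; case/andP: h3 => _; apply: lt_le_trans; by rewrite lte_fin.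
by apply: hp2; rewrite -lee_fin nE nl.
Qed.

Let mYmO m : meas_fun (Ym m).
Proof.
apply: measurable_fun_rectangle => i.
rewrite (_ : (fun _ => _) = Y m i); first exact: mY.
by apply/funext => w; rewrite tnth_mktuple.
Qed.

Let mbefore m i : meas_fun (before tau Z m i).
Proof.
have h := @measurable_left_lim R d J rJ.
apply: (@measurableT_comp _ _ _ _ _ _ _ _ (fun w => (fine (tau m.+1 w), Z i w)) h).
apply/measurable_fun_pairP; split => /=; last exact: mZ.
have hf : meas_fun (@fine R) by [].
exact: (measurableT_comp hf (mtau m.+1)).
Qed.

Let mbefore_pair m : meas_fun
  (fun w => (before tau Z m (I m w).1 w, before tau Z m (I m w).2 w)).
Proof.
apply: (@measurable_fin_case _ _ O _ _ (I m)
  (fun ab w => (before tau Z m ab.1 w, before tau Z m ab.2 w))) => // ab.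
by apply/measurable_fun_pairP; split; exact: mbefore.
Qed.

Let mstart m i : meas_fun (start tau I Z acc HK m i).
Proof.
case: m => [|m] /=.
  by apply: (measurableT_comp (measurable_eval _)); exact: mZ.
apply: measurable_rVD; first exact: mbefore.
rewrite /jump.
pose F (c : bool) (ab : 'I_N * 'I_N) (w : O) : E := if ~~ c then 0%R
  else if i == ab.1 then (HK m w).1 else if i == ab.2 then (HK m w).2 else 0%R.
apply: (@measurable_fin_case _ _ O _ bool (acc m) (fun c w => F c (I m w) w)) => // c.
apply: (@measurable_fin_case _ _ O _ _ (I m) (fun ab w => F c ab w)) => // ab.
rewrite /F; case: c => /=; last exact: measurable_cst.
case: (i == _); first exact: measurableT_comp measurable_fst (mHK m).
case: (i == _); first exact: measurableT_comp measurable_snd (mHK m).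
exact: measurable_cst.
Qed.

Let measurable_ab a b (A : set O) : @measurable _ (Oab a b) A -> measurable A.
Proof. by apply: smallest_sub => //; exact: sigma_algebra_measurable. Qed.

Let mfin a b m : @measurable _ (Oab a b) [set w | tau m w < +oo].
Proof.
have h : @measurable _ O0 [set w | tau m w < +oo].
  have := @emeasurable_lt_fun _ _ O0 (tau m) (cst +oo) (@mtau0 m) (measurable_cst _).
  by [].
exact: (measurable_preim (@idab0 a b) h).
Qed.

(** [free_evolution] tests rectangles only; [disintegration] extends it to integrands that may
    depend on the whole past and on the new free paths jointly. *)
Let free_step m (F : O -> N.-tuple (Dinf R d) -> \bar R) :
  meas_fun (fun p : Oab m m * N.-tuple (Dinf R d) => F p.1 p.2) ->
  (forall w ys, 0 <= F w ys) ->
  \int[P]_w (ind (tau m w < +oo) * F w (Ym m w)) =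
  \int[P]_w (ind (tau m w < +oo) * \int[power_kernel Pi N (st m w)]_ys F w ys).
Proof.
move=> mF F0.
have mstm := @mst m m m (leqnn m) (leqnn m).
pose K := kernel_reparam (power_kernel Pi N) mstm.
have := @disintegration _ _ _ O (Oab m m) (N.-tuple (Dinf R d)) R P id
  (@idab m m) (Ym m) (mYmO m) K setT [set w | tau m w < +oo] measurableT
  (@mfin m m m) _ (measurable_rectangles (Dinf R d) N)
  (@rectanglesI _ _ _) (rectanglesT _ _) _ F mF F0.
move=> <-; last first.
  move=> A _ mA AD [B [mB ->]]; rewrite setIT.
  transitivity (P (A `&` [set w | forall i, B i (Y m i w)])).
    by congr (P (_ `&` _)); apply/seteqP; split=> w h i; have := h i;
      rewrite tnth_mktuple.
  rewrite (Hfree mA)// -integral_indM; last exact: measurable_ab mA.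
  have mAO : meas_fun (fun w : O => @ind R (A w)).
    by apply: measurable_ind; exact: measurable_ab mA.
  apply: ge0_ae_eq_integral => //.
  - apply: emeasurable_funM => //; apply: measurable_prode => i.
    exact: measurableT_comp (measurable_kernel Pi _ (mB i)) (mstart m i).
  - apply: emeasurable_funM => //.
    apply: (measurableT_comp (measurable_kernel (power_kernel Pi N) _ _)).
      exact: measurable_rectangle.
    exact: (measurableT_comp mstm (@idab m m)).
  - by move=> w _; rewrite mule_ge0//; exact: prode_ge0.
  - by move=> w _; rewrite mule_ge0.
  - apply: filterS ae_pathwise => w [_ _ _ _ [h _]] _; apply: eq_indM => Aw.
    rewrite [RHS]power_rectangle// (h m (AD w Aw)).
    by apply: eq_bigr => i _; rewrite tnth_mktuple.
apply: eq_integral => w _; congr (_ * _).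
by apply: ind_iff; split=> [|[]].
Qed.

Let proba m w := (fine (mu (pair_at (I m w) (bef m w)) setT) / Lambda)%R.

Let mpair m : measurable_fun (setT : set (Oab m.+1 m))
  (fun w => pair_at (I m w) (bef m w)).
Proof.
apply: (@measurable_fin_case _ _ (Oab m.+1 m) _ _ (I m)
  (fun ab w => pair_at ab (bef m w))); first exact: mIab.
by move=> ab; exact: measurableT_comp (measurable_pair_at ab) (@mbef m.+1 m m _).
Qed.

Let mproba m : measurable_fun (setT : set (Oab m.+1 m)) (proba m).
Proof.
apply: measurable_funM => //; apply: measurableT_comp => //.
exact: (measurableT_comp (measurable_kernel mu _ measurableT) (@mpair m)).
Qed.

Let collisionE m w : bef m w = [tuple before tau Z m i w | i < N] ->
  collision_mu mu tau I Z m w = mu (pair_at (I m w) (bef m w)).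
Proof. by move=> ->; rewrite /collision_mu /pair_at !tnth_mktuple. Qed.

Let mcollision m B : measurable B ->
  meas_fun (fun w => collision_mu mu tau I Z m w B).
Proof.
move=> mB; exact: (measurableT_comp (measurable_kernel mu _ mB) (mbefore_pair m)).
Qed.

Let dec_step m (f : O -> \bar R) (c : bool) :
  measurable_fun (setT : set (Oab m.+1 m)) f -> (forall w, 0 <= f w) ->
  \int[P]_w (ind (tau m.+1 w < +oo /\ acc m w = c) * f w) =
  \int[P]_w (ind (tau m.+1 w < +oo) *
    ((if c then proba m w else 1 - proba m w)%R%:E * f w)).
Proof.
move=> mf f0.
have p01 w : (0 <= proba m w <= 1)%R by exact: collision_proba_itv.
pose k w := (if c then proba m w else 1 - proba m w)%R.
have k0 w : (0 <= k w)%R by rewrite /k; have := p01 w; case: (c); lra.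
have k1 w : (k w <= 1)%R by rewrite /k; have := p01 w; case: (c); lra.
have mk : measurable_fun (setT : set (Oab m.+1 m)) k.
  rewrite /k; case: (c); first exact: (@mproba m).
  by apply: measurable_funB => //; exact: (@mproba m).
have main A : @measurable _ (Oab m.+1 m) A -> A `<=` [set w | tau m.+1 w < +oo] ->
    P (A `&` [set w | acc m w]) = \int[P]_w (ind (A w) * (proba m w)%:E).
  move=> mA AD; have mAO := measurable_ab mA.
  rewrite (Hdec mA)// -integral_indM//.
  have mAi : meas_fun (fun w : O => @ind R (A w)) by exact: measurable_ind.
  apply: ge0_ae_eq_integral => //.
  - apply: emeasurable_funM => //; apply/measurable_EFinP.
    apply: measurable_funM => //; apply: measurableT_comp => //.
    exact: mcollision.
  - apply: emeasurable_funM => //; apply/measurable_EFinP.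
    exact: (measurableT_comp (@mproba m) (@idab m.+1 m)).
  - by move=> w _; rewrite mule_ge0// lee_fin divr_ge0 ?fine_ge0// ltW.
  - by move=> w _; rewrite mule_ge0// lee_fin; have /andP[] := p01 w.
  - apply: filterS ae_pathwise => w [_ _ _ h _] _; apply: eq_indM => Aw.
    by rewrite (collisionE (h m (AD w Aw))).
have macc' (c' : bool) : measurable [set w | acc m w = c'].
  by have := macc m c'; rewrite /preimage.
apply: (@density _ _ O (Oab m.+1 m) R P id (@idab m.+1 m)
  [set w | acc m w = c] [set w | tau m.+1 w < +oo] _ (@mfin _ _ _) k) => //.
move=> A mA AD; have mAO := measurable_ab mA.
rewrite /k; case: (c); first exact: main.
(* Only acceptance is prescribed. Rejection follows by subtraction, the probabilities being
   finite. *)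
have : P (A `&` [set w | acc m w = false]) + P (A `&` [set w | acc m w]) =
    \int[P]_w (ind (A w) * (1 - proba m w)%:E) +
    \int[P]_w (ind (A w) * (proba m w)%:E).
  have mAi : meas_fun (fun w : O => @ind R (A w)) by exact: measurable_ind.
  have mpO : meas_fun (proba m).
    exact: (measurableT_comp (@mproba m) (@idab m.+1 m)).
  rewrite -ge0_integralD//; last 4 first.
  - by move=> w _; rewrite mule_ge0// lee_fin; have := p01 w; lra.
  - apply: emeasurable_funM => //; apply/measurable_EFinP.
    exact: measurable_funB.
  - by move=> w _; rewrite mule_ge0// lee_fin; have := p01 w; lra.
  - by apply: emeasurable_funM => //; exact/measurable_EFinP.
  rewrite -measureU; last 3 first.
  - by apply: measurableI => //; exact: macc'.
  - by apply: measurableI => //; exact: macc'.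
  - by apply/seteqP; split=> // w [[_ /= ->] []].
  rewrite -setIUr (_ : _ `|` _ = setT) ?setIT; last first.
    by apply/seteqP; split=> // w _ /=; case: (acc m w); [right|left].
  rewrite -[LHS]integral_ind//; apply: eq_integral => w _.
  rewrite -ge0_muleDr ?lee_fin; last 2 first.
  - by have := p01 w; lra.
  - by have := p01 w; lra.
  by rewrite -EFinD subrK mule1.
rewrite main//; apply: addIe.
rewrite -main// fin_num_measure//; apply: measurableI => //; exact: macc'.
Qed.

Let upX dS (S : measurableType dS) a b dT (T : measurableType dT) (f : O * S -> T) :
  measurable_fun (setT : set (O0 * S)) f ->
  measurable_fun (setT : set (Oab a b * S)) f.
Proof.
move=> mf; have m : measurable_fun (setT : set (Oab a b * S))
    (fun p => (p.1 : O0, p.2)).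
  apply/measurable_fun_pairP; split; last exact: measurable_snd.
  exact: (measurableT_comp (@idab0 a b) measurable_fst).
rewrite (_ : f = f \o (fun p => (p.1, p.2))); last by apply/funext => -[].
exact: (measurableT_comp mf m).
Qed.

(** The acceptance probability contains the total mass of the collision measure and the law of the
    amplitudes is normalised by it: the product is [mu / Lambda], as in [collide]. *)
Let amplitude m (A : set O) (B : set (E * E)) :
  @measurable _ (Oab m.+1 m) A -> A `<=` [set w | tau m.+1 w < +oo] ->
  measurable B ->
  P (A `&` [set w | acc m w = true] `&` HK m @^-1` B) =
  \int[P]_w (ind (A w) * ((Lambda^-1)%:E * mu (pair_at (I m w) (bef m w)) B)).
Proof.
move=> mA AD mB; have mAO := measurable_ab mA.
rewrite [LHS](Hamp mA AD mB).
have macc1 : measurable [set w | acc m w = true] := macc m true.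
(* The quotient is written with a power, which is the inverse on nonnegative numbers. *)
pose r w := (fine (mu (pair_at (I m w) (bef m w)) B) *
  fine (mu (pair_at (I m w) (bef m w)) setT) `^ (-1))%R.
have rE w : r w = (fine (mu (pair_at (I m w) (bef m w)) B) /
    fine (mu (pair_at (I m w) (bef m w)) setT))%R.
  by rewrite /r powR_inv1// fine_ge0.
have mfine : meas_fun (@fine R) by [].
have r0 w : (0 <= r w)%R by rewrite rE divr_ge0// fine_ge0.
have mm U : measurable U -> measurable_fun (setT : set (Oab m.+1 m))
    (fun w => fine (mu (pair_at (I m w) (bef m w)) U)).
  move=> mU; apply: (measurableT_comp (f := @fine R)) => //.
  exact: (measurableT_comp (measurable_kernel mu U mU) (@mpair m)).
have mr : measurable_fun (setT : set (Oab m.+1 m)) r.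
  apply: measurable_funM; first exact: mm.
  exact: (measurableT_comp (measurable_powR _) (mm _ measurableT)).
have mAi : measurable_fun (setT : set (Oab m.+1 m)) (fun w => @ind R (A w)).
  exact: measurable_ind.
transitivity (\int[P]_w (ind (tau m.+1 w < +oo /\ acc m w = true) *
    (ind (A w) * (r w)%:E))).
  rewrite -integral_indM; last exact: measurableI.
  apply: ge0_ae_eq_integral => //.
  - apply: emeasurable_funM.
      by apply: measurable_ind; exact: measurableI.
    apply/measurable_EFinP; rewrite (_ : (fun _ => _) = (fun w =>
        fine (collision_mu mu tau I Z m w B) *
        fine (collision_mu mu tau I Z m w setT) `^ (-1))%R); last first.
      by apply/funext => w; rewrite powR_inv1// fine_ge0.
    apply: measurable_funM.
      exact: (measurableT_comp mfine (mcollision m mB)).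
    apply: (measurableT_comp (measurable_powR _)).
    exact: (measurableT_comp mfine (mcollision m measurableT)).
  - apply: emeasurable_funM.
      apply: measurable_ind; apply: measurableI; last exact: macc1.
      exact: measurable_ab (@mfin m m m.+1).
    have h : measurable_fun (setT : set (Oab m.+1 m))
        (fun w => ind (A w) * (r w)%:E).
      by apply: emeasurable_funM => //; exact/measurable_EFinP.
    exact: (measurableT_comp h (@idab m.+1 m)).
  - by move=> w _; rewrite mule_ge0// lee_fin divr_ge0// fine_ge0.
  - by move=> w _; rewrite !mule_ge0// lee_fin.
  - apply: filterS ae_pathwise => w [_ _ _ h _] _.
    rewrite muleA -ind_and (_ : ind (_ /\ A w) = ind ((A `&` [set w | acc m w]) w)).
      apply: eq_indM => -[Aw _].
      by rewrite (collisionE (h m (AD w Aw))) rE.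
    by apply: ind_iff; split=> [[[]]//|[Aw ?]]; split=> //; split=> //; exact: AD.
rewrite dec_step//; last 2 first.
- by apply: emeasurable_funM => //; exact/measurable_EFinP.
- by move=> w; rewrite mule_ge0// lee_fin.
apply: eq_integral => w _.
transitivity (ind (tau m.+1 w < +oo /\ A w) * ((proba m w)%:E * (r w)%:E)).
  by rewrite ind_and -!muleA; congr (_ * _); exact: muleCA.
rewrite (_ : ind (_ /\ _) = ind (A w)); last first.
  by apply: ind_iff; split=> [[]//|Aw]; split=> //; exact: AD.
rewrite rE /proba; apply: eq_indM => Aw.
have f1 : mu (pair_at (I m w) (bef m w)) setT \is a fin_num by exact: finite_kernel_measure.
have f2 : mu (pair_at (I m w) (bef m w)) B \is a fin_num by exact: finite_kernel_measure.
rewrite -EFinM -{2}(fineK f2) -EFinM; congr (_%:E).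
(* If the total mass vanishes, so does the mass of [B], and both sides are 0. *)
have [z|z] := eqVneq (fine (mu (pair_at (I m w) (bef m w)) setT)) 0%R; last by field; rewrite z gt_eqF.
rewrite z !mul0r (_ : fine _ = 0%R) ?mulr0//.
apply/eqP; rewrite eq_le fine_ge0// andbT -z fine_le//.
by apply: le_measure; rewrite ?inE.
Qed.

(** Splitting on acceptance: the rejected part keeps [bef], the accepted part is integrated over the
    amplitudes, and the sum of the two is the operator [collide]. *)
Let jump_step m (phi : O -> X -> \bar R) :
  measurable_fun (setT : set (Oab m.+1 m * X)) (fun p => phi p.1 p.2) ->
  (forall w z, 0 <= phi w z) ->
  \int[P]_w (ind (tau m.+1 w < +oo) * phi w (st m.+1 w)) =
  \int[P]_w (ind (tau m.+1 w < +oo) *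
             collide Lambda mu (I m w) (phi w) (bef m w)).
Proof.
move=> mphi phi0.
have mb := @mbef m.+1 m m (ltnSn m).
have mphib : measurable_fun (setT : set (Oab m.+1 m)) (fun w => phi w (bef m w)).
  have mm : measurable_fun (setT : set (Oab m.+1 m)) (fun w : Oab m.+1 m => (w, bef m w)).
    by apply/measurable_fun_pairP; split; [exact: measurable_id|exact: mb].
  exact: (measurableT_comp mphi mm).
pose f w hk := phi w (jumped (I m w) hk (bef m w)).
have mf : measurable_fun (setT : set (Oab m.+1 m * (E * E))) (fun p => f p.1 p.2).
  have mm : measurable_fun (setT : set (Oab m.+1 m * (E * E)))
      (fun p : Oab m.+1 m * (E * E) => (p.1, jumped (I m p.1) p.2 (bef m p.1))).
    apply/measurable_fun_pairP; split; first exact: measurable_fst.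
    apply: (@mjump _ (Oab m.+1 m * (E * E))%type (fun p => I m p.1) snd
      (fun p => bef m p.1)) => //.
      by move=> i; exact: (measurable_preim (@measurable_fst _ _ (Oab m.+1 m) (E * E)%type) (@mIab m.+1 m m i)).
    exact: (measurableT_comp mb measurable_fst).
  exact: (measurableT_comp mphi mm).
have L0 (w : Oab m.+1 m) : (0 <= Lambda^-1)%R by rewrite invr_ge0 ltW.
have L1 (w : Oab m.+1 m) : (Lambda^-1 <= Lambda^-1)%R by [].
have mL : meas_fun (fun w : Oab m.+1 m => Lambda^-1%R) by exact: measurable_cst.
pose K := kernel_weight (kernel_reparam mu (@mpair m)) L0 L1 mL.
have mG : @measurable _ (E * E)%type = <<s @measurable _ (E * E)%type >>.
  by rewrite sigma_algebra_id//; exact: sigma_algebra_measurable.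
have GI : setI_closed (@measurable _ (E * E)%type) by move=> A B; exact: measurableI.
have macc1 : measurable [set w | acc m w = true] := macc m true.
have eq1 := @disintegration _ _ _ O (Oab m.+1 m) (E * E)%type R P id
  (@idab m.+1 m) (HK m) (mHK m) K [set w | acc m w = true]
  [set w | tau m.+1 w < +oo] macc1 (@mfin m.+1 m m.+1) _ mG GI measurableT
  (fun A B mA AD mB => amplitude mA AD mB) f mf (fun w hk => phi0 w _).
have eq2 := @dec_step m (fun w => phi w (bef m w)) false mphib (fun w => phi0 w _).
have mDO : measurable [set w | tau m.+1 w < +oo].
  exact: measurable_ab (@mfin m m m.+1).
transitivity (\int[P]_w (ind (tau m.+1 w < +oo /\ acc m w = true) * f w (HK m w)) +
    \int[P]_w (ind (tau m.+1 w < +oo /\ acc m w = false) * phi w (bef m w))).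
  rewrite -ge0_integralD//; last 4 first.
  - by move=> w _; rewrite mule_ge0//; exact: phi0.
  - apply: emeasurable_funM.
      by apply: measurable_ind; exact: measurableI.
    have mm : meas_fun (fun w : O => ((w : Oab m.+1 m), HK m w)).
      by apply/measurable_fun_pairP; split; [exact: idab|exact: mHK].
    exact: (measurableT_comp mf mm).
  - by move=> w _; rewrite mule_ge0.
  - apply: emeasurable_funM.
      by apply: measurable_ind; apply: measurableI => //; exact: (macc m false).
    exact: (measurableT_comp mphib (@idab m.+1 m)).
  apply: eq_integral => w _ /=; rewrite !ind_and -!muleA -ge0_muleDr; last 2 first.
  - by rewrite mule_ge0//; exact: phi0.
  - by rewrite mule_ge0.
  congr (_ * _); case: (acc m w).
    by rewrite indT// mul1e (@indF _ (true = false))// mul0e adde0.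
  by rewrite indF// mul0e add0e indT// mul1e.
rewrite eq1 eq2 -ge0_integralD//; last 4 first.
- by move=> w _; rewrite mule_ge0//; apply: integral_ge0 => hk _; exact: phi0.
- apply: emeasurable_funM; first exact: measurable_ind.
  have h := @measurable_int_kernel _ _ _ (Oab m.+1 m) _ _ R K id (@measurable_id _ (Oab m.+1 m) setT) f mf
    (fun w hk => phi0 w _).
  exact: (measurableT_comp h (@idab m.+1 m)).
- move=> w _; rewrite !mule_ge0// lee_fin subr_ge0.
  by case/andP: (collision_proba_itv Lambda_gt0 mu_le (pair_at (I m w) (bef m w))).
- apply: emeasurable_funM; first exact: measurable_ind.
  have h : measurable_fun (setT : set (Oab m.+1 m))
      (fun w => (1 - proba m w)%:E * phi w (bef m w)).
    apply: emeasurable_funM => //; apply/measurable_EFinP.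
    by apply: measurable_funB => //; exact: (@mproba m).
  exact: (measurableT_comp h (@idab m.+1 m)).
apply: eq_integral => w _.
have p01 : (0 <= proba m w <= 1)%R by exact: collision_proba_itv.
rewrite -ge0_muleDr; last 2 first.
- by apply: integral_ge0 => hk _; exact: phi0.
- by rewrite mule_ge0// lee_fin subr_ge0; case/andP: p01.
congr (_ * _); rewrite addeC; congr (_ + _).
rewrite integral_kernel_weight//; last by move=> hk; exact: phi0.
exact: (measurableT_comp mf (pair1_measurable _)).
Qed.

Let mcomp0 dS (S : measurableType dS) (g : O -> S -> \bar R) (y : O -> S) :
  measurable_fun (setT : set (O0 * S)) (fun p => g p.1 p.2) ->
  meas_fun y -> meas_fun (fun w : O => g w (y w)).
Proof.
move=> mg my; have mm : measurable_fun (setT : set O) (fun w => ((w : O0), y w)).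
  by apply/measurable_fun_pairP; split; [exact: id0|exact: my].
exact: (measurableT_comp mg mm).
Qed.

Let ae_eq_int (F H : O -> \bar R) : meas_fun F -> meas_fun H ->
  (forall w, 0 <= F w) -> (forall w, 0 <= H w) -> {ae P, forall w, F w = H w} ->
  \int[P]_w F w = \int[P]_w H w.
Proof.
by move=> mF mH F0 H0 h; apply: ge0_ae_eq_integral => //; apply: filterS h.
Qed.

Let mobspO m : measurable [set w | obsp m w].
Proof. exact: measurable_ab (@mobsp m m m (leqnn m)). Qed.

Let mtaufinO m : measurable [set w | tau m w < +oo].
Proof. exact: measurable_ab (@mfin m m m). Qed.

Let free_flow b n (A : set O) (t : O -> R) (f : O -> X -> \bar R) :
  @measurable _ O0 A -> measurable_fun (setT : set O0) t ->
  measurable_fun (setT : set (O0 * X)) (fun p => f p.1 p.2) ->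
  (forall w z, 0 <= f w z) ->
  \int[P]_w (ind (A w /\ tau n w < +oo) *
    (ind (obsp n w /\ seen o (tm n w) (t w) (Ym n w)) *
     f w (evs b (Ym n w) (t w - tm n w)))) =
  \int[P]_w (ind (tau n w < +oo) *
    (ind (A w /\ obsp n w) * flow o Pi b (tm n w) (t w) (f w) (st n w))).
Proof.
move=> mA mt mf f0.
pose F w ys := ind (A w /\ obsp n w) * (ind (seen o (tm n w) (t w) ys) *
  f w (evs b ys (t w - tm n w))).
transitivity (\int[P]_w (ind (tau n w < +oo) * F w (Ym n w))).
  apply: eq_integral => w _; rewrite /F !ind_and -!muleA muleCA.
  by congr (_ * (_ * _)).
rewrite free_step//.
- by apply: eq_integral => w _; rewrite integral_ind_cst.
- have m1 := @measurable_fst _ _ (Oab n n) (N.-tuple (Dinf R d)).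
  apply: emeasurable_funM.
    apply: measurable_ind.
    have mAo : @measurable _ (Oab n n) [set w | A w /\ obsp n w].
      apply: measurableI; last exact: mobsp.
      exact: (measurable_preim (@idab0 n n) mA).
    exact: (measurable_preim m1 mAo).
  apply: (@measurable_flow_integrand _ _ _ o _ (Oab n n * N.-tuple (Dinf R d))%type b
    (fun p => tm n p.1) (fun p => t p.1) snd (fun p => f p.1)).
  + exact: (measurableT_comp (@mtm n n n) m1).
  + exact: (measurableT_comp (measurableT_comp mt (@idab0 n n)) m1).
  + exact: measurable_snd.
  + have mm : measurable_fun (setT : set ((Oab n n * N.-tuple (Dinf R d)) * X))
        (fun q => (q.1.1 : Oab n n, q.2)).
      apply/measurable_fun_pairP; split; last exact: measurable_snd.
      exact: (measurableT_comp m1 measurable_fst).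
    exact: (measurableT_comp (upX mf) mm).
- by move=> w ys; rewrite !mule_ge0.
Qed.

Let mst0 : meas_fun (st 0).
Proof. exact: (measurableT_comp (@mst 0 0 0 (leqnn 0) (leqnn 0)) (@idab 0 0)). Qed.

Let initial_step (g : O -> X -> \bar R) :
  measurable_fun (setT : set (O0 * X)) (fun p => g p.1 p.2) ->
  (forall w z, 0 <= g w z) ->
  \int[P]_w g w (st 0 w) = \int[P]_w \int[power_measure P0 N]_z g w z.
Proof.
move=> mg g0.
pose K := kernel_reparam (power_kernel (probability_kernel_cst P0) N)
  (@measurable_cst _ _ O0 _ setT [tuple tt | i < N]).
have := @disintegration _ _ _ O O0 X R P id id0 (st 0) mst0 K setT setT measurableT
  measurableT _ (measurable_rectangles E N) (@rectanglesI _ _ _) (rectanglesT _ _)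
  _ g mg g0.
have e1 : \int[P]_w g w (st 0 w) =
    \int[P]_w (@ind R ([set: O0] w /\ [set: O] w) * g w (st 0 w)).
  by apply: eq_integral => w _; rewrite indT// mul1e.
rewrite e1 => ->.
  by apply: eq_integral => w _; rewrite indT// mul1e.
move=> A _ mA _ [B [mB ->]]; rewrite setIT.
transitivity (P (A `&` [set w | forall i, B i (Z i w 0%R)])).
  by congr (P (_ `&` _)); apply/seteqP; split=> w h i; have := h i;
    rewrite tnth_mktuple.
rewrite (Hinit mA mB).
have mAO : measurable (A : set O) by exact: (measurable_preim id0 mA).
rewrite -[X in X * _]integral_ind//.
rewrite -(@ge0_integralZr _ _ _ _ _ measurableT)//.
- by apply: eq_integral => w _; rewrite [K w _]power_measure_rectangle.
- exact: measurable_ind.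
- exact: prode_ge0.
Qed.

Let mflow0 b (s t : O -> R) (f : O -> X -> \bar R) :
  measurable_fun (setT : set O0) s -> measurable_fun (setT : set O0) t ->
  measurable_fun (setT : set (O0 * X)) (fun p => f p.1 p.2) ->
  (forall w z, 0 <= f w z) ->
  measurable_fun (setT : set (O0 * X))
    (fun p => flow o Pi b (s p.1) (t p.1) (f p.1) p.2).
Proof. by move=> *; exact: (@measurable_flow _ _ _ o Pi _ O0). Qed.

Let mhist0 b n (t : O -> R) (f : O -> X -> \bar R) :
  measurable_fun (setT : set O0) t ->
  measurable_fun (setT : set (O0 * X)) (fun p => f p.1 p.2) ->
  (forall w z, 0 <= f w z) ->
  measurable_fun (setT : set O)
    (fun w => history Lambda mu o Pi P0 b (fun k => tm k.+1 w) (I ^~ w) n (t w) (f w)).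
Proof.
move=> mt mf f0.
have h := @measurable_history _ _ _ _ _ Lambda_gt0 mu_le o Pi P0 _ O0 b
  (fun k => tm k.+1) I n t f (fun k _ => @mtm0 k.+1) (fun k _ => @mI0 k) mt mf f0.
exact: (measurableT_comp h id0).
Qed.

(** The last free piece is integrated out, then the last jump; this leaves the same statement with
    one interaction less, the time [tm n.+1] and a new test function. Both depend on the outcome
    through the interaction times and partners, which is why [t] and [f] are random in the
    statement. *)
Let free_history n : forall b (A : set O) (t : O -> R) (f : O -> X -> \bar R),
  @measurable _ O0 A -> measurable_fun (setT : set O0) t ->
  measurable_fun (setT : set (O0 * X)) (fun p => f p.1 p.2) ->
  (forall w z, 0 <= f w z) ->
  \int[P]_w (ind (A w /\ tau n w < +oo) *
    (ind (obsp n w /\ seen o (tm n w) (t w) (Ym n w)) *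
     f w (evs b (Ym n w) (t w - tm n w)))) =
  \int[P]_w (ind (A w /\ tau n w < +oo) *
    history Lambda mu o Pi P0 b (fun k => tm k.+1 w) (I ^~ w) n (t w) (f w)).
Proof.
have mO0 A : @measurable _ O0 A -> measurable (A : set O).
  by move=> mA; exact: (measurable_preim id0 mA).
have mfin0 m : @measurable _ O0 [set w | tau m w < +oo].
  by have := @emeasurable_lt_fun _ _ O0 (tau m) (cst +oo) (@mtau0 m) (measurable_cst _).
elim: n => [|n IH] b A t f mA mt mf f0; rewrite free_flow//.
  pose g s w z := ind (A w /\ tau 0 w < +oo) * flow o Pi b (s w) (t w) (f w) z.
  have g0 s w z : 0 <= g s w z by rewrite mule_ge0//; exact: flow_ge0.
  have mA0 : @measurable _ O0 [set w | A w /\ tau 0 w < +oo].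
    have h := mfin0 0%N.
    exact: (@measurableI _ O0 _ _ mA h).
  have mg s : measurable_fun (setT : set O0) s ->
      measurable_fun (setT : set (O0 * X)) (fun p => g s p.1 p.2).
    move=> ms; apply: emeasurable_funM; last exact: mflow0.
    by apply: measurable_ind; exact: (measurable_preim (@measurable_fst _ _ O0 X) mA0).
  transitivity (\int[P]_w g (tm 0) w (st 0 w)).
    apply: eq_integral => w _; rewrite /g muleA -ind_and; congr (_ * _).
    by apply: ind_iff; split=> [[? []]//|[? ?]]; split=> //; split.
  rewrite initial_step//; last exact: mg.
  transitivity (\int[P]_w \int[power_measure P0 N]_z g (cst 0%R) w z); last first.
    by apply: eq_integral => w _; rewrite integral_ind_cst.
  have mi s : measurable_fun (setT : set O0) s ->
      meas_fun (fun w : O => \int[power_measure P0 N]_z g s w z).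
    move=> ms; have h := @measurable_int_kernel _ _ _ O0 (N.-tuple unit) X R
      (power_kernel (probability_kernel_cst P0) N) (fun=> [tuple tt | i < N])
      (measurable_cst _) (g s) (mg s ms) (g0 s).
    exact: (measurableT_comp h id0).
  apply: ae_eq_int.
  - exact: mi.
  - by apply: mi; exact: measurable_cst.
  - by move=> w; exact: integral_ge0.
  - by move=> w; exact: integral_ge0.
  - apply: filterS tau_ordered => w [t0 _ _ _].
    by apply: eq_integral => z _; rewrite /g /tm t0.
pose g w z := collide Lambda mu (I n w) (flow o Pi b (tm n.+1 w) (t w) (f w)) z.
have g0 w z : 0 <= g w z by apply: collide_ge0 => // x; exact: flow_ge0.
have mg : measurable_fun (setT : set (O0 * X)) (fun p => g p.1 p.2).
  exact: (@measurable_collide_flow _ _ _ Lambda mu o Pi _ O0 b (tm n.+1) t (I n) f (@mtm0 n.+1) mt (@mI0 n) mf f0).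
pose phi w z := ind (A w /\ obsp n.+1 w) *
  flow o Pi b (tm n.+1 w) (t w) (f w) z.
rewrite (@jump_step n phi); last 2 first.
- apply: emeasurable_funM; last by apply: upX; exact: mflow0.
  have mAo : @measurable _ (Oab n.+1 n) [set w | A w /\ obsp n.+1 w].
    apply: measurableI; last exact: mobsp.
    exact: (measurable_preim (@idab0 n.+1 n) mA).
  apply: measurable_ind.
  exact: (measurable_preim (@measurable_fst _ _ (Oab n.+1 n) X) mAo).
- by move=> w z; rewrite mule_ge0//; exact: flow_ge0.
(* The induction hypothesis is applied at the time of the last interaction, on the event that it
   takes place. *)
pose A' := [set w | A w /\ tau n.+1 w < +oo].
have mA' : @measurable _ O0 A'.
  have h := mfin0 n.+1; exact: (@measurableI _ O0 _ _ mA h).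
have mbO : meas_fun (bef n).
  exact: (measurableT_comp (@mbef n.+1 n n (ltnSn n)) (@idab n.+1 n)).
have msn m t' : measurable_fun (setT : set O0) t' ->
    measurable [set w | seen o (tm m w) (t' w) (Ym m w)].
  move=> mt'; apply: measurable_seen => //.
    exact: (measurableT_comp (@mtm0 m) id0).
  exact: (measurableT_comp mt' id0).
have mobs1 : measurable [set w | obsp n w /\ seen o (tm n w) (tm n.+1 w) (Ym n w)].
  apply: measurableI; first exact: mobspO.
  exact: (msn n (tm n.+1) (@mtm0 n.+1)).
have := IH true A' (tm n.+1) g mA' (@mtm0 n.+1) mg g0.
have mA'i : meas_fun (fun w : O => @ind R (A' w)).
  by apply: measurable_ind; exact: mO0.
have mA'n : meas_fun (fun w : O => @ind R (A' w /\ tau n w < +oo)).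
  by apply: measurable_ind; apply: measurableI; [exact: (mO0 _ mA')|exact: mtaufinO].
have tn : {ae P, forall w, tau n.+1 w < +oo -> tau n w < +oo}.
  by apply: filterS tau_ordered => w [_ h _ _]; exact: le_lt_trans.
move=> e; transitivity (\int[P]_w (ind (A' w /\ tau n w < +oo) *
   (ind (obsp n w /\ seen o (tm n w) (tm n.+1 w) (Ym n w)) * g w (bef n w)))).
  transitivity (\int[P]_w (ind (tau n.+1 w < +oo) *
      (ind (A w /\ obsp n.+1 w) * g w (bef n w)))).
    by apply: eq_integral => w _; rewrite collide_ind.
  apply: ae_eq_int.
  - apply: emeasurable_funM; first exact: measurable_ind.
    apply: emeasurable_funM; last exact: mcomp0.
    by apply: measurable_ind; apply: measurableI; [exact: (mO0 _ mA)|exact: mobspO].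
  - apply: emeasurable_funM => //; apply: emeasurable_funM; last exact: mcomp0.
    exact: measurable_ind.
  - by move=> w; rewrite !mule_ge0.
  - by move=> w; rewrite !mule_ge0.
  - apply: filterS tn => w h; rewrite !muleA -!ind_and; congr (_ * _).
    apply: ind_iff; split=> [[h1 [h2 h3]]|[[[h1 h2] h3] [h4 h5]]].
      split; first by split=> //; exact: h.
      by split=> [k kn|]; apply: h3 => //; exact: ltnW.
    split=> //; split=> // k; rewrite ltnS leq_eqVlt => /predU1P[->//|kn].
    exact: h4.
rewrite e; apply: ae_eq_int.
- by apply: emeasurable_funM => //; exact: mhist0.
- by apply: emeasurable_funM => //; exact: mhist0.
- by move=> w; rewrite mule_ge0//; exact: history_ge0.
- by move=> w; rewrite mule_ge0//; exact: history_ge0.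
- apply: filterS tn => w h; congr (_ * _); apply: ind_iff.
  by split=> [[]//|[h1 h2]]; split=> //; exact: h.
Qed.

Let mzev b t : meas_fun (fun w => zev b w t).
Proof.
apply: measurable_fun_rectangle => i; under eq_fun do rewrite !tnth_mktuple.
rewrite /ev; case: b; last exact: measurableT_comp (measurable_eval _) (mZ i).
have h := @measurable_left_lim R d J rJ.
apply: (@measurableT_comp _ _ _ _ _ _ _ _ (fun w => (t, Z i w)) h).
by apply/measurable_fun_pairP; split=> /=; [exact: measurable_cst|exact: mZ].
Qed.

Let mobsZ t : measurable [set w | obsZ t w].
Proof.
apply: measurable_forall_fin => i; apply: measurable_forall_fin => l.
apply: measurable_cond => _.
exact: (measurable_preim (measurableT_comp (measurable_eval _) (mZ i))
  (obs_measurable _ _)).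
Qed.

(** On [A] exactly [n] interactions precede [t]. Since [A] is any such event determined by the
    interaction times and partners, this is the conditional expectation given them, and the right
    side no longer involves the positions. *)
Lemma dynamics_history b n t (A : set O) (f : X -> \bar R) :
  J t -> @measurable _ O0 A ->
  A `<=` [set w | (if b then tau n w < t%:E else tau n w <= t%:E) /\
            ~~ (if b then tau n.+1 w < t%:E else tau n.+1 w <= t%:E)] ->
  meas_fun f -> (forall z, 0 <= f z) ->
  \int[P]_w (ind (A w) *
    (ind (forall i l, (@obs_time _ _ _ o l < t)%R ->
       @obs_set _ _ _ o l i (Z i w (@obs_time _ _ _ o l))) *
     f (evs b [tuple Z i w | i < N] t))) =
  \int[P]_w (ind (A w) * history Lambda mu o Pi P0 b
    (fun k => fine (tau k.+1 w)) (I ^~ w) n t f).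
Proof.
move=> Jt mA An mf f0.
have mAO : measurable (A : set O) by exact: (measurable_preim id0 mA).
have mf2 : measurable_fun (setT : set (O0 * X)) (fun p => f p.2).
  exact: (measurableT_comp mf measurable_snd).
have e := @free_history n b A (cst t) (fun _ => f) mA (measurable_cst _) mf2 (fun _ => f0).
have iE w : @ind R (A w /\ tau n w < +oo) = ind (A w).
  apply: ind_iff; split=> [[]//|Aw]; split=> //; have [+ _] := An w Aw.
  by case: (b) => [/lt_trans|/le_lt_trans]; apply; exact: ltry.
rewrite (eq_integral _ _ (fun w _ => congr1 (fun x => x * _) (esym (iE w)))).
rewrite (eq_integral _ _ (fun w _ => congr1 (fun x => x * _) (iE w))) in e.
under [RHS]eq_integral do rewrite -iE; rewrite -e.
have mi : meas_fun (fun w : O => @ind R (A w)) by exact: measurable_ind.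
apply: ae_eq_int.
- apply: emeasurable_funM; first by under eq_fun do rewrite iE.
  apply: emeasurable_funM; first by apply: measurable_ind; exact: mobsZ.
  exact: (measurableT_comp mf (mzev b t)).
- apply: emeasurable_funM => //.
  have mtO : meas_fun (tm n) by exact: (measurableT_comp (@mtm0 n) id0).
  apply: emeasurable_funM.
    apply: measurable_ind; apply: measurableI; first exact: mobspO.
    by apply: measurable_seen => //; exact: measurable_cst.
  apply: (measurableT_comp mf); apply: measurable_evs => //.
  by apply: measurable_funB => //; exact: measurable_cst.
- by move=> w; rewrite !mule_ge0.
- by move=> w; rewrite !mule_ge0.
- apply: filterS ae_pathwise => w [_ _ _ _ [_ h]]; rewrite iE; apply: eq_indM => Aw.
  have [h1 h2] := An w Aw.
  by have [<- /ind_iff <-] := h b n t Jt h1 h2.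
Qed.

End dynamics_history.

(** * Exponential clocks *)

Section probability_of.
Context d (T : measurableType d) (R : realType) (m : {measure set T -> \bar R}).

Definition probability_of (h : m setT = 1%E) : set T -> \bar R := m.

HB.instance Definition _ h := Measure.on (probability_of h).

HB.instance Definition _ (h : m setT = 1%E) :=
  @Measure_isProbability.Build _ T _ (probability_of h) h.

Definition sigma_finite_of (h : sigma_finite setT m) : set T -> \bar R := m.

HB.instance Definition _ h := Measure.on (sigma_finite_of h).

HB.instance Definition _ (h : sigma_finite setT m) :=
  @Measure_isSigmaFinite.Build _ T _ (sigma_finite_of h) h.

End probability_of.

Section lebesgue.
Local Open Scope ereal_scope.
Variable R : realType.

Let mid : meas_fun (id : measurableTypeR R -> R).
Proof. exact: measurable_id. Qed.

Let leb_sigma_finite : sigma_finite setT (image_measure (@lebesgue_measure R) mid).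
Proof. exact: (sigma_finiteT (@lebesgue_measure R)). Qed.

(* [lebesgue_measure] lives on [measurableTypeR R], a copy of [R] *)
Definition leb : {sigma_finite_measure set R -> \bar R} :=
  sigma_finite_of leb_sigma_finite.

Lemma lebE A : (leb : {measure set R -> \bar R}) A = lebesgue_measure A.
Proof. by []. Qed.

Lemma integral_leb (f : R -> \bar R) : meas_fun f -> (forall x, 0 <= f x) ->
  \int[leb]_x f x = \int[lebesgue_measure]_x f x.
Proof. by move=> mf f0; exact: (integral_image _ mid). Qed.

End lebesgue.

Section exp_law.
Local Open Scope ereal_scope.
Variable R : realType.
Local Notation leb := (@leb R).

Lemma ae_neq (a : R) : {ae leb, forall x, x != a}.
Proof.
exists [set a]; split=> //; first by rewrite lebE lebesgue_measure_set1.
by move=> x /=; apply: contra_notP => /eqP.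
Qed.

Lemma integral_shift (a : R) (f : R -> \bar R) : meas_fun f ->
  (forall x, 0 <= f x) -> \int[leb]_x f (a + x)%R = \int[leb]_x f x.
Proof.
move=> mf f0.
have ms : meas_fun (fun x : R => (a + x)%R).
  by apply: measurable_funD => //; exact: measurable_cst.
rewrite -(@integral_image _ _ _ _ _ leb _ ms)//.
apply: eq_measure_integral => A mA _; apply/esym.
rewrite lebE; have ms' : meas_fun ((fun x => (a + x)%R) :
  measurableTypeR R -> measurableTypeR R) := ms.
rewrite (@lebesgue_measure_unique _ (image_measure (@lebesgue_measure R) ms'))//.
move=> _ [[u v] /= _ <-].
rewrite /image_measure/= /pushforward.
rewrite (_ : _ @^-1` _ = `](u - a)%R, (v - a)%R]%classic).
  by rewrite ?lebE !lebesgue_measure_itv/= !lte_fin ltrD2r; case: ifP => // _;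
    rewrite -!EFinB; congr (_%:E); ring.
by apply/seteqP; split=> x /=; rewrite !in_itv/= ltrBlDl lerBrDl.
Qed.

Section law.
Variables (rate : R) (rate0 : (0 < rate)%R).
Let pdf := exponential_pdf rate.

Let pdf0 x : (0 <= pdf x)%R. Proof. exact/exponential_pdf_ge0/ltW. Qed.

Let mpdf : meas_fun pdf. Proof. exact: measurable_exponential_pdf. Qed.

Let mgraph : measurable [set p : R * R | (0 <= p.2)%R /\ (p.2 < pdf p.1)%R].
Proof.
apply: measurableI; first by apply: measurable_le_fun => //; exact: measurable_cst.
by apply: measurable_lt_fun => //; exact: measurableT_comp.
Qed.

(* the law with density [pdf], as the first marginal of the uniform law on the
   region under the graph of [pdf] *)
Definition exp_law (h : (0 < rate)%R) : {measure set R -> \bar R} :=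
  image_measure (mrestr (leb \x leb) mgraph) (@measurable_fst _ _ R R).

Lemma integral_exp_law_pdf (f : R -> \bar R) : meas_fun f ->
  (forall x, 0 <= f x) ->
  \int[exp_law rate0]_x f x = \int[leb]_x ((pdf x)%:E * f x).
Proof.
move=> mf f0; rewrite /exp_law integral_image// integral_mrestr//; last first.
  exact: measurableT_comp.
rewrite -integral_indM// fubini_tonelli1//; last first.
- by move=> x; rewrite mule_ge0.
- apply: emeasurable_funM; first exact: measurable_ind.
  exact: measurableT_comp.
apply: eq_integral => x _; rewrite /fubini_F/=.
transitivity (\int[leb]_(y in `[0%R, pdf x[) f x).
  rewrite -[RHS]integral_indM//; apply: eq_integral => y _; congr (_ * _).
  by apply: ind_iff; rewrite /= in_itv/=; split=> [[-> ->]|/andP[]].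
rewrite integral_cst// lebE lebesgue_measure_itv/= lte_fin muleC; congr (_ * _).
by case: ltP => p; rewrite -?EFinB ?subr0//; congr (_%:E); apply/eqP;
  rewrite eq_le pdf0 p.
Qed.

Lemma exp_lawE A : measurable A -> exp_law rate0 A = exponential_prob rate A.
Proof.
move=> mA; rewrite -integral_ind// integral_exp_law_pdf//; last exact: measurable_ind.
transitivity (\int[lebesgue_measure]_x (ind (A x) * (pdf x)%:E)); last exact: integral_indM.
rewrite -integral_leb.
- by apply: eq_integral => x _; rewrite muleC.
- by apply: emeasurable_funM; [exact: measurable_ind|exact/measurable_EFinP].
- by move=> x; rewrite mule_ge0// lee_fin.
Qed.

Let exp_lawT : exp_law rate0 setT = 1.
Proof. by rewrite exp_lawE// /exponential_prob integral_exponential_pdf. Qed.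

Definition exp_probability : probability R R := probability_of exp_lawT.

Let mexp : meas_fun (fun x => (rate * expR (- rate * x))%R).
Proof.
apply: measurable_funM; first exact: measurable_cst.
apply: measurableT_comp => //; apply: measurable_funM => //; exact: measurable_cst.
Qed.

Let pdfE x : x != 0%R -> (pdf x)%:E = ind (0 < x)%R * (rate * expR (- rate * x))%:E.
Proof.
move=> x0; have [x1|x1] := ltP x 0%R.
  by rewrite /pdf lt0_exponential_pdf// indF ?mul0e//; apply/negP; rewrite -leNgt ltW.
by rewrite /pdf exponential_pdfE// indT ?mul1e// lt_neqAle eq_sym x0.
Qed.

Lemma integral_exp_law (f : R -> \bar R) : meas_fun f ->
  (forall x, 0 <= f x) ->
  \int[exp_law rate0]_x f x =
  \int[leb]_x (ind (0 < x)%R * ((rate * expR (- rate * x))%:E * f x)).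
Proof.
move=> mf f0; rewrite integral_exp_law_pdf//; apply: ge0_ae_eq_integral => //.
- by apply: emeasurable_funM => //; exact/measurable_EFinP.
- apply: emeasurable_funM.
    by apply: measurable_ind; apply: measurable_lt_fun => //; exact: measurable_cst.
  by apply: emeasurable_funM => //; exact/measurable_EFinP.
- by move=> x _; rewrite mule_ge0// lee_fin.
- by move=> x _; rewrite !mule_ge0// lee_fin mulr_ge0 ?expR_ge0 ?ltW.
- by apply: filterS (ae_neq 0) => x x0 _; rewrite pdfE// muleA.
Qed.

(** Closed and open tails have the same mass because a point is negligible, and a negative threshold
    acts as 0. Both are needed, since words are considered up to [t] included or excluded. *)
Lemma exp_law_tail u :
  exp_law rate0 [set x | (u <= x)%R] = (expR (- rate * Num.max u 0))%:E /\
  exp_law rate0 [set x | (u < x)%R] = (expR (- rate * Num.max u 0))%:E.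
Proof.
have m1 : measurable [set x : R | (u <= x)%R].
  by apply: measurable_le_fun => //; exact: measurable_cst.
have m2 : measurable [set x : R | (u < x)%R].
  by apply: measurable_lt_fun => //; exact: measurable_cst.
have m0 : measurable [set x : R | (0 < x)%R].
  by apply: measurable_lt_fun => //; exact: measurable_cst.
pose v := Num.max u 0%R.
have mv : measurable [set x : R | (v < x)%R].
  by apply: measurable_lt_fun => //; exact: measurable_cst.
have e A : measurable A -> (forall x, x != u -> x != 0%R ->
    (0 < x)%R /\ A x <-> (v < x)%R) ->
    exp_law rate0 A = (expR (- rate * v))%:E.
  move=> mA h; rewrite -integral_ind// integral_exp_law//; last exact: measurable_ind.
  transitivity (\int[leb]_x (ind (v < x)%R * (rate * expR (- rate * x))%:E)).
    apply: ge0_ae_eq_integral => //.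
    - apply: emeasurable_funM; first exact: measurable_ind.
      apply: emeasurable_funM; last exact: measurable_ind.
      exact/measurable_EFinP.
    - apply: emeasurable_funM; first exact: measurable_ind.
      exact/measurable_EFinP.
    - by move=> x _; rewrite !mule_ge0// lee_fin mulr_ge0 ?expR_ge0 ?ltW.
    - by move=> x _; rewrite !mule_ge0// lee_fin mulr_ge0 ?expR_ge0 ?ltW.
    - apply: filterS2 (ae_neq 0) (ae_neq u) => x x0 xu _.
      by rewrite [_%:E * ind _]muleC muleA -ind_and (ind_iff (h x xu x0)).
  (* After translation by [v] the integrand is [expR (- rate * v)] times the density, whose integral
     is 1. *)
  rewrite -(integral_shift v); last 2 first.
  - by apply: emeasurable_funM; [exact: measurable_ind|exact/measurable_EFinP].
  - by move=> x; rewrite mule_ge0// lee_fin mulr_ge0 ?expR_ge0 ?ltW.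
  transitivity (\int[leb]_x ((expR (- rate * v))%:E * (pdf x)%:E)).
    apply: ge0_ae_eq_integral => //.
    - apply: emeasurable_funM.
        apply: measurable_ind; apply: measurable_lt_fun; first exact: measurable_cst.
        by apply: measurable_funD => //; exact: measurable_cst.
      apply/measurable_EFinP; apply: (measurableT_comp mexp).
      by apply: measurable_funD => //; exact: measurable_cst.
    - apply: emeasurable_funM; first exact: measurable_cst.
      exact/measurable_EFinP.
    - by move=> x _; rewrite !mule_ge0// lee_fin mulr_ge0 ?expR_ge0 ?ltW.
    - by move=> x _; rewrite mule_ge0// lee_fin// expR_ge0.
    - apply: filterS (ae_neq 0) => x x0 _; rewrite pdfE// ltrDl muleCA.
      congr (_ * _); rewrite -EFinM mulrDr expRD; congr (_%:E); ring.
  rewrite ge0_integralZl//.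
  - rewrite integral_leb; [|exact/measurable_EFinP|by move=> x; rewrite lee_fin].
    by rewrite integral_exponential_pdf// mule1.
  - exact/measurable_EFinP.
  - by move=> x _; rewrite lee_fin.
split; apply: e => // x xu x0; rewrite /v gt_max /=.
  split=> [[-> ux]|/andP[ux ->]]; last by split=> //; exact: ltW.
  by rewrite andbT lt_neqAle eq_sym xu.
by split=> [[-> ->]//|/andP[-> ->]].
Qed.

End law.
End exp_law.

(** * Clocks independent of the information gathered so far *)

Section fresh.
Local Open Scope ereal_scope.
Context dO (O : measurableType dO) (R : realType) (P : probability O R).
Variables (I : eqType) (rate : R) (rate0 : (0 < rate)%R) (X : I -> O -> R).
Hypothesis mX : forall i, meas_fun (X i).
Local Notation law := (exp_law rate0).

(* on [D], the [X i] for i in K are i.i.d. and independent of H *)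
Definition fresh (H : set (set O)) (D : set O) (K : set I) : Prop :=
  forall A s (B : I -> set R), <<s H >> A -> A `<=` D -> uniq s ->
    (forall i, i \in s -> K i) -> (forall i, measurable (B i)) ->
    P (A `&` [set w | forall i, i \in s -> B i (X i w)]) =
    P A * \prod_(i <- s) law (B i).

Definition learn (H : set (set O)) (i : I) : set (set O) :=
  H `|` preimage_set_system setT (X i) measurable.

Let mXs (s : seq I) (B : I -> set R) : (forall i, measurable (B i)) ->
  measurable [set w | forall i, i \in s -> B i (X i w)].
Proof.
move=> mB; elim: s => [|i s IH].
  by rewrite (_ : mkset _ = setT)//; apply/seteqP; split.
rewrite (_ : mkset _ = X i @^-1` B i `&` [set w | forall i, i \in s -> B i (X i w)]).
  by apply: measurableI => //; exact: measurable_preim (mX i) (mB i).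
apply/seteqP; split=> [w h|w [h1 h2] k]; last by rewrite inE => /predU1P[->//|]; exact: h2.
by split=> [|k ks]; apply: h; rewrite inE ?eqxx// ks orbT.
Qed.

Let law_fin A : measurable A -> law A \is a fin_num.
Proof. by move=> mA; exact: (@fin_num_measure _ _ _ (exp_probability rate0)). Qed.

Lemma learn_sub H i : H `<=` measurable -> learn H i `<=` measurable.
Proof.
by move=> Hm A [/Hm//|[B mB <-]]; rewrite setTI; exact: measurable_preim (mX i) mB.
Qed.

Lemma measurable_learn H i :
  measurable_fun (setT : set (sigma_of (learn H i))) (X i).
Proof. by move=> _ B mB; apply: sub_sigma_algebra; right; exists B. Qed.

(** The enlarged sigma-algebra is generated by the events [A1] and [X i] in [B1], stable under
    intersection. On these, freshness for [i :: s] and for [i] alone gives the factorisation. *)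
Lemma fresh_learn H D K i : H `<=` measurable -> <<s H >> D -> fresh H D K -> K i ->
  fresh (learn H i) D [set k | K k /\ k != i].
Proof.
move=> HM HD frH Ki A s B mA AD us sK mB.
have Hm C : <<s H >> C -> measurable C.
  by move=> h; apply: smallest_sub h => //; exact: sigma_algebra_measurable.
pose T := sigma_of (learn H i).
have mid : meas_fun (id : O -> T).
  exact: measurable_id_sub (learn_sub HM).
pose c := \prod_(k <- s) law (B k).
have c0 : (0 <= fine c)%R.
  by apply/fine_ge0/prode_ge0.
have cE : (fine c)%:E = c.
  rewrite fineK//; rewrite /c; elim: (s) => [|k s' IH]; first by rewrite big_nil.
  by rewrite big_cons fin_numM// law_fin.
pose E := [set w | forall k, k \in s -> B k (X k w)].
have mDE : measurable (D `&` E) by apply: measurableI; [exact: Hm|exact: mXs].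
pose m1 := image_measure (mrestr P mDE) mid.
pose m2 := image_measure (mscale (NngNum c0) (mrestr P (Hm _ HD))) mid.
have mAO : measurable (A : set O) by exact: (measurable_preim mid mA).
have AE : P (A `&` E) = m1 A.
  by rewrite /m1/= /pushforward /mrestr/= preimage_id setIA (setIidl AD).
have AE2 : P A * c = m2 A.
  rewrite /m2/= /pushforward /mscale/= /mrestr/= preimage_id (setIidl AD).
  by rewrite cE muleC.
rewrite AE AE2.
pose G := [set A : set T | exists2 A1, <<s H >> A1 & exists2 B1, measurable B1 &
  A = A1 `&` X i @^-1` B1].
have GT A1 : <<s H >> A1 -> @measurable _ T A1.
  by apply: sub_sigma_algebra2; left.
apply: (@finite_measure_unique _ _ T G) => //.
- apply/seteqP; split; last first.
    apply: smallest_sub; first exact: (@sigma_algebra_measurable _ T).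
    move=> _ [A1 hA1 [B1 mB1 ->]]; apply: (@measurableI _ T); first exact: GT.
    exact: (measurable_preim (@measurable_learn H i) mB1).
  apply: smallest_sub; first exact: smallest_sigma_algebra.
  move=> C [HC|[B1 mB1 <-]]; apply: sub_sigma_algebra.
    exists C; first exact: sub_sigma_algebra.
    by exists setT => //; rewrite preimage_setT setIT.
  exists setT; first exact: (@measurableT _ (sigma_of H)).
  by exists B1.
- move=> _ _ [A1 h1 [B1 k1 ->]] [A2 h2 [B2 k2 ->]].
  exists (A1 `&` A2); first exact: (@measurableI _ (sigma_of H)).
  exists (B1 `&` B2); first exact: measurableI.
  by rewrite preimage_setI setIACA.
- exists setT; first exact: (@measurableT _ (sigma_of H)).
  by exists setT => //; rewrite preimage_setT setIT.
- rewrite /m1/= /pushforward /mrestr/= (@le_lt_trans _ _ (P setT))//.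
    apply: le_measure; rewrite ?inE// preimage_setT; exact: measurableI.
  by rewrite ltey_eq fin_num_measure.
- move=> _ [A1 h1 [B1 k1 ->]].
  have h1D : <<s H >> (A1 `&` D) by exact: (@measurableI _ (sigma_of H)).
  (* The constraint on [X i] is added to those on [s], so that freshness for [i :: s] treats them
     all at once. *)
  pose B' k := if k == i then B1 else B k.
  have mB' k : measurable (B' k) by rewrite /B'; case: ifP.
  have i_s : i \notin s by apply/negP => /sK[_]; rewrite eqxx.
  have e1 := @frH (A1 `&` D) [:: i] B' h1D (@subIsetr _ _ _) erefl _ mB'.
  have e2 := @frH (A1 `&` D) (i :: s) B' h1D (@subIsetr _ _ _) _ _ mB'.
  rewrite /m1 /m2 /= /pushforward /mscale/= /mrestr/= preimage_id cE.
  transitivity (P ((A1 `&` D) `&`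
      [set w | forall k, k \in i :: s -> B' k (X k w)])).
    congr (P _); apply/seteqP; split=> [w [[a1 b1] [d e]]|w [[a1 d] h]].
      split=> // k; rewrite inE /B' => /predU1P[->|ks]; first by rewrite eqxx.
      by case: eqP => [->//|_]; exact: e.
    split; last (split=> // k ks).
      by split=> //; have := h i; rewrite /B' inE eqxx; apply.
    by have := h k; rewrite /B' inE ks orbT; case: eqP => [ki|_]; [rewrite ki (negbTE i_s) in ks|apply].
  rewrite e2; last 2 first.
  - by rewrite /= i_s.
  - by move=> k; rewrite inE => /predU1P[->//|/sK[]].
  rewrite big_cons /B' eqxx muleA.
  rewrite (_ : P (_ `&` _ `&` D) = P (A1 `&` D) * law B1); last first.
    transitivity (P ((A1 `&` D) `&` [set w | forall k, k \in [:: i] -> B' k (X k w)])).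
      congr (P _); apply/seteqP; split=> [w [[a1 b1] d]|w [[a1 d] h]].
        by split=> // k; rewrite inE => /eqP->; rewrite /B' eqxx.
      by split=> //; split=> //; have := h i; rewrite /B' inE eqxx; apply.
    rewrite e1; last by move=> k; rewrite inE => /eqP ->.
    by rewrite big_seq1 /B' eqxx.
  rewrite [RHS]muleC; congr (_ * _); rewrite /c [LHS]big_seq [RHS]big_seq.
  by apply: eq_bigr => k ks; case: eqP => // ki; rewrite -ki ks in i_s.
Qed.

Lemma fresh_integral H D K i (g : O -> R -> \bar R) :
  H `<=` measurable -> <<s H >> D -> fresh H D K -> K i ->
  measurable_fun (setT : set (sigma_of H * R)) (fun p => g p.1 p.2) ->
  (forall w x, 0 <= g w x) ->
  \int[P]_w (ind (D w) * g w (X i w)) =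
  \int[P]_w (ind (D w) * \int[law]_x g w x).
Proof.
move=> HM HD frH Ki mg g0; pose T := sigma_of H.
have mid : meas_fun (id : O -> T) by exact: measurable_id_sub HM.
pose KK := kernel_reparam (probability_kernel_cst (exp_probability rate0))
  (@measurable_cst _ _ T _ setT tt).
have mG : @measurable _ R = <<s @measurable _ R >>.
  by rewrite sigma_algebra_id//; exact: sigma_algebra_measurable.
have GI : setI_closed (@measurable _ R) by move=> A B; exact: measurableI.
have := @disintegration _ _ _ O T R R P id mid (X i) (mX i) KK setT D measurableT
  HD _ mG GI measurableT _ g mg g0.
have e1 : \int[P]_w (ind (D w) * g w (X i w)) =
    \int[P]_w (@ind R (D w /\ [set: O] w) * g w (X i w)).
  by apply: eq_integral => w _; congr (_ * _); apply: ind_iff; split=> [|[]].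
rewrite e1 => -> // A B mA AD mB; rewrite setIT.
have mAO : measurable (A : set O) by exact: (measurable_preim mid mA).
transitivity (P (A `&` [set w | forall k, k \in [:: i] -> B (X k w)])).
  congr (P (_ `&` _)); apply/seteqP; split=> [w h k|w h].
    by rewrite inE => /eqP ->.
  by apply: h; rewrite inE.
rewrite (@frH A [:: i] (fun=> B))//; last by move=> k; rewrite inE => /eqP ->.
rewrite big_seq1 -[X in X * _]integral_ind//.
rewrite -(@ge0_integralZr _ _ _ _ _ measurableT)//.
exact: measurable_ind.
Qed.

(** The thresholds are known from [H] but the clocks are not. They are read one at a time: the
    indicator of the clock just read joins [phi], the induction treats the others, and that clock is
    integrated out at the end. *)
Lemma fresh_tails b (s : seq I) : forall H D K (u : I -> O -> R) (phi : O -> \bar R),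
  H `<=` measurable -> <<s H >> D -> fresh H D K ->
  uniq s -> (forall i, i \in s -> K i) ->
  (forall i, measurable_fun (setT : set (sigma_of H)) (u i)) ->
  measurable_fun (setT : set (sigma_of H)) phi -> (forall w, 0 <= phi w) ->
  \int[P]_w (ind (D w) * (phi w *
    \prod_(i <- s) ind (if b then u i w <= X i w else u i w < X i w)%R)) =
  \int[P]_w (ind (D w) * (phi w *
    (expR (- rate * \sum_(i <- s) Num.max (u i w) 0)%R)%:E)).
Proof.
elim: s => [|i s IH] H D K u phi HM HD frH /= us sK mu_ mphi phi0.
  by apply: eq_integral => w _; rewrite !big_nil mulr0 expR0.
move: us => /andP[i_s us].
have Ki : K i by apply: sK; rewrite inE eqxx.
pose H' := learn H i.
have HH' : H `<=` H' by move=> A; left.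
have up : meas_fun (id : sigma_of H' -> sigma_of H).
  exact: measurable_id_mono.
have mcmp dT (T : measurableType dT) (f g : T -> R) (bb : bool) :
    meas_fun f -> meas_fun g ->
    meas_fun (fun x => @ind R (if bb then f x <= g x else f x < g x)%R).
  move=> mf mg; apply: measurable_ind.
  by case: (bb); [exact: measurable_le_fun|exact: measurable_lt_fun].
pose phi' w := phi w * ind (if b then u i w <= X i w else u i w < X i w)%R.
have e1 := @IH H' D [set k | K k /\ k != i] u phi' (learn_sub HM) _
  (fresh_learn HM HD frH Ki) us.
transitivity (\int[P]_w (ind (D w) * (phi' w *
    \prod_(i <- s) ind (if b then u i w <= X i w else u i w < X i w)%R))).
  by apply: eq_integral => w _; rewrite big_cons /phi' !muleA.
rewrite e1; first last.
- by move=> w; rewrite mule_ge0.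
- apply: emeasurable_funM; first exact: (measurableT_comp mphi up).
  apply: mcmp; last exact: measurable_learn.
  exact: (measurableT_comp (mu_ i) up).
- by move=> k; exact: (measurableT_comp (mu_ k) up).
- move=> k ks; split; first by apply: sK; rewrite inE ks orbT.
  by apply: contraNneq i_s => <-.
- by apply: sub_sigma_algebra2 HD.
pose v w := (expR (- rate * \sum_(k <- s) Num.max (u k w) 0)%R)%:E.
have v0 w : 0 <= v w by rewrite lee_fin expR_ge0.
have mv : measurable_fun (setT : set (sigma_of H)) v.
  apply/measurable_EFinP; apply: measurableT_comp => //.
  apply: measurable_funM; first exact: measurable_cst.
  apply: measurable_sum => k; apply: measurable_maxr => //.
pose g w x := phi w * v w * ind (if b then u i w <= x else u i w < x)%R.
transitivity (\int[P]_w (ind (D w) * g w (X i w))).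
  by apply: eq_integral => w _; rewrite /g /phi' muleAC.
rewrite (fresh_integral HM HD frH Ki); last 2 first.
- have m1 := @measurable_fst _ _ (sigma_of H) R.
  apply: emeasurable_funM.
    apply: emeasurable_funM; first exact: (measurableT_comp mphi m1).
    exact: (measurableT_comp mv m1).
  apply: mcmp; last exact: measurable_snd.
  exact: (measurableT_comp (mu_ i) m1).
- by move=> w x; rewrite !mule_ge0.
apply: eq_integral => w _; congr (_ * _).
rewrite /g ge0_integralZl//; last 2 first.
- by apply: mcmp => //; exact: measurable_cst.
- by rewrite mule_ge0.
rewrite -muleA; congr (_ * _).
rewrite (_ : \int[_]_x _ = (expR (- rate * Num.max (u i w) 0))%:E).
  by rewrite /v -EFinM -expRD big_cons; congr (expR _)%:E; ring.
have [t1 t2] := exp_law_tail rate0 (u i w).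
case: (b); rewrite integral_ind//.
  by apply: measurable_le_fun => //; exact: measurable_cst.
by apply: measurable_lt_fun => //; exact: measurable_cst.
Qed.

Fixpoint known (s : seq I) : set (set O) :=
  if s is i :: s' then learn (known s') i else set0.

Lemma known_sub s : known s `<=` measurable.
Proof. by elim: s => [|i s IH]; [exact: sub0set|exact: learn_sub]. Qed.

Lemma measurable_known (s : seq I) i : i \in s ->
  measurable_fun (setT : set (sigma_of (known s))) (X i).
Proof.
elim: s => [//|k s IH]; rewrite inE => /predU1P[->|/IH mi] /=.
  exact: measurable_learn.
have hs : known s `<=` learn (known s) k by move=> A; left.
exact: (measurableT_comp mi (measurable_id_mono hs)).
Qed.

Lemma fresh_known (s : seq I) : iid_exponential P rate X -> uniq s ->
  fresh (known s) setT [set i | i \notin s].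
Proof.
move=> [_ lawX iX]; elim: s => [_|i s IH /= /andP[i_s us]].
  move=> A s B mA _ us _ mB.
  have XB i : law (B i) = P (X i @^-1` B i) by rewrite lawX// exp_lawE.
  (* Nothing has been read yet: the sigma-algebra generated by no event is trivial. *)
  have : A = set0 \/ A = setT.
    apply: (smallest_sub (X := [set A | A = set0 \/ A = setT]) _ _ mA).
      split=> [|C [->|->]|F h].
      - by left.
      - by right; rewrite setD0.
      - by left; rewrite setDv.
      - have [[n Fn]|F0] := pselect (exists n, F n = setT).
          by right; apply/seteqP; split=> // w _; exists n => //; rewrite Fn.
        left; apply/seteqP; split=> // w [n _]; have [->//|e] := h n.
        by case: F0; exists n.
    by move=> ? [].
  move=> [->|->]; first by rewrite set0I measure0 mul0e.
  rewrite setTI probability_setT mul1e iX//.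
  by apply: eq_bigr.
move=> A t B mA AD ut ts mB.
have isK : [set i | i \notin s] i by [].
apply: (fresh_learn (@known_sub s) (@measurableT _ (sigma_of (known s)))
  (IH us) isK) => //.
by move=> k /ts; rewrite /= inE negb_or => /andP[].
Qed.

End fresh.

(** * The forward renewal equation *)

Definition prior (R : realType) (b : bool) (x t : R) : bool :=
  if b then x < t else x <= t.

Lemma prior_le (R : realType) b (x y t : R) : x <= y -> prior b y t -> prior b x t.
Proof. by rewrite /prior; case: b => [/le_lt_trans|/le_trans]; apply. Qed.

Lemma nprior_le (R : realType) b (x y t : R) : prior b x t -> ~~ prior b y t -> x < y.
Proof. by move=> px; apply: contraNlt => yx; exact: prior_le px. Qed.

(** * Increasing enumerations of marked points *)

Section enumerates.
Local Open Scope ereal_scope.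
Variables (R : realType) (N : nat).
Variables (tau : nat -> \bar R) (I : nat -> 'I_N * 'I_N).
Variable pts : set (R * ('I_N * 'I_N)).
Hypothesis Htau : enumerates tau I pts.

Lemma enumerates_le m k : (m <= k)%N -> tau m <= tau k.
Proof.
case: Htau => _ h _ _; elim: k => [|k IH]; first by rewrite leqn0 => /eqP ->.
by rewrite leq_eqVlt => /predU1P[->//|/IH mk]; exact: le_trans mk (h k).
Qed.

Lemma enumerates_lt m k : (m < k)%N -> tau m < +oo -> tau m < tau k.
Proof.
by move=> mk mf; case: Htau => _ _ h _; exact: lt_le_trans (h m mf) (enumerates_le mk).
Qed.

Lemma enumerates_ge0 m : 0 <= tau m.
Proof. by have := enumerates_le (leq0n m); case: Htau => ->. Qed.

Lemma enumerates_pt p : pts p -> exists m, tau m.+1 = p.1%:E /\ I m = p.2.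
Proof. by case: Htau => _ _ _ ->. Qed.

Lemma enumerates_mem m : tau m.+1 < +oo -> pts (fine (tau m.+1), I m).
Proof.
move=> mf; case: (Htau) => _ _ _ ->; exists m; split=> //=.
by rewrite fineK// ge0_fin_numE// enumerates_ge0.
Qed.

Lemma enumerates_next n x ij : pts (x, ij) -> tau n < x%:E ->
  x%:E <= tau n.+1 -> tau n.+1 = x%:E /\ I n = ij.
Proof.
move=> /enumerates_pt[m /= [mx mI]]; rewrite -mx => h1 h2.
have nm : (n <= m)%N.
  by rewrite -ltnS ltnNge; apply/negP => /enumerates_le; rewrite leNgt h1.
have [mn|mn] := eqVneq m n; first by rewrite -mn.
have : tau n.+1 < tau m.+1.
  by apply: enumerates_lt; rewrite ?ltnS ?ltn_neqAle 1?eq_sym ?mn//;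
     rewrite (le_lt_trans _ (ltry x))// -mx enumerates_le// ltnS.
by rewrite ltNge h2.
Qed.

(** A finite increasing list that exhausts the marked points prior to [t] has to be the beginning of
    the enumeration. The backward events, read in reverse order, are recognised in this way. *)
Lemma enumerates_prefix b t n (s : nat -> R) (K : nat -> 'I_N * 'I_N) :
  prior b 0%R t ->
  (forall k, (k < n)%N -> pts (s k, K k) /\ prior b (s k) t) ->
  (forall k, (k.+1 < n)%N -> (s k < s k.+1)%R) ->
  (forall p, pts p -> prior b p.1 t -> exists2 k, (k < n)%N & p = (s k, K k)) ->
  [/\ forall k, (k < n)%N -> tau k.+1 = (s k)%:E /\ I k = K k,
      (if b then tau n < t%:E else tau n <= t%:E) &
      ~~ (if b then tau n.+1 < t%:E else tau n.+1 <= t%:E)].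
Proof.
move=> p0 spts smono sall.
have sle j k : (j <= k < n)%N -> (s j <= s k)%R.
  elim: k => [|k IH]; first by rewrite leqn0 => /andP[/eqP->].
  rewrite leq_eqVlt => /andP[/predU1P[->//|jk] kn].
  apply: le_trans (IH _) (ltW (smono _ kn)).
  by rewrite -ltnS jk /= ltnW.
have prE x : prior b x t = (if b then x%:E < t%:E else x%:E <= t%:E).
  by rewrite /prior; case: (b); rewrite ?lee_fin ?lte_fin.
(* The middle clause says that a listed point later than [tau k] has index at least [k]; it prevents
   the enumeration from skipping a point of the list. *)
have main k : (k <= n)%N -> (if b then tau k < t%:E else tau k <= t%:E) /\
    (forall j, (j < n)%N -> tau k < (s j)%:E -> (k <= j)%N) /\
    (forall j, (j < k)%N -> tau j.+1 = (s j)%:E /\ I j = K j).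
  elim: k => [|k IH] kn.
    by split; [case: Htau => -> _ _ _; rewrite -prE|].
  have [h1 [h2 h3]] := IH (ltnW kn).
  have [pk bk] := spts k kn.
  have kfin : tau k < +oo.
    by move: h1; case: (b) => [/lt_trans|/le_lt_trans]; apply; exact: ltry.
  have tks : tau k < (s k)%:E.
    case: k {IH bk h2 kfin h1} kn pk h3 => [|k] kn pk h3.
      have [m /= [<- _]] := enumerates_pt pk.
      by apply: enumerates_lt => //; case: Htau => ->.
    by have [-> _] := h3 k (ltnSn k); rewrite lte_fin smono.
  have [m /= [mx mI]] := enumerates_pt pk.
  have km : (k <= m)%N.
    by rewrite -ltnS ltnNge; apply/negP => /enumerates_le; rewrite leNgt mx tks.
  have le1 : tau k.+1 <= (s k)%:E by rewrite -mx enumerates_le.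
  have f1 : tau k.+1 < +oo := le_lt_trans le1 (ltry _).
  have fE : (fine (tau k.+1))%:E = tau k.+1.
    by rewrite fineK// ge0_fin_numE// enumerates_ge0.
  have [|j jn [sj Kj]] := sall _ (enumerates_mem f1).
    by rewrite /= prE fE; move: bk; rewrite prE; case: (b) => h;
      [exact: le_lt_trans h|exact: le_trans h].
  have kj : (k <= j)%N.
    by apply: h2 => //; rewrite -sj fE; apply: enumerates_lt.
  have ek : tau k.+1 = (s k)%:E.
    by apply/eqP; rewrite eq_le le1 -fE sj lee_fin sle// kj.
  have [e1 e2] : tau k.+1 = (s k)%:E /\ I k = K k.
    by apply: enumerates_next => //; rewrite ek.
  split; first by rewrite ek -prE.
  split=> [i ikn|i]; last by rewrite ltnS leq_eqVlt => /predU1P[->|/h3].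
  rewrite ek lte_fin => ski; rewrite ltnNge; apply/negP => ik.
  by move: ski; rewrite ltNge sle// ik.
have [h1 [h2 h3]] := main n (leqnn n); split=> //.
apply/negP => h4.
have f1 : tau n.+1 < +oo.
  by move: h4; case: (b) => [/lt_trans|/le_lt_trans]; apply; exact: ltry.
have fE : (fine (tau n.+1))%:E = tau n.+1.
  by rewrite fineK// ge0_fin_numE// enumerates_ge0.
have [|j jn [sj Kj]] := sall _ (enumerates_mem f1); first by rewrite /= prE fE.
have := h2 j jn; rewrite leqNgt jn -sj fE => h.
have : tau n < tau n.+1.
  by apply: enumerates_lt => //; apply: le_lt_trans f1; exact: enumerates_le.
by move/h.
Qed.

End enumerates.

(** * Words of successive interactions *)

Section words.
Variables (R : realType) (N : nat).
Context {dO : measure_display} {O : measurableType dO}.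
Variable X : pairs N * nat -> O -> R.
Variable w : O.

(* a word lists the successive interacting pairs, the last one first *)
Definition last_time (v : seq (pairs N)) : R :=
  if v is c :: v' then arrival X c (count_mem c v') w else 0.

Fixpoint ordered_word (v : seq (pairs N)) : Prop :=
  if v is c :: v' then last_time v' < last_time v /\ ordered_word v' else True.

(** [v] is the complete word of the interactions prior to [t]: it uses [count_mem c v] arrivals of
    the pair [c], and since indices start at 0, [arrival X c (count_mem c v)] is the next arrival,
    which must not be prior to [t]. *)
Definition is_word b (v : seq (pairs N)) (t : R) : Prop :=
  [/\ ordered_word v, prior b (last_time v) t &
      forall c, ~~ prior b (arrival X c (count_mem c v) w) t].

Definition past_time (v : seq (pairs N)) c : R := \sum_(k < count_mem c v) X (c, k : nat) w.

Lemma arrival_past v c :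
  arrival X c (count_mem c v) w = past_time v c + X (c, count_mem c v) w.
Proof. by rewrite /arrival big_ord_recr. Qed.

Lemma past_time_cons v c c' : past_time (c :: v) c' =
  if c' == c then arrival X c (count_mem c v) w else past_time v c'.
Proof.
by rewrite /past_time /=; case: eqVneq => [->|]; rewrite ?eqxx ?add0n.
Qed.

Lemma past_time_le v c : ordered_word v -> past_time v c <= last_time v.
Proof.
elim: v => [|c' v IH] /=; first by rewrite /past_time big_ord0.
move=> [h /IH h2]; rewrite past_time_cons; case: eqP => // _.
exact: le_trans h2 (ltW h).
Qed.

Lemma last_time_ge0 v : ordered_word v -> 0 <= last_time v.
Proof.
by elim: v => [//|c v IH] [h /IH h2]; exact: le_trans h2 (ltW h).
Qed.

(** The last interaction is excluded from the shorter word, which is therefore taken strictly before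
    its time, whatever [b]. This parallels the left values in [history]. *)
Lemma is_word_cons b c v t : is_word b (c :: v) t ->
  is_word true v (last_time (c :: v)).
Proof.
move=> [[h1 h2] h3 h4]; split=> // c'; rewrite /prior -leNgt.
have [->//|cc'] := eqVneq c' c.
apply/ltW/(nprior_le h3); have := h4 c'.
by rewrite /= eq_sym (negbTE cc').
Qed.

Hypothesis X_gt0 : forall i, 0 < X i w.

Lemma arrival_mono c l l' : (l < l')%N -> arrival X c l w < arrival X c l' w.
Proof.
elim: l' => [//|l' IH]; rewrite ltnS leq_eqVlt.
have S : arrival X c l' w < arrival X c l'.+1 w.
  by rewrite /arrival [ltRHS]big_ord_recr /= ltrDl.
by move=> /predU1P[->//|/IH h]; exact: lt_trans h S.
Qed.

Lemma arrival_le c l l' : (l <= l')%N -> arrival X c l w <= arrival X c l' w.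
Proof. by rewrite leq_eqVlt => /predU1P[->//|/(arrival_mono c)/ltW]. Qed.

Lemma arrival_gt0 c l : 0 < arrival X c l w.
Proof.
apply: lt_le_trans (arrival_le c (leq0n l)).
by rewrite /arrival big_ord1.
Qed.

Hypothesis X_inj : forall c c' l l', arrival X c l w = arrival X c' l' w -> c = c'.

(** The last letter of a word is the latest arrival prior to [t]. So two words end at the same time,
    hence by [X_inj] with the same pair, and the induction goes on at that time. *)
Lemma is_word_uniq b v v' t : is_word b v t -> is_word b v' t -> v = v'.
Proof.
have nil b0 c u s : is_word b0 [::] s -> is_word b0 (c :: u) s -> False.
  move=> [_ _ h] [_ h' _]; move/negP: (h c); apply.
  exact: prior_le (arrival_le c (leq0n _)) h'.
elim: v b v' t => [|c v IH] b [|c' v'] t // h h'.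
- by case: (nil _ _ _ _ h h').
- by case: (nil _ _ _ _ h' h).
(* If the second word did not use the last arrival of the first, that arrival would come at or after
   the next arrival of its pair, which is not prior to [t]. *)
have le_last c1 u1 c2 u2 : is_word b (c1 :: u1) t -> is_word b (c2 :: u2) t ->
    last_time (c1 :: u1) <= last_time (c2 :: u2).
  move=> [_ p1 _] [ow2 _ n2]; apply: le_trans (past_time_le c1 ow2).
  have k1 : (count_mem c1 u1 < count_mem c1 (c2 :: u2))%N.
    rewrite ltnNge; apply/negP => /(arrival_le c1) hh.
    by move/negP: (n2 c1); apply; exact: prior_le hh p1.
  rewrite /past_time; case: (count_mem c1 (c2 :: u2)) k1 => // k; rewrite ltnS.
  exact: arrival_le.
have e : last_time (c :: v) = last_time (c' :: v').
  by apply/eqP; rewrite eq_le !le_last.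
have ec : c = c' by exact: X_inj e.
rewrite -ec in h' e *; congr (_ :: _).
by apply: (IH _ _ _ (is_word_cons h)); rewrite e; exact: is_word_cons h'.
Qed.

Variables (tau : nat -> \bar R) (I : nat -> 'I_N * 'I_N).

Fixpoint matches (v : seq (pairs N)) : Prop :=
  if v is c :: v' then [/\ tau (size v) = (last_time v)%:E,
    I (size v') = val c & matches v'] else True.

Hypothesis Htau : enumerates tau I
  [set p | exists (c : pairs N) n, p = (arrival X c n w, val c)].

Lemma enumerates_word n : (tau n < +oo)%E ->
  exists v, [/\ size v = n, matches v, ordered_word v, (last_time v)%:E = tau n &
    forall c l, ((arrival X c l w)%:E <= tau n)%E <-> (l < count_mem c v)%N].
Proof.
elim: n => [|n IH] nf.
  exists [::]; have t0 : tau 0 = 0%E by case: Htau.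
  split=> // c l; rewrite t0 lee_fin leNgt arrival_gt0; split=> //.
have nf' : (tau n < +oo)%E by apply: le_lt_trans nf; exact: (enumerates_le Htau).
have [v [sv mv ov lv hv]] := IH nf'.
have [c [l [xE IE]]] := enumerates_mem Htau nf.
have tE : tau n.+1 = (arrival X c l w)%:E.
  by rewrite -xE fineK// ge0_fin_numE// (enumerates_ge0 Htau).
have tlt : (tau n < tau n.+1)%E by exact: (enumerates_lt Htau).
have ptc c' l' : [set p | exists (c : pairs N) n, p = (arrival X c n w, val c)]
  (arrival X c' l' w, val c') by exists c', l'.
have lE : l = count_mem c v.
  apply/eqP; rewrite eqn_leq; apply/andP; split; last first.
    rewrite leqNgt; apply/negP => /hv; rewrite -tE leNgt tlt//.
  rewrite leqNgt; apply/negP => kl.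
  have h1 : (tau n < (arrival X c (count_mem c v) w)%:E)%E.
    by rewrite ltNge; apply/negP => /hv; rewrite ltnn.
  have h2 : ((arrival X c (count_mem c v) w)%:E < tau n.+1)%E.
    by rewrite tE lte_fin arrival_mono.
  have [e _] := enumerates_next Htau (ptc c _) h1 (ltW h2).
  by move: h2; rewrite e ltxx.
have lastE : last_time (c :: v) = arrival X c l w by rewrite /= lE.
exists (c :: v); split=> //=.
- by rewrite sv.
- by split=> //; rewrite ?sv// -lE.
- by split=> //; rewrite -lte_fin lv -lE -tE.
- by rewrite -lE tE.
move=> c' l'; have [<-|cc'] := eqVneq c c'.
  rewrite /= add1n ltnS -lE tE lee_fin; split; last exact: arrival_le.
  by move=> h; rewrite leqNgt; apply/negP => /(arrival_mono c); rewrite ltNge h.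
rewrite /= add0n -hv; split=> [h|/le_trans]; last by apply; exact: ltW.
rewrite leNgt; apply/negP => h1.
have [_ e] := enumerates_next Htau (ptc c' l') h1 h.
by move: IE; rewrite e => /val_inj h2; rewrite h2 eqxx in cc'.
Qed.

Lemma is_word_enumerates b n t : (if b then tau n < t%:E else tau n <= t%:E)%E ->
  ~~ (if b then tau n.+1 < t%:E else tau n.+1 <= t%:E)%E ->
  exists v, [/\ size v = n, matches v & is_word b v t].
Proof.
move=> h1 h2; have nf : (tau n < +oo)%E.
  by move: h1; case: (b) => [/lt_trans|/le_lt_trans]; apply; exact: ltry.
have [v [sv mv ov lv hv]] := enumerates_word nf; exists v; split=> //; split=> //.
  by move: h1; rewrite -lv /prior; case: (b); rewrite ?lte_fin ?lee_fin.
move=> c; have ltn : (tau n < (arrival X c (count_mem c v) w)%:E)%E.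
  by rewrite ltNge; apply/negP => /hv; rewrite ltnn.
have [|m [/= emx _]] := @enumerates_pt _ _ _ _ _ Htau
  (arrival X c (count_mem c v) w, val c); first by exists c, (count_mem c v).
have mx : (tau n.+1 <= (arrival X c (count_mem c v) w)%:E)%E.
  rewrite -emx; apply: (enumerates_le Htau); rewrite ltnS.
  by rewrite -ltnS ltnNge; apply/negP => /(enumerates_le Htau); rewrite emx leNgt ltn.
apply: contra h2; rewrite /prior; case: (b) => h.
  by rewrite (le_lt_trans mx)// lte_fin.
by rewrite (le_trans mx)// lee_fin.
Qed.

(** Otherwise there would be words of every length before [t], while the number of letters equal to
    [c] is bounded by the index of an arrival of [c] after [t]. *)
Lemma enumerates_stops b t : (forall c, exists l, t < arrival X c l w) ->
  prior b 0 t -> exists n, (if b then tau n < t%:E else tau n <= t%:E)%E /\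
  ~~ (if b then tau n.+1 < t%:E else tau n.+1 <= t%:E)%E.
Proof.
move=> /choice[l hl] p0.
apply/not_existsP => h.
have all n : (if b then tau n < t%:E else tau n <= t%:E)%E.
  elim: n => [|n IH].
    have -> : tau 0 = 0%E by case: Htau.
    by move: p0; rewrite /prior; case: (b); rewrite ?lte_fin ?lee_fin.
  by apply/negP => /negP h'; apply: (h n).
pose n := (\sum_(c : pairs N) l c).+1.
have nt : (tau n <= t%:E)%E by move: (all n); case: (b) => // /ltW.
have [v [sv _ _ _ hv]] := enumerates_word (le_lt_trans nt (ltry _)).
suff : (size v < n)%N by rewrite sv ltnn.
rewrite ltnS (_ : size v = \sum_(c : pairs N) count_mem c v)%N.
  apply: leq_sum => c _; rewrite leqNgt; apply/negP => /hv h'.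
  by have := le_trans h' nt; rewrite lee_fin leNgt hl.
rewrite -[in LHS](count_predT v) -sum1_count.
under [RHS]eq_bigr do rewrite -sum1_count big_mkcond.
rewrite exchange_big/=; apply: eq_bigr => c _.
by rewrite -big_mkcond/= (big_pred1 c)// => c' /=; rewrite eq_sym.
Qed.

End words.

(** * Laws of the words *)

Section word_law.
Local Open Scope ereal_scope.
Variables (R : realType) (N : nat).
Context {dO : measure_display} {O : measurableType dO}.
Variable P : probability O R.
Variables (rate : R) (rate0 : (0 < rate)%R) (X : pairs N * nat -> O -> R).
Hypothesis HX : iid_exponential P rate X.
Local Notation law := (exp_law rate0).
Local Notation M := #|{: pairs N}|.

Let mX i : meas_fun (X i). Proof. by case: HX. Qed.

(** The waiting times read by a word. They determine its interaction times, and all the other clocks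
    are still fresh. *)
Fixpoint indices (v : seq (pairs N)) : seq (pairs N * nat) :=
  if v is c :: v' then (c, count_mem c v') :: indices v' else [::].

Lemma mem_indices v c l : ((c, l) \in indices v) = (l < count_mem c v)%N.
Proof.
elim: v => //= c' v IH; rewrite inE IH xpair_eqE.
have [->|cc'] /= := eqVneq c c'; first by rewrite add1n ltnS [RHS]leq_eqVlt.
by [].
Qed.

Lemma uniq_indices v : uniq (indices v).
Proof. by elim: v => //= c v ->; rewrite mem_indices ltnn. Qed.

Local Notation Ov v := (sigma_of (known X (indices v))).

Lemma measurable_known_sum (v : seq (pairs N)) c n : (n <= count_mem c v)%N ->
  measurable_fun (setT : set (Ov v)) (fun w => \sum_(k < n) X (c, k : nat) w)%R.
Proof.
move=> nv; apply: measurable_sum => k; apply: measurable_known.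
by rewrite mem_indices (leq_trans (ltn_ord k)).
Qed.

Lemma measurable_past_time v c :
  measurable_fun (setT : set (Ov v)) (fun w => past_time X w v c).
Proof. exact: (measurable_known_sum (v := v) (c := c) (n := count_mem c v)). Qed.

Lemma known_up v c : meas_fun (id : Ov (c :: v) -> Ov v).
Proof. by apply: measurable_id_mono => A h; left. Qed.

Lemma known_id v : meas_fun (id : O -> Ov v).
Proof. exact: measurable_id_sub (known_sub mX (s := indices v)). Qed.

Lemma measurable_last_time v :
  measurable_fun (setT : set (Ov v)) (fun w => last_time X w v).
Proof.
case: v => [|c v]; first exact: measurable_cst.
by apply: measurable_known_sum; rewrite /= eqxx add1n.
Qed.

Lemma measurable_ordered v :
  @measurable _ (Ov v) [set w | ordered_word X w v].
Proof.
elim: v => [|c v IH]; first by rewrite (_ : mkset _ = setT)//; apply/seteqP; split.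
apply: (@measurableI _ (Ov (c :: v))); last exact: (measurable_preim (@known_up v c) IH).
apply: (@measurable_lt_fun _ _ (Ov (c :: v))); last exact: measurable_last_time.
exact: (measurableT_comp (@measurable_last_time v) (@known_up v c)).
Qed.

Lemma measurable_prior b dT (T : measurableType dT) (f g : T -> R) :
  meas_fun f -> meas_fun g ->
  measurable [set x | prior b (f x) (g x)].
Proof.
by move=> mf mg; rewrite /prior; case: b;
  [exact: measurable_lt_fun|exact: measurable_le_fun].
Qed.

Lemma measurable_is_word dT (T : measurableType dT) (g : T -> O) (t : T -> R) b v :
  (forall i, meas_fun (fun x => X i (g x))) -> meas_fun t ->
  measurable [set x | is_word X (g x) b v (t x)].
Proof.
move=> mXg mt.
have marr c n : meas_fun (fun x => arrival X c n (g x)).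
  by apply: measurable_sum => k.
have ml u : meas_fun (fun x => last_time X (g x) u).
  by case: u => [|c u]; [exact: measurable_cst|exact: marr].
have mo u : measurable [set x | ordered_word X (g x) u].
  elim: u => [|c u IH]; first by rewrite (_ : mkset _ = setT)//; apply/seteqP; split.
  by apply: measurableI => //; apply: measurable_lt_fun.
have -> : [set x | is_word X (g x) b v (t x)] =
  [set x | ordered_word X (g x) v] `&` ([set x | prior b (last_time X (g x) v) (t x)] `&`
  [set x | forall c, ~~ prior b (arrival X c (count_mem c v) (g x)) (t x)]).
  by apply/seteqP; split=> x /= [? []].
apply: measurableI => //; apply: measurableI; first exact: measurable_prior.
apply: measurable_forall_fin => c.
rewrite (_ : mkset _ = ~` [set x | prior b (arrival X c (count_mem c v) (g x)) (t x)]).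
  by apply: measurableC; exact: measurable_prior.
by apply/seteqP; split=> x /negP.
Qed.

(** The probability, given the clocks read by [v], that no pair has a further arrival up to [t]. *)
Let expo v (t : R) w : \bar R := (expR (- rate * \sum_c (t - past_time X w v c)))%:E.

Let expo0 v t w : 0 <= expo v t w. Proof. by rewrite lee_fin expR_ge0. Qed.

Let mexpo v : measurable_fun (setT : set (Ov v * R)) (fun p => expo v p.2 p.1).
Proof.
apply/measurable_EFinP; apply: measurableT_comp => //.
apply: measurable_funM; first exact: measurable_cst.
apply: measurable_sum => c; apply: measurable_funB; first exact: measurable_snd.
exact: (measurableT_comp (@measurable_past_time v c) measurable_fst).
Qed.

(** Given the clocks read by [v], the word is complete at [t] when the next waiting time of each
    pair exceeds the time elapsed since its last arrival. The tails multiply to [expo]. *)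
Lemma word_tail b v t (phi : O -> \bar R) :
  measurable_fun (setT : set (Ov v)) phi -> (forall w, 0 <= phi w) ->
  \int[P]_w (ind (is_word X w b v t) * phi w) =
  \int[P]_w (ind (ordered_word X w v /\ prior b (last_time X w v) t) *
             (phi w * expo v t w)).
Proof.
move=> mphi phi0.
pose s := [seq (c, count_mem c v) | c <- enum {: pairs N}].
pose u (i : pairs N * nat) w := (t - past_time X w v i.1)%R.
pose phi' w := ind (ordered_word X w v /\ prior b (last_time X w v) t) * phi w.
have mi : measurable_fun (setT : set (Ov v))
    (fun w => @ind R (ordered_word X w v /\ prior b (last_time X w v) t)).
  apply: measurable_ind; apply: measurableI; first exact: measurable_ordered.
  by apply: measurable_prior; [exact: measurable_last_time|exact: measurable_cst].
have := @fresh_tails _ _ _ P _ rate rate0 X mX b s (known X (indices v)) setT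
  [set i | i \notin indices v] u phi' (known_sub mX (s := indices v))
  (@measurableT _ (Ov v)) (fresh_known rate0 mX HX (uniq_indices v)) _ _ _ _ _.
have e1 w : ind (setT w) * (phi' w * \prod_(i <- s)
    ind (if b then u i w <= X i w else u i w < X i w)%R) =
    ind (is_word X w b v t) * phi w.
  rewrite indT// mul1e /phi' muleAC; congr (_ * _).
  rewrite big_map big_enum prod_ind -ind_and; apply: ind_iff.
  split=> [[[h1 h2] h3]|[h1 h2 h3]].
    split=> // c; have := h3 c; rewrite /u /= arrival_past /prior.
    by case: (b); rewrite -?leNgt -?ltNge ?lerBlDl ?ltrBlDl.
  split=> // c; have := h3 c; rewrite /u /= arrival_past /prior.
  by case: (b); rewrite -?leNgt -?ltNge ?lerBlDl ?ltrBlDl.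
under eq_integral do rewrite e1; move=> ->.
- apply: eq_integral => w _; rewrite indT// mul1e /phi' -muleA.
  apply: eq_indM => -[ow pw]; congr (_ * (expR (_ * _))%:E).
  rewrite big_map big_enum; apply: eq_bigr => c _; rewrite /u /=.
  apply/max_idPl; rewrite subr_ge0 (le_trans (past_time_le c ow))//.
  by move: pw; rewrite /prior; case: (b) => // /ltW.
- by rewrite map_inj_uniq ?enum_uniq// => c c' [].
- by move=> i /mapP[c _ ->]; rewrite /= mem_indices ltnn.
- move=> i; apply: measurable_funB; first exact: measurable_cst.
  exact: measurable_past_time.
- exact: emeasurable_funM.
- by move=> w; rewrite mule_ge0.
Qed.

(** The last waiting time is integrated out and its end becomes the variable [s]. What is left is
    the shorter word completed at [s], the rate of the last arrival, and the probability that none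
    of the [M] pairs interacts between [s] and [t]. *)
Lemma word_step b c v t (Psi : O -> R -> \bar R) :
  measurable_fun (setT : set (Ov v * R)) (fun p => Psi p.1 p.2) ->
  (forall w s, 0 <= Psi w s) ->
  \int[P]_w (ind (is_word X w b (c :: v) t) * Psi w (last_time X w (c :: v))) =
  \int[leb R]_s (ind (0 < s < t)%R * ((rate * expR (- rate * (M%:R * (t - s))))%:E *
    \int[P]_w (ind (is_word X w true v s) * Psi w s))).
Proof.
move=> mPsi Psi0.
pose a w := past_time X w v c.
pose i := (c, count_mem c v).
have lastE w : last_time X w (c :: v) = (a w + X i w)%R by rewrite /= arrival_past.
have m1 := @measurable_fst _ _ (Ov v) R.
have ma : measurable_fun (setT : set (Ov v)) a by exact: measurable_past_time.
have mi Q : @measurable _ (Ov v * R)%type [set p | Q p.1 p.2] ->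
    measurable_fun (setT : set (Ov v * R)) (fun p => @ind R (Q p.1 p.2)).
  exact: measurable_ind.
have mord : @measurable _ (Ov v * R)%type
    [set p | ordered_word X p.1 v /\ (last_time X p.1 v < p.2)%R].
  apply: measurableI; first exact: (measurable_preim m1 (@measurable_ordered v)).
  apply: measurable_lt_fun; last exact: measurable_snd.
  exact: (measurableT_comp (@measurable_last_time v) m1).
pose G0 w s := ind ((ordered_word X w v /\ (last_time X w v < s)%R) /\ prior b s t) *
  (Psi w s * expo v t w).
have G00 w s : 0 <= G0 w s by rewrite !mule_ge0.
have mG0 : measurable_fun (setT : set (Ov v * R)) (fun p => G0 p.1 p.2).
  apply: emeasurable_funM.
    apply: measurable_ind; apply: measurableI => //.
    by apply: measurable_prior; [exact: measurable_snd|exact: measurable_cst].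
  apply: emeasurable_funM => //.
  have mm : measurable_fun (setT : set (Ov v * R)) (fun p => (p.1, t)).
    by apply/measurable_fun_pairP; split; [exact: m1|exact: measurable_cst].
  exact: (measurableT_comp (@mexpo v) mm).
have me (k : R) : meas_fun (fun x : R => (expR (k * x))%:E).
  by apply/measurable_EFinP; apply: measurableT_comp => //; apply: measurable_funM.
(* Moving the last arrival of [c] from [a] to [a + x] multiplies [expo] by [expR (rate * x)]. This
   cancels the exponential of the law of [x], so only the constant [rate] survives in [W]. *)
pose G w x := G0 w (a w + x)%R * (expR (rate * x))%:E.
have G_ge0 w x : 0 <= G w x by rewrite mule_ge0// lee_fin expR_ge0.
have mash : measurable_fun (setT : set (Ov v * R)) (fun p => (p.1, (a p.1 + p.2)%R)).
  apply/measurable_fun_pairP; split; first exact: m1.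
  apply: measurable_funD; last exact: measurable_snd.
  exact: (measurableT_comp ma m1).
have mG : measurable_fun (setT : set (Ov v * R)) (fun p => G p.1 p.2).
  apply: emeasurable_funM; first exact: (measurableT_comp mG0 mash).
  exact: (measurableT_comp (me rate) measurable_snd).
have mlast : measurable_fun (setT : set (Ov (c :: v)))
    (fun w => Psi w (last_time X w (c :: v))).
  have mm : measurable_fun (setT : set (Ov (c :: v)))
      (fun w => (w : Ov v, last_time X w (c :: v))).
    apply/measurable_fun_pairP; split; first exact: known_up.
    exact: measurable_last_time.
  exact: (measurableT_comp mPsi mm).
rewrite word_tail//.
transitivity (\int[P]_w (ind (setT w) * G w (X i w))).
  apply: eq_integral => w _; rewrite (indT I) mul1e /G /G0 -lastE -!muleA.
  rewrite (_ : ind (ordered_word X w (c :: v) /\ _) = ind ((ordered_word X w v /\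
      (last_time X w v < last_time X w (c :: v))%R) /\
      prior b (last_time X w (c :: v)) t)); last first.
    by apply: ind_iff; split=> [[[]]|[[]]].
  congr (_ * (_ * _)); rewrite /expo -EFinM -expRD; congr (expR _)%:E.
  rewrite (bigD1 c)//= [in RHS](bigD1 c)//= past_time_cons eqxx arrival_past.
  rewrite (eq_bigr (fun c' => t - past_time X w v c')%R); last first.
    by move=> c' cc'; rewrite past_time_cons (negbTE cc').
  by rewrite -/(a w) -/i; ring.
have iK : [set i | i \notin indices v] i by rewrite /= mem_indices ltnn.
rewrite (fresh_integral mX (known_sub mX (s := indices v)) (@measurableT _ (Ov v))
  (fresh_known rate0 mX HX (uniq_indices v)) iK mG G_ge0).
pose W w s := rate%:E * (ind (a w < s)%R * G0 w s).
have W0 w s : 0 <= W w s by rewrite !mule_ge0// lee_fin ltW.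
have mW : measurable_fun (setT : set (Ov v * R)) (fun p => W p.1 p.2).
  apply: emeasurable_funM; first exact: measurable_cst.
  apply: emeasurable_funM => //; apply: measurable_ind.
  by apply: measurable_lt_fun; [exact: (measurableT_comp ma m1)|exact: measurable_snd].
have mWO : measurable_fun (setT : set (O * R)) (fun p => W p.1 p.2).
  have mm : measurable_fun (setT : set (O * R)) (fun p => (p.1 : Ov v, p.2)).
    apply/measurable_fun_pairP; split; last exact: measurable_snd.
    exact: (measurableT_comp (@known_id v) measurable_fst).
  exact: (measurableT_comp mW mm).
transitivity (\int[P]_w \int[leb R]_s W w s).
  apply: eq_integral => w _; rewrite (indT I) mul1e integral_exp_law; last 2 first.
  - exact: (measurableT_comp mG (@pair1_measurable _ _ (Ov v) _ w)).
  - by move=> x; exact: G_ge0.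
  rewrite -[RHS](integral_shift (a w)); last 2 first.
  - exact: (measurableT_comp mW (@pair1_measurable _ _ (Ov v) _ w)).
  - by move=> x; exact: W0.
  apply: eq_integral => x _; rewrite /W /G ltrDl.
  have eE : (rate * expR (- rate * x))%:E * (expR (rate * x))%:E = rate%:E.
    by rewrite -EFinM -mulrA -expRD mulNr addNr expR0 mulr1.
  by rewrite [G0 _ _ * _]muleC [X in _ * X]muleA eE muleCA.
rewrite (@fubini_tonelli _ _ _ _ _ P (leb R) (fun p => W p.1 p.2))//.
have mWs s : measurable_fun (setT : set O) (W ^~ s).
  exact: (measurableT_comp mWO (pair2_measurable s)).
pose V w s := ind (ordered_word X w v /\ (last_time X w v < s)%R) *
  (Psi w s * expo v s w).
have V0 w s : 0 <= V w s by rewrite !mule_ge0.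
have mV : measurable_fun (setT : set (O * R)) (fun p => V p.1 p.2).
  have mm : measurable_fun (setT : set (O * R)) (fun p => (p.1 : Ov v, p.2)).
    apply/measurable_fun_pairP; split; last exact: measurable_snd.
    exact: (measurableT_comp (@known_id v) measurable_fst).
  suff h : measurable_fun (setT : set (Ov v * R)) (fun p => V p.1 p.2).
    exact: (measurableT_comp h mm).
  by apply: emeasurable_funM; [exact: measurable_ind|exact: emeasurable_funM].
have Vs s : \int[P]_w (ind (is_word X w true v s) * Psi w s) = \int[P]_w V w s.
  rewrite word_tail//.
  exact: (measurableT_comp mPsi (pair2_measurable s)).
apply: ge0_ae_eq_integral => //.
- exact: (measurable_fun_fubini_tonelli_G _ mWO).
- apply: emeasurable_funM.
    apply: measurable_ind; rewrite (_ : mkset _ = [set` `]0%R, t[])//.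
  apply: emeasurable_funM.
    apply/measurable_EFinP; apply: measurable_funM; first exact: measurable_cst.
    apply: measurableT_comp => //; apply: measurable_funM; first exact: measurable_cst.
    apply: measurable_funM; first exact: measurable_cst.
    by apply: measurable_funB => //; exact: measurable_cst.
  under eq_fun do rewrite Vs.
  exact: (measurable_fun_fubini_tonelli_G _ mV).
- by move=> s _; apply: integral_ge0.
- move=> s _; apply: mule_ge0 => //; apply: mule_ge0.
    by rewrite lee_fin mulr_ge0 ?expR_ge0 ?ltW.
  by apply: integral_ge0 => w _; rewrite mule_ge0.
apply: filterS (ae_neq t) => s st _; rewrite Vs.
rewrite -ge0_integralZl//; last 2 first.
- exact: (measurableT_comp mV (pair2_measurable s)).
- by rewrite lee_fin mulr_ge0 ?expR_ge0 ?ltW.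
rewrite -integral_ind_cst; apply: eq_integral => w _.
rewrite /W /G0 /V.
transitivity (ind ((0 < s < t)%R /\ (ordered_word X w v /\ (last_time X w v < s)%R)) *
  (rate%:E * (Psi w s * expo v t w))).
  rewrite (muleA (ind _)) -ind_and muleCA; congr (_ * _); apply: ind_iff.
  split=> [[h1 [[h2 h3] h4]]|[/andP[h1 h2] [h3 h4]]].
    split=> //; rewrite (le_lt_trans (last_time_ge0 h2) h3)/=.
    by move: h4; rewrite /prior; case: (b) => //; rewrite lt_neqAle st.
  split; first exact: le_lt_trans (past_time_le c h3) h4.
  by split=> //; rewrite /prior; case: (b) => //; exact: ltW.
rewrite ind_and -muleA; congr (_ * _); rewrite [RHS]muleCA.
apply: eq_indM => -[ow ls]; rewrite muleCA [RHS]muleCA; congr (_ * _).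
rewrite /expo -!EFinM -mulrA -expRD; congr (_ * expR _)%:E.
have e u : (\sum_c (u - past_time X w v c) = M%:R * u - \sum_c past_time X w v c)%R.
  by rewrite sumrB sumr_const mulr_natl.
by rewrite !e; move: (\sum_c _)%R (M%:R : R) => q m; ring.
Qed.

End word_law.

Lemma nneseries_single (R : realType) (f : nat -> \bar R) n0 :
  (forall n, 0 <= f n)%E -> (forall n, n != n0 -> f n = 0%E) ->
  (\sum_(0 <= n <oo) f n = f n0)%E.
Proof.
move=> f0 h; rewrite (nneseries_split 0 n0.+1)//.
rewrite add0n big_nat_recr//= big_nat big1 ?add0r; last first.
  by move=> i /andP[_ ik]; rewrite h// ltn_eqF.
by rewrite eseries0 ?addr0// => k kn _; rewrite h// gtn_eqF.
Qed.

Section all_words.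
Variable N : nat.

Fixpoint words n : seq (seq (pairs N)) :=
  if n is m.+1 then [seq c :: v | c <- enum {: pairs N}, v <- words m] else [:: [::]].

Lemma mem_words n v : (v \in words n) = (size v == n).
Proof.
elim: n v => [|n IH] [|c v] //=.
  by apply/negbTE/allpairsPdep => -[? [? []]].
rewrite eqSS -IH; apply/allpairsPdep/idP => [[c' [v' [_ h [_ ->]]]]//|h].
by exists c, v; rewrite mem_enum.
Qed.

Lemma uniq_words n : uniq (words n).
Proof.
elim: n => //= n IH; apply: allpairs_uniq => //; first exact: enum_uniq.
by move=> [c v] [c' v'] _ _ [-> ->].
Qed.

End all_words.

Lemma fin_measurable_cst d (T : measurableType d) (I : finType) (i : I) :
  fin_measurable (fun _ : T => i).
Proof. by move=> j; rewrite preimage_cst; case: ifP. Qed.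

Lemma ae_forall_count d (T : measurableType d) (R : realType)
    (m : {measure set T -> \bar R}) (I : countType) (Q : I -> T -> Prop) :
  (forall i, {ae m, forall x, Q i x}) -> {ae m, forall x, forall i, Q i x}.
Proof.
move=> h; have : {ae m, forall x, forall n, if unpickle n is Some i then Q i x else True}.
  apply: ae_foralln => n; case: (unpickle n) => [i|]; first exact: h.
  exact: aeW.
by apply: filterS => x hx i; have := hx (pickle i); rewrite pickleK.
Qed.

Lemma ae_probability1 d (T : measurableType d) (R : realType)
    (P : probability T R) (A : set T) : measurable A -> P A = 1%E ->
  {ae P, forall x, A x}.
Proof.
move=> mA PA; exists (~` A); split=> //; first exact: measurableC.
by rewrite probability_setC// PA subee.
Qed.

Section interacting.
Local Open Scope ereal_scope.
Variables (R : realType) (d N : nat) (Lambda : R).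
Local Notation E := 'rV[R]_d.
Local Notation X := (N.-tuple E).
Variable mu : R.-fker (E * E)%type ~> (E * E)%type.
Variable Pi : R.-pker E ~> Dinf R d.
Variable P0 : probability E R.
Context {dO : measure_display} {O : measurableType dO}.
Variable P : probability O R.
Variable o : observation R d N.
Hypotheses (Lambda_gt0 : (0 < Lambda)%R) (mu_le : forall v, mu v setT <= Lambda%:E).
Hypothesis obs_time_ge0 : forall l, (0 <= @obs_time _ _ _ o l)%R.

Definition seen_event (J : set R) (Z : 'I_N -> O -> @skorohod R d J) (t : R) : set O :=
  [set w | forall i l, (@obs_time _ _ _ o l < t)%R ->
       @obs_set _ _ _ o l i (Z i w (@obs_time _ _ _ o l))].

Definition seen_value b (J : set R) (Z : 'I_N -> O -> @skorohod R d J) (t : R)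
    (f : X -> \bar R) (w : O) : \bar R :=
  ind (seen_event Z t w) * f (evs b [tuple Z i w | i < N] t).

Lemma interacting_history (J : set R) (G : set (set O)) (tau : nat -> O -> \bar R)
    (I : nat -> O -> 'I_N * 'I_N) (Z : 'I_N -> O -> @skorohod R d J)
    (pts : O -> set (R * ('I_N * 'I_N))) :
  left_regular J -> (forall s t, (0 <= s)%R -> (s <= t)%R -> J t -> J s) ->
  G `<=` measurable ->
  {ae P, forall w, enumerates (tau ^~ w) (I ^~ w) (pts w) /\
                   forall m, tau m w < +oo -> J (fine (tau m w))} ->
  interacting_dynamics Lambda Pi mu P0 P G tau I Z ->
  [/\ forall m, meas_fun (tau m), forall m, fin_measurable (I m),
      forall i, meas_fun (Z i) &
      forall b n t (A : set O) (f : X -> \bar R), J t ->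
        <<s G `|` gen_by tau `|` gen_by_fin I >> A ->
        A `<=` [set w | (if b then tau n w < t%:E else tau n w <= t%:E) /\
            ~~ (if b then tau n.+1 w < t%:E else tau n.+1 w <= t%:E)] ->
        meas_fun f -> (forall z, 0 <= f z) ->
        \int[P]_w (ind (A w) * seen_value b Z t f w) =
        \int[P]_w (ind (A w) * history Lambda mu o Pi P0 b
          (fun k => fine (tau k.+1 w)) (I ^~ w) n t f)].
Proof.
move=> rJ Jdown GM ae [Y [acc [HK [Hp Hi Hf [Hd Ha Hpp]]]]].
have tau_ordered : {ae P, forall w, [/\ tau 0%N w = 0,
  forall m, tau m w <= tau m.+1 w,
  forall m, tau m w < +oo -> tau m w < tau m.+1 w
  & forall m, tau m w < +oo -> J (fine (tau m w))]}.
  by apply: filterS ae => w [[? ? ? _] ?].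
split; try by case: Hp.
move=> b n t A f Jt mA An mf f0.
exact: (dynamics_history Lambda_gt0 mu_le rJ Jdown GM obs_time_ge0 tau_ordered
  Hp Hi Hf Hd Ha Hpp Jt mA An mf f0).
Qed.

End interacting.

Section law_values.
Local Open Scope ereal_scope.
Variables (R : realType) (d N : nat).
Local Notation X := (N.-tuple 'rV[R]_d).
Context {dO : measure_display} {O : measurableType dO}.
Variable P : probability O R.
Variable o : observation R d N.
Variable Z : 'I_N -> O -> Dinf R d.
Hypothesis mZ : forall i, meas_fun (Z i).

Definition law_value b t f := \int[P]_w seen_value o b Z t f w.

Lemma measurable_seen_value dT (T : measurableType dT) b (g : T -> O) (t : T -> R)
    (f : T -> X -> \bar R) :
  meas_fun g -> meas_fun t ->
  meas_fun (fun p => f p.1 p.2) ->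
  meas_fun (fun x => seen_value o b Z (t x) (f x) (g x)).
Proof.
move=> mg mt mf; apply: emeasurable_funM.
  apply: measurable_ind; apply: measurable_forall_fin => i.
  apply: measurable_forall_fin => l; apply: measurable_imply.
    by apply: measurable_lt_fun => //; exact: measurable_cst.
  have h := measurableT_comp (@measurable_eval _ _ _ (@obs_time _ _ _ o l))
    (measurableT_comp (mZ i) mg).
  exact: (measurable_preim h (obs_measurable _ _)).
have m : meas_fun (fun x => (x, evs b [tuple Z i (g x) | i < N] (t x))).
  apply/measurable_fun_pairP; split; first exact: measurable_id.
  apply: measurable_evs => //; apply: measurable_fun_rectangle => i.
  rewrite (_ : (fun _ => _) = Z i \o g); first exact: measurableT_comp.
  by apply/funext => x; rewrite tnth_mktuple.
exact: (measurableT_comp mf m).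
Qed.

Lemma law_value_ge0 b t f : (forall z, 0 <= f z) -> 0 <= law_value b t f.
Proof. by move=> f0; apply: integral_ge0 => w _; rewrite mule_ge0. Qed.

Lemma law_value_le1 b t f : meas_fun f -> (forall z, 0 <= f z) ->
  (forall z, f z <= 1) -> law_value b t f <= 1.
Proof.
move=> mf f0 f1; rewrite -(@probability_setT _ _ _ P) -[leRHS]mul1e -integral_cst//.
apply: ge0_le_integral => //.
- by move=> w _; rewrite mule_ge0.
- apply: (@measurable_seen_value _ O b id (cst t) (fun=> f)) => //.
  exact: (measurableT_comp mf measurable_snd).
- move=> w _; rewrite -[leRHS]mule1; apply: lee_pmul => //; exact: ind_le1.
Qed.

Lemma measurable_law_value dT (T : measurableType dT) b (t : T -> R)
    (f : T -> X -> \bar R) :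
  meas_fun t -> meas_fun (fun p => f p.1 p.2) ->
  (forall x z, 0 <= f x z) ->
  meas_fun (fun x => law_value b (t x) (f x)).
Proof.
move=> mt mf f0.
pose K := kernel_reparam (probability_kernel_cst P) (@measurable_cst _ _ T _ setT tt).
have h : meas_fun (fun p : T * O => seen_value o b Z (t p.1) (f p.1) p.2).
  apply: (@measurable_seen_value _ (T * O)%type b snd (fun p => t p.1) (fun p => f p.1)).
  - exact: measurable_snd.
  - exact: (measurableT_comp mt measurable_fst).
  - have mm : measurable_fun (setT : set ((T * O) * X)) (fun q => (q.1.1, q.2)).
      apply/measurable_fun_pairP; split; last exact: measurable_snd.
      exact: (measurableT_comp measurable_fst measurable_fst).
    exact: (measurableT_comp mf mm).
apply: (@measurable_int_kernel _ _ _ T unit O R (probability_kernel_cst P) (fun=> tt)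
  (measurable_cst _) (fun x w => seen_value o b Z (t x) (f x) w) h).
by move=> x w; rewrite mule_ge0.
Qed.

End law_values.

(** * The forward expectation as a sum over words *)

Section forward.
Local Open Scope ereal_scope.
Variables (R : realType) (d N : nat) (Lambda : R).
Local Notation E := 'rV[R]_d.
Local Notation X := (N.-tuple E).
Variable mu : R.-fker (E * E)%type ~> (E * E)%type.
Variable Pi : R.-pker E ~> Dinf R d.
Variable P0 : probability E R.
Context {dO : measure_display} {O : measurableType dO}.
Variable P : probability O R.
Variable o : observation R d N.
Hypotheses (Lambda_gt0 : (0 < Lambda)%R) (mu_le : forall v, mu v setT <= Lambda%:E).
Hypothesis obs_time_ge0 : forall l, (0 <= @obs_time _ _ _ o l)%R.
Variables (rate : R) (rate0 : (0 < rate)%R) (W : pairs N * nat -> O -> R).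
Hypothesis HW : iid_exponential P rate W.
Variables (tau : nat -> O -> \bar R) (I : nat -> O -> 'I_N * 'I_N).
Hypothesis Hae : {ae P, forall w, enumerates (tau ^~ w) (I ^~ w)
   [set p | exists (c : pairs N) n, p = (arrival W c n w, val c)]}.
Variable Z : 'I_N -> O -> Dinf R d.
Hypothesis HZ : interacting_dynamics Lambda Pi mu P0 P (gen_by W) tau I Z.
Local Notation law := (exp_law rate0).
Local Notation law_value := (law_value P o Z).
Local Notation M := #|{: pairs N}|.
Local Notation leb := (leb R).

Let mW i : meas_fun (W i). Proof. by case: HW. Qed.

Local Notation Ov v := (sigma_of (known W (indices v))).

(** [history] computed from the clocks along a given word instead of from the enumeration: it is
    measurable with respect to the clocks read by the word, as [word_tail] and [word_step]
    require. *)
Fixpoint word_history b v t (f : X -> \bar R) (w : O) : \bar R :=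
  if v is c :: v' then word_history true v' (last_time W w v)
    (collide Lambda mu (val c) (flow o Pi b (last_time W w v) t f)) w
  else \int[power_measure P0 N]_z flow o Pi b 0 t f z.

Lemma history_word b v t f w (s : nat -> \bar R) (J : nat -> 'I_N * 'I_N) :
  matches W w s J v ->
  history Lambda mu o Pi P0 b (fun k => fine (s k.+1)) J (size v) t f =
  word_history b v t f w.
Proof.
by elim: v b t f => [//|c v IH] b t f /= [-> -> h]; exact: IH.
Qed.

Lemma word_history_ge0 b v t f w : (forall z, 0 <= f z) -> 0 <= word_history b v t f w.
Proof.
elim: v b t f => [|c v IH] b t f f0 /=.
  by apply: integral_ge0 => z _; exact: flow_ge0.
by apply: IH => z; apply: collide_ge0 => // x; exact: flow_ge0.
Qed.

Lemma measurable_word_history dT (T : measurableType dT) v : forall b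
    (g : T -> Ov v) (t : T -> R) (f : T -> X -> \bar R),
  meas_fun g -> meas_fun t ->
  meas_fun (fun p => f p.1 p.2) -> (forall x z, 0 <= f x z) ->
  meas_fun (fun x => word_history b v (t x) (f x) (g x)).
Proof.
elim: v => [|c v IH] b g t f mg mt mf f0 /=.
  apply: (@measurable_int_kernel _ _ _ T (N.-tuple unit) X R
    (power_kernel (probability_kernel_cst P0) N) (fun=> [tuple tt | i < N])
    (measurable_cst _) (fun x z => flow o Pi b 0 (t x) (f x) z)).
    exact: (@measurable_flow _ _ _ o Pi _ T b (cst 0%R) t f (measurable_cst _) mt mf f0).
  by move=> x z; exact: flow_ge0.
have ml : meas_fun (fun x => last_time W (g x) (c :: v)).
  have h := @measurable_last_time R N dO O W (c :: v).
  rewrite (_ : (fun x => _) = (last_time W)^~ (c :: v) \o g)//.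
  exact: measurableT_comp h mg.
apply: (IH true g (fun x => last_time W (g x) (c :: v))
  (fun x => collide Lambda mu (val c) (flow o Pi b (last_time W (g x) (c :: v)) (t x) (f x)))).
- exact: (measurableT_comp (@known_up _ _ _ _ W v c) mg).
- exact: ml.
- have mI : fin_measurable (fun _ : T => val c).
    exact: fin_measurable_cst.
  exact: (@measurable_collide_flow _ _ _ Lambda mu o Pi _ T b _ t (fun=> val c) f ml mt mI mf f0).
- by move=> x z; apply: collide_ge0 => // y; exact: flow_ge0.
Qed.

Lemma measurable_word_history1 v b t f : meas_fun f -> (forall z, 0 <= f z) ->
  measurable_fun (setT : set (Ov v)) (word_history b v t f).
Proof.
move=> mf f0; apply: (@measurable_word_history _ (Ov v) v b id (cst t) (fun=> f)) => //.
exact: (measurableT_comp mf measurable_snd).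
Qed.

Definition no_event b t f : \bar R :=
  \int[power_measure P0 N]_z flow o Pi b 0 t f z.

(** The contribution of the outcomes with exactly [n] interactions before [t]. *)
Let yn b t f n := \sum_(v <- words N n)
  \int[P]_w (ind (is_word W w b v t) * word_history b v t f w).

Lemma renewal_nil b t f : (0 < t)%R -> meas_fun f -> (forall z, 0 <= f z) ->
  yn b t f 0 = (expR (- rate * (M%:R * t)))%:E * no_event b t f.
Proof.
move=> t0 mf f0; rewrite /yn /= big_seq1 (word_tail rate0 HW); last 2 first.
- exact: measurable_word_history1.
- by move=> w; exact: word_history_ge0.
transitivity (\int[P]_w ((expR (- rate * (M%:R * t)))%:E * no_event b t f)).
  apply: eq_integral => w _; rewrite indT; last first.
    by split=> //; rewrite /prior; case: (b) => //=; exact: ltW.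
  rewrite mul1e muleC; congr ((expR (_ * _))%:E * _).
  under eq_bigr do rewrite /past_time big_ord0 subr0.
  by rewrite sumr_const mulr_natl.
rewrite [LHS](integral_cst _ measurableT) -[RHS]mule1; congr (_ * _).
exact: probability_setT.
Qed.

Lemma renewal_cons b t f n : meas_fun f -> (forall z, 0 <= f z) ->
  yn b t f n.+1 = \sum_(c : pairs N) \int[leb]_s (ind (0 < s < t)%R *
    ((rate * expR (- rate * (M%:R * (t - s))))%:E *
     yn true s (collide Lambda mu (val c) (flow o Pi b s t f)) n)).
Proof.
move=> mf f0; rewrite {1}/yn /= big_allpairs_dep big_enum; apply: eq_bigr => c _.
pose Psi v w s := word_history true v s (collide Lambda mu (val c) (flow o Pi b s t f)) w.
have Psi0 v w s : 0 <= Psi v w s.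
  by apply: word_history_ge0 => z; apply: collide_ge0 => // x; exact: flow_ge0.
have mPsi v : measurable_fun (setT : set (Ov v * R)) (fun p => Psi v p.1 p.2).
  apply: (@measurable_word_history _ (Ov v * R)%type v true fst snd
    (fun p => collide Lambda mu (val c) (flow o Pi b p.2 t f))).
  - exact: measurable_fst.
  - exact: measurable_snd.
  - have mI : fin_measurable (fun _ : Ov v * R => val c).
      exact: fin_measurable_cst.
    apply: (@measurable_collide_flow _ _ _ Lambda mu o Pi _ (Ov v * R)%type b
      snd (cst t) (fun=> val c) (fun=> f)) => //.
    exact: (measurableT_comp mf measurable_snd).
  - by move=> x z; apply: collide_ge0 => // y; exact: flow_ge0.
under eq_bigr => v _ do rewrite (word_step rate0 HW b c t (mPsi v) (Psi0 v)).
pose K s : \bar R := (rate * expR (- rate * (M%:R * (t - s))))%:E.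
have K0 s : 0 <= K s by rewrite lee_fin mulr_ge0 ?expR_ge0 ?ltW.
pose Q v s := \int[P]_w (ind (is_word W w true v s) * Psi v w s).
have Q0 v s : 0 <= Q v s by apply: integral_ge0 => w _; exact: mule_ge0.
have mQ v : meas_fun (Q v).
  have mi : measurable_fun (setT : set (O * R))
      (fun p => @ind R (is_word W p.1 true v p.2) * Psi v p.1 p.2).
    apply: emeasurable_funM.
      apply: measurable_ind; apply: measurable_is_word; last exact: measurable_snd.
      by move=> i; exact: (measurableT_comp (mW i) measurable_fst).
    have mm : measurable_fun (setT : set (O * R)) (fun p => (p.1 : Ov v, p.2)).
      apply/measurable_fun_pairP; split; last exact: measurable_snd.
      exact: (measurableT_comp (@known_id _ _ _ _ _ _ _ HW v) measurable_fst).
    exact: (measurableT_comp (mPsi v) mm).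
  by apply: (measurable_fun_fubini_tonelli_G _ mi) => p; exact: mule_ge0.
have mK : meas_fun (fun s : R => ind (0 < s < t)%R * K s).
  apply: emeasurable_funM.
    by apply: measurable_ind; rewrite (_ : mkset _ = [set` `]0%R, t[]).
  apply/measurable_EFinP; apply: measurable_funM; first exact: measurable_cst.
  apply: measurableT_comp => //; apply: measurable_funM; first exact: measurable_cst.
  apply: measurable_funM; first exact: measurable_cst.
  by apply: measurable_funB => //; exact: measurable_cst.
rewrite -ge0_integral_sum//.
- apply: eq_integral => s _.
  have -> : yn true s (collide Lambda mu (val c) (flow o Pi b s t f)) n =
    \sum_(v <- words N n) Q v s by [].
  rewrite -/(K s) ge0_sume_distrr; last by move=> v _; exact: Q0.
  rewrite ge0_sume_distrr// => v _.
  by apply: mule_ge0; [exact: K0|exact: Q0].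
- move=> v; under eq_fun do rewrite muleA.
  by apply: emeasurable_funM => //; exact: mQ.
- by move=> v s _; rewrite !mule_ge0//; [exact: K0|exact: Q0].
Qed.

Let positive : {ae P, forall w, forall i, (0 < W i w)%R}.
Proof.
apply: ae_forall_count => i.
have m0 : measurable [set x : R | (0 < x)%R].
  by apply: measurable_lt_fun => //; exact: measurable_cst.
apply: (@ae_probability1 _ _ _ P (W i @^-1` [set x | (0 < x)%R])).
  exact: measurable_preim.
have [_ -> // _] := HW.
by rewrite -(exp_lawE rate0)//; have [_ ->] := exp_law_tail rate0 0%R;
  rewrite maxxx mulr0 expR0.
Qed.

(** If all arrivals of [c] stayed below [t], so would all its waiting times. This has probability at
    most [r ^+ k] for every [k], where [r < 1] is the probability that one of them does. *)
Let unbounded t : {ae P, forall w, forall c, exists l, (t < arrival W c l w)%R}.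
Proof.
apply: ae_forall_count => c.
have mle : measurable [set x : R | (x <= t)%R].
  by apply: measurable_le_fun => //; exact: measurable_cst.
have mlt : measurable [set x : R | (t < x)%R].
  by apply: measurable_lt_fun => //; exact: measurable_cst.
pose r := fine (law [set x | (x <= t)%R]).
have rE : law [set x | (x <= t)%R] = r%:E.
  by rewrite /r fineK//; exact: (@fin_num_measure _ _ _ (exp_probability rate0)).
have r0 : (0 <= r)%R by rewrite fine_ge0.
have r1 : (r < 1)%R.
  rewrite -lte_fin -rE (_ : [set x | _] = ~` [set x | (t < x)%R]); last first.
    by apply/seteqP; split=> x /=; rewrite leNgt => /negP.
  have -> : law (~` [set x | (t < x)%R]) = 1 - law [set x | (t < x)%R].
    exact: (@probability_setC _ _ _ (exp_probability rate0)).
  have [_ ->] := exp_law_tail rate0 t.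
  by rewrite -EFinB lte_fin ltrBlDr ltrDl expR_gt0.
pose A := [set w | forall l, (W (c, l) w <= t)%R].
have mA : measurable A.
  by apply: measurable_forall_nat => l; exact: (measurable_preim (mW (c, l)) mle).
have Ak k : P A <= (r ^+ k)%:E.
  pose s := [seq (c, l) | l <- iota 0 k].
  have us : uniq s by rewrite map_inj_uniq ?iota_uniq// => l l' [].
  have [_ _ iW] := HW.
  apply: (@le_trans _ _ (P [set w | forall i, i \in s -> [set x | (x <= t)%R] (W i w)])).
    apply: le_measure; rewrite ?inE//.
      rewrite (_ : mkset _ = [set w | forall l, (l < k)%N -> (W (c, l) w <= t)%R]).
        apply: measurable_forall_nat => l; apply: measurable_cond => _.
        exact: (measurable_preim (mW (c, l)) mle).
      apply/seteqP; split=> w h.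
        by move=> l lk; apply: h; apply/mapP; exists l; rewrite // mem_iota.
      by move=> i /mapP[l]; rewrite mem_iota => /andP[_ lk] ->; exact: h.
    by move=> w Aw i /mapP[l _ ->]; exact: Aw.
  rewrite (iW s (fun=> [set x | (x <= t)%R]))//.
  rewrite (eq_bigr (fun=> r%:E)); last first.
    by move=> i _; have [_ -> // _] := HW; rewrite -(exp_lawE rate0).
  have -> : \prod_(i <- s) r%:E = (r ^+ size s)%:E.
    by elim: (s) => [|i s' IH]; rewrite ?big_nil ?big_cons// IH -EFinM exprS.
  by rewrite size_map size_iota.
have A0 : P A = 0.
  have pE : P A = (fine (P A))%:E by rewrite fineK// fin_num_measure.
  apply/eqP; rewrite eq_le measure_ge0 andbT pE lee_fin.
  have h1 : (fine (P A) @[k --> \oo] --> fine (P A))%R by exact: cvg_cst.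
  have h2 : (r ^+ k @[k --> \oo] --> (0 : R))%R.
    by apply: cvg_expr; rewrite ger0_norm.
  apply: (ler_cvg_to h1 h2); near=> k.
  by have := Ak k; rewrite pE lee_fin.
have nA : {ae P, forall w, ~ A w}.
  exists A; split=> // w /=; apply: contra_notP => h.
  exact: h.
apply: filterS2 positive nA => w pos /existsNP[l /negP]; rewrite -ltNge => h.
exists l; apply: (lt_le_trans h); rewrite /arrival big_ord_recr/= lerDr.
by apply: sumr_ge0 => k _; exact/ltW/pos.
Unshelve. all: by end_near. Qed.

Let GW : gen_by W `<=` measurable. Proof. exact: gen_by_sub. Qed.

Let Jdown (s t : R) : (0 <= s)%R -> (s <= t)%R ->
  [set` `[(0 : R), +oo[%R] t -> [set` `[(0 : R), +oo[%R] s.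
Proof. by move=> s0 _ _; rewrite /= in_itv/= s0. Qed.

Let Hae' : {ae P, forall w, enumerates (tau ^~ w) (I ^~ w)
   [set p | exists (c : pairs N) n, p = (arrival W c n w, val c)] /\
   forall m, tau m w < +oo -> [set` `[(0 : R), +oo[%R] (fine (tau m w))}.
Proof.
apply: filterS Hae => w h; split=> // m _.
by rewrite /= in_itv/= andbT fine_ge0// (enumerates_ge0 h).
Qed.

Let HZ' := interacting_history Lambda_gt0 mu_le obs_time_ge0
  (@left_regular_infinite R) Jdown GW Hae' HZ.

Let mZ i : meas_fun (Z i). Proof. by case: HZ'. Qed.

(** Almost surely exactly one [n] and one word fit, so the expectation splits over the words. On
    each of them the conditional expectation given the interactions replaces the positions by
    [history], which equals [word_history] there. *)
Lemma forward_series b t f : (0 < t)%R -> meas_fun f ->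
  (forall z, 0 <= f z) ->
  law_value b t f = \sum_(0 <= n <oo) yn b t f n.
Proof.
move=> t0 mf f0; have [mtau mI _ hist] := HZ'.
pose D n := [set w | (if b then tau n w < t%:E else tau n w <= t%:E) /\
   ~~ (if b then tau n.+1 w < t%:E else tau n.+1 w <= t%:E)].
pose gens := gen_by W `|` gen_by tau `|` gen_by_fin I.
pose O0 := sigma_of gens.
have gensM : gens `<=` measurable.
  by move=> A [[/GW//|]|]; [exact: gen_by_sub|exact: gen_by_fin_sub].
have id0 : meas_fun (id : O -> O0) by exact: measurable_id_sub.
have mtau0 n : measurable_fun (setT : set O0) (tau n).
  by apply: (@measurable_gen_by _ _ _ _ _ tau) => A h; left; right.
have mpre n : @measurable _ O0 [set w | if b then tau n w < t%:E else tau n w <= t%:E].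
  by case: (b); [apply: (@emeasurable_lt_fun _ _ O0)|apply: (@emeasurable_le_fun _ _ O0)];
    (exact: mtau0 || exact: measurable_cst).
have mD n : @measurable _ O0 (D n).
  apply: (@measurableI _ O0); first exact: mpre.
  rewrite (_ : (fun w => _) = ~` [set w | if b then tau n.+1 w < t%:E else tau n.+1 w <= t%:E]).
    exact: (@measurableC _ O0).
  by apply/seteqP; split=> w /negP.
have mw v : @measurable _ O0 [set w | is_word W w b v t].
  apply: (@measurable_is_word _ _ _ _ _ _ O0 id (cst t) b v) => // i.
  by apply: (@measurable_gen_by _ _ _ _ _ W) => A h; left; left.
pose A n v := D n `&` [set w | is_word W w b v t].
have mA n v : @measurable _ O0 (A n v) by exact: (@measurableI _ O0).
have mAO n v : measurable (A n v : set O) by exact: (measurable_preim id0 (mA n v)).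
pose F w := seen_value o b Z t f w.
have F0 w : 0 <= F w by rewrite mule_ge0.
have mF : meas_fun F.
  apply: (@measurable_seen_value _ _ _ _ _ o Z mZ _ O b id (cst t) (fun=> f)) => //.
  exact: (measurableT_comp mf measurable_snd).
have good : {ae P, forall w, [/\ exists n, D n w,
    forall n, D n w -> exists v, [/\ size v = n, matches W w (tau ^~ w) (I ^~ w) v &
       is_word W w b v t] &
    forall v v', is_word W w b v t -> is_word W w b v' t -> v = v']}.
  apply: filterS2 (positive) (filterI Hae (unbounded t)) => w pos [en ub].
  (* Two pairs never interact at the same time: each would be enumerated, and finite enumerated
     times are distinct. *)
  have inj c c' l l' : arrival W c l w = arrival W c' l' w -> c = c'.
    move=> e; have [m [/= m1 m2]] : exists m, tau m.+1 w = (arrival W c l w)%:E /\ I m w = val c.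
      by apply: (@enumerates_pt _ _ _ _ _ en (arrival W c l w, val c)); exists c, l.
    have [m' [/= m3 m4]] : exists m, tau m.+1 w = (arrival W c' l' w)%:E /\ I m w = val c'.
      by apply: (@enumerates_pt _ _ _ _ _ en (arrival W c' l' w, val c')); exists c', l'.
    have mm : m = m'.
      apply/eqP; rewrite eqn_leq; apply/andP; split; rewrite leqNgt; apply/negP => mm.
        have := enumerates_lt en (mm : (m'.+1 < m.+1)%N).
        by rewrite m1 m3 e ltxx => /(_ (ltry _)).
      have := enumerates_lt en (mm : (m.+1 < m'.+1)%N).
      by rewrite m1 m3 e ltxx => /(_ (ltry _)).
    have e1 : sval c = sval c' by rewrite -m2 mm m4.
    exact: val_inj e1.
  split.
  - have [|n h] := enumerates_stops pos en ub (b := b) (t := t).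
      by rewrite /prior; case: (b) => //; exact: ltW.
    by exists n.
  - by move=> n [h1 h2]; exact: (is_word_enumerates pos en).
  - by move=> v v'; exact: is_word_uniq.
transitivity (\int[P]_w \sum_(0 <= n <oo) \sum_(v <- words N n) (ind (A n v w) * F w)).
  apply: ge0_ae_eq_integral => //.
  - apply: ge0_emeasurable_sum => [n w _ _|n _].
      by apply: sume_ge0 => v _; rewrite mule_ge0.
    apply: emeasurable_sum => v; apply: emeasurable_funM => //.
    exact: (measurable_ind (mAO n v)).
  - by move=> w _; apply: nneseries_ge0 => n _ _; apply: sume_ge0 => v _; rewrite mule_ge0.
  - apply: filterS good => w [[n0 Dn0] h uniq] _.
    have [v0 [s0 m0 w0]] := h n0 Dn0.
    have nv n v : A n v w -> n = n0 /\ v = v0.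
      move=> [Dn iw]; have [v' [s' m' w']] := h n Dn.
      by rewrite -s' -s0 (uniq _ _ w' w0) (uniq _ _ iw w0).
    rewrite (@nneseries_single _ _ n0); first last.
    - move=> n nn0; rewrite big1// => v _; rewrite indF ?mul0e// => /nv[nE _].
      by rewrite nE eqxx in nn0.
    - by move=> n; apply: sume_ge0 => v _; rewrite mule_ge0.
    rewrite (bigD1_seq v0) ?uniq_words ?mem_words ?s0//=.
    rewrite indT ?mul1e; last by split.
    rewrite big1 ?adde0// => v vv0; rewrite indF ?mul0e// => /nv[_ vE].
    by rewrite vE eqxx in vv0.
rewrite integral_nneseries//; last 2 first.
- move=> n; apply: emeasurable_sum => v; apply: emeasurable_funM => //.
  exact: (measurable_ind (mAO n v)).
- by move=> n w _; apply: sume_ge0 => v _; rewrite mule_ge0.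
apply: eq_eseriesr => n _; rewrite /yn ge0_integral_sum//; last 2 first.
- by move=> v; apply: emeasurable_funM => //; exact: (measurable_ind (mAO n v)).
- by move=> v w _; rewrite mule_ge0.
rewrite [LHS]big_seq [RHS]big_seq; apply: eq_bigr => v; rewrite mem_words => /eqP sv.
rewrite (hist b n t (A n v) f)//; last 3 first.
- by rewrite /= in_itv/= ltW.
- exact: (mA n v).
- by move=> w [].
apply: ge0_ae_eq_integral => //.
- apply: emeasurable_funM; first exact: (measurable_ind (mAO n v)).
  apply: (@measurable_history _ _ _ _ _ Lambda_gt0 mu_le o Pi P0 _ O b
    (fun k w => fine (tau k.+1 w)) I n (cst t) (fun=> f)) => //.
    move=> k _; have hf : meas_fun (@fine R) by [].
    exact: (measurableT_comp hf (mtau k.+1)).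
  exact: (measurableT_comp mf measurable_snd).
- apply: emeasurable_funM.
    by apply: measurable_ind; exact: (measurable_preim id0 (mw v)).
  exact: (measurableT_comp (@measurable_word_history1 v b t f mf f0)
    (@known_id _ _ _ _ _ _ _ HW v)).
- by move=> w _; rewrite mule_ge0// history_ge0.
- by move=> w _; rewrite mule_ge0// word_history_ge0.
- apply: filterS good => w [[n0 Dn0] h uniq] _.
  rewrite (@ind_iff _ (A n v w) (is_word W w b v t)); last first.
    split=> [[]//|iw]; split=> //; have [v0 [s0 m0 w0]] := h n0 Dn0.
    by rewrite -sv (uniq _ _ iw w0) s0.
  apply: eq_indM => iw; have [v0 [s0 m0 w0]] := h n0 Dn0.
  rewrite -sv (uniq _ _ iw w0).
  exact: (@history_word b v0 t f w (tau ^~ w) (I ^~ w) m0).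
Qed.

Local Notation Kst t s := ((rate * expR (- rate * (M%:R * (t - s))))%:E : \bar R).

Let yn_ge0 b t f n : (forall z, 0 <= f z) -> 0 <= yn b t f n.
Proof.
move=> f0; apply: sume_ge0 => v _; apply: integral_ge0 => w _.
by rewrite mule_ge0// word_history_ge0.
Qed.

Lemma measurable_collide_flow_time (c : 'I_N * 'I_N) b t f :
  meas_fun f -> (forall z, 0 <= f z) ->
  measurable_fun (setT : set (R * X))
    (fun p => collide Lambda mu c (flow o Pi b p.1 t f) p.2).
Proof.
move=> mf f0; apply: (@measurable_collide_flow _ _ _ Lambda mu o Pi _ R b
  id (cst t) (fun=> c) (fun=> f)) => //.
- exact: fin_measurable_cst.
- exact: (measurableT_comp mf measurable_snd).
Qed.

(** The series starts with the empty word; removing the last letter [c], at time [s], from the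
    others leaves the whole series at [s] for the test function [collide] of the flow. *)
Lemma renewal b t f : (0 < t)%R -> meas_fun f -> (forall z, 0 <= f z) ->
  law_value b t f = (expR (- rate * (M%:R * t)))%:E * no_event b t f +
    \sum_(c : pairs N) \int[leb]_s (ind (0 < s < t)%R * (Kst t s *
       law_value true s (collide Lambda mu (val c) (flow o Pi b s t f)))).
Proof.
move=> t0 mf f0; rewrite forward_series// (nneseries_split 0 1); last first.
  by move=> k _; exact: yn_ge0.
rewrite add0n big_nat1 renewal_nil//; congr (_ + _).
have g0 c s z : 0 <= collide Lambda mu c (flow o Pi b s t f) z.
  by apply: collide_ge0 => // x; exact: flow_ge0.
have K0 s : 0 <= Kst t s by rewrite lee_fin mulr_ge0 ?expR_ge0 ?ltW.
pose h (c : pairs N) (n : nat) (s : R) : \bar R := ind (0 < s < t)%R * (Kst t s *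
  yn true s (collide Lambda mu (val c) (flow o Pi b s t f)) n).
have h0 (c : pairs N) n s : 0 <= h c n s.
  apply: mule_ge0 => //; apply: mule_ge0; first exact: K0.
  by apply: yn_ge0 => z; exact: g0.
have mK : meas_fun (fun s : R => ind (0 < s < t)%R * Kst t s).
  apply: emeasurable_funM.
    by apply: measurable_ind; rewrite (_ : mkset _ = [set` `]0%R, t[]).
  apply/measurable_EFinP; apply: measurable_funM; first exact: measurable_cst.
  apply: measurableT_comp => //; apply: measurable_funM; first exact: measurable_cst.
  apply: measurable_funM; first exact: measurable_cst.
  by apply: measurable_funB => //; exact: measurable_cst.
have mh (c : pairs N) n : meas_fun (h c n).
  rewrite /h; under eq_fun do rewrite muleA.
  apply: emeasurable_funM => //; apply: emeasurable_sum => v.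
  have mi : measurable_fun (setT : set (O * R))
      (fun p => @ind R (is_word W p.1 true v p.2) * word_history true v p.2
         (collide Lambda mu (val c) (flow o Pi b p.2 t f)) p.1).
    apply: emeasurable_funM.
      apply: measurable_ind; apply: measurable_is_word; last exact: measurable_snd.
      by move=> i; exact: (measurableT_comp (mW i) measurable_fst).
    apply: (@measurable_word_history _ (O * R)%type v true fst snd
      (fun p => collide Lambda mu (val c) (flow o Pi b p.2 t f))).
    - exact: (measurableT_comp (@known_id _ _ _ _ _ _ _ HW v) measurable_fst).
    - exact: measurable_snd.
    - have mm : measurable_fun (setT : set ((O * R) * X)) (fun q => (q.1.2, q.2)).
        apply/measurable_fun_pairP; split; last exact: measurable_snd.
        exact: (measurableT_comp measurable_snd measurable_fst).
      exact: (measurableT_comp (measurable_collide_flow_time (val c) b t mf f0) mm).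
    - by move=> x z; exact: g0.
  apply: (measurable_fun_fubini_tonelli_G _ mi) => p; rewrite mule_ge0//.
  by apply: word_history_ge0.
transitivity (\sum_(0 <= n <oo) \sum_(c : pairs N) \int[leb]_s h c n s).
  rewrite -(nneseries_addn 1); last by move=> k; exact: yn_ge0.
  by apply: eq_eseriesr => n _; rewrite addn1 renewal_cons.
rewrite nneseries_sum; last by move=> c n _; apply: integral_ge0 => s _; exact: h0.
apply: eq_bigr => c _; rewrite -integral_nneseries//.
apply: eq_integral => s _.
have [/andP[s0 st]|nst] := pselect (0 < s < t)%R; last first.
  rewrite indF// mul0e; apply: eseries0 => n _ _; by rewrite /h indF// mul0e.
rewrite indT; last by rewrite s0.
rewrite mul1e forward_series//; last first.
  have h1 := measurable_collide_flow_time (val c) b t mf f0.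
  exact: (measurableT_comp h1 (pair1_measurable s)).
rewrite -nneseriesZl; last by move=> n _; exact: yn_ge0.
by apply: eq_eseriesr => n _; rewrite /h indT ?mul1e// s0.
Qed.

End forward.

(** * Restriction to the influential particles *)

(** A rational number chosen between [x] and [x + e x] determines [x], because no other point of [A]
    lies in that interval. *)
Lemma right_isolated_countable (R : realType) (A : set R) :
  (forall x, A x -> exists2 e, 0 < e & forall y, A y -> ~~ (x < y < x + e)) ->
  countable A.
Proof.
move=> h.
have /choice[e he] : forall x, exists e : R, A x -> 0 < e /\
    forall y, A y -> ~~ (x < y < x + e).
  move=> x; have [Ax|nAx] := pselect (A x); last by exists 0.
  by have [e e0 he] := h x Ax; exists e.
have /choice[q hq] : forall x, exists q : rat, A x -> ratr q \in `]x, x + e x[.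
  move=> x; have [Ax|nAx] := pselect (A x); last by exists 0.
  by have [|q] := @rat_in_itvoo R x (x + e x); [rewrite ltrDl; case: (he x Ax)|exists q].
apply/countable_injP; exists (fun x => pickle (q x)) => x y; rewrite !inE => Ax Ay.
move=> /(pcan_inj pickleK) qxy.
wlog xy : x y Ax Ay qxy / x < y.
  by move=> H; case: (ltgtP x y) => // [|yx]; [exact: H|apply/esym/H].
have /negP[] := (he x Ax).2 y Ay; rewrite xy /=.
have := hq x Ax; have := hq y Ay; rewrite -qxy !in_itv/= => /andP[h1 _] /andP[_ h2].
exact: lt_trans h1 h2.
Qed.

(** * Almost every time is a continuity time *)

Section jumps.
Variables (R : realType) (d : nat).
Implicit Types w : Dinf R d.

Let jump_set w n i : set R :=
  [set t | 0 < t /\ n.+1%:R^-1 < `|w t ord0 i - left_lim w t ord0 i|].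

(** Right continuity at [s] isolates [s] from the large jumps that follow: at a jump time [u] close
    to [s], both the value and the left limit would be close to the value at [s]. *)
Let countable_jump_set w n i : countable (jump_set w n i).
Proof.
apply: right_isolated_countable => s [s0 _].
(* One third, for the three comparisons of the triangle inequality [tri]. *)
pose e : R := n.+1%:R^-1 / 3%:R.
have e0 : 0 < e by rewrite divr_gt0 ?invr_gt0.
have Js : [set` `[(0 : R), +oo[] s by rewrite /= in_itv/= ltW.
have [rc _] := @path_cadlag _ _ _ w s Js.
have rball : \forall u \near s, s < u -> 0 <= u -> `|w s ord0 i - w u ord0 i| < e.
  have h := rc _ (nbhsx_ballx (w s) e e0).
  have {}h : \forall u \near s, s < u -> u \in `[0, +oo[ -> ball (w s) e (w u) := h.
  apply: filterS h => u h su u0.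
  have uJ : u \in `[0, +oo[ by rewrite in_itv/= andbT.
  by case: (h su uJ) => _ /(_ ord0 i).
have [dl /= dl0 hdl] := rball.
exists dl => // u [u0 hu]; apply/negP => /andP[su usd]; move: hu; apply/negP.
have near_s v : s < v -> v <= u -> `|w s ord0 i - w v ord0 i| < e.
  move=> sv vu; apply: hdl => //; last by rewrite (ltW (lt_trans s0 sv)).
  by rewrite /ball/= distrC ger0_norm ?subr_ge0 ?ltW// ltrBlDl (le_lt_trans vu).
have lb := @left_limP _ _ _ w u (@left_regular_infinite R) _
  (nbhsx_ballx (left_lim w u) e e0).
have {}lb : \forall v \near u, v < u -> `|left_lim w u ord0 i - w v ord0 i| < e.
  have {}lb : \forall v \near u, v < u -> ball (left_lim w u) e (w v) := lb.
  apply: filterS lb => v h vu.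
  by case: (h vu) => _ /(_ ord0 i).
have [v [sv vu hv]] : exists v, [/\ s < v, v < u & `|left_lim w u ord0 i - w v ord0 i| < e].
  have [dl' /= dl'0 hdl'] := lb.
  (* A time between [s] and [u], close enough to [u] for the left limit at [u]. *)
  pose v := Num.max ((s + u) / 2%:R) (u - dl' / 2%:R).
  have vu : v < u.
    by rewrite /v gt_max midf_lt//= ltrBlDr ltrDl divr_gt0.
  exists v; split=> //.
    by rewrite /v lt_max midf_lt.
  apply: hdl' => //; rewrite /ball/= ger0_norm ?subr_ge0 ?(ltW vu)//.
  have h1 : u - dl' / 2%:R <= v by rewrite /v le_max lexx orbT.
  have h2 : dl' / 2%:R < dl' by rewrite ltr_pdivrMr// ltr_pMr// ltr1n.
  by lra.
have h1 := near_s u su (lexx _); have h2 := near_s v sv (ltW vu).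
rewrite -leNgt.
have tri : `|w u ord0 i - left_lim w u ord0 i| <=
    `|w s ord0 i - w u ord0 i| + `|w s ord0 i - w v ord0 i| +
    `|left_lim w u ord0 i - w v ord0 i|.
  rewrite (_ : w u ord0 i - left_lim w u ord0 i =
    - (w s ord0 i - w u ord0 i) + (w s ord0 i - w v ord0 i) -
    (left_lim w u ord0 i - w v ord0 i)); last by ring.
  apply: (le_trans (ler_normB _ _)); rewrite lerD2r.
  by apply: (le_trans (ler_normD _ _)); rewrite normrN.
apply: (le_trans tri).
have -> : n.+1%:R^-1 = e + e + e :> R by rewrite /e; field.
by rewrite ltW// !ltrD.
Qed.

Lemma ae_no_jump w : {ae leb R, forall t, 0 < t -> left_lim w t = w t}.
Proof.
have h : {ae leb R, forall t, forall ni : nat * 'I_d, ~ jump_set w ni.1 ni.2 t}.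
  apply: ae_forall_count => -[n i].
  pose A : set R := jump_set w n i.
  have cA : countable A := @countable_jump_set w n i.
  have mA : measurable A by exact: countable_measurable.
  exists A; split=> //; last by move=> x /= /contrapT.
  by rewrite lebE// countable_lebesgue_measure0.
apply: filterS h => t h t0; apply/esym/rowP => i; apply/eqP; rewrite -subr_eq0.
rewrite -normr_le0 leNgt; apply/negP => pos.
have [n hn] : exists n : nat, n.+1%:R^-1 < `|w t ord0 i - left_lim w t ord0 i|.
  have := @near_infty_natSinv_lt R (PosNum pos) => -[n _ /(_ n (leqnn n)) hn].
  by exists n.
by apply: (h (n, i)).
Qed.

End jumps.

Section left_values.
Local Open Scope ereal_scope.
Variables (R : realType) (d N : nat).
Local Notation X := (N.-tuple 'rV[R]_d).
Context {dO : measure_display} {O : measurableType dO}.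
Variable P : probability O R.
Variable o : observation R d N.
Variable Z : 'I_N -> O -> Dinf R d.
Hypothesis mZ : forall i, meas_fun (Z i).

(* the paths are almost surely continuous at almost every time *)
Lemma integral_law_value_left (t : R) (k : R -> \bar R) (f : R -> X -> \bar R) :
  meas_fun k -> (forall s, 0 <= k s) ->
  meas_fun (fun p => f p.1 p.2) -> (forall s z, 0 <= f s z) ->
  \int[leb R]_s (ind (0 < s < t)%R * (k s * law_value P o Z true s (f s))) =
  \int[leb R]_s (ind (0 < s < t)%R * (k s * law_value P o Z false s (f s))).
Proof.
move=> mk k0 mf f0.
pose g b (p : R * O) := ind (0 < p.1 < t)%R * (k p.1 * seen_value o b Z p.1 (f p.1) p.2).
have g0 b p : 0 <= g b p by rewrite !mule_ge0.
have ms b : meas_fun (fun p : R * O => seen_value o b Z p.1 (f p.1) p.2).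
  apply: (@measurable_seen_value _ _ _ _ _ o Z mZ _ (R * O)%type b snd fst
    (fun p => f p.1)) => //.
  have mm : measurable_fun (setT : set ((R * O) * X)) (fun q => (q.1.1, q.2)).
    apply/measurable_fun_pairP; split; last exact: measurable_snd.
    exact: (measurableT_comp measurable_fst measurable_fst).
  exact: (measurableT_comp mf mm).
have mg b : meas_fun (g b).
  apply: emeasurable_funM.
    apply: measurable_ind.
    exact: (measurable_preim (measurable_fst : measurable_fun (setT : set (R * O)) fst)
      (@measurable_itv _ `]0%R, t[)).
  by apply: emeasurable_funM => //; exact: (measurableT_comp mk measurable_fst).
have e b : \int[leb R]_s (ind (0 < s < t)%R * (k s * law_value P o Z b s (f s))) =
    \int[P]_w \int[leb R]_s g b (s, w).
  rewrite -(fubini_tonelli _ (mg b) (g0 b)); apply: eq_integral => s _.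
  rewrite /law_value muleA -ge0_integralZl//.
  - by apply: eq_integral => w _; rewrite -muleA.
  - exact: (measurableT_comp (ms b) (pair1_measurable s)).
  - by move=> w _; rewrite mule_ge0.
  - by rewrite mule_ge0.
rewrite !e; apply: eq_integral => w _; apply: ge0_ae_eq_integral => //.
- exact: (measurableT_comp (mg true) (pair2_measurable w)).
- exact: (measurableT_comp (mg false) (pair2_measurable w)).
have h : {ae leb R, forall s, forall i, (0 < s)%R -> left_lim (Z i w) s = Z i w s}.
  by apply: ae_forall_count => i; exact: ae_no_jump.
apply: filterS h => s h _; apply: eq_indM => /= /andP[s0 _]; congr (_ * (_ * f _ _)).
by apply: eq_from_tnth => i; rewrite !tnth_mktuple /ev h.
Qed.

End left_values.

(** * Elimination of the invisible interactions *)

Section renewal.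
Local Open Scope ereal_scope.
Variable R : realType.
Local Notation leb := (leb R).

Let K a (s t : R) : \bar R := (expR (- a * (t - s)))%:E.

(** After division by [expR (- a * (t - r))] this says that a clock of rate [k] started at [r]
    either has not rung by [t], or rings at some time [s] in between. *)
Lemma exp_weight (a k r t : R) : (0 < k)%R -> (r < t)%R ->
  K (a + k) r t + \int[leb]_s (ind (r < s < t)%R * (k%:E * (K a s t * K (a + k) r s))) =
  K a r t.
Proof.
move=> k0 rt.
have mI (u v : R) : measurable [set s : R | (u < s < v)%R].
  by rewrite (_ : mkset _ = [set` `]u, v[]).
have mk : meas_fun (fun s : R => (k * expR (- k * s))%:E).
  apply/measurable_EFinP; apply: measurable_funM; first exact: measurable_cst.
  apply: measurableT_comp => //; apply: measurable_funM => //; exact: measurable_cst.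
have k0' x : (0 <= k * expR x)%R by rewrite mulr_ge0 ?expR_ge0 ?ltW.
pose f s := ind (0 < s < t - r)%R * (k * expR (- k * s))%:E.
have f0 s : 0 <= f s by rewrite mule_ge0// lee_fin.
have mf : meas_fun f.
  by apply: emeasurable_funM => //; exact: measurable_ind.
have -> : \int[leb]_s (ind (r < s < t)%R * (k%:E * (K a s t * K (a + k) r s))) =
    K a r t * \int[leb]_s f s.
  rewrite -(integral_shift (- r) mf f0) -(@ge0_integralZl _ _ _ leb _ measurableT).
  - apply: eq_integral => s _; rewrite /f muleCA.
    rewrite (@ind_iff _ (r < s < t)%R (0 < - r + s < t - r)%R); last first.
      by rewrite [(- r + s)%R]addrC subr_gt0 ltrD2r.
    rewrite muleCA [RHS]muleCA; apply: eq_indM => _; rewrite /K -!EFinM; congr (_%:E).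
    rewrite [RHS]mulrCA -!expRD; congr (_ * expR _)%R; ring.
  - by apply: (measurableT_comp mf); apply: measurable_funD => //; exact: measurable_cst.
  - by move=> s _; exact: f0.
  - by rewrite lee_fin expR_ge0.
have fE : \int[leb]_s f s = exp_law k0 [set s | (0 < s)%R] - exp_law k0 [set s | (t - r <= s)%R].
  have m1 : measurable [set s : R | (0 < s)%R].
    by apply: measurable_lt_fun => //; exact: measurable_cst.
  have m2 : measurable [set s : R | (t - r <= s)%R].
    by apply: measurable_le_fun => //; exact: measurable_cst.
  have fin : exp_law k0 [set s | (t - r <= s)%R] \is a fin_num.
    exact: (@fin_num_measure _ _ _ (exp_probability k0)).
  have m3 : measurable [set s : R | (0 < s < t - r)%R] by exact: mI.
  have -> : [set s | (0 < s)%R] = [set s | (0 < s < t - r)%R] `|` [set s | (t - r <= s)%R].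
    apply/seteqP; split=> s /=.
      by move=> s0; have [h|h] := ltP s (t - r)%R; [left; rewrite s0|right].
    by case=> [/andP[]//|]; apply: lt_le_trans; rewrite subr_gt0.
  rewrite measureU//; last first.
    by apply/seteqP; split=> s //= [/andP[_ h1] h2]; move: h1; rewrite ltNge h2.
  rewrite addeK//.
  transitivity (\int[exp_law k0]_s ind (0 < s < t - r)%R); last exact: integral_ind.
  rewrite integral_exp_law//; last exact: measurable_ind.
  apply: eq_integral => s _; rewrite /f [in RHS]muleCA -ind_and [in RHS]muleC; congr (_ * _).
  by apply: ind_iff; split=> [/andP[? ?]|[? /andP[]]] //; rewrite ?andbT; do ?split => //; apply/andP.
rewrite fE; have [_ ->] := exp_law_tail k0 0%R; have [-> _] := exp_law_tail k0 (t - r)%R.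
rewrite maxxx mulr0 expR0 (max_idPl _); last by rewrite subr_ge0 ltW.
rewrite /K -EFinB -EFinM -EFinD; congr (_%:E).
have -> : expR (- (a + k) * (t - r)) = (expR (- a * (t - r)) * expR (- k * (t - r)))%R.
  by rewrite -expRD; congr expR; ring.
ring.
Qed.

Lemma measurable_exp_weight dT (T : measurableType dT) a (s t : T -> R) :
  meas_fun s -> meas_fun t ->
  meas_fun (fun x => K a (s x) (t x)).
Proof.
move=> ms mt; apply/measurable_EFinP; apply: measurableT_comp => //.
by apply: measurable_funM; [exact: measurable_cst|exact: measurable_funB].
Qed.

Let K0 a s t : 0 <= K a s t. Proof. by rewrite lee_fin expR_ge0. Qed.

(* The substitution of the equation for [h] into [\int k e^{- a (t - s)} h s ds]
   turns the rate [a + k] into the rate [a]. *)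
Lemma renewal_solve (a k t : R) (G h : R -> \bar R) (n hb : \bar R) :
  (0 <= k)%R -> (0 < t)%R -> meas_fun G -> (forall s, 0 <= G s) ->
  meas_fun h -> (forall s, 0 <= h s <= 1) -> 0 <= n ->
  (forall s, (0 < s < t)%R -> h s = K (a + k) 0 s * n +
     \int[leb]_r (ind (0 < r < s)%R * (K (a + k) r s * (G r + k%:E * h r)))) ->
  hb = K (a + k) 0 t * n +
     \int[leb]_r (ind (0 < r < t)%R * (K (a + k) r t * (G r + k%:E * h r))) ->
  hb = K a 0 t * n + \int[leb]_r (ind (0 < r < t)%R * (K a r t * G r)).
Proof.
move=> k0 t0 mG G0 mh h01 n0 eqh eqhb.
have [k_eq0|kn0] := eqVneq k 0%R.
  rewrite eqhb k_eq0 addr0; congr (_ + _); apply: eq_integral => r _.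
  by rewrite mul0e adde0.
have {kn0}kgt0 : (0 < k)%R by rewrite lt_neqAle eq_sym kn0.
have h0 s : 0 <= h s by case/andP: (h01 s).
pose c : R := (a + k)%R.
pose Q r := G r + k%:E * h r.
have kE0 : 0 <= k%:E by rewrite lee_fin.
have Q0 r : 0 <= Q r by rewrite adde_ge0// mule_ge0.
have mQ : meas_fun Q.
  by apply: emeasurable_funD => //; apply: emeasurable_funM => //; exact: measurable_cst.
have mi dT (T : measurableType dT) (u v w : T -> R) : meas_fun u ->
    meas_fun v -> meas_fun w ->
    meas_fun (fun x => @ind R (u x < v x < w x)%R).
  move=> mu mv mw; apply: measurable_ind.
  rewrite (_ : mkset _ = [set x | (u x < v x)%R] `&` [set x | (v x < w x)%R]).
    by apply: measurableI; exact: measurable_lt_fun.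
  by apply/seteqP; split=> x /= => [/andP[]|[-> ->]].
have mid : meas_fun (id : R -> R) by exact: measurable_id.
have mc (x : R) : measurable_fun (setT : set R) (cst x) by exact: measurable_cst.
pose A := \int[leb]_s (ind (0 < s < t)%R * (k%:E * (K a s t * h s))).
have A0 : 0 <= A.
  by apply: integral_ge0 => s _; rewrite !mule_ge0.
have mA : meas_fun (fun s : R => ind (0 < s < t)%R * (k%:E * (K a s t * h s))).
  apply: emeasurable_funM; first exact: mi.
  apply: emeasurable_funM; first exact: measurable_cst.
  by apply: emeasurable_funM => //; exact: measurable_exp_weight.
(* [A] will be added to both sides of the goal and cancelled, so it has to be finite. Since [h] is
   at most 1, the weight is bounded by [expR (|a| * t)] whatever the sign of [a]. *)
have Afin : A \is a fin_num.
  rewrite ge0_fin_numE//.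
  pose B : R := (k * expR (`|a| * t))%R.
  apply: (@le_lt_trans _ _ (\int[leb]_(s in `]0%R, t[) B%:E)).
    rewrite -[leRHS]integral_indM//; apply: ge0_le_integral => //.
    - by move=> s _; rewrite !mule_ge0.
    - apply: emeasurable_funM; last exact: measurable_cst.
      by apply: measurable_ind; exact: measurable_itv.
    - move=> s _; rewrite (@ind_iff _ (`]0%R, t[%classic s) (0 < s < t)%R); last first.
        by rewrite /= in_itv.
      apply: le_indM => /andP[s0 st].
      rewrite /B EFinM; apply: lee_pmul => //; first by rewrite mule_ge0.
      rewrite -[leRHS]mule1; apply: lee_pmul => //; last by case/andP: (h01 s).
      rewrite lee_fin ler_expR; apply: (@le_trans _ _ (`|a| * (t - s))%R).
        by apply: ler_wpM2r; rewrite ?subr_ge0 ?(ltW st)// -normrN ler_norm.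
      by rewrite ler_wpM2l// lerBlDr lerDl ltW.
  rewrite integral_cst// lebE lebesgue_measure_itv/= lte_fin t0 -EFinB -EFinM.
  exact: ltry.
(* The equation of [h] is inserted in [A] and the two integrals are exchanged. *)
have AE : A = \int[leb]_s (ind (0 < s < t)%R * (k%:E * (K a s t * K c 0 s))) * n +
    \int[leb]_r (ind (0 < r < t)%R *
      (\int[leb]_s (ind (r < s < t)%R * (k%:E * (K a s t * K c r s))) * Q r)).
  pose g (p : R * R) := ind (0 < p.1 < t)%R * (ind (0 < p.2 < p.1)%R *
    (k%:E * (K a p.1 t * (K c p.2 p.1 * Q p.2)))).
  have g0 p : 0 <= g p by rewrite !mule_ge0.
  have m1 : meas_fun (fst : R * R -> R) by exact: measurable_fst.
  have m2 : meas_fun (snd : R * R -> R) by exact: measurable_snd.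
  have mg : meas_fun g.
    apply: emeasurable_funM; first by apply: mi => //; exact: measurable_cst.
    apply: emeasurable_funM; first by apply: mi => //; exact: measurable_cst.
    apply: emeasurable_funM; first exact: measurable_cst.
    apply: emeasurable_funM; first by apply: measurable_exp_weight => //; exact: measurable_cst.
    apply: emeasurable_funM; first exact: measurable_exp_weight.
    exact: (measurableT_comp mQ m2).
  transitivity (\int[leb]_s (ind (0 < s < t)%R * (k%:E * (K a s t * K c 0 s)) * n) +
      \int[leb]_s \int[leb]_r g (s, r)).
    rewrite -ge0_integralD//; last 4 first.
    - by move=> s _; rewrite !mule_ge0.
    - apply: emeasurable_funM; last exact: measurable_cst.
      apply: emeasurable_funM; first exact: mi.
      apply: emeasurable_funM; first exact: measurable_cst.
      by apply: emeasurable_funM; exact: measurable_exp_weight.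
    - by move=> s _; apply: integral_ge0 => r _; exact: g0.
    - exact: (measurable_fun_fubini_tonelli_F _ mg).
    apply: eq_integral => s _.
    have [st|nst] := pselect (0 < s < t)%R; last first.
      rewrite indF// !mul0e add0e integral0_eq// => r _.
      by rewrite /g indF ?mul0e.
    rewrite /g/= indT// !mul1e; under eq_integral do rewrite mul1e.
    rewrite eqh// -/c ge0_muleDr//; last 2 first.
    - by rewrite mule_ge0.
    - by apply: integral_ge0 => r _; rewrite !mule_ge0// Q0.
    rewrite ge0_muleDr//; last 2 first.
    - by rewrite !mule_ge0.
    - by rewrite mule_ge0//; apply: integral_ge0 => r _; rewrite !mule_ge0// Q0.
    congr (_ + _); first by rewrite !muleA.
    have mq : meas_fun (fun r : R => ind (0 < r < s)%R * (K c r s * Q r)).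
      apply: emeasurable_funM; first exact: mi.
      by apply: emeasurable_funM => //; exact: measurable_exp_weight.
    rewrite muleA -ge0_integralZl//.
    - apply: eq_integral => r _; rewrite muleCA; congr (_ * _); by rewrite !muleA.
    - by move=> r _; do ![apply: mule_ge0 => //]; rewrite ?Q0 ?h0.
    - by rewrite mule_ge0.
  congr (_ + _).
    rewrite ge0_integralZr//.
    - apply: emeasurable_funM; first exact: mi.
      apply: emeasurable_funM; first exact: measurable_cst.
      by apply: emeasurable_funM; exact: measurable_exp_weight.
    - by move=> s _; rewrite !mule_ge0.
  rewrite (fubini_tonelli _ mg g0); apply: eq_integral => r _.
  have mk : meas_fun (fun s : R => ind (r < s < t)%R * (k%:E * (K a s t * K c r s))).
    apply: emeasurable_funM; first exact: mi.
    apply: emeasurable_funM; first exact: measurable_cst.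
    by apply: emeasurable_funM; exact: measurable_exp_weight.
  rewrite -ge0_integralZr//; last by move=> s _; rewrite !mule_ge0.
  rewrite -ge0_integralZl//; last 2 first.
  - by apply: emeasurable_funM => //; exact: measurable_cst.
  - by move=> s _; rewrite !mule_ge0.
  apply: eq_integral => s _; rewrite /g/=.
  transitivity (ind ((0 < s < t)%R /\ (0 < r < s)%R) *
    (k%:E * (K a s t * K c r s) * Q r)); first by rewrite ind_and !muleA.
  transitivity (ind ((0 < r < t)%R /\ (r < s < t)%R) *
    (k%:E * (K a s t * K c r s) * Q r)); last by rewrite ind_and !muleA.
  congr (_ * _); apply: ind_iff; split=> [[/andP[s0 st] /andP[r0 rs]]|[/andP[r0 rt] /andP[rs st]]].
    by rewrite r0 rs st (lt_trans rs st).
  by rewrite r0 rs st (lt_trans r0 rs).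
(* With [A] added to both sides, one copy is kept in the source term and the other is expanded by
   [AE]; [exp_weight] then turns the rate [a + k] into [a]. *)
apply: (addIe Afin); rewrite {1}AE eqhb -/c addeACA.
pose I r := \int[leb]_s (ind (r < s < t)%R * (k%:E * (K a s t * K c r s))).
have I0 r : 0 <= I r by apply: integral_ge0 => s _; rewrite !mule_ge0.
have mI : meas_fun I.
  pose g (p : R * R) := ind (p.1 < p.2 < t)%R * (k%:E * (K a p.2 t * K c p.1 p.2)).
  have m1 : meas_fun (fst : R * R -> R) by exact: measurable_fst.
  have m2 : meas_fun (snd : R * R -> R) by exact: measurable_snd.
  have mg : meas_fun g.
    apply: emeasurable_funM; first by apply: mi => //; exact: measurable_cst.
    apply: emeasurable_funM; first exact: measurable_cst.
    by apply: emeasurable_funM; apply: measurable_exp_weight => //; exact: measurable_cst.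
  apply: (measurable_fun_fubini_tonelli_F _ mg) => p; by rewrite !mule_ge0.
have mw (f : R -> \bar R) : meas_fun f ->
    meas_fun (fun r : R => ind (0 < r < t)%R * f r).
  by move=> mf; apply: emeasurable_funM => //; exact: mi.
rewrite -[RHS]addeA; congr (_ + _).
  rewrite -ge0_muleDl ?I0//; congr (_ * _); exact: exp_weight.
have mQK x : meas_fun (fun r : R => ind (0 < r < t)%R * (K x r t * Q r)).
  by apply: mw; apply: emeasurable_funM => //; exact: measurable_exp_weight.
have mGK : meas_fun (fun r : R => ind (0 < r < t)%R * (K a r t * G r)).
  by apply: mw; apply: emeasurable_funM => //; exact: measurable_exp_weight.
have mIQ : meas_fun (fun r : R => ind (0 < r < t)%R * (I r * Q r)).
  by apply: mw; exact: emeasurable_funM.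
have w0 r x y : 0 <= x -> 0 <= y -> 0 <= ind (0 < r < t)%R * (x * y).
  by move=> x0 y0; rewrite !mule_ge0.
rewrite -(ge0_integralD _ measurableT _ (mQK c) _ mIQ)//; last 2 first.
- by move=> r _; apply: w0.
- by move=> r _; apply: w0.
rewrite -(ge0_integralD _ measurableT _ mGK _ mA)//; last 2 first.
- by move=> r _; apply: w0.
- by move=> r _; apply: w0 => //; rewrite mule_ge0.
apply: eq_integral => r _.
have [/andP[r0 rt]|nr] := pselect (0 < r < t)%R; last by rewrite !indF// !mul0e.
rewrite !indT ?r0// !mul1e -/(Q r) -ge0_muleDl ?I0//.
rewrite (exp_weight a kgt0 rt) /Q ge0_muleDr//; last by rewrite mule_ge0.
by rewrite [k%:E * (_ * _)]muleCA.
Qed.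

End renewal.

Lemma emeasurable_sum_cond d (T : measurableType d) (R : realType) (I : finType)
    (Q : pred I) (F : I -> T -> \bar R) : (forall i, meas_fun (F i)) ->
  meas_fun (fun x => \sum_(i | Q i) F i x)%E.
Proof.
move=> mF; rewrite (_ : (fun _ => _) = (fun x => \sum_i if Q i then F i x else 0)%E).
  by apply: emeasurable_sum => i; case: (Q i) => //; exact: measurable_cst.
by apply/funext => x; rewrite big_mkcond.
Qed.

Section reflection.
Local Open Scope ereal_scope.
Variable R : realType.

Lemma integral_reflect (a : R) (f : R -> \bar R) : meas_fun f ->
  (forall x, 0 <= f x) -> \int[leb R]_x f (a - x)%R = \int[leb R]_x f x.
Proof.
move=> mf f0.
have ms : meas_fun (fun x : R => (a - x)%R).
  by apply: measurable_funB => //; exact: measurable_cst.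
rewrite -(@integral_image _ _ _ _ _ (leb R) _ ms)//.
apply: eq_measure_integral => A mA _; apply/esym.
rewrite lebE; have ms' : meas_fun ((fun x => (a - x)%R) :
  measurableTypeR R -> measurableTypeR R) := ms.
rewrite (@lebesgue_measure_unique _ (image_measure (@lebesgue_measure R) ms'))//.
move=> _ [[u v] /= _ <-].
rewrite /image_measure/= /pushforward.
rewrite (_ : _ @^-1` _ = `[(a - v)%R, (a - u)%R[%classic).
  rewrite ?lebE !lebesgue_measure_itv/= !lte_fin ltrD2l ltrN2; case: ifP => // _.
  by rewrite -!EFinB; congr (_%:E); ring.
by apply/seteqP; split=> x /=; rewrite !in_itv/= => /andP[h1 h2]; apply/andP; split; lra.
Qed.

End reflection.

Section unordered_pairs.
Variable N : nat.
Variable C : {set 'I_N}.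

Definition touches (p : 'I_N * 'I_N) := (p.1 \in C) || (p.2 \in C).

(* the weights of the ordered pairs in the backward draws; summed over both
   orders, every unordered pair meeting [C] has weight 1 *)
Definition pair_weight {R : realType} (p : 'I_N * 'I_N) : R :=
  ((p.1 \in C) && (p.2 \notin C))%:R +
  [&& p.1 \in C, p.2 \in C & p.1 != p.2]%:R / 2%:R.

Lemma pair_weight_ge0 (R : realType) p : 0 <= pair_weight p :> R.
Proof. by rewrite addr_ge0// divr_ge0. Qed.

Lemma sum_touching (R : realType) (y : 'I_N * 'I_N -> \bar R) :
  (forall p, 0 <= y p)%E -> (forall a b, a != b -> y (a, b) = y (b, a)) ->
  (\sum_(c : pairs N | touches (val c)) y (val c) =
   \sum_p (pair_weight p)%:E * y p)%E.
Proof.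
move=> y0 ysym.
pose lt (p : 'I_N * 'I_N) := (p.1 < p.2)%N.
transitivity (\sum_(p | lt p && touches p) y p)%E; first by rewrite big_sub_cond.
pose sw (p : 'I_N * 'I_N) := (p.2, p.1).
have swK : involutive sw by case.
rewrite [RHS](bigID lt)/=.
rewrite [X in _ = (_ + X)%E](_ : _ = \sum_(p | lt p) (pair_weight (sw p))%:E * y (sw p))%E.
  rewrite -big_split/=; rewrite [LHS]big_mkcondr/=; apply: eq_bigr => -[a b] ab.
  have nab : a != b by rewrite neq_ltn; apply/orP; left; exact: ab.
  rewrite /sw/= (ysym b a) 1?eq_sym// -ge0_muleDl ?lee_fin ?pair_weight_ge0//.
  rewrite /pair_weight/touches/= [b == a]eq_sym nab !andbT.
  case: (a \in C); case: (b \in C) => /=; rewrite ?mul0e ?addr0 ?mul0r ?add0r -?EFinD.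
  - by rewrite (_ : _ + _ = 1) ?mul1e//; field.
  - by rewrite ?addr0 ?add0r mul1e.
  - by rewrite ?addr0 ?add0r mul1e.
  - by rewrite ?addr0 ?add0r mul0e.
rewrite (reindex_inj (inv_inj swK))/= [LHS](bigID (fun p => p.1 == p.2))/= big1 ?add0e.
  apply: eq_bigl => -[a b]; rewrite /lt/sw/= -leqNgt.
  by rewrite [(a < b)%N]ltn_neqAle andbC.
move=> [a b] /andP[_ /eqP/= ->]; rewrite /pair_weight/= eqxx !andbF mul0r addr0.
by rewrite andbN mul0e.
Qed.

(** In units of [Lambda / (N-1)], this is the total speed of the two backward clocks: new particles,
    then loops. *)
Lemma sum_pair_weight (R : realType) :
  \sum_p pair_weight p = #|C|%:R * (N - #|C|)%:R + #|C|%:R * (#|C|%:R - 1) / 2%:R :> R.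
Proof.
have e (Q : pred ('I_N * 'I_N)) : \sum_p (Q p)%:R = #|Q|%:R :> R.
  by rewrite -natr_sum -sum1_card [in RHS]big_mkcond.
rewrite big_split/= -mulr_suml !e; congr (_ + _ / _).
  rewrite (eq_card (B := finset.setX C (~: C)%SET)); last first.
    by move=> [a b]; rewrite !inE.
  by rewrite cardsX natrM (cardsCs (~: C)%SET) finset.setCK card_ord.
have -> : #|[pred p : 'I_N * 'I_N | [&& p.1 \in C, p.2 \in C & p.1 != p.2]]| =
    (\sum_(a in C) #|(C :\ a)%SET|)%N.
  rewrite -sum1_card; under [RHS]eq_bigr do rewrite -sum1_card.
  rewrite pair_big_dep/=; apply: eq_bigl => -[a b]; rewrite !inE/=.
  by rewrite [b == a]eq_sym [(b \in C) && _]andbC.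
rewrite (eq_bigr (fun=> #|C|.-1)); last first.
  by move=> a aC; rewrite [in RHS](cardsD1 a) aC.
rewrite sum_nat_const natrM.
by case: #|C| => [|n]; rewrite ?mul0r// -[n.+1%:R]natr1 addrK.
Qed.

End unordered_pairs.

(** * The renewal equation restricted to the pairs that touch a set *)

Section restricted_renewal.
Local Open Scope ereal_scope.
Variables (R : realType) (d N : nat) (Lambda : R).
Local Notation E := 'rV[R]_d.
Local Notation X := (N.-tuple E).
Variable mu : R.-fker (E * E)%type ~> (E * E)%type.
Variable Pi : R.-pker E ~> Dinf R d.
Variable P0 : probability E R.
Context {dO : measure_display} {O : measurableType dO}.
Variable P : probability O R.
Variable o : observation R d N.
Hypotheses (Lambda_gt0 : (0 < Lambda)%R) (mu_le : forall v, mu v setT <= Lambda%:E).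
Hypothesis mu_sym : forall v w (A : set (E * E)), measurable A ->
  mu (v, w) A = mu (w, v) ((fun hk => (hk.2, hk.1)) @^-1` A).
Hypothesis markov_Pi : markov_process Pi.
Hypothesis obs_time_ge0 : forall l, (0 <= @obs_time _ _ _ o l)%R.
Variable Z : 'I_N -> O -> Dinf R d.
Hypothesis mZ : forall i, meas_fun (Z i).
Variables (rate : R) (rate_ge0 : (0 <= rate)%R).
Hypothesis renewal : forall b t f, (0 < t)%R -> meas_fun f ->
  (forall z, 0 <= f z) ->
  law_value P o Z b t f =
  (expR (- rate * (#|{: pairs N}|%:R * t)))%:E * no_event Pi P0 o b t f +
    \sum_(c : pairs N) \int[leb R]_s (ind (0 < s < t)%R *
       (((rate * expR (- rate * (#|{: pairs N}|%:R * (t - s))))%:E : \bar R) *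
       law_value P o Z true s (collide Lambda mu (val c) (flow o Pi b s t f)))).
Variable C : {set 'I_N}.
Hypothesis obs_in : forall l i, i \notin C -> @obs_set _ _ _ o l i = setT.

Local Notation Y := (law_value P o Z false).
Local Notation M := #|{: pairs N}|.
Let K a (s t : R) : \bar R := (expR (- a * (t - s)))%:E.
Let K0 a s t : 0 <= K a s t. Proof. by rewrite lee_fin expR_ge0. Qed.

Section one_function.
Variables (b : bool) (t : R) (f : X -> \bar R).
Hypotheses (mf : meas_fun f) (f0 : forall z, 0 <= f z).

Let col0 c s z : 0 <= collide Lambda mu c (flow o Pi b s t f) z.
Proof. by apply: collide_ge0 => // x; exact: flow_ge0. Qed.

Lemma measurable_law_value_collide b' c : meas_fun
  (fun s => law_value P o Z b' s (collide Lambda mu c (flow o Pi b s t f))).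
Proof.
apply: (@measurable_law_value _ _ _ _ _ P o Z mZ _ R b' id
  (fun s => collide Lambda mu c (flow o Pi b s t f))) => //.
exact: measurable_collide_flow_time.
Qed.

Lemma measurable_law_value_flow :
  meas_fun (fun s => Y s (flow o Pi b s t f)).
Proof.
apply: (@measurable_law_value _ _ _ _ _ P o Z mZ _ R false id
  (fun s => flow o Pi b s t f)) => //.
- apply: (@measurable_flow _ _ _ o Pi _ R b id (cst t) (fun=> f)) => //.
  exact: (measurableT_comp mf measurable_snd).
- by move=> s z; exact: flow_ge0.
Qed.

End one_function.

Definition touching : nat := #|[pred c : pairs N | touches C (val c)]|.

(** The pairs that do not touch [C] contribute the unknown itself, namely the value at [s] of the
    flow of [f] from [s] to [t]. Since flows compose, this function of [s] satisfies an equation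
    with the same source [G], and [renewal_solve] applies. *)
Lemma restricted_renewal b t f : (0 < t)%R -> meas_fun f ->
  (forall z, 0 <= f z) -> (forall z, f z <= 1) -> depends_on C f ->
  law_value P o Z b t f = K (rate * touching%:R) 0 t * no_event Pi P0 o b t f +
    \int[leb R]_s (ind (0 < s < t)%R * (K (rate * touching%:R) s t *
      \sum_(c : pairs N | touches C (val c)) rate%:E *
        Y s (collide Lambda mu (val c) (flow o Pi b s t f)))).
Proof.
move=> t0 mf f0 f_le1 fC.
pose a := (rate * touching%:R)%R.
pose k := (rate * #|[pred c : pairs N | ~~ touches C (val c)]|%:R)%R.
pose G f b t s := \sum_(c : pairs N | touches C (val c)) rate%:E *
        Y s (collide Lambda mu (val c) (flow o Pi b s t f)).
have akE : (a + k = rate * M%:R)%R.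
  rewrite /a/k -mulrDr -natrD; congr (_ * _%:R)%R.
  by rewrite /touching -[RHS](cardC [pred c : pairs N | touches C (val c)]).
have rate0 : 0 <= rate%:E by rewrite lee_fin.
have mk0 s u : meas_fun (fun r : R => K s r u).
  by apply: measurable_exp_weight => //; exact: measurable_cst.
(* The full equation, with the invisible pairs gathered in the term with factor [k], and with left
   values replaced by values: flows compose only at the latter. *)
have key b1 t1 h : (0 < t1)%R -> meas_fun h -> (forall z, 0 <= h z) ->
    depends_on C h ->
    law_value P o Z b1 t1 h = K (a + k) 0 t1 * no_event Pi P0 o b1 t1 h +
    \int[leb R]_r (ind (0 < r < t1)%R * (K (a + k) r t1 *
      (G h b1 t1 r + k%:E * Y r (flow o Pi b1 r t1 h)))).
  move=> t10 mh h0 fC1; rewrite renewal//; congr (_ * _ + _).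
    by rewrite /K akE subr0; congr (expR _)%:E; ring.
  have col0 c s z : 0 <= collide Lambda mu c (flow o Pi b1 s t1 h) z.
    by apply: collide_ge0 => // x; exact: flow_ge0.
  rewrite (eq_bigr (fun c : pairs N => \int[leb R]_s (ind (0 < s < t1)%R *
    (((rate * expR (- rate * (#|{: pairs N}|%:R * (t1 - s))))%:E : \bar R) *
     Y s (collide Lambda mu (val c) (flow o Pi b1 s t1 h)))))); last first.
    move=> c _; apply: (@integral_law_value_left _ _ _ _ _ P o Z mZ t1
      (fun s => (rate * expR (- rate * (#|{: pairs N}|%:R * (t1 - s))))%:E)) => //.
    - apply/measurable_EFinP; apply: measurable_funM; first exact: measurable_cst.
      apply: measurableT_comp => //; apply: measurable_funM; first exact: measurable_cst.
      apply: measurable_funM; first exact: measurable_cst.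
      by apply: measurable_funB => //; exact: measurable_cst.
    - by move=> s; rewrite lee_fin mulr_ge0 ?expR_ge0.
    - exact: measurable_collide_flow_time.
  have Y0 c s : 0 <= Y s (collide Lambda mu c (flow o Pi b1 s t1 h)).
    by apply: law_value_ge0 => z; exact: col0.
  rewrite -ge0_integral_sum//; last 2 first.
  - move=> c; rewrite (_ : (fun _ => _) = fun s => ind (0 < s < t1)%R *
      (rate%:E * (K (a + k) s t1 * Y s (collide Lambda mu (val c) (flow o Pi b1 s t1 h))))).
      apply: emeasurable_funM.
        by apply: measurable_ind; rewrite (_ : mkset _ = [set` `]0%R, t1[]).
      apply: emeasurable_funM; first exact: measurable_cst.
      by apply: emeasurable_funM => //; exact: measurable_law_value_collide.
    apply/funext => s; congr (_ * _); rewrite muleA -EFinM; congr ((rate * expR _)%:E * _).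
    by rewrite akE; ring.
  - by move=> c s _; rewrite !mule_ge0// lee_fin mulr_ge0 ?expR_ge0.
  apply: eq_integral => s _.
  rewrite -ge0_sume_distrr; last first.
    by move=> c _; rewrite !mule_ge0// lee_fin mulr_ge0 ?expR_ge0.
  congr (_ * _).
  transitivity (\sum_(c : pairs N) K (a + k) s t1 *
     (rate%:E * Y s (collide Lambda mu (val c) (flow o Pi b1 s t1 h)))).
    apply: eq_bigr => c _; rewrite [RHS]muleCA [RHS]muleA -EFinM.
    congr ((rate * expR _)%:E * _).
    by rewrite akE; ring.
  rewrite -ge0_sume_distrr; last by move=> c _; rewrite mule_ge0.
  congr (_ * _); rewrite (bigID (fun c : pairs N => touches C (val c)))/=; congr (_ + _).
  rewrite (eq_bigr (fun=> rate%:E * Y s (flow o Pi b1 s t1 h))); last first.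
    move=> c; rewrite negb_or => /andP[c1 c2]; congr (_ * Y s _); apply/funext => z.
    apply: (collide_outside Lambda_gt0 mu_le z c1 c2).
      by move=> x; exact: flow_ge0.
    exact: (@flow_dep _ _ _ o Pi C b1 s t1 h).
  rewrite -ge0_sume_distrl// sumEFin sumr_const -mulr_natr /k.
  by congr ((rate * _%:R)%:E * _).
have flow0 s z : 0 <= flow o Pi b s t f z by exact: flow_ge0.
have flow1 s z : flow o Pi b s t f z <= 1 by exact: flow_le1.
have mfl s : meas_fun (flow o Pi b s t f).
  by apply: (@measurable_flow1 _ _ _ o Pi).
have gg s r : (0 < r < s)%R -> (s < t)%R ->
    flow o Pi false r s (flow o Pi b s t f) = flow o Pi b r t f.
  move=> /andP[r0 rs] st; apply/funext => z.
  apply: flow_flow => //; first exact: ltW.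
  by case: (b) => //; exact: ltW.
have mG : meas_fun (G f b t).
  apply: emeasurable_sum_cond => c; apply: emeasurable_funM; first exact: measurable_cst.
  exact: measurable_law_value_collide.
apply: (@renewal_solve R a k t (G f b t) (fun s => Y s (flow o Pi b s t f))).
- by rewrite mulr_ge0.
- by [].
- exact: mG.
- move=> s; apply: sume_ge0 => c _; rewrite mule_ge0// law_value_ge0// => z.
  exact: collide_ge0.
- exact: measurable_law_value_flow.
- by move=> s; rewrite law_value_ge0//= law_value_le1.
- by apply: integral_ge0 => z _.
- move=> s /andP[s0 st]; rewrite (key false s _ s0 (mfl s) (flow0 s)); last first.
    exact: (@flow_dep _ _ _ o Pi C b s t f).
  have -> : no_event Pi P0 o false s (flow o Pi b s t f) = no_event Pi P0 o b t f.
    apply: eq_integral => z _; apply: flow_flow => //; first exact: ltW.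
    by case: (b) => //; exact: ltW.
  apply: (f_equal2 adde); first by [].
  apply: eq_integral => r _; apply: eq_indM => rs; rewrite (gg s r rs st).
  have -> // : G (flow o Pi b s t f) false s r = G f b t r.
  by apply: eq_bigr => c _; rewrite (gg s r rs st).
- exact: key.
Qed.

Definition total_weight : R := (#|C|%:R * (N - #|C|)%:R + #|C|%:R * (#|C|%:R - 1) / 2%:R)%R.

Lemma touchingE : touching%:R = total_weight.
Proof.
apply: EFin_inj; rewrite /total_weight -sum_pair_weight -sumEFin.
transitivity (\sum_(c : pairs N | touches C (val c)) (1%R : R)%:E).
  by rewrite sumEFin sumr_const.
rewrite (@sum_touching N C R (fun=> 1))//.
by apply: eq_bigr => p _; rewrite mule1.
Qed.

(** The same equation in the variables of the backward chain: the time elapsed from [t] downwards,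
    ordered pairs with their weights, and again left values, since the next step starts just before
    the interaction. *)
Lemma backward_renewal b t f : (0 < t)%R -> meas_fun f ->
  (forall z, 0 <= f z) -> (forall z, f z <= 1) -> depends_on C f ->
  law_value P o Z b t f =
    (expR (- (rate * total_weight) * t))%:E * no_event Pi P0 o b t f +
    \int[leb R]_s (ind (0 < s < t)%R * ((expR (- (rate * total_weight) * s))%:E *
      \sum_p (rate * pair_weight C p)%:E *
        law_value P o Z true (t - s) (collide Lambda mu p (flow o Pi b (t - s) t f)))).
Proof.
move=> t0 mf f0 f1 fC; rewrite (restricted_renewal b t0 mf f0 f1 fC) touchingE.
have L0 b' p s : 0 <= law_value P o Z b' s (collide Lambda mu p (flow o Pi b s t f)).
  by apply: law_value_ge0 => z; apply: collide_ge0 => // x; exact: flow_ge0.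
have rate0 : 0 <= rate%:E by rewrite lee_fin.
rewrite {1}/K subr0; apply: (f_equal2 adde); first by [].
have w0 p : 0 <= (rate * pair_weight C p)%:E :> \bar R.
  by rewrite lee_fin mulr_ge0// pair_weight_ge0.
pose S b' s := \sum_p (rate * pair_weight C p)%:E *
  law_value P o Z b' s (collide Lambda mu p (flow o Pi b s t f)).
have SE s : \sum_(c : pairs N | touches C (val c)) rate%:E *
    Y s (collide Lambda mu (val c) (flow o Pi b s t f)) = S false s.
  rewrite (@sum_touching N C R (fun p => rate%:E *
    Y s (collide Lambda mu p (flow o Pi b s t f)))).
  - by apply: eq_bigr => p _; rewrite muleA -EFinM mulrC.
  - by move=> p; rewrite mule_ge0.
  - move=> u v uv; congr (_ * Y s _); apply/funext => z; apply: collide_sym => //.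
      exact: measurable_flow1.
    by move=> x; exact: flow_ge0.
pose a := (rate * total_weight)%R.
have mKa : meas_fun (fun s : R => K a s t).
  by apply: measurable_exp_weight => //; exact: measurable_cst.
have mI : meas_fun (fun s : R => @ind R (0 < s < t)%R).
  by apply: measurable_ind; rewrite (_ : mkset _ = [set` `]0%R, t[]).
pose g s := ind (0 < s < t)%R * (K a s t * S true s).
have g0 s : 0 <= g s by rewrite !mule_ge0//; apply: sume_ge0 => p _; rewrite mule_ge0.
have mg : meas_fun g.
  apply: emeasurable_funM => //; apply: emeasurable_funM => //.
  apply: emeasurable_sum => p; apply: emeasurable_funM; first exact: measurable_cst.
  exact: measurable_law_value_collide.
have distr b' : \int[leb R]_s (ind (0 < s < t)%R * (K a s t * S b' s)) =
    \sum_p \int[leb R]_s (ind (0 < s < t)%R * ((K a s t * (rate * pair_weight C p)%:E) *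
      law_value P o Z b' s (collide Lambda mu p (flow o Pi b s t f)))).
  rewrite -ge0_integral_sum//.
  - apply: eq_integral => s _; rewrite -ge0_sume_distrr; last first.
      by move=> p _; rewrite !mule_ge0.
    congr (_ * _); rewrite ge0_sume_distrr; last by move=> p _; rewrite mule_ge0.
    by apply: eq_bigr => p _; rewrite muleA.
  - move=> p; apply: emeasurable_funM => //; apply: emeasurable_funM.
      by apply: emeasurable_funM => //; exact: measurable_cst.
    exact: measurable_law_value_collide.
  - by move=> p s _; rewrite !mule_ge0.
transitivity (\int[leb R]_s (ind (0 < s < t)%R * (K a s t * S false s))).
  by apply: eq_integral => s _; rewrite SE.
transitivity (\int[leb R]_s g s).
  apply: (eq_trans (distr false)); apply: (eq_trans _ (esym (distr true))).
  apply: eq_bigr => p _; apply/esym.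
  apply: (@integral_law_value_left _ _ _ _ _ P o Z mZ t
    (fun s => K a s t * (rate * pair_weight C p)%:E)) => //.
  - by apply: emeasurable_funM => //; exact: measurable_cst.
  - by move=> s; rewrite mule_ge0.
  - exact: measurable_collide_flow_time.
  - by move=> s z; apply: collide_ge0 => // x; exact: flow_ge0.
(* The variable becomes the time elapsed since [t]. *)
transitivity (\int[leb R]_s g (t - s)%R); first exact/esym/integral_reflect.
apply: eq_integral => s _.
rewrite /g /K (_ : t - (t - s) = s)%R; last by ring.
congr (_ * _); apply: ind_iff; split=> /andP[h1 h2]; apply/andP; split; lra.
Qed.

End restricted_renewal.

Section scaling.
Local Open Scope ereal_scope.
Variable R : realType.

Lemma integral_scale (a : R) (f : R -> \bar R) : (0 < a)%R -> meas_fun f ->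
  (forall x, 0 <= f x) -> \int[leb R]_x f x = \int[leb R]_x (a%:E * f (a * x)%R).
Proof.
move=> a0 mf f0; have a0' : (0 <= a)%R := ltW a0.
have ms : meas_fun (fun x : R => (a * x)%R).
  by apply: measurable_funM => //; exact: measurable_cst.
rewrite ge0_integralZl//; last exact: measurableT_comp mf ms.
rewrite -(@integral_image _ _ _ _ _ (leb R) _ ms)//.
rewrite -(@ge0_integral_mscale _ _ _ _ _ measurableT (NngNum a0'))//.
apply: eq_measure_integral => A mA _.
rewrite lebE; have ms' : meas_fun ((fun x => (a * x)%R) :
  measurableTypeR R -> measurableTypeR R) := ms.
rewrite (@lebesgue_measure_unique _
  (mscale (NngNum a0') (image_measure (@lebesgue_measure R) ms')))//.
move=> _ [[u v] /= _ <-].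
rewrite /mscale/= /image_measure/= /pushforward.
rewrite (_ : _ @^-1` _ = `](u / a)%R, (v / a)%R]%classic).
  rewrite ?lebE !lebesgue_measure_itv/= !lte_fin ltr_pM2r ?invr_gt0//; case: ifP => // _.
    by rewrite -!EFinB -EFinM; congr (_%:E); field; rewrite gt_eqF.
  by rewrite mule0.
by apply/seteqP; split=> x /=; rewrite !in_itv/= ltr_pdivrMr// ler_pdivlMr// ![(x * a)%R]mulrC.
Qed.

End scaling.

Section finite_trace.
Context d (O : measurableType d) (I : finType).

(** The sets with this property form a sigma-algebra that contains the generators. Once the value of
    [kappa] is fixed, the enlarged information reduces to [H]. *)
Lemma gen_fin_trace (H : set (set O)) (kappa : O -> I) (A : set O) :
  <<s H `|` preimage_set_system setT kappa setT >> A ->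
  forall i, exists2 A1, <<s H >> A1 &
    A `&` kappa @^-1` [set i] = A1 `&` kappa @^-1` [set i].
Proof.
pose M := [set A : set O | forall i, exists2 A1, <<s H >> A1 &
    A `&` kappa @^-1` [set i] = A1 `&` kappa @^-1` [set i]].
apply: (smallest_sub (X := M)).
  split=> [i|B MB i|F MF i].
  - by exists set0 => //; exact: (@measurable0 _ (sigma_of H)).
  - have [B1 h1 e1] := MB i; exists (~` B1).
      exact: (@measurableC _ (sigma_of H)).
    rewrite setTD; apply/seteqP; split=> w [nB ki]; split=> // b1; apply: nB.
      by have : (B1 `&` kappa @^-1` [set i]) w by []; rewrite -e1 => -[].
    by have : (B `&` kappa @^-1` [set i]) w by []; rewrite e1 => -[].
  - have /choice[F1 h1] : forall n, exists A1, <<s H >> A1 /\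
        F n `&` kappa @^-1` [set i] = A1 `&` kappa @^-1` [set i].
      by move=> n; have [A1 ? ?] := MF n i; exists A1.
    exists (\bigcup_n F1 n).
      by apply: (@bigcup_measurable _ (sigma_of H)) => n _; exact: (h1 n).1.
    by rewrite !setI_bigcupl; apply: eq_bigcupr => n _; exact: (h1 n).2.
move=> B [HB|[C _ <-]] i; first by exists B => //; exact: sub_sigma_algebra.
rewrite setTI; have [Ci|nCi] := pselect (C i).
  exists setT; first exact: (@measurableT _ (sigma_of H)).
  by apply/seteqP; split=> w [_ ki]; split=> //=; rewrite ki.
exists set0; first exact: (@measurable0 _ (sigma_of H)).
by rewrite set0I; apply/seteqP; split=> w //= [+ ki]; rewrite ki.
Qed.

End finite_trace.

(** * The backward chain *)

Lemma measurable_inv (R : realType) : meas_fun (fun x : R => x^-1).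
Proof.
apply: (measurability _ (RGenOInfty.measurableE R)) => //.
move=> _ [_ [y ->] <-]; rewrite setTI.
rewrite (_ : _ @^-1` _ = ([set x | 0 < x] `&` [set x | x * y < 1]) `|`
  (([set x | x < 0] `&` [set x | 1 < x * y]) `|` ([set 0] `&` [set x | y < 0]))).
  have mc (c : R) : meas_fun (cst c : R -> R) by exact: measurable_cst.
  have mi : meas_fun (id : R -> R) by exact: measurable_id.
  have my : meas_fun (fun x : R => x * y) by exact: measurable_funM.
  apply: measurableU; last apply: measurableU; apply: measurableI => //;
    exact: measurable_lt_fun.
apply/seteqP; split=> x /=; rewrite in_itv/= andbT.
  have [x0|x0|->] := ltgtP x 0.
  - by rewrite -[_^-1]mul1r ltr_ndivlMr// mulrC => h; right; left.
  - by rewrite -[_^-1]mul1r ltr_pdivlMr// mulrC => h; left.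
  - by rewrite invr0; right; right.
case=> [[x0 h]|[[x0 h]|[-> h]]]; last by rewrite invr0.
- by rewrite -[_^-1]mul1r ltr_pdivlMr// mulrC.
- by rewrite -[_^-1]mul1r ltr_ndivlMr// mulrC.
Qed.

Section race.
Local Open Scope ereal_scope.
Context dO (O : measurableType dO) (R : realType) (P : probability O R).
Variables (I : eqType) (X : I -> O -> R).
Hypothesis mX : forall i, meas_fun (X i).

(* two independent exponential clocks run at the speeds [a1] and [a2]; the clock
   [i1] rings first, at time [X i1 / a1], before [tau] *)
Lemma race b (i1 i2 : I) H D K (a1 a2 tau : O -> R) (g : O -> R -> \bar R) :
  H `<=` measurable -> <<s H >> D -> fresh P ltr01 X H D K -> K i1 -> K i2 -> i1 != i2 ->
  measurable_fun (setT : set (sigma_of H)) a1 ->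
  measurable_fun (setT : set (sigma_of H)) a2 ->
  measurable_fun (setT : set (sigma_of H)) tau ->
  (forall w, 0 <= a1 w)%R -> (forall w, 0 <= a2 w)%R ->
  measurable_fun (setT : set (sigma_of H * R)) (fun p => g p.1 p.2) ->
  (forall w s, 0 <= g w s) ->
  \int[P]_w (ind (D w) * (ind (X i1 w < tau w * a1 w)%R *
    (ind (if b then X i1 w / a1 w * a2 w <= X i2 w else X i1 w / a1 w * a2 w < X i2 w)%R *
     g w (X i1 w / a1 w)%R))) =
  \int[P]_w (ind (D w) * \int[leb R]_s (ind (0 < s < tau w)%R *
    ((a1 w * expR (- (a1 w + a2 w) * s))%:E * g w s))).
Proof.
move=> HM HD frH K1 K2 i12 ma1 ma2 mtau a10 a20 mg g0.
pose H' := learn X H i1; pose T := sigma_of H; pose T' := sigma_of H'.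
have HH' : H `<=` H' by move=> A; left.
have up : meas_fun (id : T' -> T) by exact: measurable_id_mono.
have mX1 : measurable_fun (setT : set T') (X i1) by exact: measurable_learn.
have mq dS (S : measurableType dS) (y : S -> R) (h : S -> T) :
    meas_fun y -> meas_fun h ->
    meas_fun (fun x => (y x / a1 (h x))%R).
  move=> my mh; apply: measurable_funM => //.
  exact: (measurableT_comp (@measurable_inv R) (measurableT_comp ma1 mh)).
have mphi dS (S : measurableType dS) (y : S -> R) (h : S -> T) :
    meas_fun y -> meas_fun h ->
    meas_fun (fun x => ind (y x < tau (h x) * a1 (h x))%R *
      g (h x) (y x / a1 (h x))%R).
  move=> my mh; apply: emeasurable_funM.
    apply: measurable_ind; apply: measurable_lt_fun => //.
    by apply: measurable_funM; [exact: measurableT_comp mtau mh|exact: measurableT_comp ma1 mh].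
  have m : meas_fun (fun x => (h x, (y x / a1 (h x))%R)).
    by apply/measurable_fun_pairP; split; [exact: mh|exact: mq].
  exact: (measurableT_comp mg m).
pose phi w := ind (X i1 w < tau w * a1 w)%R * g w (X i1 w / a1 w)%R.
pose u (i : I) w := (X i1 w / a1 w * a2 w)%R.
transitivity (\int[P]_w (ind (D w) * (phi w *
    \prod_(i <- [:: i2]) ind (if b then u i w <= X i w else u i w < X i w)%R))).
  apply: eq_integral => w _; rewrite big_seq1 /phi -!muleA; congr (_ * (_ * _)).
  by rewrite muleC.
rewrite (@fresh_tails _ _ _ _ _ _ ltr01 X mX b [:: i2] H' D [set k | K k /\ k != i1] u phi
  (learn_sub mX HM) (sub_sigma_algebra2 HH' HD) (fresh_learn mX HM HD frH K1)) //; last 4 first.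
- by move=> k; rewrite inE => /eqP ->; split; rewrite // eq_sym.
- move=> k; apply: measurable_funM; last exact: (measurableT_comp ma2 up).
  exact: (mq _ T' (X i1) id mX1 up).
- exact: (mphi _ T' (X i1) id mX1 up).
- by move=> w; rewrite mule_ge0.
pose g' w x := ind (x < tau w * a1 w)%R * g w (x / a1 w)%R *
  (expR (- 1 * Num.max (x / a1 w * a2 w)%R 0)%R)%:E.
transitivity (\int[P]_w (ind (D w) * g' w (X i1 w))).
  by apply: eq_integral => w _; rewrite big_seq1.
have mg' : measurable_fun (setT : set (T * R)) (fun p => g' p.1 p.2).
  apply: emeasurable_funM.
    exact: (mphi _ (T * R)%type snd fst measurable_snd measurable_fst).
  apply/measurable_EFinP; apply: measurableT_comp => //.
  apply: measurable_funM; first exact: measurable_cst.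
  apply: measurable_maxr => //; apply: measurable_funM.
    exact: (mq _ (T * R)%type snd fst measurable_snd measurable_fst).
  exact: (measurableT_comp ma2 (@measurable_fst _ _ T R)).
have g'0 w x : 0 <= g' w x by rewrite !mule_ge0// lee_fin expR_ge0.
rewrite (fresh_integral mX HM HD frH K1 mg' g'0).
apply: eq_integral => w _; congr (_ * _).
have mg'w : meas_fun (g' w).
  exact: (measurableT_comp mg' (@pair1_measurable _ _ T R w)).
have mexp (c : R) : meas_fun (fun x : R => (1 * expR (c * x))%:E).
  apply/measurable_EFinP; apply: measurable_funM; first exact: measurable_cst.
  apply: measurableT_comp => //; apply: measurable_funM => //; exact: measurable_cst.
rewrite integral_exp_law//.
(* A clock of speed 0 never rings: the event in [g'] is then empty for positive arguments, so the
   value given to a division by 0 has no effect. *)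
have [a1w|a1w] := eqVneq (a1 w) 0%R.
  rewrite !integral0_eq// => x _.
    by rewrite a1w mul0r mul0e mule0.
  have [x0|x0] := pselect (0 < x)%R; last by rewrite indF ?mul0e.
  rewrite /g' a1w mulr0 [ind (x < 0)%R]indF ?mul0e ?mule0//.
  by apply/negP; rewrite -leNgt ltW.
have a1p : (0 < a1 w)%R by rewrite lt_neqAle eq_sym a1w a10.
(* The variable becomes the time [s] at which the first clock rings. *)
rewrite (@integral_scale _ (a1 w))//; last 2 first.
- apply: emeasurable_funM; last by apply: emeasurable_funM => //; exact: mexp.
  by apply: measurable_ind; apply: measurable_lt_fun => //; exact: measurable_cst.
- by move=> x; rewrite !mule_ge0// lee_fin mul1r expR_ge0.
apply: eq_integral => s _; rewrite /g' (_ : a1 w * s / a1 w = s)%R; last first.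
  by rewrite mulrAC divff// mul1r.
rewrite (@ind_iff _ (0 < a1 w * s)%R (0 < s)%R); last by rewrite pmulr_rgt0.
rewrite (@ind_iff _ (a1 w * s < tau w * a1 w)%R (s < tau w)%R); last first.
  by rewrite mulrC ltr_pM2r.
rewrite (@ind_iff _ (0 < s < tau w)%R ((0 < s)%R /\ (s < tau w)%R)); last by split=> [/andP|[-> ->]].
rewrite ind_and; have [s0|s0] := pselect (0 < s)%R; last by rewrite (indF s0) !mul0e mule0.
rewrite (indT s0) !mul1e (max_idPl _); last by rewrite mulr_ge0// ltW.
move: (ind _) (g w s) => i G.
rewrite [i * G * _]muleC !muleA -!EFinM [_ * i]muleC -!muleA.
congr (_ * (_%:E * _)); rewrite mul1r -mulrA -expRD; congr (_ * expR _)%R; ring.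
Qed.

End race.

Section first_time.
Variables (R : realType) (T : R).

Lemma first_time_ge t rate u : (t <= first_time T t rate u)%E.
Proof. by apply/ereal_infP => _ [s [ts _ _] <-]. Qed.

(** The infimum is attained at the first [s] at which the threshold is met, provided it is at most
    [T]. If [rate] is 0, the threshold is met at once or never, and [u / 0 = 0] gives the right
    value in the first case. *)
Lemma first_timeE t rate u : 0 <= rate -> (0 <= t)%E ->
  first_time T t rate u =
  if (t <= T%:E)%E && ((u <= 0) || (u <= (T - fine t) * rate))
  then (fine t + Num.max (u / rate) 0)%:E else +oo%E.
Proof.
move=> rate0 t0; case: ifPn => [/andP[tT h]|h].
  have tE : t = (fine t)%:E.
    by rewrite fineK// ge0_fin_numE// (le_lt_trans tT)// ltry.
  have tT' : fine t <= T by rewrite -lee_fin -tE.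
  have feasible s : (t <= s%:E)%E /\ u <= (s - fine t) * rate <->
      fine t + Num.max (u / rate) 0 <= s.
    rewrite {1}tE lee_fin -lerBrDl ge_max subr_ge0.
    have [r0|rn0] := eqVneq rate 0.
      rewrite r0 invr0 mulr0 mulr0 subr_ge0; move: h; rewrite r0 mulr0 orbb => u0.
      by split=> [[-> _]|/andP[_ ->]].
    have rp : 0 < rate by rewrite lt_neqAle eq_sym rn0.
    by rewrite ler_pdivrMr//; split=> [[-> ->]|/andP[-> ->]].
  apply/eqP; rewrite eq_le; apply/andP; split.
    apply: ereal_inf_lbound; exists (fine t + Num.max (u / rate) 0) => //.
    have [h1 h2] := (feasible _).2 (lexx _); split=> //.
    apply/(feasible T).1; rewrite tE lee_fin; split=> //.
    by case/orP: h => // u0; apply: (le_trans u0); rewrite mulr_ge0// subr_ge0.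
  by apply/ereal_infP => _ [s [ts _ us] <-]; rewrite lee_fin; apply/feasible.
apply/eqP; rewrite eq_le leey /=; apply/ereal_infP => _ [s [ts sT us] <-].
have tT : (t <= T%:E)%E by apply: (le_trans ts); rewrite lee_fin.
move: h; rewrite tT /= negb_or -!ltNge => /andP[_]; rewrite ltNge => /negP[].
by apply: (le_trans us); apply: ler_wpM2r => //; rewrite lerB.
Qed.

Lemma measurable_first_time d (O : measurableType d) (t : O -> \bar R) (rate u : O -> R) :
  meas_fun t -> meas_fun rate -> meas_fun u ->
  (forall w, 0 <= rate w) -> (forall w, 0 <= t w)%E ->
  meas_fun (fun w => first_time T (t w) (rate w) (u w)).
Proof.
move=> mt mr mu_ r0 t0; under eq_fun do rewrite first_timeE//.
have mft : meas_fun (fun w => fine (t w)).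
  have hf : meas_fun (@fine R) by [].
  exact: (measurableT_comp hf mt).
have mc (c : R) : meas_fun (cst c : O -> R) by exact: measurable_cst.
apply: measurable_fun_ifT.
- apply: (measurable_fun_bool true).
  rewrite setTI (_ : _ @^-1` _ = [set w | (t w <= T%:E)%E] `&`
    ([set w | u w <= 0] `|` [set w | u w <= (T - fine (t w)) * rate w])).
    apply: measurableI; first by apply: emeasurable_le_fun => //; exact: measurable_cst.
    apply: measurableU; first exact: measurable_le_fun.
    apply: measurable_le_fun => //; apply: measurable_funM => //.
    exact: measurable_funB.
  by apply/seteqP; split=> w /=; [move=> /andP[-> /orP]|move=> [-> h]; apply/orP].
- apply/measurable_EFinP; apply: measurable_funD => //; apply: measurable_maxr => //.
  apply: measurable_funM => //; exact: (measurableT_comp (@measurable_inv R) mr).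
- exact: measurable_cst.
Qed.

End first_time.

Lemma measurable_prop d (T : measurableType d) (Q : Prop) : measurable [set _ : T | Q].
Proof.
have [h|h] := pselect Q.
  by rewrite (_ : mkset _ = setT)//; apply/seteqP; split.
by rewrite (_ : mkset _ = set0)//; apply/seteqP; split.
Qed.

(** * Comparison and measurability of the backward times *)

Section states.
Local Open Scope ereal_scope.
Variables (R : realType) (N q : nat) (Lambda T : R).
Hypotheses (Lambda_gt0 : (0 < Lambda)%R).
Local Notation rate := (Lambda / N.-1%:R)%R.

Let rate_ge0 : (0 <= rate)%R. Proof. by rewrite divr_ge0// ltW. Qed.

Lemma rate_newE K : rate_new N Lambda K = (rate * (K%:R * (N - K)%N%:R))%R.
Proof. by rewrite /rate_new; ring. Qed.

Lemma rate_oldE K : rate_old N Lambda K = (rate * (K%:R * (K%:R - 1) / 2%:R))%R.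
Proof. by rewrite /rate_old invfM; ring. Qed.

Lemma rate_new_ge0 K : (0 <= rate_new N Lambda K)%R.
Proof. by rewrite rate_newE mulr_ge0// mulr_ge0 ?ler0n. Qed.

Lemma rate_old_ge0 K : (0 <= rate_old N Lambda K)%R.
Proof.
rewrite rate_oldE mulr_ge0// divr_ge0//; case: K => [|K]; first by rewrite mul0r.
by rewrite mulr_ge0// subr_ge0 ler1n.
Qed.

Lemma rate_total (C : {set 'I_N}) :
  (rate_new N Lambda #|C| + rate_old N Lambda #|C| = rate * total_weight R C)%R.
Proof. by rewrite rate_newE rate_oldE /total_weight [RHS]mulrDr. Qed.

Section one.
Variables (u v : nat -> R) (r j : nat -> 'I_N).
Local Notation bstate := (bstate q Lambda T u v r j).
Local Notation btime := (btime q Lambda T u v r j).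
Local Notation btime_new := (btime_new q Lambda T u v r j).
Local Notation btime_old := (btime_old q Lambda T u v r j).
Local Notation bset := (bset q Lambda T u v r j).

Lemma btimeS k : btime k.+1 = Order.min (btime_new k) (btime_old k).
Proof. by rewrite /btime/= /btime_new /btime_old /bset; case: (bstate k). Qed.

Lemma bstateS k i : (bstate k.+1).2 i =
  if [&& btime_new k <= btime_old k, btime_new k < +oo & r k \in (bstate k).2 i]
  then (j k |: (bstate k).2 i)%SET else (bstate k).2 i.
Proof. by rewrite /= /btime_new /btime_old /bset; case: (bstate k). Qed.

Lemma btime_le k : btime k <= btime k.+1.
Proof. by rewrite btimeS le_min !first_time_ge. Qed.

Lemma btime_ge0 k : 0 <= btime k.
Proof. by elim: k => [//|k IH]; exact: le_trans IH (btime_le k). Qed.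

Lemma btime_mono k l : (k <= l)%N -> btime k <= btime l.
Proof.
elim: l => [|l IH]; first by rewrite leqn0 => /eqP ->.
by rewrite leq_eqVlt => /predU1P[->//|/IH kl]; exact: le_trans kl (btime_le l).
Qed.

Lemma bset0 : (q <= N)%N -> bset 0 = [set i : 'I_N | (i < q)%N]%SET.
Proof.
move=> qN; apply/setP => i; rewrite /bset /influence !inE.
apply/existsP/idP => [[a]|iq]; first by rewrite /= inE => /eqP /= ->.
by exists (Ordinal iq); rewrite inE.
Qed.

(** The order of the two candidate times and of [T] in terms of the clocks, in the form treated by
    [race]. A tie goes to the new particle, as in [bstate]: hence a large inequality on one side and
    a strict one on the other. *)
Lemma btime_race k (t := fine (btime k)) (a1 := rate_new N Lambda #|bset k|)
    (a2 := rate_old N Lambda #|bset k|) :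
  btime k < T%:E -> (0 < u k)%R -> (0 < v k)%R ->
  [/\ btime k.+1 < T%:E /\ btime_new k <= btime_old k <->
        (u k < (T - t) * a1)%R /\ (u k / a1 * a2 <= v k)%R,
      btime k.+1 < T%:E /\ ~ btime_new k <= btime_old k <->
        (v k < (T - t) * a2)%R /\ (v k / a2 * a1 < u k)%R,
      btime k.+1 < T%:E -> btime_new k <= btime_old k ->
        (fine (btime k.+1) - t = u k / a1)%R &
      btime k.+1 < T%:E -> ~ btime_new k <= btime_old k ->
        (fine (btime k.+1) - t = v k / a2)%R].
Proof.
move=> kT u0 v0.
have tE : btime k = t%:E.
  by rewrite fineK// ge0_fin_numE ?btime_ge0// (lt_trans kT)// ltry.
have tT : (t < T)%R by rewrite -lte_fin -tE.
have a10 : (0 <= a1)%R by exact: rate_new_ge0.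
have a20 : (0 <= a2)%R by exact: rate_old_ge0.
have ft a x : (0 <= a)%R -> (0 < x)%R -> first_time T (btime k) a x =
    if (x <= (T - t) * a)%R then (t + x / a)%:E else +oo.
  move=> ha hx; rewrite first_timeE ?btime_ge0// (ltW kT)/= leNgt hx/= -/t.
  by case: ifP => // _; rewrite (max_idPl _)// divr_ge0// ltW.
have e1 : btime_new k = if (u k <= (T - t) * a1)%R then (t + u k / a1)%:E else +oo.
  exact: ft.
have e2 : btime_old k = if (v k <= (T - t) * a2)%R then (t + v k / a2)%:E else +oo.
  exact: ft.
have pos a x : (0 <= a)%R -> (0 < x)%R -> (x <= (T - t) * a)%R -> (0 < a)%R.
  move=> ha hx; rewrite lt_neqAle ha andbT eq_sym; case: eqP => // ->.
  by rewrite mulr0 leNgt hx.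
have ltT a x : (0 < a)%R -> ((t + x / a)%:E < T%:E) = (x < (T - t) * a)%R.
  by move=> ha; rewrite lte_fin addrC -ltrBrDr ltr_pdivrMr.
have cmp a b x y : (0 < a)%R -> (0 < b)%R ->
    ((t + x / a)%:E <= (t + y / b)%:E) = (x / a * b <= y)%R.
  by move=> ha hb; rewrite lee_fin lerD2l ler_pdivlMr.
have far a b x y : (0 < a)%R -> (0 <= b)%R -> (x <= (T - t) * a)%R ->
    ~~ (y <= (T - t) * b)%R -> (x / a * b < y)%R.
  move=> ha hb hx; rewrite -ltNge; apply: le_lt_trans; rewrite ler_wpM2r//.
  by rewrite ler_pdivrMr.
rewrite btimeS e1 e2.
have [h1|h1] := boolP (u k <= (T - t) * a1)%R;
  have [h2|h2] := boolP (v k <= (T - t) * a2)%R.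
- have p1 := pos _ _ a10 u0 h1; have p2 := pos _ _ a20 v0 h2.
  have cmp' : ((t + u k / a1)%:E <= (t + v k / a2)%:E) = ~~ (v k / a2 * a1 < u k)%R.
    by rewrite lee_fin lerD2l ler_pdivrMr// leNgt.
  split.
  + rewrite (cmp _ _ _ _ p1 p2) -(ltT _ _ p1); split=> -[l1 l2]; split=> //.
      by move: l1; rewrite (min_idPl _)// cmp.
    by rewrite (min_idPl _)// cmp.
  + rewrite cmp' -(ltT _ _ p2); split=> -[l1 l2]; split=> //.
    * by move: l1; rewrite (min_idPr _)// ltW// ltNge cmp'; apply/negP.
    * by apply: contra_notT l2.
    * by rewrite (min_idPr _)// ltW// ltNge cmp' l2.
    * by rewrite l2.
  + by move=> _ l; rewrite (min_idPl l)/=; ring.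
  + by move=> _ /negP; rewrite -ltNge => /ltW l; rewrite (min_idPr l)/=; ring.
- have p1 := pos _ _ a10 u0 h1; have f := far _ _ _ _ p1 a20 h1 h2.
  rewrite (min_idPl (leey _)) leey; split.
  + by rewrite (ltT _ _ p1); split=> -[l1 l2]; split=> //; exact: ltW.
  + by split=> [[_ []//]|[/ltW l1]]; rewrite l1 in h2.
  + by move=> _ _ /=; ring.
  + by [].
- have p2 := pos _ _ a20 v0 h2; have f := far _ _ _ _ p2 a10 h2 h1.
  rewrite (min_idPr (leey _)) leye_eq; split.
  + by split=> -[] // /ltW l1; rewrite l1 in h1.
  + by rewrite (ltT _ _ p2); split=> -[l1 l2]; split.
  + by [].
  + by move=> _ _ /=; ring.
- rewrite minxx lexx; split=> //.
  + by split=> -[] // /ltW l1; rewrite l1 in h1.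
  + by split=> -[] // /ltW l1; rewrite l1 in h2.
Qed.

Lemma btime_next k (t := fine (btime k)) :
  btime k < T%:E -> (0 < u k)%R -> (0 < v k)%R ->
  (btime k.+1 < T%:E) = (u k < (T - t) * rate_new N Lambda #|bset k|)%R ||
    (v k < (T - t) * rate_old N Lambda #|bset k|)%R.
Proof.
move=> kT u0 v0.
have ft a x : (0 <= a)%R -> (0 < x)%R ->
    (first_time T (btime k) a x < T%:E) = (x < (T - t) * a)%R.
  move=> ha hx; rewrite first_timeE ?btime_ge0// (ltW kT)/= leNgt hx/= -/t.
  case: ifPn => [h|]; last by rewrite -ltNge => /ltW/le_gtF ->.
  have [a0|an0] := eqVneq a 0%R; first by move: h; rewrite a0 mulr0 leNgt hx.
  have ap : (0 < a)%R by rewrite lt_neqAle eq_sym an0.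
  rewrite (max_idPl _); last by rewrite divr_ge0// ltW.
  by rewrite lte_fin addrC -ltrBrDr ltr_pdivrMr.
by rewrite btimeS gt_min !ft ?rate_new_ge0 ?rate_old_ge0.
Qed.

End one.

Section measurability.
Context dS (S : measurableType dS) (u v : nat -> S -> R) (r j : nat -> S -> 'I_N) (n : nat).
Hypotheses (mu_ : forall k, (k < n)%N -> meas_fun (u k))
  (mv : forall k, (k < n)%N -> meas_fun (v k))
  (mr : forall k, (k < n)%N -> fin_measurable (r k))
  (mj : forall k, (k < n)%N -> fin_measurable (j k)).
Local Notation bstate_ k w := (bstate q Lambda T (u ^~ w) (v ^~ w) (r ^~ w) (j ^~ w) k).
Local Notation btime_ k w := (btime q Lambda T (u ^~ w) (v ^~ w) (r ^~ w) (j ^~ w) k).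
Local Notation bset_ k w := (bset q Lambda T (u ^~ w) (v ^~ w) (r ^~ w) (j ^~ w) k).
Local Notation btime_new_ k w := (btime_new q Lambda T (u ^~ w) (v ^~ w) (r ^~ w) (j ^~ w) k).
Local Notation btime_old_ k w := (btime_old q Lambda T (u ^~ w) (v ^~ w) (r ^~ w) (j ^~ w) k).

Lemma fin_measurable_influence (C : S -> 'I_q -> {set 'I_N}) :
  (forall i, fin_measurable (fun w => C w i)) ->
  fin_measurable (fun w => influence (C w)).
Proof.
move=> mC A; rewrite (_ : _ @^-1` _ =
  [set w | forall x, x \in A <-> exists i, x \in C w i]).
  apply: measurable_forall_fin => x.
  have m1 : measurable [set w | exists i, x \in C w i].
    apply: measurable_exists_fin => i.
    exact: (fin_measurable_preim (fun B : {set 'I_N} => x \in B : Prop) (mC i)).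
  have [xA|xA] := boolP (x \in A).
    by rewrite (_ : mkset _ = [set w | exists i, x \in C w i])//; apply/seteqP; split=> w /= => [[h _]|h]; [exact: h|split].
  rewrite (_ : mkset _ = ~` [set w | exists i, x \in C w i]); first exact: measurableC.
  by apply/seteqP; split=> w /=; [move=> h [i xi]; have : false by apply/h; exists i|move=> h; split].
apply/seteqP; split=> w /=.
  by move=> <- x; rewrite inE; split=> [/existsP|/existsP].
move=> h; apply/setP => x; rewrite inE; apply/existsP/idP => [|/h//]; exact: (h x).2.
Qed.

Lemma fin_measurable_fun (I : finType) (kappa : S -> I) (f : I -> R) :
  fin_measurable kappa -> meas_fun (fun w => f (kappa w)).
Proof.
move=> mk; apply: (@measurable_fin_case _ _ S R I kappa (fun i _ => f i)) => //.
Qed.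

Let both k : (k <= n)%N -> meas_fun (fun w => btime_ k w) /\
  forall i, fin_measurable (fun w => (bstate_ k w).2 i).
Proof.
elim: k => [_|k IH kn]; first by split=> [|i]; [exact: measurable_cst|exact: fin_measurable_cst].
have [mt mC] := IH (ltnW kn).
have mK := fin_measurable_influence mC.
have mn : meas_fun (fun w => btime_new_ k w).
  apply: measurable_first_time => //.
  - exact: (fin_measurable_fun (fun C : {set 'I_N} => rate_new N Lambda #|C|) mK).
  - exact: mu_.
  - by move=> w; exact: rate_new_ge0.
  - by move=> w; exact: btime_ge0.
have mo : meas_fun (fun w => btime_old_ k w).
  apply: measurable_first_time => //.
  - exact: (fin_measurable_fun (fun C : {set 'I_N} => rate_old N Lambda #|C|) mK).
  - exact: mv.
  - by move=> w; exact: rate_old_ge0.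
  - by move=> w; exact: btime_ge0.
split=> [|i].
  under eq_fun do rewrite btimeS.
  exact: measurable_mine.
have mD : measurable [set w | (btime_new_ k w <= btime_old_ k w) /\ (btime_new_ k w < +oo)].
  apply: measurableI; first exact: emeasurable_le_fun.
  by apply: emeasurable_lt_fun => //; exact: measurable_cst.
move=> A; rewrite (_ : _ @^-1` _ =
  ([set w | (btime_new_ k w <= btime_old_ k w) /\ (btime_new_ k w < +oo)] `&`
   [set w | forall a b B, r k w = a -> j k w = b -> (bstate_ k w).2 i = B ->
      (if a \in B then b |: B else B)%SET = A]) `|`
  (~` [set w | (btime_new_ k w <= btime_old_ k w) /\ (btime_new_ k w < +oo)] `&`
    [set w | (bstate_ k w).2 i = A])).
  apply: measurableU; apply: measurableI => //; last 2 first.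
  - exact: measurableC.
  - exact: mC.
  apply: measurable_forall_fin => a; apply: measurable_forall_fin => b.
  apply: measurable_forall_fin => B; apply: measurable_imply; first exact: mr.
  apply: measurable_imply; first exact: mj.
  by apply: measurable_imply; [exact: mC|exact: measurable_prop].
apply/seteqP; split=> w /=; rewrite bstateS.
  have [[h1 h2]|h] := pselect (btime_new_ k w <= btime_old_ k w /\ btime_new_ k w < +oo).
    by rewrite h1 h2 /= => e; left; split=> // a b B <- <- <-.
  case: ifP => [/and3P[h1 h2 _]|_ e]; first by case: h.
  by right.
case=> [[[-> ->] h]|[h e]]; first exact: (h _ _ _ erefl erefl erefl).
by case: ifP => [/and3P[h1 h2 _]|//]; case: h.
Qed.

Lemma measurable_btime k : (k <= n)%N -> meas_fun (fun w => btime_ k w).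
Proof. by move=> kn; case: (both kn). Qed.

Lemma fin_measurable_bset k : (k <= n)%N -> fin_measurable (fun w => bset_ k w).
Proof. by move=> kn; case: (both kn) => _; exact: fin_measurable_influence. Qed.

Lemma measurable_btime_new k : (k <= n)%N -> meas_fun (u k) ->
  meas_fun (fun w => btime_new_ k w).
Proof.
move=> kn muk; apply: measurable_first_time => //.
- exact: measurable_btime.
- exact: (fin_measurable_fun (fun C : {set 'I_N} => rate_new N Lambda #|C|)
    (fin_measurable_bset kn)).
- by move=> w; exact: rate_new_ge0.
- by move=> w; exact: btime_ge0.
Qed.

Lemma measurable_btime_old k : (k <= n)%N -> meas_fun (v k) ->
  meas_fun (fun w => btime_old_ k w).
Proof.
move=> kn mvk; apply: measurable_first_time => //.
- exact: measurable_btime.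
- exact: (fin_measurable_fun (fun C : {set 'I_N} => rate_old N Lambda #|C|)
    (fin_measurable_bset kn)).
- by move=> w; exact: rate_old_ge0.
- by move=> w; exact: btime_ge0.
Qed.

Lemma measurable_btimeS k : (k <= n)%N -> meas_fun (u k) ->
  meas_fun (v k) -> meas_fun (fun w => btime_ k.+1 w).
Proof.
move=> kn muk mvk; under eq_fun do rewrite btimeS.
by apply: measurable_mine; [exact: measurable_btime_new|exact: measurable_btime_old].
Qed.

End measurability.
End states.

Lemma iid_exponential_gt0 dO (O : measurableType dO) (R : realType) (P : probability O R)
    (I : countType) (rate : R) (X : I -> O -> R) : 0 < rate ->
  iid_exponential P rate X -> {ae P, forall w, forall i, 0 < X i w}.
Proof.
move=> rate0 [mX lawX _]; apply: ae_forall_count => i.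
have m0 : measurable [set x : R | 0 < x].
  by apply: measurable_lt_fun => //; exact: measurable_cst.
apply: (@ae_probability1 _ _ _ P (X i @^-1` [set x | 0 < x])).
  exact: measurable_preim.
rewrite lawX// -(exp_lawE rate0)//; have [_ ->] := exp_law_tail rate0 0.
by rewrite maxxx mulr0 expR0.
Qed.

Section fresh_event.
Local Open Scope ereal_scope.
Context dO (O : measurableType dO) (R : realType) (P : probability O R).
Variables (I : eqType) (rate : R) (rate0 : (0 < rate)%R) (X : I -> O -> R).
Hypothesis mX : forall i, meas_fun (X i).

Lemma fresh_event H D K (s : seq I) (B : I -> set R) (f : O -> \bar R) :
  H `<=` measurable -> <<s H >> D -> fresh P rate0 X H D K -> uniq s ->
  (forall i, i \in s -> K i) -> (forall i, measurable (B i)) ->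
  measurable_fun (setT : set (sigma_of H)) f -> (forall w, 0 <= f w) ->
  \int[P]_w (ind (D w /\ forall i, i \in s -> B i (X i w)) * f w) =
  \prod_(i <- s) exp_law rate0 (B i) * \int[P]_w (ind (D w) * f w).
Proof.
move=> HM HD frH us sK mB mf f0; set c := \prod_(i <- s) _.
have id0 : meas_fun (id : O -> sigma_of H).
  exact: measurable_id_sub HM.
have /andP[c0 c1] : 0 <= c <= 1.
  rewrite /c; elim: (s) => [|i s' /andP[h0 h1]]; first by rewrite big_nil lexx lee01.
  rewrite big_cons; apply/andP; split; first by rewrite mule_ge0.
  apply: (@le_trans _ _ (1 * 1)); last by rewrite mule1.
  apply: lee_pmul => //.
  exact: (@probability_le1 _ _ _ (exp_probability rate0)).
have cE : (fine c)%:E = c by rewrite fineK// ge0_fin_numE// (le_lt_trans c1)// ltry.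
have mE : measurable [set w | forall i, i \in s -> B i (X i w)].
  elim: (s) => [|i s' IH].
    by rewrite (_ : mkset _ = setT)//; apply/seteqP; split.
  rewrite (_ : mkset _ = X i @^-1` B i `&` [set w | forall i, i \in s' -> B i (X i w)]).
    by apply: measurableI => //; exact: measurable_preim (mX i) (mB i).
  apply/seteqP; split=> [w h|w [h1 h2] k]; last by rewrite inE => /predU1P[->//|]; exact: h2.
  by split=> [|k ks]; apply: h; rewrite inE ?eqxx// ks orbT.
have := @density _ _ O (sigma_of H) R P id id0 _ D mE HD (cst (fine c)).
move=> -> //; first last.
- move=> A mA AD; rewrite integral_indM; last exact: (measurable_preim id0 mA).
  have mAO : measurable (A : set O) by exact: (measurable_preim id0 mA).
  rewrite /= cE (integral_cst _ mAO).
  by rewrite (frH A s B mA AD us sK mB) muleC.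
- by move=> ?; rewrite /= -lee_fin cE.
- by move=> ?; rewrite /= fine_ge0.
rewrite -ge0_integralZl//.
- by apply: eq_integral => w _; rewrite /= cE muleCA.
- apply: emeasurable_funM; last exact: (measurableT_comp mf id0).
  by apply: measurable_ind; exact: (measurable_preim id0 HD).
- by move=> w _; rewrite mule_ge0.
Qed.

End fresh_event.

(** * The conditional law of the next backward event *)

Section chain.
Local Open Scope ereal_scope.
Context dO (O : measurableType dO) (R : realType) (P : probability O R).
Variables (N q : nat) (Lambda T : R).
Variables (U V : nat -> O -> R) (r j : nat -> O -> 'I_N).
Hypothesis Lambda_gt0 : (0 < Lambda)%R.
Local Notation X := (fun c : bool * nat => if c.1 then U c.2 else V c.2).
Hypothesis HX : iid_exponential P 1 X.
Hypotheses (mr : forall k, fin_measurable (r k)) (mj : forall k, fin_measurable (j k)).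
Hypothesis draws : uniform_draws q Lambda T P U V r j.
Local Notation btime_ k w := (btime q Lambda T (U ^~ w) (V ^~ w) (r ^~ w) (j ^~ w) k).
Local Notation bset_ k w := (bset q Lambda T (U ^~ w) (V ^~ w) (r ^~ w) (j ^~ w) k).
Local Notation btime_new_ k w := (btime_new q Lambda T (U ^~ w) (V ^~ w) (r ^~ w) (j ^~ w) k).
Local Notation btime_old_ k w := (btime_old q Lambda T (U ^~ w) (V ^~ w) (r ^~ w) (j ^~ w) k).
Local Notation rate := (Lambda / N.-1%:R)%R.

Let mX c : meas_fun (X c). Proof. by case: HX. Qed.
Let mU k : meas_fun (U k). Proof. exact: (mX (true, k)). Qed.
Let mV k : meas_fun (V k). Proof. exact: (mX (false, k)). Qed.

Definition hist k : set (set O) :=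
  gen_by (fun l : 'I_k => U l) `|` gen_by (fun l : 'I_k => V l) `|`
  gen_by_fin (fun l : 'I_k => r l) `|` gen_by_fin (fun l : 'I_k => j l).

(** The later clocks are included, as in [uniform_draws]: given the earlier draws, a draw then
    carries no information on the clocks yet to be read. *)
Definition clocks_hist k : set (set O) :=
  gen_by U `|` gen_by V `|` gen_by_fin (fun l : 'I_k => r l) `|`
  gen_by_fin (fun l : 'I_k => j l).

Lemma hist_sub k : hist k `<=` measurable.
Proof.
move=> A [[[]|]|]; first exact: gen_by_sub.
- exact: gen_by_sub.
- exact: gen_by_fin_sub.
- exact: gen_by_fin_sub.
Qed.

Lemma clocks_hist_sub k : clocks_hist k `<=` measurable.
Proof.
move=> A [[[]|]|]; first exact: gen_by_sub.
- exact: gen_by_sub.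
- exact: gen_by_fin_sub.
- exact: gen_by_fin_sub.
Qed.

(** Strictly before [T], although [first_time] admits [T]: an event at [T] would be an interaction
    at time 0, which [enumerates_alive] excludes. *)
Definition alive_at k : set O := [set w | btime_ k w < T%:E].
Definition branch_new k : set O :=
  [set w | btime_ k.+1 w < T%:E /\ btime_new_ k w <= btime_old_ k w].
Definition branch_old k : set O :=
  [set w | btime_ k.+1 w < T%:E /\ ~ btime_new_ k w <= btime_old_ k w].

Lemma aliveS k : alive_at k.+1 `<=` alive_at k.
Proof. by move=> w; apply: le_lt_trans; exact: btime_le. Qed.

Section on_history.
Variables (H : set (set O)) (k : nat).
Local Notation S := (sigma_of H).
Hypothesis histH : hist k `<=` H.

Let hU l : (l < k)%N -> measurable_fun (setT : set S) (U l).
Proof.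
move=> lk; apply: (@measurable_gen_by _ _ _ _ _ (fun l : 'I_k => U l) H (Ordinal lk)).
by move=> A h; apply: histH; do 3 left.
Qed.

Let hV l : (l < k)%N -> measurable_fun (setT : set S) (V l).
Proof.
move=> lk; apply: (@measurable_gen_by _ _ _ _ _ (fun l : 'I_k => V l) H (Ordinal lk)).
by move=> A h; apply: histH; do 2 left; right.
Qed.

Let hr l : (l < k)%N -> fin_measurable (r l : S -> 'I_N).
Proof.
move=> lk x; apply: sub_sigma_algebra; apply: histH; left; right.
by exists (Ordinal lk) => //; exists [set x] => //; rewrite setTI.
Qed.

Let hj l : (l < k)%N -> fin_measurable (j l : S -> 'I_N).
Proof.
move=> lk x; apply: sub_sigma_algebra; apply: histH; right.
by exists (Ordinal lk) => //; exists [set x] => //; rewrite setTI.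
Qed.

Lemma hist_btime : measurable_fun (setT : set S) (fun w => btime_ k w).
Proof. exact: (@measurable_btime R N q Lambda T Lambda_gt0 _ S U V r j k hU hV hr hj k). Qed.

Lemma hist_bset : fin_measurable ((fun w => bset_ k w) : S -> _).
Proof. exact: (@fin_measurable_bset R N q Lambda T Lambda_gt0 _ S U V r j k hU hV hr hj k). Qed.

Lemma hist_alive : @measurable _ S (alive_at k).
Proof.
by apply: (@emeasurable_lt_fun _ _ S); [exact: hist_btime|exact: measurable_cst].
Qed.

Section clocks.
Hypotheses (hUk : measurable_fun (setT : set S) (U k))
  (hVk : measurable_fun (setT : set S) (V k)).

Lemma hist_btimeS : measurable_fun (setT : set S) (fun w => btime_ k.+1 w).
Proof.
exact: (@measurable_btimeS R N q Lambda T Lambda_gt0 _ S U V r j k hU hV hr hj k).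
Qed.

Lemma hist_btime_old : measurable_fun (setT : set S) (fun w => btime_old_ k w).
Proof.
exact: (@measurable_btime_old R N q Lambda T Lambda_gt0 _ S U V r j k hU hV hr hj k).
Qed.

Lemma hist_new_le_old : @measurable _ S [set w | btime_new_ k w <= btime_old_ k w].
Proof.
apply: (@emeasurable_le_fun _ _ S).
  exact: (@measurable_btime_new R N q Lambda T Lambda_gt0 _ S U V r j k hU hV hr hj k).
exact: hist_btime_old.
Qed.

Let malive : @measurable _ S [set w | btime_ k.+1 w < T%:E].
Proof.
by apply: (@emeasurable_lt_fun _ _ S); [exact: hist_btimeS|exact: measurable_cst].
Qed.

Lemma hist_branch_new : @measurable _ S (branch_new k).
Proof. by apply: (@measurableI _ S); [exact: malive|exact: hist_new_le_old]. Qed.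

Lemma hist_branch_old : @measurable _ S (branch_old k).
Proof.
apply: (@measurableI _ S); first exact: malive.
exact: (@measurableC _ S _ hist_new_le_old).
Qed.

End clocks.
End on_history.

Definition weight_new (C : {set 'I_N}) (c : 'I_N * 'I_N) : R :=
  if (c.1 \in C) && (c.2 \notin C) then (#|C|%:R^-1 * (N - #|C|)%N%:R^-1)%R else 0%R.
Definition weight_old (C : {set 'I_N}) (c : 'I_N * 'I_N) : R :=
  if (c.1 \in C) && (c.2 \in (C :\ c.1)%SET) then (#|C|%:R^-1 * #|C|.-1%:R^-1)%R else 0%R.

Let inv01 (n : nat) : (0 <= (n%:R : R)^-1 <= 1)%R.
Proof.
rewrite invr_ge0 ler0n /=; case: n => [|n]; first by rewrite invr0.
by rewrite invf_le1 ?ltr0n// ler1n.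
Qed.

Lemma weight_new01 C c : (0 <= weight_new C c <= 1)%R.
Proof.
rewrite /weight_new; case: ifP => _; last by rewrite lexx ler01.
have /andP[a0 a1] := inv01 #|C|; have /andP[b0 b1] := inv01 (N - #|C|).
by rewrite mulr_ge0//= mulr_ile1.
Qed.

Lemma weight_old01 C c : (0 <= weight_old C c <= 1)%R.
Proof.
rewrite /weight_old; case: ifP => _; last by rewrite lexx ler01.
have /andP[a0 a1] := inv01 #|C|; have /andP[b0 b1] := inv01 #|C|.-1.
by rewrite mulr_ge0//= mulr_ile1.
Qed.

Definition drawn k w := (r k w, j k w).

Let mdrawn k c : measurable [set w | drawn k w = c].
Proof.
rewrite (_ : mkset _ = r k @^-1` [set c.1] `&` j k @^-1` [set c.2]).
  by apply: measurableI; [exact: mr|exact: mj].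
by apply/seteqP; split=> w /=; rewrite /drawn; [case: c => a b [-> ->]|case: c => a b /= [-> ->]].
Qed.

(* on [B], [wt] is the conditional law of the next draws given the clocks and the
   earlier draws *)
Definition draw_law k (B : set O) (wt : {set 'I_N} -> 'I_N * 'I_N -> R) : Prop :=
  forall (f : O -> \bar R) c,
    measurable_fun (setT : set (sigma_of (clocks_hist k))) f ->
    (forall w, 0 <= f w) ->
    \int[P]_w (ind (B w /\ drawn k w = c) * f w) =
    \int[P]_w (ind (B w) * ((wt (bset_ k w) c)%:E * f w)).

Let hist_clocks k : hist k `<=` clocks_hist k.
Proof.
move=> A [[[]|]|h]; last by right.
- by move=> [l _ h]; do 3 left; exists l.
- by move=> [l _ h]; do 2 left; right; exists l.
- by move=> h; left; right.
Qed.

Let cU k l : measurable_fun (setT : set (sigma_of (clocks_hist k))) (U l).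
Proof. by apply: (@measurable_gen_by _ _ _ _ _ U) => A h; do 3 left. Qed.

Let cV k l : measurable_fun (setT : set (sigma_of (clocks_hist k))) (V l).
Proof. by apply: (@measurable_gen_by _ _ _ _ _ V) => A h; do 2 left; right. Qed.

Let draw_law_of k B wt : @measurable _ (sigma_of (clocks_hist k)) B ->
  (forall C c, 0 <= wt C c <= 1)%R ->
  (forall c A, <<s clocks_hist k >> A -> A `<=` B ->
    P (A `&` [set w | r k w = c.1 /\ j k w = c.2]) =
    \int[P]_(w in A) (wt (bset_ k w) c)%:E) ->
  draw_law k B wt.
Proof.
move=> mB wt01 h f c mf f0; set S := sigma_of (clocks_hist k).
have id0 : meas_fun (id : O -> S) by exact: measurable_id_sub (@clocks_hist_sub k).
have mbs : fin_measurable ((fun w => bset_ k w) : S -> {set 'I_N}).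
  exact: (hist_bset (@hist_clocks k)).
apply: (@density _ _ O S R P id id0 [set w | drawn k w = c] B (mdrawn k c) mB
  (fun w => wt (bset_ k w) c)) => //.
- by move=> w; case/andP: (wt01 (bset_ k w) c).
- by move=> w; case/andP: (wt01 (bset_ k w) c).
- exact: (@fin_measurable_fun R _ S _ _ (fun C : {set 'I_N} => wt C c) mbs).
- move=> A mA AB; rewrite integral_indM; last exact: (measurable_preim id0 mA).
  rewrite -h//; congr (P (_ `&` _)); apply/seteqP; split=> w /=; rewrite /drawn.
    by move=> <-.
  by case: (c) => a b /= [-> ->].
Qed.

Lemma draw_new k : draw_law k (branch_new k) weight_new.
Proof.
have mB := @hist_branch_new (clocks_hist k) k (@hist_clocks k) (@cU k k) (@cV k k).
apply: (draw_law_of mB); first exact: weight_new01.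
move=> [a b] A mA AB; have [h _] := @draws k A a b mA; apply: h.
move=> w /AB [h1 h2]; split; first by rewrite (lt_trans h1) ?ltry.
by rewrite btimeS (min_idPl h2).
Qed.

Lemma draw_old k : draw_law k (branch_old k) weight_old.
Proof.
have mB := @hist_branch_old (clocks_hist k) k (@hist_clocks k) (@cU k k) (@cV k k).
apply: (draw_law_of mB); first exact: weight_old01.
move=> [a b] A mA AB; have [_ h] := @draws k A a b mA; apply: h.
move=> w /AB [h1 /negP]; rewrite -ltNge => /ltW h2; split; first by rewrite (lt_trans h1) ?ltry.
by rewrite btimeS (min_idPr h2).
Qed.

Let X_of H c : preimage_set_system setT (X c) measurable `<=` H ->
  measurable_fun (setT : set (sigma_of H)) (X c).
Proof. by move=> h _ B mB; apply: sub_sigma_algebra; apply: h; exists B. Qed.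

(** The information of the first [k] events and of the two clocks of the next round: it decides
    which clock rings and when, before the partners are drawn. *)
Definition raced k := learn X (learn X (hist k) (true, k)) (false, k).

Let hist_raced k : hist k `<=` raced k. Proof. by move=> A h; left; left. Qed.
Let rU k : measurable_fun (setT : set (sigma_of (raced k))) (U k).
Proof. by apply: (@X_of (raced k) (true, k)) => A h; left; right. Qed.
Let rV k : measurable_fun (setT : set (sigma_of (raced k))) (V k).
Proof. by apply: (@X_of (raced k) (false, k)) => A h; right. Qed.

Let raced_clocks k : raced k `<=` clocks_hist k.
Proof.
move=> A [[|]|]; first exact: hist_clocks.
- by move=> h; do 3 left; exists k.
- by move=> h; do 2 left; right; exists k.
Qed.

Let raced_sub k : raced k `<=` measurable.
Proof. by move=> A /raced_clocks; exact: clocks_hist_sub. Qed.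

Let hist_raced_drawn k :
  hist k.+1 `<=` raced k `|` preimage_set_system setT (drawn k) setT.
Proof.
have cases (l : 'I_k.+1) : (exists l' : 'I_k, l = l' :> nat) \/ l = k :> nat.
  have := ltn_ord l; rewrite ltnS leq_eqVlt => /predU1P[->|lk]; first by right.
  by left; exists (Ordinal lk).
move=> A [[[]|]|] [l _ [B mB <-]]; have [[l' ->]|->] := cases l.
- by left; apply: hist_raced; do 3 left; exists l' => //; exists B.
- by left; left; right; exists B.
- by left; apply: hist_raced; do 2 left; right; exists l' => //; exists B.
- by left; right; exists B.
- by left; apply: hist_raced; left; right; exists l' => //; exists B.
- by right; exists [set c | B c.1].
- by left; apply: hist_raced; right; exists l' => //; exists B.
- by right; exists [set c | B c.2].
Qed.

Let weight_measurable k (wt : {set 'I_N} -> 'I_N * 'I_N -> R) c H : hist k `<=` H ->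
  measurable_fun (setT : set (sigma_of H)) (fun w => (wt (bset_ k w) c)%:E).
Proof.
move=> h; apply/measurable_EFinP.
exact: (@fin_measurable_fun R _ (sigma_of H) _ _
  (fun C : {set 'I_N} => wt C c) (hist_bset h)).
Qed.

(** A round adds two clocks and two draws to the information. The clocks are absorbed by
    [fresh_learn]; the draws are removed by their conditional law given all the clocks, which
    depends on the past only. This law is prescribed only when an event takes place, hence the
    restriction to [alive_at k]. *)
Lemma fresh_hist k : fresh P ltr01 X (hist k) (alive_at k) [set c | (k <= c.2)%N].
Proof.
elim: k => [|k IH].
  move=> A s B mA _ us _ mB; have [_ lawX iX] := HX.
  have XB c : exp_law ltr01 (B c) = P (X c @^-1` B c) by rewrite lawX// exp_lawE.
  under eq_bigr do rewrite XB.
  have : A = set0 \/ A = setT.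
    apply: (smallest_sub (X := [set A | A = set0 \/ A = setT]) _ _ mA).
      split=> [|C [->|->]|F h].
      - by left.
      - by right; rewrite setD0.
      - by left; rewrite setDv.
      - have [[n Fn]|F0] := pselect (exists n, F n = setT).
          by right; apply/seteqP; split=> // w _; exists n => //; rewrite Fn.
        left; apply/seteqP; split=> // w [n _]; have [->//|e] := h n.
        by case: F0; exists n.
    by move=> C [[[]|]|] [[]].
  case=> ->; first by rewrite set0I measure0 mul0e.
  by rewrite setTI probability_setT mul1e iX.
move=> A s B mA Ak us sK mB.
set E := [set w | forall i, i \in s -> B i (X i w)]; set c := \prod_(i <- s) _.
have Hm := @hist_sub k; have Ha := hist_alive (@subset_refl _ (hist k)).
have fr1 := fresh_learn mX Hm Ha IH (leqnn k : [set c | (k <= c.2)%N] (true, k)).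
have Ha1 : <<s learn X (hist k) (true, k) >> (alive_at k).
  by apply: (sub_sigma_algebra2 _ Ha) => C; left.
have fr2 := fresh_learn mX (learn_sub mX Hm) Ha1 fr1
  (conj (leqnn k) isT : ([set k0 | [set c | (k <= c.2)%N] k0 /\ k0 != (true, k)]) (false, k)).
have Ha2 : <<s raced k >> (alive_at k) by apply: (sub_sigma_algebra2 _ Ha1) => C; left.
have id2 : meas_fun (id : O -> sigma_of (raced k)).
  exact: measurable_id_sub (@raced_sub k).
have upc : meas_fun
    (id : sigma_of (clocks_hist k) -> sigma_of (raced k)).
  exact: measurable_id_mono (@raced_clocks k).
have mAO : measurable (A : set O).
  exact: (measurable_preim (measurable_id_sub (@hist_sub k.+1)) mA).
have mEc : @measurable _ (sigma_of (clocks_hist k)) E.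
  rewrite /E; elim: (s) => [|i s' IHs].
    rewrite (_ : mkset _ = setT); first exact: (@measurableT _ (sigma_of _)).
    by apply/seteqP; split.
  rewrite (_ : mkset _ = [set w | B i (X i w)] `&` [set w | forall i, i \in s' -> B i (X i w)]).
    apply: (@measurableI _ (sigma_of _)) => //.
    by case: i => -[] l; [exact: (measurable_preim (@cU k l))|exact: (measurable_preim (@cV k l))].
  apply/seteqP; split=> [w h|w [h1 h2] l]; last by rewrite inE => /predU1P[->//|]; exact: h2.
  by split=> [|l ls]; apply: h; rewrite inE ?eqxx// ls orbT.
have mEO : measurable E.
  exact: (measurable_preim (measurable_id_sub (@clocks_hist_sub k)) mEc).
(* on either branch, [E] is independent of [raced k] and the draws *)
have branch (Br : set O) wt A1 p : <<s raced k >> Br -> Br `<=` alive_at k ->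
    draw_law k Br wt -> (forall C p, 0 <= wt C p <= 1)%R -> <<s raced k >> A1 ->
    P ((A1 `&` [set w | Br w /\ drawn k w = p]) `&` E) =
    P (A1 `&` [set w | Br w /\ drawn k w = p]) * c.
  move=> mBr BrD dl wt01 mA1.
  have mB' : measurable [set w | Br w /\ drawn k w = p].
    exact: (measurableI _ _ (measurable_preim id2 mBr) (mdrawn k p)).
  have mA1O : measurable (A1 : set O) by exact: (measurable_preim id2 mA1).
  have mi H' C : @measurable _ (sigma_of H') C ->
      measurable_fun (setT : set (sigma_of H')) (fun w => @ind R (C w)).
    by move=> mC; apply: (@measurable_ind _ _ (sigma_of H')).
  have up C : <<s raced k >> C -> <<s clocks_hist k >> C.
    by move=> h; exact: (measurable_preim upc h).
  have w0 w : 0 <= (wt (bset_ k w) p)%:E.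
    by rewrite lee_fin; case/andP: (wt01 (bset_ k w) p).
  have mw := @weight_measurable k wt p (raced k) (@hist_raced k).
  rewrite -[LHS]integral_ind; last by apply: measurableI => //; exact: measurableI.
  rewrite -[X in X * c]integral_ind; last exact: measurableI.
  transitivity (\int[P]_w (ind (Br w /\ drawn k w = p) * (ind (A1 w) * ind (E w)))).
    apply: eq_integral => w _; rewrite -!ind_and; apply: ind_iff.
    by split=> [[[? []] ?]|[[] ? ? []]].
  rewrite dl; last 2 first.
  - by apply: emeasurable_funM; apply: mi => //; exact: up.
  - by move=> w; rewrite mule_ge0.
  transitivity (\int[P]_w (ind (alive_at k w /\ forall i, i \in s -> B i (X i w)) *
      ((wt (bset_ k w) p)%:E * (ind (A1 w) * ind (Br w))))).
    apply: eq_integral => w _; rewrite muleCA [RHS]muleCA; congr (_ * _).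
    rewrite -!ind_and; apply: ind_iff.
    by split=> [[br [a e]]|[[_ e] [a br]]]; do ?split => //; exact: BrD.
  rewrite (fresh_event mX (@raced_sub k) Ha2 fr2 us)//; last 3 first.
  - move=> [b l] ls; have /= kl := sK _ ls.
    by do ?split; [exact: ltnW|apply/eqP => -[_ lk]..]; move: kl; rewrite lk ltnn.
  - apply: emeasurable_funM; first exact: mw.
    by apply: emeasurable_funM; exact: mi.
  - by move=> w; rewrite !mule_ge0.
  rewrite muleC -/c; congr (_ * _).
  transitivity (\int[P]_w (ind (Br w) * ((wt (bset_ k w) p)%:E * ind (A1 w)))).
    apply: eq_integral => w _; rewrite muleCA [RHS]muleCA; congr (_ * _).
    rewrite -!ind_and; apply: ind_iff.
    by split=> [[_ [a br]]|[br a]]; do ?split => //; exact: BrD.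
  rewrite -dl; last 2 first.
  - exact: mi (up _ mA1).
  - by [].
  by apply: eq_integral => w _; rewrite -ind_and; apply: ind_iff; split=> [[[]]|[? []]].
have mBn := hist_branch_new (@hist_raced k) (@rU k) (@rV k).
have mBo := hist_branch_old (@hist_raced k) (@rU k) (@rV k).
(* Once the draws are fixed to [p], the event [A] can be replaced by one that is determined by
   [raced k]. *)
have trace p := @gen_fin_trace _ O _ (raced k) (drawn k) A
  (sub_sigma_algebra2 (@hist_raced_drawn k) mA) p.
(* [A] lies in [alive_at k.+1], the disjoint union of the two branches. *)
have split_A (C : set O) : measurable C -> P (A `&` C) =
    \sum_(p : 'I_N * 'I_N) (P (A `&` [set w | branch_new k w /\ drawn k w = p] `&` C) +
      P (A `&` [set w | branch_old k w /\ drawn k w = p] `&` C)).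
  move=> mC; have mp (Br : set O) p : <<s raced k >> Br ->
      measurable [set w | Br w /\ drawn k w = p].
    by move=> mBr; exact: (measurableI _ _ (measurable_preim id2 mBr) (mdrawn k p)).
  rewrite -integral_ind; last exact: measurableI.
  transitivity (\int[P]_w \sum_(p : 'I_N * 'I_N)
    (ind ((A `&` [set w | branch_new k w /\ drawn k w = p] `&` C) w) +
     ind ((A `&` [set w | branch_old k w /\ drawn k w = p] `&` C) w))).
    apply: eq_integral => w _; rewrite (bigD1 (drawn k w))//= big1; last first.
      move=> p pn; rewrite !indF ?adde0//.
        by move=> [[_ [_ e]] _]; rewrite e eqxx in pn.
      by move=> [[_ [_ e]] _]; rewrite e eqxx in pn.
    rewrite adde0; have [[a c0]|n] := pselect ((A `&` C) w); last first.
      by rewrite !indF ?adde0// => -[[a _] c0]; exact: n.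
    rewrite indT//; have [le|nle] := pselect (btime_new_ k w <= btime_old_ k w).
      rewrite indT ?indF ?adde0//; first by move=> [[_ [[_]]]].
      by split=> //; split=> //; split=> //; split=> //; exact: Ak.
    rewrite indF ?indT ?add0e//; last by move=> [[_ [[_]]]].
    by split=> //; split=> //; split=> //; split=> //; exact: Ak.
  rewrite ge0_integral_sum//; last 2 first.
  - move=> p; apply: emeasurable_funD; apply: measurable_ind;
      (apply: measurableI => //; apply: measurableI => //; exact: mp).
  - by move=> p w _; rewrite adde_ge0.
  apply: eq_bigr => p _; rewrite ge0_integralD//.
  - by rewrite !integral_ind//; apply: measurableI => //; apply: measurableI => //; exact: mp.
  - by apply: measurable_ind; apply: measurableI => //; apply: measurableI => //; exact: mp.
  - by apply: measurable_ind; apply: measurableI => //; apply: measurableI => //; exact: mp.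
rewrite split_A// -[A in RHS]setIT split_A// ge0_sume_distrl; last first.
  by move=> p _; rewrite adde_ge0.
apply: eq_bigr => p _; have [A1 mA1 e1] := trace p.
have eA (Br : set O) : A `&` [set w | Br w /\ drawn k w = p] =
    A1 `&` [set w | Br w /\ drawn k w = p].
  rewrite (_ : [set w | _] = Br `&` (drawn k @^-1` [set p]))// setICA e1.
  by rewrite setICA.
rewrite !setIT !eA ge0_muleDl//; congr (_ + _).
- apply: (branch _ weight_new) => //; last exact: weight_new01.
    by move=> w [h _]; exact: aliveS.
  exact: draw_new.
- apply: (branch _ weight_old) => //; last exact: weight_old01.
    by move=> w [h _]; exact: aliveS.
  exact: draw_old.
Qed.

Local Notation clock k w := (fine (btime_ k w)).
Local Notation a1 k w := (rate_new N Lambda #|bset_ k w|).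
Local Notation a2 k w := (rate_old N Lambda #|bset_ k w|).

Let positive : {ae P, forall w, forall c, (0 < X c w)%R}.
Proof. exact: iid_exponential_gt0 HX. Qed.

Let mclock H k : hist k `<=` H ->
  measurable_fun (setT : set (sigma_of H)) (fun w => clock k w).
Proof.
move=> h; have hf : meas_fun (@fine R) by [].
exact: (measurableT_comp hf (hist_btime h)).
Qed.

Let mclockS k : measurable_fun (setT : set (sigma_of (clocks_hist k)))
  (fun w => clock k.+1 w).
Proof.
have hf : meas_fun (@fine R) by [].
exact: (measurableT_comp hf (hist_btimeS (@hist_clocks k) (@cU k k) (@cV k k))).
Qed.

Let ma1 H k : hist k `<=` H ->
  measurable_fun (setT : set (sigma_of H)) (fun w => a1 k w).
Proof.
move=> h; exact: (@fin_measurable_fun R _ (sigma_of H) _ _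
  (fun C : {set 'I_N} => rate_new N Lambda #|C|) (hist_bset h)).
Qed.

Let ma2 H k : hist k `<=` H ->
  measurable_fun (setT : set (sigma_of H)) (fun w => a2 k w).
Proof.
move=> h; exact: (@fin_measurable_fun R _ (sigma_of H) _ _
  (fun C : {set 'I_N} => rate_old N Lambda #|C|) (hist_bset h)).
Qed.

Let id_clocks k : meas_fun (id : O -> sigma_of (clocks_hist k)).
Proof. exact: measurable_id_sub (@clocks_hist_sub k). Qed.

Section one_step.
Variables (k : nat) (g : O -> R -> \bar R).
Hypothesis mg : measurable_fun (setT : set (sigma_of (hist k) * R))
  (fun p => g p.1 p.2).
Hypothesis g0 : forall w s, 0 <= g w s.

Let mgd : measurable_fun (setT : set (sigma_of (clocks_hist k)))
  (fun w => g w (clock k.+1 w - clock k w)%R).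
Proof.
have m : measurable_fun (setT : set (sigma_of (clocks_hist k)))
    (fun w => (w : sigma_of (hist k), (clock k.+1 w - clock k w)%R)).
  apply/measurable_fun_pairP; split.
    exact: (measurable_id_mono (@hist_clocks k)).
  by apply: measurable_funB; [exact: mclockS|exact: mclock].
exact: (measurableT_comp mg m).
Qed.

Let mwg (wt : {set 'I_N} -> 'I_N * 'I_N -> R) (c : 'I_N * 'I_N) : measurable_fun (setT : set (sigma_of (hist k) * R))
  (fun p => (wt (bset_ k p.1) c)%:E * g p.1 p.2).
Proof.
apply: emeasurable_funM => //.
exact: (measurableT_comp (@weight_measurable k wt c _ (@subset_refl _ (hist k)))
  measurable_fst).
Qed.

Let mind (b : bool) (wt : {set 'I_N} -> 'I_N * 'I_N -> R) (c : 'I_N * 'I_N) (x1 x2 : O -> R) (y1 y2 : O -> R) :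
  meas_fun x1 -> meas_fun x2 ->
  meas_fun y1 -> meas_fun y2 ->
  meas_fun (fun w => ind (alive_at k w) *
    (ind (x1 w < (T - clock k w) * y1 w)%R *
     (ind (if b then x1 w / y1 w * y2 w <= x2 w else x1 w / y1 w * y2 w < x2 w)%R *
     ((wt (bset_ k w) c)%:E * g w (x1 w / y1 w)%R)))).
Proof.
move=> mx1 mx2 my1 my2.
have idh : meas_fun (id : O -> sigma_of (hist k)).
  exact: measurable_id_sub (@hist_sub k).
have mq : meas_fun (fun w => (x1 w / y1 w)%R).
  apply: measurable_funM => //; exact: (measurableT_comp (@measurable_inv R) my1).
apply: emeasurable_funM.
  apply: measurable_ind.
  exact: (measurable_preim idh (hist_alive (@subset_refl _ (hist k)))).
apply: emeasurable_funM.
  apply: measurable_ind; apply: measurable_lt_fun => //; apply: measurable_funM => //.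
  apply: measurable_funB; first exact: measurable_cst.
  exact: (measurableT_comp (mclock (@subset_refl _ (hist k))) idh).
apply: emeasurable_funM.
  apply: measurable_ind.
  by case: (b); [apply: measurable_le_fun|apply: measurable_lt_fun] => //; exact: measurable_funM.
have m : meas_fun (fun w : O => (w : sigma_of (hist k), (x1 w / y1 w)%R)).
  by apply/measurable_fun_pairP.
exact: (measurableT_comp (@mwg wt c) m).
Qed.

Let ma1O : meas_fun (fun w => a1 k w).
Proof. exact: (measurableT_comp (ma1 (@hist_clocks k)) (@id_clocks k)). Qed.

Let ma2O : meas_fun (fun w => a2 k w).
Proof. exact: (measurableT_comp (ma2 (@hist_clocks k)) (@id_clocks k)). Qed.

(** The draw is replaced by its conditional weight, a function of the past; the two clocks, fresh
    for [hist k], are then integrated out by [race]. The clocks are almost surely positive, which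
    [btime_race] requires. *)
Lemma step_new c :
  \int[P]_w (ind (branch_new k w /\ drawn k w = c) * g w (clock k.+1 w - clock k w)%R) =
  \int[P]_w (ind (alive_at k w) * \int[leb R]_s (ind (0 < s < T - clock k w)%R *
    ((a1 k w * expR (- (a1 k w + a2 k w) * s))%:E *
     ((weight_new (bset_ k w) c)%:E * g w s)))).
Proof.
have refl := @subset_refl _ (hist k).
rewrite draw_new; [|exact: mgd|by move=> w].
rewrite -(@race _ O R P _ X mX true (true, k) (false, k) (hist k) (alive_at k)
  [set c | (k <= c.2)%N] (fun w => a1 k w) (fun w => a2 k w) (fun w => T - clock k w)%R
  (fun w s => (weight_new (bset_ k w) c)%:E * g w s) (@hist_sub k) (hist_alive refl)
  (@fresh_hist k) (leqnn k) (leqnn k))//; first last.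
- by move=> w s; rewrite mule_ge0// lee_fin; case/andP: (weight_new01 (bset_ k w) c).
- by move=> w; exact: rate_old_ge0.
- by move=> w; exact: rate_new_ge0.
- by apply: measurable_funB; [exact: measurable_cst|exact: mclock].
- exact: ma2.
- exact: ma1.
apply: ge0_ae_eq_integral => //.
- apply: emeasurable_funM.
    apply: measurable_ind; apply: (measurable_preim (@id_clocks k)).
    exact: hist_branch_new (@hist_clocks k) (@cU k k) (@cV k k).
  apply: emeasurable_funM; last exact: (measurableT_comp mgd (@id_clocks k)).
  exact: (measurableT_comp (@weight_measurable k weight_new c _ (@hist_clocks k)) (@id_clocks k)).
- exact: (@mind true weight_new c (U k) (V k)).
- move=> w _; rewrite !mule_ge0// lee_fin; by case/andP: (weight_new01 (bset_ k w) c).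
- move=> w _; rewrite !mule_ge0// lee_fin; by case/andP: (weight_new01 (bset_ k w) c).
apply: filterS positive => w pos _.
have [al|nal] := pselect (alive_at k w); last first.
  by rewrite (indF nal) mul0e indF ?mul0e// => -[h _]; apply: nal; exact: aliveS.
have [h1 _ h3 _] := btime_race Lambda_gt0 al (pos (true, k)) (pos (false, k)).
rewrite /= (indT al) mul1e [RHS]muleA -ind_and -(ind_iff h1).
by apply: eq_indM => -[l1 l2]; rewrite (h3 l1 l2).
Qed.

Lemma step_old c :
  \int[P]_w (ind (branch_old k w /\ drawn k w = c) * g w (clock k.+1 w - clock k w)%R) =
  \int[P]_w (ind (alive_at k w) * \int[leb R]_s (ind (0 < s < T - clock k w)%R *
    ((a2 k w * expR (- (a2 k w + a1 k w) * s))%:E *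
     ((weight_old (bset_ k w) c)%:E * g w s)))).
Proof.
have refl := @subset_refl _ (hist k).
rewrite draw_old; [|exact: mgd|by move=> w].
rewrite -(@race _ O R P _ X mX false (false, k) (true, k) (hist k) (alive_at k)
  [set c | (k <= c.2)%N] (fun w => a2 k w) (fun w => a1 k w) (fun w => T - clock k w)%R
  (fun w s => (weight_old (bset_ k w) c)%:E * g w s) (@hist_sub k) (hist_alive refl)
  (@fresh_hist k) (leqnn k) (leqnn k))//; first last.
- by move=> w s; rewrite mule_ge0// lee_fin; case/andP: (weight_old01 (bset_ k w) c).
- by move=> w; exact: rate_new_ge0.
- by move=> w; exact: rate_old_ge0.
- by apply: measurable_funB; [exact: measurable_cst|exact: mclock].
- exact: ma1.
- exact: ma2.
apply: ge0_ae_eq_integral => //.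
- apply: emeasurable_funM.
    apply: measurable_ind; apply: (measurable_preim (@id_clocks k)).
    exact: hist_branch_old (@hist_clocks k) (@cU k k) (@cV k k).
  apply: emeasurable_funM; last exact: (measurableT_comp mgd (@id_clocks k)).
  exact: (measurableT_comp (@weight_measurable k weight_old c _ (@hist_clocks k)) (@id_clocks k)).
- exact: (@mind false weight_old c (V k) (U k)).
- move=> w _; rewrite !mule_ge0// lee_fin; by case/andP: (weight_old01 (bset_ k w) c).
- move=> w _; rewrite !mule_ge0// lee_fin; by case/andP: (weight_old01 (bset_ k w) c).
apply: filterS positive => w pos _.
have [al|nal] := pselect (alive_at k w); last first.
  by rewrite (indF nal) mul0e indF ?mul0e// => -[h _]; apply: nal; exact: aliveS.
have [_ h1 _ h3] := btime_race Lambda_gt0 al (pos (true, k)) (pos (false, k)).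
rewrite /= (indT al) mul1e [RHS]muleA -ind_and -(ind_iff h1).
by apply: eq_indM => -[l1 l2]; rewrite (h3 l1 l2).
Qed.

(** The number of admissible draws cancels: a new ordered pair receives the rate K (N - K) / (K (N -
    K)) = 1 and a loop K (K - 1) / 2 / (K (K - 1)) = 1/2, in units of [rate]. These are the weights
    of the restricted renewal equation. *)
Lemma step_weight (C : {set 'I_N}) c :
  (rate_new N Lambda #|C| * weight_new C c + rate_old N Lambda #|C| * weight_old C c =
   rate * pair_weight C c)%R.
Proof.
rewrite rate_newE rate_oldE /weight_new /weight_old /pair_weight !inE.
move: (Lambda / N.-1%:R)%R => y.
have [aC|aC] := boolP (c.1 \in C); rewrite /= ?mulr0 ?mul0r ?addr0 ?mulr0//.
have K0 : (#|C|%:R != 0 :> R)%R.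
  by rewrite pnatr_eq0 -lt0n card_gt0; apply/set0Pn; exists c.1.
have [bC|bC] := boolP (c.2 \in C); rewrite /= ?andbF ?andbT ?mulr0 ?add0r ?mul0r ?addr0.
  rewrite [c.2 == _]eq_sym; case: eqVneq => [e|cc] /=; first by rewrite mulr0 mul0r mulr0.
  have : (1 < #|C|)%N.
    rewrite (cardsD1 c.1) aC ltnS card_gt0; apply/set0Pn; exists c.2.
    by rewrite !inE eq_sym cc.
  case: #|C| K0 => [//|K] K0; rewrite ltnS => K1.
  have K'0 : (K%:R != 0 :> R)%R by rewrite pnatr_eq0 -lt0n.
  by rewrite -[K.+1%:R]natr1 addrK /=; field; rewrite natr1 K0 K'0.
have NC : ((N - #|C|)%N%:R != 0 :> R)%R.
  rewrite pnatr_eq0 -lt0n subn_gt0.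
  by rewrite -[ltnRHS]card_ord -cardsT proper_card// finset.properEneq finset.subsetT andbT;
    apply: contraNneq bC => ->; rewrite inE.
by field; rewrite K0 NC.
Qed.

End one_step.

(* the conditional law, given the first [k] events, of the next event *)
Lemma one_step k (Phi : O -> R -> 'I_N * 'I_N -> \bar R) :
  (forall c, measurable_fun (setT : set (sigma_of (hist k) * R))
    (fun p => Phi p.1 p.2 c)) ->
  (forall w s c, 0 <= Phi w s c) ->
  \int[P]_w (ind (alive_at k.+1 w) * Phi w (clock k.+1 w - clock k w)%R (drawn k w)) =
  \int[P]_w (ind (alive_at k w) * \int[leb R]_s (ind (0 < s < T - clock k w)%R *
    ((expR (- (rate * total_weight R (bset_ k w)) * s))%:E *
     \sum_c (rate * pair_weight (bset_ k w) c)%:E * Phi w s c))).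
Proof.
move=> mPhi Phi0; have refl := @subset_refl _ (hist k).
pose S := sigma_of (hist k).
have idh : meas_fun (id : O -> S) by exact: measurable_id_sub (@hist_sub k).
have mfst : meas_fun (fst : S * R -> S) by exact: measurable_fst.
have msnd : meas_fun (snd : S * R -> R) by exact: measurable_snd.
have mI : meas_fun (fun p : S * R => @ind R (0 < p.2 < T - clock k p.1)%R).
  apply: measurable_ind.
  rewrite (_ : mkset _ = [set p : S * R | (0 < p.2)%R] `&` [set p | (p.2 < T - clock k p.1)%R]).
    apply: measurableI; first by apply: measurable_lt_fun => //; exact: measurable_cst.
    apply: measurable_lt_fun => //; apply: measurable_funB; first exact: measurable_cst.
    exact: (measurableT_comp (mclock refl) mfst).
  by apply/seteqP; split=> p /= => [/andP[]|[-> ->]].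
pose Gn w s c := ind (0 < s < T - clock k w)%R * ((a1 k w * expR (- (a1 k w + a2 k w) * s))%:E *
     ((weight_new (bset_ k w) c)%:E * Phi w s c)).
pose Go w s c := ind (0 < s < T - clock k w)%R * ((a2 k w * expR (- (a2 k w + a1 k w) * s))%:E *
     ((weight_old (bset_ k w) c)%:E * Phi w s c)).
have mexp (x y : O -> R) : measurable_fun (setT : set S) x -> measurable_fun (setT : set S) y ->
    meas_fun (fun p : S * R => (x p.1 * expR (- (x p.1 + y p.1) * p.2))%:E).
  move=> mx my; have mx' := measurableT_comp mx mfst; have my' := measurableT_comp my mfst.
  apply/measurable_EFinP; apply: measurable_funM => //; apply: measurableT_comp => //.
  by apply: measurable_funM => //; apply: measurableT_comp => //; exact: measurable_funD.
have mw wt c : meas_fun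
    (fun p : S * R => (wt (bset_ k p.1) c)%:E * Phi p.1 p.2 c).
  apply: emeasurable_funM => //.
  exact: (measurableT_comp (@weight_measurable k wt c _ refl) mfst).
have mGn c : meas_fun (fun p : S * R => Gn p.1 p.2 c).
  apply: emeasurable_funM => //; apply: emeasurable_funM; last exact: mw.
  exact (mexp _ _ (@ma1 _ k refl) (@ma2 _ k refl)).
have mGo c : meas_fun (fun p : S * R => Go p.1 p.2 c).
  apply: emeasurable_funM => //; apply: emeasurable_funM; last exact: mw.
  exact (mexp _ _ (@ma2 _ k refl) (@ma1 _ k refl)).
have Gn0 w s c : 0 <= Gn w s c.
  rewrite !mule_ge0// lee_fin; first by rewrite mulr_ge0 ?expR_ge0// rate_new_ge0.
  by case/andP: (weight_new01 (bset_ k w) c).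
have Go0 w s c : 0 <= Go w s c.
  rewrite !mule_ge0// lee_fin; first by rewrite mulr_ge0 ?expR_ge0// rate_old_ge0.
  by case/andP: (weight_old01 (bset_ k w) c).
have mint (G : O -> R -> \bar R) : meas_fun (fun p : S * R => G p.1 p.2) ->
    (forall w s, 0 <= G w s) ->
    measurable_fun (setT : set O) (fun w => ind (alive_at k w) * \int[leb R]_s G w s).
  move=> mG G0; apply: emeasurable_funM.
    by apply: measurable_ind; exact: (measurable_preim idh (hist_alive refl)).
  have h : measurable_fun (setT : set S) (fun w => \int[leb R]_s G w s).
    by apply: (measurable_fun_fubini_tonelli_F _ mG) => p; exact: G0.
  exact: (measurableT_comp h idh).
have msec (G : O -> R -> \bar R) w : meas_fun (fun p : S * R => G p.1 p.2) ->
    meas_fun (G w).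
  by move=> mG; exact: (measurableT_comp mG (@pair1_measurable _ _ S R w)).
have mlhs c (Br : set O) : @measurable _ (sigma_of (clocks_hist k)) Br ->
    meas_fun (fun w => ind (Br w /\ drawn k w = c) *
      Phi w (clock k.+1 w - clock k w)%R c).
  move=> mB; apply: emeasurable_funM.
    apply: measurable_ind.
    exact: (measurableI _ _ (measurable_preim (@id_clocks k) mB) (mdrawn k c)).
  have m : meas_fun (fun w : O => (w : S, (clock k.+1 w - clock k w)%R)).
    apply/measurable_fun_pairP; split; first exact: idh.
    apply: measurable_funB; first exact: (measurableT_comp (@mclockS k) (@id_clocks k)).
    exact: (measurableT_comp (mclock refl) idh).
  exact: (measurableT_comp (mPhi c) m).
have mBn := hist_branch_new (@hist_clocks k) (@cU k k) (@cV k k).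
have mBo := hist_branch_old (@hist_clocks k) (@cU k k) (@cV k k).
transitivity (\int[P]_w \sum_(c : 'I_N * 'I_N)
  (ind (branch_new k w /\ drawn k w = c) * Phi w (clock k.+1 w - clock k w)%R c +
   ind (branch_old k w /\ drawn k w = c) * Phi w (clock k.+1 w - clock k w)%R c)).
  apply: eq_integral => w _; rewrite (bigD1 (drawn k w))//= big1 ?adde0; last first.
    move=> c cn; rewrite !indF ?mul0e ?adde0//.
      by move=> [_ e]; rewrite e eqxx in cn.
    by move=> [_ e]; rewrite e eqxx in cn.
  rewrite (ind_split _ (btime_new_ k w <= btime_old_ k w))//.
  congr (_ * _ + _ * _); apply: ind_iff; split.
  - by move=> [? ?]; split.
  - by move=> [[]].
  - by move=> [? ?]; split.
  - by move=> [[]].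
transitivity (\sum_(c : 'I_N * 'I_N)
  (\int[P]_w (ind (alive_at k w) * \int[leb R]_s Gn w s c) +
   \int[P]_w (ind (alive_at k w) * \int[leb R]_s Go w s c))).
  rewrite ge0_integral_sum//; last 2 first.
  - by move=> c; apply: emeasurable_funD; exact: mlhs.
  - by move=> c w _; rewrite adde_ge0// mule_ge0.
  apply: eq_bigr => c _; rewrite ge0_integralD//; last 4 first.
  - by move=> w _; rewrite mule_ge0.
  - exact: mlhs.
  - by move=> w _; rewrite mule_ge0.
  - exact: mlhs.
  apply: (f_equal2 adde).
    exact: (@step_new k (fun w s => Phi w s c) (mPhi c) (fun w s => Phi0 w s c) c).
  exact: (@step_old k (fun w s => Phi w s c) (mPhi c) (fun w s => Phi0 w s c) c).
transitivity (\int[P]_w \sum_(c : 'I_N * 'I_N)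
  (ind (alive_at k w) * \int[leb R]_s Gn w s c + ind (alive_at k w) * \int[leb R]_s Go w s c)).
  rewrite ge0_integral_sum//; last 2 first.
  - by move=> c; apply: emeasurable_funD; exact: mint.
  - by move=> c w _; rewrite adde_ge0// mule_ge0// integral_ge0.
  apply: eq_bigr => c _; rewrite ge0_integralD//.
  - by move=> w _; rewrite mule_ge0// integral_ge0.
  - exact: mint.
  - by move=> w _; rewrite mule_ge0// integral_ge0.
  - exact: mint.
apply: eq_integral => w _.
transitivity (\sum_(c : 'I_N * 'I_N) ind (alive_at k w) * \int[leb R]_s (Gn w s c + Go w s c)).
  apply: eq_bigr => c _; rewrite -ge0_muleDr ?integral_ge0//; congr (_ * _).
  rewrite ge0_integralD//; [exact: (msec (fun w s => Gn w s c))|exact: (msec (fun w s => Go w s c))].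
rewrite -ge0_sume_distrr; last first.
  by move=> c _; apply: integral_ge0 => s _; rewrite adde_ge0.
congr (_ * _); rewrite -ge0_integral_sum//; last 2 first.
- move=> c; apply: emeasurable_funD;
    [exact: (msec (fun w s => Gn w s c))|exact: (msec (fun w s => Go w s c))].
- by move=> c s _; rewrite adde_ge0.
apply: eq_integral => s _.
rewrite ge0_sume_distrr; last first.
  by move=> c _; rewrite mule_ge0// lee_fin mulr_ge0 ?pair_weight_ge0// divr_ge0// ltW.
rewrite ge0_sume_distrr; last first.
  move=> c _; rewrite !mule_ge0// lee_fin ?expR_ge0//.
  by rewrite mulr_ge0 ?pair_weight_ge0// divr_ge0// ltW.
apply: eq_bigr => c _.
rewrite /Gn /Go -ge0_muleDr; last 2 first.
- rewrite !mule_ge0// lee_fin; first by rewrite mulr_ge0 ?expR_ge0// rate_new_ge0.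
  by case/andP: (weight_new01 (bset_ k w) c).
- rewrite !mule_ge0// lee_fin; first by rewrite mulr_ge0 ?expR_ge0// rate_old_ge0.
  by case/andP: (weight_old01 (bset_ k w) c).
congr (_ * _); rewrite !muleA -ge0_muleDl; last 2 first.
- rewrite -EFinM lee_fin; apply: mulr_ge0; first by rewrite mulr_ge0 ?expR_ge0// rate_new_ge0.
  by case/andP: (weight_new01 (bset_ k w) c).
- rewrite -EFinM lee_fin; apply: mulr_ge0; first by rewrite mulr_ge0 ?expR_ge0// rate_old_ge0.
  by case/andP: (weight_old01 (bset_ k w) c).
congr (_ * _); rewrite -!EFinM -EFinD; congr (_%:E).
rewrite [(a2 k w + a1 k w)%R]addrC rate_total// -step_weight.
move: (expR _) (weight_new _ _) (weight_old _ _) => e x y; ring.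
Qed.

(** No event before [T] means that both clocks exceed their thresholds at [T]; the two tails
    multiply. *)
Lemma no_step k (phi : O -> \bar R) :
  measurable_fun (setT : set (sigma_of (hist k))) phi -> (forall w, 0 <= phi w) ->
  \int[P]_w (ind (alive_at k w /\ ~ alive_at k.+1 w) * phi w) =
  \int[P]_w (ind (alive_at k w) *
    ((expR (- (rate * total_weight R (bset_ k w)) * (T - clock k w)))%:E * phi w)).
Proof.
move=> mphi phi0; have refl := @subset_refl _ (hist k).
pose u (c : bool * nat) w := ((T - clock k w) * (if c.1 then a1 k w else a2 k w))%R.
have mtau : measurable_fun (setT : set (sigma_of (hist k))) (fun w => (T - clock k w)%R).
  by apply: measurable_funB; [exact: measurable_cst|exact: mclock].
have mu_ c : measurable_fun (setT : set (sigma_of (hist k))) (u c).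
  by case: c => -[] l; apply: measurable_funM => //; [exact: ma1|exact: ma2].
have idh : meas_fun (id : O -> sigma_of (hist k)).
  exact: measurable_id_sub (@hist_sub k).
have := @fresh_tails _ O R P _ _ ltr01 X mX true [:: (true, k); (false, k)] (hist k)
  (alive_at k) [set c | (k <= c.2)%N] u phi (@hist_sub k) (hist_alive refl) (@fresh_hist k).
move=> /(_ isT); rewrite (_ : \int[P]_w _ =
  \int[P]_w (ind (alive_at k w /\ ~ alive_at k.+1 w) * phi w)); last first.
  apply: ge0_ae_eq_integral => //.
  - apply: emeasurable_funM.
      by apply: measurable_ind; exact: (measurable_preim idh (hist_alive refl)).
    apply: emeasurable_funM; first exact: (measurableT_comp mphi idh).
    under eq_fun do rewrite big_cons big_seq1.
    apply: emeasurable_funM; apply: measurable_ind; apply: measurable_le_fun.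
    - exact: (measurableT_comp (@mu_ (true, k)) idh).
    - exact: mU.
    - exact: (measurableT_comp (@mu_ (false, k)) idh).
    - exact: mV.
  - apply: emeasurable_funM; last exact: (measurableT_comp mphi idh).
    apply: measurable_ind; apply: measurableI.
      exact: (measurable_preim idh (hist_alive refl)).
    have mS : @measurable _ (sigma_of (clocks_hist k)) (alive_at k.+1).
      apply: (@emeasurable_lt_fun _ _ (sigma_of (clocks_hist k))).
        exact: hist_btimeS (@hist_clocks k) (@cU k k) (@cV k k).
      exact: measurable_cst.
    exact: (measurableC (measurable_preim (@id_clocks k) mS)).
  - by move=> w _; rewrite mule_ge0// mule_ge0// prode_ge0.
  - by move=> w _; rewrite mule_ge0.
  apply: filterS positive => w pos _; rewrite big_cons big_seq1 ind_and -muleA.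
  apply: eq_indM => al; rewrite muleC; congr (_ * _); rewrite -ind_and; apply: ind_iff.
  rewrite /alive_at/= (btime_next Lambda_gt0 al (pos (true, k)) (pos (false, k))).
  rewrite /u/=; split=> [[h1 h2]|/negP]; first by rewrite !ltNge h1 h2.
  by rewrite negb_or -!leNgt => /andP[].
move=> ->.
- apply: eq_integral => w _; apply: eq_indM => al; rewrite muleC; congr ((expR _)%:E * _).
  rewrite big_cons big_seq1 /u/= -rate_total//.
  have t0 : (0 <= T - clock k w)%R.
    rewrite subr_ge0 -lee_fin fineK ?(ltW al)// ge0_fin_numE ?btime_ge0//.
    exact: lt_trans al (ltry _).
  have m0 x : (0 <= x)%R ->
      Num.max ((T - clock k w) * x)%R 0%R = ((T - clock k w) * x)%R.
    by move=> x0; apply/max_idPl; rewrite mulr_ge0.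
  rewrite !m0 ?rate_new_ge0 ?rate_old_ge0//; ring.
- by move=> c; rewrite !inE => /orP[] /eqP -> /=.
- exact: mu_.
- exact: mphi.
- exact: phi0.
Qed.

Lemma ae_draw k (B : set O) wt : @measurable _ (sigma_of (clocks_hist k)) B ->
  draw_law k B wt -> {ae P, forall w, B w -> (wt (bset_ k w) (drawn k w) != 0)%R}.
Proof.
move=> mB dl.
suff h : {ae P, forall w, forall c, ~ ((B w /\ drawn k w = c) /\ wt (bset_ k w) c = 0%R)}.
  by apply: filterS h => w h Bw; apply/eqP => e; apply: (h (drawn k w)).
apply: ae_forall_count => c.
have mwt : @measurable _ (sigma_of (clocks_hist k)) [set w | wt (bset_ k w) c = 0%R].
  have h := @fin_measurable_fun R _ (sigma_of (clocks_hist k)) _ _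
    (fun C : {set 'I_N} => wt C c) (hist_bset (@hist_clocks k)).
  have := measurable_preim h (measurable_set1 (0%R : R)).
  by [].
have mA : measurable ([set w | B w /\ drawn k w = c] `&` [set w | wt (bset_ k w) c = 0%R]).
  apply: measurableI; last exact: (measurable_preim (@id_clocks k) mwt).
  exact: (measurableI _ _ (measurable_preim (@id_clocks k) mB) (mdrawn k c)).
exists ([set w | B w /\ drawn k w = c] `&` [set w | wt (bset_ k w) c = 0%R]).
split=> //; last by move=> w /= /contrapT [].
rewrite -integral_ind//.
transitivity (\int[P]_w (ind (B w /\ drawn k w = c) * @ind R (wt (bset_ k w) c = 0%R))).
  by apply: eq_integral => w _; rewrite -ind_and.
rewrite dl//; last first.
  exact: (@measurable_ind _ _ (sigma_of (clocks_hist k))).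
apply: integral0_eq => w _.
have [->|/eqP n] := eqVneq (wt (bset_ k w) c) 0%R; first by rewrite mul0e mule0.
by rewrite [ind (_ = _)]indF// !mule0.
Qed.

Lemma bset_draw k w : r k w \in bset_ k w -> btime_ k.+1 w < T%:E ->
  (btime_new_ k w <= btime_old_ k w) = (j k w \notin bset_ k w) ->
  bset_ k.+1 w = (j k w |: bset_ k w)%SET.
Proof.
move=> rk al e; apply/setP => x; rewrite /bset /influence !inE.
have fin : btime_new_ k w <= btime_old_ k w -> btime_new_ k w < +oo.
  by move=> le; move: al; rewrite btimeS (min_idPl le) => h; exact: lt_trans h (ltry _).
under eq_existsb do rewrite bstateS.
have [jn|jo] := boolP (j k w \in bset_ k w).
  rewrite jn in e; have [->|_] /= := eqVneq x (j k w).
    by under eq_existsb do rewrite e /=; move: jn; rewrite inE.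
  by under eq_existsb do rewrite e /=.
have le : btime_new_ k w <= btime_old_ k w by rewrite e.
apply/existsP/orP => [[i]|].
  case: ifP => _; last by move=> xi; right; apply/existsP; exists i.
  by rewrite !inE => /predU1P[->|xi]; [left|right; apply/existsP; exists i].
case=> [/eqP ->|/existsP[i xi]].
  move: rk; rewrite inE => /existsP[i ri]; exists i.
  by rewrite le fin// ri/= !inE eqxx.
by exists i; case: ifP => // _; rewrite !inE xi orbT.
Qed.

Lemma ae_history : {ae P, forall w, forall k, alive_at k.+1 w ->
  [/\ r k w \in bset_ k w, r k w != j k w,
      (btime_new_ k w <= btime_old_ k w) = (j k w \notin bset_ k w) &
      bset_ k.+1 w = (j k w |: bset_ k w)%SET]}.
Proof.
apply: ae_forall_count => k.
have mBn := hist_branch_new (@hist_clocks k) (@cU k k) (@cV k k).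
have mBo := hist_branch_old (@hist_clocks k) (@cU k k) (@cV k k).
apply: filterS2 (ae_draw mBn (@draw_new k)) (ae_draw mBo (@draw_old k)) => w hn ho al.
suff [rk rj e] : [/\ r k w \in bset_ k w, r k w != j k w &
    (btime_new_ k w <= btime_old_ k w) = (j k w \notin bset_ k w)].
  by split=> //; exact: bset_draw.
have [le|nle] := boolP (btime_new_ k w <= btime_old_ k w).
  have := hn (conj al le); rewrite /weight_new /drawn/=; case: ifP => [/andP[rk jk] _|]; last by rewrite eqxx.
  by split=> //; apply: contraNneq jk => <-.
have := ho (conj al (elimN idP nle)); rewrite /weight_old /drawn/= !inE.
case: ifP => [/and3P[rk jr jk] _|]; last by rewrite eqxx.
by split=> //; rewrite ?jk// eq_sym.
Qed.

(** Ties are included here: [loops] counts a loop as soon as T_k = T''_k, while the branches above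
    give ties to T'_k. Together with [ae_history] this excludes ties almost surely, so that both
    conventions agree. *)
Lemma ae_loop_draw : {ae P, forall w, forall k, alive_at k.+1 w ->
  btime_ k.+1 w = btime_old_ k w -> j k w \in bset_ k w}.
Proof.
apply: ae_forall_count => k; pose S := sigma_of (clocks_hist k).
pose B := [set w | btime_ k.+1 w < T%:E /\ btime_ k.+1 w = btime_old_ k w].
have hS : measurable_fun (setT : set S) (fun w => btime_ k.+1 w).
  exact: (hist_btimeS (@hist_clocks k) (@cU k k) (@cV k k)).
have mB : @measurable _ S B.
  apply: (@measurableI _ S).
    by apply: (@emeasurable_lt_fun _ _ S) => //; exact: measurable_cst.
  rewrite -[X in measurable X]setTI.
  by apply: (@measurable_eqe _ S) => //; exact: (hist_btime_old (@hist_clocks k) (@cV k k)).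
have dl : draw_law k B weight_old.
  apply: (draw_law_of mB); first exact: weight_old01.
  move=> [c b] A mA AB; have [_ h] := @draws k A c b mA; apply: h.
  by move=> w /AB [h1 h2]; split=> //; rewrite (lt_trans h1) ?ltry.
apply: filterS (ae_draw mB dl) => w h al e.
have := h (conj al e); rewrite /weight_old /drawn/= !inE.
by case: ifP => [/and3P[]//|]; rewrite eqxx.
Qed.

End chain.

(** * Equality of the laws *)

Section backward_values.
Local Open Scope ereal_scope.
Variables (R : realType) (d N q : nat) (Lambda T : R).
Local Notation E := 'rV[R]_d.
Local Notation X := (N.-tuple E).
Variable mu : R.-fker (E * E)%type ~> (E * E)%type.
Variable Pi : R.-pker E ~> Dinf R d.
Variable P0 : probability E R.
Context {dO : measure_display} {O : measurableType dO}.
Variable P : probability O R.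
Variables (U V : nat -> O -> R) (r j : nat -> O -> 'I_N).
Variable o : observation R d N.
Hypotheses (Lambda_gt0 : (0 < Lambda)%R) (mu_le : forall v, mu v setT <= Lambda%:E).
Hypothesis T_gt0 : (0 < T)%R.
Hypothesis qN : (q <= N)%N.
Local Notation X_ := (fun c : bool * nat => if c.1 then U c.2 else V c.2).
Hypothesis HX : iid_exponential P 1 X_.
Hypotheses (mr : forall k, fin_measurable (r k)) (mj : forall k, fin_measurable (j k)).
Hypothesis draws : uniform_draws q Lambda T P U V r j.
Hypothesis obs_roots : forall l (i : 'I_N), ~~ (i < q)%N -> @obs_set _ _ _ o l i = setT.
Local Notation btime_ k w := (btime q Lambda T (U ^~ w) (V ^~ w) (r ^~ w) (j ^~ w) k).
Local Notation bset_ k w := (bset q Lambda T (U ^~ w) (V ^~ w) (r ^~ w) (j ^~ w) k).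
Local Notation clock k w := (fine (btime_ k w)).
Local Notation rate := (Lambda / N.-1%:R)%R.
Local Notation alive := (alive_at q Lambda T U V r j).
Local Notation hist := (hist U V r j).
Local Notation drawn := (drawn r j).

Let mU k : meas_fun (U k). Proof. by case: HX => h _ _; exact: (h (true, k)). Qed.
Let mV k : meas_fun (V k). Proof. by case: HX => h _ _; exact: (h (false, k)). Qed.

Let histM k : hist k `<=` measurable. Proof. exact: (hist_sub HX mr mj). Qed.

Let hist_mono k : hist k `<=` hist k.+1.
Proof.
pose s (l : 'I_k) : 'I_k.+1 := widen_ord (leqnSn k) l.
by move=> A [[[]|]|] [l _ h]; [do 3 left|do 2 left; right|left; right|right]; exists (s l).
Qed.

Let refl k := @subset_refl _ (hist k).

Let idh k : meas_fun (id : O -> sigma_of (hist k)).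
Proof. exact: measurable_id_sub (@histM k). Qed.

Let malive k : @measurable _ (sigma_of (hist k)) (alive k).
Proof. exact: (hist_alive q T Lambda_gt0 (@refl k)). Qed.

Let maliveO k : measurable (alive k).
Proof. exact: (measurable_preim (@idh k) (@malive k)). Qed.

Let mclock k : measurable_fun (setT : set (sigma_of (hist k))) (fun w => (T - clock k w)%R).
Proof.
apply: measurable_funB; first exact: measurable_cst.
have hf : meas_fun (@fine R) by [].
exact: (measurableT_comp hf (hist_btime q T Lambda_gt0 (@refl k))).
Qed.

Let left_time k w : alive k w -> (0 < T - clock k w)%R.
Proof.
move=> al; rewrite subr_gt0 -lte_fin fineK// ge0_fin_numE ?btime_ge0//.
exact: lt_trans al (ltry _).
Qed.

(* the observation of the roots, carried backward through the first [k]
   interactions to a function of the configuration just before the last of them *)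
Fixpoint test_fun (f : X -> \bar R) k (w : O) : X -> \bar R :=
  if k is k'.+1 then
    collide Lambda mu (drawn k' w)
      (flow o Pi (0 < k')%N (T - clock k w) (T - clock k' w) (test_fun f k' w))
  else f.

Section one_test.
Variable f : X -> \bar R.
Hypotheses (mf : meas_fun f) (f0 : forall z, 0 <= f z) (f1 : forall z, f z <= 1).
Local Notation test := (test_fun f).

Lemma test_fun_ge0 k w z : 0 <= test k w z.
Proof.
elim: k z => [|k IH] z //=; apply: collide_ge0 => // y; exact: flow_ge0.
Qed.

Lemma measurable_test_fun k : measurable_fun (setT : set (sigma_of (hist k) * X))
  (fun p => test k p.1 p.2).
Proof.
elim: k => [|k IH] /=; first exact: (measurableT_comp mf measurable_snd).
have up : meas_fun (id : sigma_of (hist k.+1) -> sigma_of (hist k)).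
  exact: measurable_id_mono (@hist_mono k).
have mI : fin_measurable (drawn k : sigma_of (hist k.+1) -> _).
  move=> [a b]; rewrite (_ : _ @^-1` _ = r k @^-1` [set a] `&` j k @^-1` [set b]).
    apply: (@measurableI _ (sigma_of (hist k.+1))); apply: sub_sigma_algebra.
      by left; right; exists ord_max => //; exists [set a] => //; rewrite setTI.
    by right; exists ord_max => //; exists [set b] => //; rewrite setTI.
  by apply/seteqP; split=> w; rewrite /drawn /preimage/= => -[-> ->].
apply: (@measurable_collide_flow _ _ _ Lambda mu o Pi _ (sigma_of (hist k.+1))
  (0 < k)%N (fun w => (T - clock k.+1 w)%R) (fun w => (T - clock k w)%R) (drawn k)
  (fun w => test k w)) => //.
- exact: (measurableT_comp (@mclock k) up).
- have m : measurable_fun (setT : set (sigma_of (hist k.+1) * X))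
      (fun p => (p.1 : sigma_of (hist k), p.2)).
    apply/measurable_fun_pairP; split; last exact: measurable_snd.
    exact: (measurableT_comp up measurable_fst).
  exact: (measurableT_comp IH m).
- by move=> w z; exact: test_fun_ge0.
Qed.

Lemma measurable_test_fun1 k w : meas_fun (test k w).
Proof.
exact: (measurableT_comp (@measurable_test_fun k) (@pair1_measurable _ _ (sigma_of (hist k)) X w)).
Qed.

Lemma test_fun_le1 k w z : test k w z <= 1.
Proof.
elim: k z => [|k IH] z //=; apply: collide_le1 => //.
- by apply: measurable_flow1; [exact: measurable_test_fun1|exact: test_fun_ge0].
- by move=> y; apply: flow_ge0; exact: test_fun_ge0.
- by move=> y; apply: flow_le1 => //; [exact: measurable_test_fun1|exact: test_fun_ge0].
Qed.

Hypothesis f_roots : depends_on [set i : 'I_N | (i < q)%N]%SET f.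

(** Each interaction involves a particle of the current set and one that is in the next set, so the
    dependence follows the growth of [bset_]. *)
Lemma ae_test_fun_dep : {ae P, forall w, forall k, alive k w ->
  depends_on (bset_ k w) (test k w) /\
  forall l i, i \notin bset_ k w -> @obs_set _ _ _ o l i = setT}.
Proof.
apply: filterS (ae_history Lambda_gt0 HX mr mj draws) => w h.
elim=> [|k IH] al.
  rewrite bset0//; split; first exact: f_roots.
  by move=> l i; rewrite inE; exact: obs_roots.
have alk : alive k w by exact: aliveS al.
have [dk ok] := IH alk; have [rk _ _ ->] := h k al; split.
  apply: (@collide_dep _ _ _ Lambda mu (bset_ k w)).
  - exact: finset.subsetUr.
  - by rewrite finset.in_setU1 rk orbT.
  - by rewrite finset.in_setU1 eqxx.
  - apply: flow_dep => //; [exact: measurable_test_fun1|exact: test_fun_ge0].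
by move=> l i; rewrite finset.in_setU1 negb_or => /andP[_]; exact: ok.
Qed.

(** [Y] stands for the expectation in the forward system, seen through its renewal equations and its
    bounds. *)
Variable Y : bool -> R -> (X -> \bar R) -> \bar R.
Hypothesis Y_renewal : forall (C : {set 'I_N}) b t g,
  (forall l i, i \notin C -> @obs_set _ _ _ o l i = setT) ->
  (0 < t)%R -> meas_fun g -> (forall z, 0 <= g z) -> (forall z, g z <= 1) ->
  depends_on C g ->
  Y b t g = (expR (- (rate * total_weight R C) * t))%:E * no_event Pi P0 o b t g +
    \int[leb R]_s (ind (0 < s < t)%R * ((expR (- (rate * total_weight R C) * s))%:E *
      \sum_p (rate * pair_weight C p)%:E *
        Y true (t - s) (collide Lambda mu p (flow o Pi b (t - s) t g)))).
Hypothesis measurable_Y : forall dT (S : measurableType dT) b (t : S -> R) (g : S -> X -> \bar R),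
  meas_fun t -> meas_fun (fun p => g p.1 p.2) ->
  (forall x z, 0 <= g x z) -> meas_fun (fun x => Y b (t x) (g x)).
Hypothesis Y_ge0 : forall b t g, (forall z, 0 <= g z) -> 0 <= Y b t g.
Hypothesis Y_le1 : forall b t g, meas_fun g -> (forall z, 0 <= g z) ->
  (forall z, g z <= 1) -> Y b t g <= 1.

Definition ended k : O -> Prop := fun w => alive k w /\ ~ alive k.+1 w.
(** The flag [(0 < k)%N] selects the value at [T] itself when no interaction has been treated, and
    afterwards the value just before the last interaction treated. *)
Definition last_value k w : \bar R :=
  no_event Pi P0 o (0 < k)%N (T - clock k w) (test k w).
Definition pending k : \bar R :=
  \int[P]_w (ind (alive k w) * Y (0 < k)%N (T - clock k w) (test k w)).

Lemma last_value_ge0 k w : 0 <= last_value k w.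
Proof. by apply: integral_ge0 => z _; apply: flow_ge0; exact: test_fun_ge0. Qed.

Lemma measurable_last_value k :
  measurable_fun (setT : set (sigma_of (hist k))) (last_value k).
Proof.
apply: (@measurable_history _ _ _ _ _ Lambda_gt0 mu_le o Pi P0 _ (sigma_of (hist k))
  (0 < k)%N (fun _ _ => 0%R) (fun _ => drawn k) 0 (fun w => (T - clock k w)%R)
  (fun w => test k w)) => //.
- exact: measurable_test_fun.
- by move=> w z; exact: test_fun_ge0.
Qed.

(** The equation is applied under the integral with the random set [bset_ k] and the remaining time.
    Its first term is the probability of no further event, by [no_step]; its integral is the law of
    the next event, by [one_step]. *)
Lemma pending_step k :
  pending k = \int[P]_w (ind (ended k w) * last_value k w) + pending k.+1.
Proof.
have rate0 : (0 <= rate)%R by rewrite divr_ge0// ltW.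
pose S := sigma_of (hist k).
pose ex w s : \bar R := (expR (- (rate * total_weight R (bset_ k w)) * s))%:E.
have ex0 w s : 0 <= ex w s by rewrite lee_fin expR_ge0.
pose Phi w s c := Y true (T - clock k w - s)%R
  (collide Lambda mu c (flow o Pi (0 < k)%N (T - clock k w - s) (T - clock k w) (test k w))).
have Phi0 w s c : 0 <= Phi w s c.
  by apply: Y_ge0 => z; apply: collide_ge0 => // y; apply: flow_ge0; exact: test_fun_ge0.
have mfst : meas_fun (fst : S * R -> S) by exact: measurable_fst.
have msnd : meas_fun (snd : S * R -> R) by exact: measurable_snd.
have mt : meas_fun (fun p : S * R => (T - clock k p.1 - p.2)%R).
  by apply: measurable_funB => //; exact: (measurableT_comp (@mclock k) mfst).
have mPhi c : meas_fun (fun p : S * R => Phi p.1 p.2 c).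
  apply: (@measurable_Y _ (S * R)%type true (fun p => (T - clock k p.1 - p.2)%R)
    (fun p => collide Lambda mu c (flow o Pi (0 < k)%N (T - clock k p.1 - p.2)
      (T - clock k p.1) (test k p.1)))) => //.
  - apply: (@measurable_collide_flow _ _ _ Lambda mu o Pi _ (S * R)%type (0 < k)%N
      (fun p => (T - clock k p.1 - p.2)%R) (fun p => (T - clock k p.1)%R) (fun=> c)
      (fun p => test k p.1)) => //.
    + exact: (measurableT_comp (@mclock k) mfst).
    + exact: fin_measurable_cst.
    + have m : measurable_fun (setT : set ((S * R) * X)) (fun p => (p.1.1, p.2)).
        apply/measurable_fun_pairP; split; last exact: measurable_snd.
        exact: (measurableT_comp mfst measurable_fst).
      exact: (measurableT_comp (@measurable_test_fun k) m).
    + by move=> p z; exact: test_fun_ge0.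
  - by move=> p z; apply: collide_ge0 => // y; apply: flow_ge0; exact: test_fun_ge0.
have mbs : fin_measurable ((fun w => bset_ k w) : S -> _).
  exact: (hist_bset q T Lambda_gt0 (@refl k)).
have mC (h : {set 'I_N} -> R) : measurable_fun (setT : set S) (fun w => h (bset_ k w)).
  exact: (@fin_measurable_fun R _ S _ _ h mbs).
have mex dS (S' : measurableType dS) (g : S' -> S) (s : S' -> R) :
    meas_fun g -> meas_fun s ->
    meas_fun (fun x => ex (g x) (s x)).
  move=> mg ms; apply/measurable_EFinP; apply: measurableT_comp => //.
  apply: measurable_funM => //; apply: measurableT_comp => //.
  apply: measurable_funM; first exact: measurable_cst.
  exact: (measurableT_comp (@mC (fun C => total_weight R C)) mg).
pose J w := \int[leb R]_s (ind (0 < s < T - clock k w)%R * (ex w s *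
      \sum_c (rate * pair_weight (bset_ k w) c)%:E * Phi w s c)).
have w0 w c : 0 <= (rate * pair_weight (bset_ k w) c)%:E :> \bar R.
  by rewrite lee_fin mulr_ge0// pair_weight_ge0.
have J0 w : 0 <= J w.
  apply: integral_ge0 => s _; rewrite !mule_ge0//; apply: sume_ge0 => c _.
  by rewrite mule_ge0.
have mJ : measurable_fun (setT : set S) J.
  pose G (p : S * R) := ind (0 < p.2 < T - clock k p.1)%R * (ex p.1 p.2 *
      \sum_c (rate * pair_weight (bset_ k p.1) c)%:E * Phi p.1 p.2 c).
  have mG : meas_fun G.
    apply: emeasurable_funM.
      apply: measurable_ind.
      rewrite (_ : mkset _ = [set p : S * R | (0 < p.2)%R] `&` [set p | (p.2 < T - clock k p.1)%R]).
        apply: measurableI; first by apply: measurable_lt_fun => //; exact: measurable_cst.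
        by apply: measurable_lt_fun => //; exact: (measurableT_comp (@mclock k) mfst).
      by apply/seteqP; split=> p /= => [/andP[]|[-> ->]].
    apply: emeasurable_funM; first exact: mex.
    apply: emeasurable_sum => c; apply: emeasurable_funM => //; apply/measurable_EFinP.
    apply: measurable_funM; first exact: measurable_cst.
    exact: (measurableT_comp (@mC (fun C => pair_weight C c)) mfst).
  apply: (measurable_fun_fubini_tonelli_F _ mG) => p.
  by rewrite !mule_ge0//; apply: sume_ge0 => c _; rewrite mule_ge0.
have mlv := @measurable_last_value k.
have mia : meas_fun (fun w => @ind R (alive k w)) by exact: (measurable_ind (@maliveO k)).
transitivity (\int[P]_w (ind (alive k w) * (ex w (T - clock k w)%R * last_value k w + J w))).
  apply: ge0_ae_eq_integral => //.
  - apply: emeasurable_funM => //.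
    have h := @measurable_Y _ S (0 < k)%N (fun w => (T - clock k w)%R) (fun w => test k w)
      (@mclock k) (@measurable_test_fun k) (fun w z => test_fun_ge0 k w z).
    exact: (measurableT_comp h (@idh k)).
  - apply: emeasurable_funM => //.
    have h : measurable_fun (setT : set S) (fun w => ex w (T - clock k w)%R * last_value k w + J w).
      apply: emeasurable_funD => //; apply: emeasurable_funM => //.
      by apply: (@mex _ S id) => //; exact: mclock.
    exact: (measurableT_comp h (@idh k)).
  - by move=> w _; rewrite mule_ge0// Y_ge0// => z; exact: test_fun_ge0.
  - by move=> w _; rewrite mule_ge0// adde_ge0// mule_ge0// last_value_ge0.
  apply: filterS ae_test_fun_dep => w h _; apply: eq_indM => al; have [dep obs] := h k al.
  apply: (@Y_renewal (bset_ k w) (0 < k)%N (T - clock k w)%R (test k w) obs (left_time al)) => //.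
  - exact: measurable_test_fun1.
  - by move=> z; exact: test_fun_ge0.
  - by move=> z; exact: test_fun_le1.
transitivity (\int[P]_w (ind (alive k w) * (ex w (T - clock k w)%R * last_value k w)) +
    \int[P]_w (ind (alive k w) * J w)).
  rewrite -ge0_integralD//.
  - by apply: eq_integral => w _; rewrite ge0_muleDr// mule_ge0// last_value_ge0.
  - by move=> w _; rewrite mule_ge0// mule_ge0// last_value_ge0.
  - apply: emeasurable_funM => //.
    have h : measurable_fun (setT : set S) (fun w => ex w (T - clock k w)%R * last_value k w).
      by apply: emeasurable_funM => //; apply: (@mex _ S id) => //; exact: mclock.
    exact: (measurableT_comp h (@idh k)).
  - by move=> w _; rewrite mule_ge0.
  - by apply: emeasurable_funM => //; exact: (measurableT_comp mJ (@idh k)).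
apply: (f_equal2 adde).
  by rewrite (no_step Lambda_gt0 HX mr mj draws)//; exact: last_value_ge0.
rewrite /J -(one_step Lambda_gt0 HX mr mj draws mPhi Phi0).
apply: eq_integral => w _; apply: eq_indM => al; rewrite /Phi /=.
by rewrite (_ : (T - clock k w - (clock k.+1 w - clock k w) = T - clock k.+1 w)%R)//; ring.
Qed.

Hypothesis ae_stops : {ae P, forall w, exists k, ~ alive k w}.

(** After [n] steps the remainder is [pending n], at most the probability that the chain is still
    alive. It tends to 0 because the chain almost surely stops. *)
Lemma backward_value : Y false T f = \sum_(0 <= k <oo) \int[P]_w (ind (ended k w) * last_value k w).
Proof.
pose n_ k := \int[P]_w (ind (ended k w) * last_value k w).
have n0 k : 0 <= n_ k by apply: integral_ge0 => w _; rewrite mule_ge0// last_value_ge0.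
have YE n : Y false T f = \sum_(0 <= k < n) n_ k + pending n.
  elim: n => [|n IH]; last first.
    by rewrite big_nat_recr//= -addeA -pending_step.
  rewrite big_geq// add0e /pending /=.
  rewrite (eq_integral (cst (Y false T f))); last first.
    by move=> w _; rewrite indT ?mul1e ?subr0// /alive_at/= lte_fin.
  by rewrite (integral_cst _ measurableT) -[LHS]mule1; congr (_ * _); rewrite -(@probability_setT _ _ _ P).
have pending_le n : pending n <= P (alive n).
  rewrite -integral_ind//; apply: ge0_le_integral => //.
  - by move=> w _; rewrite mule_ge0// Y_ge0// => z; exact: test_fun_ge0.
  - apply: emeasurable_funM; first exact: (measurable_ind (@maliveO n)).
    have h := @measurable_Y _ (sigma_of (hist n)) (0 < n)%N
      (fun w => (T - clock n w)%R) (fun w => test n w)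
      (@mclock n) (@measurable_test_fun n) (fun w z => test_fun_ge0 n w z).
    exact: (measurableT_comp h (@idh n)).
  - exact: (measurable_ind (@maliveO n)).
  - move=> w _; rewrite -[leRHS]mule1; apply: le_indM => al.
    by apply: Y_le1; [exact: measurable_test_fun1|move=> z; exact: test_fun_ge0|move=> z; exact: test_fun_le1].
have pending0 n : 0 <= pending n.
  by apply: integral_ge0 => w _; rewrite mule_ge0// Y_ge0// => z; exact: test_fun_ge0.
apply/eqP; rewrite eq_le; apply/andP; split; last first.
  apply: lime_le; first by apply: is_cvg_nneseries => k _ _; exact: n0.
  by apply: nearW => n; rewrite (YE n) leeDl.
have cv : P (alive n) @[n --> \oo] --> P (\bigcap_n alive n).
  apply: nonincreasing_cvg_mu.
  - by rewrite (le_lt_trans (probability_le1 P (maliveO 0)))// ltry.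
  - by move=> n.
  - exact: bigcapT_measurable.
  - move=> m n mn; apply/subsetPset => w; apply: le_lt_trans; exact: btime_mono.
have P0' : P (\bigcap_n alive n) = 0.
  have mI : measurable (\bigcap_n alive n) by exact: bigcapT_measurable.
  apply/(negligibleP _ mI); apply: negligibleS ae_stops => w h [k nk]; exact/nk/h.
(* The remainder is made smaller than [e] by a suitable number of steps. *)
rewrite P0' in cv; apply/lee_addgt0Pr => e e0.
have [n hn] : exists n, P (alive n) < e%:E.
  move/fine_cvgP: cv => [_ /cvgrPdist_lt /(_ e e0)] [n _ /(_ n (leqnn n)) H]; exists n.
  rewrite -[ltLHS]fineK ?fin_num_measure// lte_fin.
  by move: H; rewrite /= sub0r normrN ger0_norm// fine_ge0.
rewrite (YE n); apply: leeD; last exact: le_trans (pending_le n) (ltW hn).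
exact: nneseries_lim_ge.
Qed.

End one_test.
End backward_values.

(** * The backward system read forward in time *)

Section backward_law.
Local Open Scope ereal_scope.
Variables (R : realType) (d N q : nat) (Lambda T : R).
Local Notation E := 'rV[R]_d.
Local Notation X := (N.-tuple E).
Variable mu : R.-fker (E * E)%type ~> (E * E)%type.
Variable Pi : R.-pker E ~> Dinf R d.
Variable P0 : probability E R.
Context {dO : measure_display} {O : measurableType dO}.
Variable P : probability O R.
Variables (U V : nat -> O -> R) (r j : nat -> O -> 'I_N).
Variable o : observation R d N.
Hypotheses (Lambda_gt0 : (0 < Lambda)%R) (mu_le : forall v, mu v setT <= Lambda%:E).
Hypothesis T_gt0 : (0 < T)%R.
Local Notation X_ := (fun c : bool * nat => if c.1 then U c.2 else V c.2).
Hypothesis HX : iid_exponential P 1 X_.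
Hypotheses (mr : forall k, fin_measurable (r k)) (mj : forall k, fin_measurable (j k)).
Hypothesis obs_time_ge0 : forall l, (0 <= @obs_time _ _ _ o l)%R.
Local Notation btime_ k w := (btime q Lambda T (U ^~ w) (V ^~ w) (r ^~ w) (j ^~ w) k).
Local Notation bset_ k w := (bset q Lambda T (U ^~ w) (V ^~ w) (r ^~ w) (j ^~ w) k).
Local Notation clock k w := (fine (btime_ k w)).
Local Notation alive := (alive_at q Lambda T U V r j).
Local Notation hist := (hist U V r j).
Local Notation drawn := (drawn r j).
Local Notation G := (gen_by U `|` gen_by V `|` gen_by_fin r `|` gen_by_fin j).
Variables (tau : nat -> O -> \bar R) (I : nat -> O -> 'I_N * 'I_N).
Variable Z : 'I_N -> O -> Dhor d T.
Hypothesis Hae : {ae P, forall w, enumerates (tau ^~ w) (I ^~ w)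
  [set x | exists2 k, btime_ k.+1 w = (T - x.1)%:E & x.2 = (r k w, j k w)]}.
Hypothesis HZ : interacting_dynamics Lambda Pi mu P0 P G tau I Z.

Local Notation pts w := [set x | exists2 k, btime_ k.+1 w = (T - x.1)%:E & x.2 = (r k w, j k w)].

(** Enumerated interaction times are later than [tau 0 = 0], so no backward event takes place at [T]
    itself. *)
Lemma enumerates_alive w k : enumerates (tau ^~ w) (I ^~ w) (pts w) ->
  btime_ k.+1 w < +oo -> alive k.+1 w.
Proof.
move=> en fin; have bE : btime_ k.+1 w = (T - (T - clock k.+1 w))%:E.
  by rewrite subKr fineK// ge0_fin_numE// btime_ge0.
have [m [/= m1 _]] := enumerates_pt en
  (ex_intro2 _ _ k bE erefl : pts w ((T - clock k.+1 w)%R, (r k w, j k w))).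
have : tau 0%N w < tau m.+1 w.
  by case: (en) => t0 _ _ _; apply: (enumerates_lt en) => //; rewrite t0.
case: (en) => -> _ _ _; rewrite m1 lte_fin => h.
by rewrite /alive_at/= bE lte_fin ltrBlDr ltrDl.
Qed.

Lemma alive_mono w k l : (k <= l)%N -> alive l w -> alive k w.
Proof. by move=> kl; apply: le_lt_trans; exact: btime_mono. Qed.

Lemma alive_fin w k : alive k w -> btime_ k w = (clock k w)%:E.
Proof.
move=> al; rewrite fineK// ge0_fin_numE ?btime_ge0//; exact: lt_trans al (ltry _).
Qed.

Lemma clock_lt w k : (forall c, 0 < X_ c w)%R -> alive k.+1 w ->
  (clock k w < clock k.+1 w)%R.
Proof.
move=> pos al; have alk : alive k w by exact: aliveS al.
have [h1 h2 h3 h4] := btime_race Lambda_gt0 alk (pos (true, k)) (pos (false, k)).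
have t0 : (0 < T - clock k w)%R by rewrite subr_gt0 -lte_fin -alive_fin.
have aux (u a : R) : (0 < u)%R -> (u < (T - clock k w) * a)%R -> (0 < u / a)%R.
  move=> u0 ua; apply: divr_gt0 => //.
  by move: (lt_trans u0 ua); rewrite pmulr_rgt0.
rewrite -subr_gt0.
have [le|nle] := pselect (btime_new q Lambda T (U ^~ w) (V ^~ w) (r ^~ w) (j ^~ w) k <=
  btime_old q Lambda T (U ^~ w) (V ^~ w) (r ^~ w) (j ^~ w) k).
  by rewrite (h3 al le); apply: aux (h1.1 (conj al le)).1; exact: (pos (true, k)).
by rewrite (h4 al nle); apply: aux (h2.1 (conj al nle)).1; exact: (pos (false, k)).
Qed.

Let positive : {ae P, forall w, forall c, (0 < X_ c w)%R}.
Proof. exact: iid_exponential_gt0 HX. Qed.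

(** If the chain never stopped, the times T - T_k would decrease strictly, and so would their
    indices in the increasing enumeration, without end. *)
Lemma ae_stops : {ae P, forall w, exists k, ~ alive k w}.
Proof.
apply: filterS2 positive Hae => w pos en; apply/not_existsP => h.
have al k : alive k w by apply: contrapT; exact: h.
have pt k : exists m, tau m.+1 w = (T - clock k.+1 w)%:E.
  have bE : btime_ k.+1 w = (T - (T - clock k.+1 w))%:E by rewrite subKr -alive_fin.
  have [m [/= m1 _]] := enumerates_pt en
    (ex_intro2 _ _ k bE erefl : pts w ((T - clock k.+1 w)%R, (r k w, j k w))).
  by exists m.
have desc n : forall k m, (m <= n)%N -> tau m.+1 w = (T - clock k.+1 w)%:E -> False.
  elim: n => [|n IH] k m mn mk; have [m' mk'] := pt k.+1.
    have : tau m'.+1 w < tau m.+1 w.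
      by rewrite mk mk' lte_fin ltrD2l ltrN2 clock_lt.
    rewrite ltNge => /negP; apply; apply: (enumerates_le en).
    by move: mn; rewrite leqn0 => /eqP ->.
  apply: (IH k.+1 m' _ mk'); rewrite -ltnS; apply: leq_trans mn.
  rewrite ltnNge; apply/negP => mm.
  have := enumerates_le en (mm : (m.+1 <= m'.+1)%N).
  by rewrite mk mk' lee_fin lerD2l lerN2 leNgt clock_lt.
have [m mk] := pt 0%N; exact: (desc m 0%N m (leqnn m) mk).
Qed.

(** Time reversal: with [n] events in all, the interaction number k+1 is the backward event number
    n-k. Its partners have index n-k-1, since [r] and [j] are indexed from 0. *)
Lemma enumerates_ended w n : (forall c, 0 < X_ c w)%R ->
  enumerates (tau ^~ w) (I ^~ w) (pts w) -> ended q Lambda T U V r j n w ->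
  [/\ forall k, (k < n)%N ->
        tau k.+1 w = (T - clock (n - k)%N w)%:E /\ I k w = drawn (n - k).-1 w,
      tau n w <= T%:E & ~~ (tau n.+1 w <= T%:E)].
Proof.
move=> pos en [al nal].
have clock0 k : (0 <= clock k w)%R by rewrite fine_ge0// btime_ge0.
apply: (@enumerates_prefix _ _ _ _ _ en false T n (fun k => T - clock (n - k)%N w)%R
  (fun k => drawn (n - k).-1 w)).
- exact: ltW.
- move=> k kn; split; last by rewrite /prior lerBlDr lerDl.
  exists (n - k).-1 => //=; rewrite prednK ?subn_gt0// subKr -alive_fin//.
  exact: alive_mono (leq_subr _ _) al.
- move=> k kn; rewrite ltrD2l ltrN2.
  have -> : (n - k = (n - k.+1).+1)%N by lia.
  by apply: clock_lt => //; apply: alive_mono al; lia.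
- move=> [x c] [k /= bk ->] _.
  have alk : alive k.+1 w by apply: (enumerates_alive en); rewrite bk ltry.
  have kn : (k < n)%N.
    rewrite ltnNge; apply/negP => nk; apply: nal; exact: alive_mono (_ : n.+1 <= k.+1)%N alk.
  exists (n - k.+1)%N; first by lia.
  have -> : (n - (n - k.+1) = k.+1)%N by lia.
  by rewrite bk /= subKr.
Qed.

Section one_test.
Variable f : X -> \bar R.
Hypotheses (mf : meas_fun f) (f0 : forall z, 0 <= f z).
Local Notation test := (test_fun q Lambda T mu Pi U V r j o f).
Local Notation last := (last_value q Lambda T mu Pi P0 U V r j o f).
Local Notation ended := (ended q Lambda T U V r j).

(** [history] removes the interactions from the last to the first, which is the order of the
    backward events; [test_fun] is what it has accumulated after [m] of them. *)
Lemma history_ended w n (s : nat -> R) (K : nat -> 'I_N * 'I_N) :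
  (forall k, (k < n)%N -> s k = (T - clock (n - k)%N w)%R /\ K k = drawn (n - k).-1 w) ->
  history Lambda mu o Pi P0 false s K n T f = last n w.
Proof.
move=> h; suff H m : (m <= n)%N -> history Lambda mu o Pi P0 false s K n T f =
    history Lambda mu o Pi P0 (0 < m)%N s K (n - m) (T - clock m w) (test m w).
  by rewrite (H n)// subnn.
elim: m => [_|m IH mn]; first by rewrite subn0 /= subr0.
rewrite IH; last exact: ltnW.
have -> : (n - m = (n - m.+1).+1)%N by lia.
have [s1 K1] : s (n - m.+1)%N = (T - clock m.+1 w)%R /\ K (n - m.+1)%N = drawn m w.
  have [|-> ->] := h (n - m.+1)%N; first by lia.
  by have -> : (n - (n - m.+1) = m.+1)%N by lia.
by rewrite [LHS]/= s1 K1.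
Qed.

(** Almost surely the chain ends after exactly one number [n] of events. On that event the
    conditional expectation given the interactions is [last n]. *)
Lemma backward_law : \int[P]_w seen_value o false Z T f w =
  \sum_(0 <= n <oo) \int[P]_w (ind (ended n w) * last n w).
Proof.
have GM : G `<=` measurable.
  have [mX _ _] := HX.
  have mU k : meas_fun (U k) by exact: (mX (true, k)).
  have mV k : meas_fun (V k) by exact: (mX (false, k)).
  by move=> A [[[]|]|]; [exact: gen_by_sub|exact: gen_by_sub|exact: gen_by_fin_sub|exact: gen_by_fin_sub].
have Jdown (s t : R) : (0 <= s)%R -> (s <= t)%R -> `[0%R, T]%classic t -> `[0%R, T]%classic s.
  by move=> s0 st; rewrite /= !in_itv/= s0 => /andP[_ /(le_trans st)].
have Hae' : {ae P, forall w, enumerates (tau ^~ w) (I ^~ w) (pts w) /\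
   forall m, tau m w < +oo -> `[0%R, T]%classic (fine (tau m w))}.
  apply: filterS Hae => w en; split=> // -[|m] fin.
    by case: (en) => -> _ _ _; rewrite /= in_itv/= lexx ltW.
  rewrite /= in_itv/= fine_ge0 ?(enumerates_ge0 en)//=.
  have [k /= bk _] := enumerates_mem en fin.
  have := btime_ge0 q Lambda T (U ^~ w) (V ^~ w) (r ^~ w) (j ^~ w) k.+1.
  by rewrite bk lee_fin subr_ge0.
have [mtau mI mZ hist_] := interacting_history Lambda_gt0 mu_le obs_time_ge0
  (@left_regular_horizon R T) Jdown GM Hae' HZ.
pose gens := G `|` gen_by tau `|` gen_by_fin I.
pose O0 := sigma_of gens.
have gensM : gens `<=` measurable.
  by move=> A [[/GM//|]|]; [exact: gen_by_sub|exact: gen_by_fin_sub].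
have id0 : meas_fun (id : O -> O0) by exact: measurable_id_sub.
have mtau0 n : measurable_fun (setT : set O0) (tau n).
  by apply: (@measurable_gen_by _ _ _ _ _ tau) => A h; left; right.
have hist_gens k : hist k `<=` gens.
  move=> A h; left; left; move: h => [[[]|]|] [l _ h]; [do 3 left|do 2 left; right|left; right|right];
    by exists l.
have mal k : @measurable _ O0 (alive k) by exact: (hist_alive q T Lambda_gt0 (@hist_gens k)).
have mended k : @measurable _ O0 (ended k).
  apply: (@measurableI _ O0); first exact: mal.
  exact: (@measurableC _ O0 _ (mal k.+1)).
pose A n := ended n `&` ([set w | tau n w <= T%:E] `&` ~` [set w | tau n.+1 w <= T%:E]).
have mA n : @measurable _ O0 (A n).
  apply: (@measurableI _ O0) => //; apply: (@measurableI _ O0).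
    by apply: (@emeasurable_le_fun _ _ O0); [exact: mtau0|exact: measurable_cst].
  apply: (@measurableC _ O0).
  by apply: (@emeasurable_le_fun _ _ O0); [exact: mtau0|exact: measurable_cst].
have mAO n : measurable (A n) by exact: (measurable_preim id0 (mA n)).
have mendedO n : measurable (ended n) by exact: (measurable_preim id0 (mended n)).
pose F w := seen_value o false Z T f w.
have F0 w : 0 <= F w by rewrite mule_ge0.
have mF : meas_fun F.
  apply: emeasurable_funM.
    apply: measurable_ind; apply: measurable_forall_fin => i.
    apply: measurable_forall_fin => l; apply: measurable_cond => _.
    have h := measurableT_comp (@measurable_eval _ _ _ (@obs_time _ _ _ o l)) (mZ i).
    exact: (measurable_preim h (obs_measurable _ _)).
  apply: (measurableT_comp mf); apply: measurable_fun_rectangle => i.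
  rewrite (_ : (fun _ => _) = (fun w => (w : Dhor d T) T) \o Z i).
    exact: (measurableT_comp (@measurable_eval _ _ _ T) (mZ i)).
  by apply/funext => w /=; rewrite !tnth_mktuple.
have good : {ae P, forall w, [/\ exists n, ended n w,
   forall n, ended n w -> A n w,
   forall n m, ended n w -> ended m w -> n = m &
   forall n, ended n w -> history Lambda mu o Pi P0 false
     (fun k => fine (tau k.+1 w)) (I ^~ w) n T f = last n w]}.
  apply: filterS2 positive (filterI Hae ae_stops) => w pos [en [k0 nk0]].
  split.
  - have [m nm min] := ex_minnP (ex_intro (fun k => `[<~ alive k w>]) k0 (asboolT nk0)).
    case: m nm min => [/asboolP na _|m /asboolP nam min].
      by exfalso; apply: na; rewrite /alive_at/= lte_fin.
    exists m; split=> //; apply: contrapT => na.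
    by have := min m (asboolT na); rewrite ltnn.
  - move=> n e; have [_ h1 h2] := enumerates_ended pos en e.
    by split=> //; split=> //=; exact/negP.
  - move=> n m [a1 n1] [a2 n2]; apply/eqP; rewrite eqn_leq; apply/andP; split.
      by rewrite leqNgt; apply/negP => mn; apply: n2; exact: alive_mono mn a1.
    by rewrite leqNgt; apply/negP => mn; apply: n1; exact: alive_mono mn a2.
  - move=> n e; have [h _ _] := enumerates_ended pos en e.
    by apply: history_ended => k kn; have [-> ->] := h k kn.
transitivity (\int[P]_w \sum_(0 <= n <oo) (ind (A n w) * F w)).
  apply: ge0_ae_eq_integral => //.
  - apply: ge0_emeasurable_sum => [n w _ _|n _]; first by rewrite mule_ge0.
    by apply: emeasurable_funM => //; exact: (measurable_ind (mAO n)).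
  - by move=> w _; apply: nneseries_ge0 => n _ _; rewrite mule_ge0.
  - apply: filterS good => w [[n0 e0] h uniq _] _.
    rewrite (@nneseries_single _ _ n0).
    + by rewrite indT ?mul1e//; exact: h.
    + by move=> n; rewrite mule_ge0.
    + move=> n nn0; rewrite indF ?mul0e// => -[e _].
      by rewrite (uniq _ _ e e0) eqxx in nn0.
rewrite integral_nneseries//; last 2 first.
- by move=> n; apply: emeasurable_funM => //; exact: (measurable_ind (mAO n)).
- by move=> n w _; rewrite mule_ge0.
apply: eq_eseriesr => n _.
rewrite (hist_ false n T (A n) f)//; last 3 first.
- by rewrite /= in_itv/= lexx ltW.
- exact: (mA n).
- by move=> w [_ [h1 h2]]; split=> //; exact/negP.
apply: ge0_ae_eq_integral => //.
- apply: emeasurable_funM; first exact: (measurable_ind (mAO n)).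
  apply: (@measurable_history _ _ _ _ _ Lambda_gt0 mu_le o Pi P0 _ O false
    (fun k w => fine (tau k.+1 w)) I n (cst T) (fun=> f)) => //.
    move=> k _; have hf : meas_fun (@fine R) by [].
    exact: (measurableT_comp hf (mtau k.+1)).
  exact: (measurableT_comp mf measurable_snd).
- apply: emeasurable_funM; first exact: (measurable_ind (mendedO n)).
  have h := @measurable_last_value _ _ _ q Lambda T mu Pi P0 _ O U V r j o
    Lambda_gt0 mu_le f mf f0 n.
  exact: (measurableT_comp h (measurable_id_sub (hist_sub HX mr mj (k := n)))).
- by move=> w _; rewrite mule_ge0// history_ge0.
- by move=> w _; rewrite mule_ge0// last_value_ge0.
- apply: filterS good => w [_ h _ e] _.
  rewrite (@ind_iff _ (A n w) (ended n w)); first by apply: eq_indM; exact: e.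
  by split=> [[]|]//; exact: h.
Qed.

End one_test.
End backward_law.

(** * Relabelling of the particles *)

Section relabeling.
Local Open Scope ereal_scope.
Variables (R : realType) (d N : nat).
Local Notation E := 'rV[R]_d.
Local Notation X := (N.-tuple E).
Variables (o : observation R d N) (p pinv : 'I_N -> 'I_N).
Hypotheses (pK : cancel p pinv) (pinvK : cancel pinv p).

(** The constraint meant for particle [i] is imposed on particle [p i]. *)
Definition relabeled_observation : observation R d N :=
  Observation (fun l => @obs_time _ _ _ o l)
    (fun l i => @obs_measurable _ _ _ o l (pinv i)).
Local Notation o' := relabeled_observation.

Definition relabel D (z : N.-tuple D) : N.-tuple D := [tuple tnth z (p i) | i < N].

Lemma seen_relabel s t ys : seen o' s t ys <-> seen o s t (relabel ys).
Proof.
split=> h i l sl.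
  by have := h (p i) l sl; rewrite /= pK tnth_mktuple.
by have := h (pinv i) l sl; rewrite tnth_mktuple pinvK.
Qed.

Lemma measurable_relabel dD (D : measurableType dD) :
  meas_fun (@relabel D).
Proof.
apply: measurable_fun_rectangle => i; under eq_fun do rewrite tnth_mktuple.
exact: measurable_tnth.
Qed.

Lemma sum_relabel (F : 'I_N * 'I_N -> \bar R) :
  \sum_c F c = \sum_c F (p c.1, p c.2).
Proof.
apply: (reindex (fun c : 'I_N * 'I_N => (p c.1, p c.2))).
by exists (fun c => (pinv c.1, pinv c.2)) => -[a b] _ /=; rewrite ?pK ?pinvK.
Qed.

Lemma pair_weight_relabel (C : {set 'I_N}) c :
  pair_weight (p @: C)%SET (p c.1, p c.2) = pair_weight C c :> R.
Proof.
have pinj := can_inj pK.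
by rewrite /pair_weight /= !(mem_imset _ _ pinj) (inj_eq pinj).
Qed.

Lemma total_weight_relabel (C : {set 'I_N}) : total_weight R (p @: C)%SET = total_weight R C.
Proof. by rewrite /total_weight !card_imset//; exact: can_inj pK. Qed.

Lemma depends_on_relabel (C : {set 'I_N}) (f : X -> \bar R) :
  depends_on C f -> depends_on (p @: C)%SET (f \o @relabel E).
Proof.
move=> fC z z' h; apply: fC => i iC; rewrite !tnth_mktuple; apply: h.
exact: imset_f.
Qed.

Lemma flowE (Pi : R.-pker E ~> Dinf R d) b s u (g : X -> \bar R) :
  meas_fun g -> (forall z, 0 <= g z) ->
  flow o' Pi b s u (g \o @relabel E) = flow o Pi b s u g \o @relabel E.
Proof.
move=> mg g0; apply/funext => z.
apply: (flow_relabel Pi b s u z _ mg g0); first by exists pinv.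
by move=> s0 t1 ys; exact: seen_relabel.
Qed.

Lemma no_event_relabel (P0 : probability E R) (Pi : R.-pker E ~> Dinf R d) b t
    (g : X -> \bar R) : meas_fun g -> (forall z, 0 <= g z) ->
  no_event Pi P0 o' b t (g \o @relabel E) = no_event Pi P0 o b t g.
Proof.
move=> mg g0; rewrite /no_event.
have -> : flow o' Pi b 0 t (g \o @relabel E) = flow o Pi b 0 t g \o @relabel E by exact: flowE.
apply: (@power_measure_perm _ _ _ P0 N p); first by exists pinv.
  exact: measurable_flow1.
by move=> z; exact: flow_ge0.
Qed.

Section forward.
Variables (Lambda : R) (mu : R.-fker (E * E)%type ~> (E * E)%type).
Variable Pi : R.-pker E ~> Dinf R d.
Variable P0 : probability E R.
Context {dO : measure_display} {O : measurableType dO}.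
Variable P : probability O R.
Hypotheses (Lambda_gt0 : (0 < Lambda)%R) (mu_le : forall v, mu v setT <= Lambda%:E).
Hypothesis mu_sym : forall v w (A : set (E * E)), measurable A ->
  mu (v, w) A = mu (w, v) ((fun hk => (hk.2, hk.1)) @^-1` A).
Hypothesis markov_Pi : markov_process Pi.
Hypothesis obs_time_ge0 : forall l, (0 <= @obs_time _ _ _ o l)%R.
Hypothesis N2 : (1 < N)%N.
Variable Z : 'I_N -> O -> Dinf R d.
Hypothesis HZ : particle_system Lambda Pi mu P0 P Z.
Local Notation rate := (Lambda / N.-1%:R)%R.

Let rate_gt0 : (0 < rate)%R.
Proof. by rewrite divr_gt0// ltr0n -subn1 subn_gt0. Qed.

Let mZ i : meas_fun (Z i).
Proof. by have [X' [tau [I [_ _ [Y [acc [HK [[]]]]]]]]] := HZ. Qed.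

(** The forward expectation with the particles [p i] in the place of the particles [i]. Test
    functions keep the labels of the backward system, so that the same flow and collision operators
    appear on both sides. *)
Definition forward_value b t (f : X -> \bar R) : \bar R :=
  law_value P o' Z b t (f \o @relabel E).

Lemma forward_value_ge0 b t f : (forall z, 0 <= f z) -> 0 <= forward_value b t f.
Proof. by move=> f0; apply: law_value_ge0 => z; exact: f0. Qed.

Lemma forward_value_le1 b t f : meas_fun f -> (forall z, 0 <= f z) ->
  (forall z, f z <= 1) -> forward_value b t f <= 1.
Proof.
move=> mf f0 f1; apply: law_value_le1 => // [|z|z]; [|exact: f0|exact: f1].
exact: measurableT_comp mf (@measurable_relabel _ E).
Qed.

Lemma measurable_forward_value dT (S : measurableType dT) b (t : S -> R)
    (g : S -> X -> \bar R) :
  meas_fun t -> meas_fun (fun p => g p.1 p.2) ->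
  (forall x z, 0 <= g x z) -> meas_fun (fun x => forward_value b (t x) (g x)).
Proof.
move=> mt mg g0.
apply: (@measurable_law_value _ _ _ _ _ P o' Z mZ _ S b t (fun x => g x \o @relabel E)) => //.
  have m : measurable_fun (setT : set (S * X)) (fun p => (p.1, relabel p.2)).
    apply/measurable_fun_pairP; split; first exact: measurable_fst.
    exact: (measurableT_comp (@measurable_relabel _ E) measurable_snd).
  exact: (measurableT_comp mg m).
by move=> x z; exact: g0.
Qed.

(** The equation for the image of [C] under [p], transported back: the initial law, the flows, the
    collisions and the weights of the pairs are invariant under relabelling. *)
Lemma forward_value_renewal (C : {set 'I_N}) b t g :
  (forall l i, i \notin C -> @obs_set _ _ _ o l i = setT) ->
  (0 < t)%R -> meas_fun g -> (forall z, 0 <= g z) -> (forall z, g z <= 1) ->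
  depends_on C g ->
  forward_value b t g =
    (expR (- (rate * total_weight R C) * t))%:E * no_event Pi P0 o b t g +
    \int[leb R]_s (ind (0 < s < t)%R * ((expR (- (rate * total_weight R C) * s))%:E *
      \sum_c (rate * pair_weight C c)%:E *
        forward_value true (t - s) (collide Lambda mu c (flow o Pi b (t - s) t g)))).
Proof.
move=> oC t0 mg g0 g1 gC; have [X' [tau [I [HX Hae Hdyn]]]] := HZ.
have o'C l i : i \notin (p @: C)%SET -> @obs_set _ _ _ o' l i = setT.
  move=> ip; apply: oC; apply: contra ip => h.
  by rewrite -(pinvK i); exact: imset_f.
have mgr : meas_fun (g \o @relabel E).
  exact: measurableT_comp mg (@measurable_relabel _ E).
have gr0 z : 0 <= (g \o @relabel E) z by exact: g0.
have gr1 z : (g \o @relabel E) z <= 1 by exact: g1.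
have o'ge0 l : (0 <= @obs_time _ _ _ o' l)%R by exact: obs_time_ge0.
have Hren := renewal Lambda_gt0 mu_le o'ge0 rate_gt0 HX Hae Hdyn.
apply: (eq_trans (@backward_renewal _ _ _ Lambda mu Pi P0 _ _ P o' Lambda_gt0 mu_le mu_sym
  markov_Pi Z mZ rate (ltW rate_gt0) Hren
  (p @: C)%SET o'C b t (g \o @relabel E) t0 mgr gr0 gr1 (depends_on_relabel gC))).
clear Hren HX Hae Hdyn; rewrite total_weight_relabel; apply: (f_equal2 adde).
  by rewrite no_event_relabel.
apply: eq_integral => s _.
apply: (f_equal (mule _)); apply: (f_equal (mule _)).
apply: (eq_trans (sum_relabel _)).
apply: eq_bigr => -[a c] _.
rewrite pair_weight_relabel (flowE Pi b (t - s) t mg g0).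
apply: (f_equal (mule _)).
apply: (f_equal (law_value P o' Z true (t - s)%R)).
by apply/funext => z; apply: collide_relabel; exact: can_inj pK.
Qed.

End forward.
End relabeling.

Lemma perm_extending (q N : nat) (qN : (q <= N)%N) (a : 'I_q -> 'I_N) : injective a ->
  exists p : {perm 'I_N}, forall i, p (widen_ord qN i) = a i.
Proof.
move=> inj; pose s1 := codom a ++ [seq x <- enum 'I_N | x \notin codom a].
have us1 : uniq s1.
  rewrite cat_uniq (map_inj_uniq inj) enum_uniq filter_uniq ?enum_uniq// andbT /=.
  by apply/hasPn => x; rewrite mem_filter => /andP[].
have sz : size s1 = N.
  rewrite -[RHS](size_enum_ord N); apply: perm_size; apply: uniq_perm => //.
    by rewrite enum_uniq.
  move=> x; rewrite mem_cat mem_filter mem_enum inE andbT.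
  by case: (x \in codom a).
case: N => [|N] in qN a inj s1 us1 sz *.
  exists 1%g => i; by case: (widen_ord qN i).
have pinj : injective (fun i : 'I_N.+1 => nth ord0 s1 i).
  by move=> x y /eqP; rewrite nth_uniq ?sz// => /eqP/val_inj.
exists (perm pinj) => i; rewrite permE /= nth_cat size_codom card_ord ltn_ord.
by rewrite (nth_map i) ?size_enum_ord// nth_ord_enum.
Qed.

Lemma restrE (R : realType) (d : nat) (T : R) (w : Dinf R d) t :
  (0 <= t)%R -> (t <= T)%R -> restr T w t = w t.
Proof.
by move=> t0 tT; rewrite /restr/= /patch; case: ifPn => // /negP[]; rewrite inE /= in_itv/= t0.
Qed.

Lemma measurable_restr (R : realType) (d : nat) (T : R) :
  meas_fun (@restr R d T).
Proof.
apply: measurable_fun_skorohod => t /=; rewrite in_itv/= => /andP[t0 tT].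
rewrite (_ : (fun _ => _) = fun w : Dinf R d => w t); first exact: measurable_eval.
by apply/funext => w; exact: restrE.
Qed.

Lemma measurable_mktuple dX dY (X : measurableType dX) (Y : measurableType dY) n
    (f : 'I_n -> X -> Y) : (forall i, meas_fun (f i)) ->
  meas_fun (fun w => [tuple f i w | i < n]).
Proof.
move=> mf; apply: measurable_fun_rectangle => i.
by rewrite (_ : (fun _ => _) = f i)//; apply/funext => w; rewrite tnth_mktuple.
Qed.

(** * Cylinder events on tuples of paths *)

Section cylinder_sets.
Variables (R : realType) (d q : nat) (T : R).
Local Notation E := 'rV[R]_d.

Definition cylinders : set (set (q.-tuple (Dhor d T))) :=
  [set A | exists m (t : 'I_m -> R) (B : 'I_m -> 'I_q -> set E),
    [/\ forall l, 0 <= t l <= T, forall l i, measurable (B l i) &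
        A = [set x : q.-tuple (Dhor d T) | forall l i, B l i (tnth x i (t l))]]].

Lemma cylindersT : cylinders setT.
Proof.
exists 0, (fun=> 0), (fun _ _ => setT); split=> [[]//|[]//|].
by apply/seteqP; split=> // x _ [].
Qed.

Lemma cylindersI : setI_closed cylinders.
Proof.
move=> _ _ [m1 [t1 [B1 [h1 mB1 ->]]]] [m2 [t2 [B2 [h2 mB2 ->]]]].
exists (m1 + m2)%N, (fun l => match fintype.split l with inl k => t1 k | inr k => t2 k end),
  (fun l => match fintype.split l with inl k => B1 k | inr k => B2 k end); split.
- by move=> l; case: (fintype.split l).
- by move=> l; case: (fintype.split l).
apply/seteqP; split=> x /=.
  by move=> [x1 x2] l i; case: (fintype.split l).
move=> h; split=> l i.
  by have := h (lshift m2 l) i; rewrite (unsplitK (inl l)).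
by have := h (rshift m1 l) i; rewrite (unsplitK (inr l)).
Qed.

Lemma measurable_cylinders : measurable = <<s cylinders >>.
Proof.
apply/seteqP; split=> A mA; last first.
  apply: (smallest_sub (X := measurable) _ _ mA); first exact: sigma_algebra_measurable.
  move=> _ [m [t [B [h mB ->]]]].
  apply: measurable_forall_fin => l; apply: measurable_forall_fin => i.
  apply: (measurable_preim _ (mB l i)).
  exact: (measurableT_comp (measurable_eval (t l)) (measurable_tnth i)).
have mid : meas_fun (id : sigma_of cylinders -> q.-tuple (Dhor d T)).
  apply: measurable_fun_rectangle => i; apply: measurable_fun_skorohod => t Jt.
  move=> _ B mB; rewrite setTI; apply: sub_sigma_algebra.
  exists 1, (fun=> t), (fun _ i' => if i' == i then B else setT); split.
  - by move=> _; move: Jt; rewrite /= in_itv.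
  - by move=> _ i'; case: ifP => // _; exact: measurableT.
  - apply/seteqP; split=> x /= h.
      by move=> _ i'; case: eqP => // ->.
    by have := h ord0 i; rewrite eqxx.
by have := mid measurableT _ mA; rewrite setTI.
Qed.

End cylinder_sets.

Section cylinders.
Local Open Scope ereal_scope.
Variables (R : realType) (d N q : nat) (Lambda T : R).
Local Notation E := 'rV[R]_d.
Local Notation X := (N.-tuple E).
Variable mu : R.-fker (E * E)%type ~> (E * E)%type.
Variable Pi : R.-pker E ~> Dinf R d.
Variable P0 : probability E R.
Context {dO : measure_display} {O : measurableType dO}.
Variable P : probability O R.
Context {dO' : measure_display} {O' : measurableType dO'}.
Variable P' : probability O' R.
Variables (U V : nat -> O' -> R) (r j : nat -> O' -> 'I_N).
Hypotheses (Lambda_gt0 : (0 < Lambda)%R) (mu_le : forall v, mu v setT <= Lambda%:E).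
Hypothesis mu_sym : forall v w (A : set (E * E)), measurable A ->
  mu (v, w) A = mu (w, v) ((fun hk => (hk.2, hk.1)) @^-1` A).
Hypothesis markov_Pi : markov_process Pi.
Hypothesis T_gt0 : (0 < T)%R.
Hypotheses (qN : (q <= N)%N) (N2 : (1 < N)%N).
Variable Zbar : 'I_N -> O -> Dinf R d.
Hypothesis HZbar : particle_system Lambda Pi mu P0 P Zbar.
Variable Z : 'I_N -> O' -> Dhor d T.
Hypothesis HZ : backward_system q Lambda P' Pi mu P0 U V r j Z.
Variable a : 'I_q -> 'I_N.
Hypothesis a_inj : injective a.

Section one_cylinder.
Variables (m : nat) (t : 'I_m -> R) (B : 'I_m -> 'I_q -> set E).
Hypothesis t_bounds : forall l, (0 <= t l <= T)%R.
Hypothesis mB : forall l i, measurable (B l i).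

(** The constraints on the [q] roots, extended to all particles by [setT]. *)
Let S l (i : 'I_N) : set E := if insub (val i) is Some i' then B l i' else setT.

Let mS l i : measurable (S l i).
Proof. by rewrite /S; case: insubP => [i' _ _|_]; [exact: mB|exact: measurableT]. Qed.

Let o := Observation t mS.

Let S_roots l (i : 'I_N) : ~~ (i < q)%N -> S l i = setT.
Proof. by move=> iq; rewrite /S insubF//; exact/negbTE. Qed.

Let S_widen l i : S l (widen_ord qN i) = B l i.
Proof. by rewrite /S /= valK. Qed.

(** Observations account for times strictly before [T]; the constraints at [T] itself form the test
    function. *)
Let f (z : X) : \bar R := ind (forall l, t l = T -> forall i, S l i (tnth z i)).

Let mf : meas_fun f.
Proof.
apply: measurable_ind; apply: measurable_forall_fin => l.
apply: measurable_cond => _; apply: measurable_forall_fin => i.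
by apply: (measurable_preim _ (mS l i)); exact: measurable_tnth.
Qed.

Let f0 z : 0 <= f z. Proof. exact: ind_ge0. Qed.
Let f1 z : f z <= 1. Proof. exact: ind_le1. Qed.

Let f_roots : depends_on [set i : 'I_N | (i < q)%N]%SET f.
Proof.
move=> z z' zz'; apply: ind_iff; split=> h l tl i; have := h l tl i;
  (have [iq|iq] := boolP (i < q)%N; first by rewrite zz' ?inE);
  by rewrite S_roots.
Qed.

(** With [p] a permutation that extends [a], the left side is a forward value, and both sides have
    the same expansion in the number of backward events. *)
Lemma cylinder_law :
  P [set w | forall l i, B l i (restr T (Zbar (a i) w) (t l))] =
  P' [set w | forall l i, B l i (Z (widen_ord qN i) w (t l))].
Proof.
have [p pa] := perm_extending qN a_inj.
have pK : cancel p p^-1%g by exact: permK.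
have pinvK : cancel p^-1%g p by exact: permKV.
have ot l : (0 <= @obs_time _ _ _ o l)%R by case/andP: (t_bounds l).
have [HX [mr mj] draws [tau [I [Hae Hdyn]]]] := HZ.
have mZbar i : meas_fun (Zbar i).
  by have [X' [tau' [I' [_ _ [Y [acc [HK [[]]]]]]]]] := HZbar.
have mZ i : meas_fun (Z i).
  by have [Y [acc [HK [[]]]]] := Hdyn.
transitivity (forward_value o p p^-1%g P Zbar false T f).
  rewrite -integral_ind; last first.
    apply: measurable_forall_fin => l; apply: measurable_forall_fin => i.
    have [h1 h2] := andP (t_bounds l).
    rewrite (_ : mkset _ = [set w | B l i (Zbar (a i) w (t l))]).
      apply: (measurable_preim _ (mB l i)).
      exact: (measurableT_comp (measurable_eval (t l)) (mZbar (a i))).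
    by apply/seteqP; split=> w; rewrite /mkset restrE.
  apply: eq_integral => w _; rewrite /seen_value /f -ind_and; apply: ind_iff.
  split=> [h|[h1 h2] l i].
    split=> [i l lT|l tl i].
      rewrite /= /S; case: insubP => // i' _ i'E; have := h l i'.
      rewrite restrE ?(andP (t_bounds l)).1 ?(andP (t_bounds l)).2// -pa.
      by rewrite (_ : widen_ord qN i' = p^-1%g i) ?pinvK//; exact: val_inj.
    rewrite /relabel !tnth_mktuple /= /S; case: insubP => // i' _ i'E; have := h l i'.
    rewrite restrE ?(andP (t_bounds l)).1 ?(andP (t_bounds l)).2// -pa tl.
    by rewrite (_ : widen_ord qN i' = i)//; exact: val_inj.
  rewrite restrE ?(andP (t_bounds l)).1 ?(andP (t_bounds l)).2// -pa -(S_widen l i).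
  have [_] := andP (t_bounds l); rewrite le_eqVlt => /orP[/eqP tl|tl].
    by have := h2 l tl (widen_ord qN i); rewrite /relabel !tnth_mktuple /= tl.
  by have := h1 (p (widen_ord qN i)) l tl; rewrite /= pK.
have ast := ae_stops Lambda_gt0 HX Hae.
apply: (eq_trans (backward_value Lambda_gt0 mu_le T_gt0 qN HX mr mj draws (o := o) S_roots
  mf f0 f1 f_roots (Y := forward_value o p p^-1%g P Zbar) _ _ _ _ ast)).
- move=> C b s g.
  exact: (forward_value_renewal pK pinvK Lambda_gt0 mu_le mu_sym markov_Pi ot N2 HZbar b).
- move=> dS S' b s g ms mg g0.
  exact: (measurable_forward_value (Lambda := Lambda) (mu := mu) (Pi := Pi) (P0 := P0)
    o p p^-1%g HZbar b ms mg g0).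
- by move=> b s g; exact: forward_value_ge0.
- by move=> b s g; exact: (forward_value_le1 o p p^-1%g HZbar).
apply: (eq_trans (esym (backward_law Lambda_gt0 mu_le T_gt0 HX mr mj ot Hae Hdyn mf f0))).
rewrite -integral_ind; last first.
  apply: measurable_forall_fin => l; apply: measurable_forall_fin => i.
  apply: (measurable_preim _ (mB l i)).
  exact: (measurableT_comp (measurable_eval (t l)) (mZ (widen_ord qN i))).
apply: eq_integral => w _; rewrite /seen_value /f -ind_and; apply: ind_iff.
split=> [[h1 h2] l i|h].
  have [_] := andP (t_bounds l); rewrite -(S_widen l i) le_eqVlt => /orP[/eqP tl|tl].
    by have := h2 l tl (widen_ord qN i); rewrite !tnth_mktuple /= tl.
  exact: (h1 (widen_ord qN i) l tl).
split=> [i l _|l tl i]; rewrite /= ?tnth_mktuple /S; case: insubP => // i' _ i'E.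
  by have := h l i'; rewrite (_ : widen_ord qN i' = i)//; exact: val_inj.
by have := h l i'; rewrite (_ : widen_ord qN i' = i) ?tl//; exact: val_inj.
Qed.
End one_cylinder.

Let m1 : meas_fun (fun w => [tuple restr T (Zbar (a i) w) | i < q]).
Proof.
have [X' [tau' [I' [_ _ [Y [acc [HK [[_ _ mZ _] _ _ _]]]]]]]] := HZbar.
by apply: measurable_mktuple => i; exact: (measurableT_comp (@measurable_restr R d T) (mZ (a i))).
Qed.

Let m2 : meas_fun (fun w => [tuple Z (widen_ord qN i) w | i < q]).
Proof.
have [_ _ _ [tau [I [_ [Y [acc [HK [[_ _ mZ _] _ _ _]]]]]]]] := HZ.
by apply: measurable_mktuple => i; exact: mZ.
Qed.

Lemma tuple_law A : measurable A ->
  P [set w | (A : set (q.-tuple (Dhor d T))) [tuple restr T (Zbar (a i) w) | i < q]] =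
  P' [set w | A [tuple Z (widen_ord qN i) w | i < q]].
Proof.
move: A; apply: (finite_measure_unique (m1 := image_measure P m1) (m2 := image_measure P' m2)
  (@measurable_cylinders R d q T)).
- exact: cylindersI.
- exact: cylindersT.
- by rewrite /image_measure/= /pushforward preimage_setT probability_setT ltry.
move=> _ [n [t [B [tb mB ->]]]]; rewrite /image_measure/= /pushforward /preimage.
rewrite (_ : mkset _ = [set w | forall l i, B l i (restr T (Zbar (a i) w) (t l))]).
  rewrite (cylinder_law tb mB); congr (P' _).
  by apply/seteqP; split=> w h l i; have := h l i; rewrite /mkset tnth_mktuple.
by apply/seteqP; split=> w h l i; have := h l i; rewrite /mkset tnth_mktuple.
Qed.

Lemma integral_tuple (F : q.-tuple (Dhor d T) -> R) : meas_fun F ->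
  \int[P]_w (F [tuple restr T (Zbar (a i) w) | i < q])%:E =
  \int[P']_w (F [tuple Z (widen_ord qN i) w | i < q])%:E.
Proof.
move=> mF.
have key G : meas_fun G -> (forall x, 0 <= G x) ->
    \int[P]_w G [tuple restr T (Zbar (a i) w) | i < q] =
    \int[P']_w G [tuple Z (widen_ord qN i) w | i < q].
  move=> mG G0; rewrite -(integral_image P m1)// -(integral_image P' m2)//.
  by apply: eq_measure_integral => A mA _; exact: tuple_law.
have mF' : meas_fun (EFin \o F) by exact: measurableT_comp.
rewrite integralE [RHS]integralE; congr (_ - _).
  apply: (eq_trans (eq_trans _ (key _ (measurable_funepos mF') (funepos_ge0 _))));
    by apply: eq_integral => w _; rewrite !funeposE.
apply: (eq_trans (eq_trans _ (key _ (measurable_funeneg mF') (funeneg_ge0 _))));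
  by apply: eq_integral => w _; rewrite !funenegE.
Qed.
End cylinders.

(** * The expansion *)

Section averages.
Local Open Scope ereal_scope.
Variables (R : realType).
Context {dO : measure_display} {O : measurableType dO} {dD : measure_display} {D : measurableType dD}.
Variable P : probability O R.

Lemma bounded_integrable (f : O -> R) : bounded_measurable f ->
  P.-integrable setT (EFin \o f).
Proof.
move=> [mf [M fM]]; apply: measurable_bounded_integrable => //.
  by apply: le_lt_trans (probability_le1 P measurableT) _; rewrite ltry.
by exists M; split; [exact: num_real|move=> x Mx w _; exact: le_trans (fM w) (ltW Mx)].
Qed.

Lemma bounded_measurable_comp (F : D -> R) (g : O -> D) : bounded_measurable F ->
  meas_fun g -> bounded_measurable (F \o g).
Proof.
by move=> [mF [M FM]] mg; split; [exact: measurableT_comp mF mg|exists M => w; exact: FM].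
Qed.

Lemma expectation_empirical (N q : nat) (Zs : 'I_N -> O -> D) (F : q.-tuple D -> R)
    (c : \bar R) : (q <= N)%N -> (forall i, meas_fun (Zs i)) ->
  bounded_measurable F ->
  (forall a : 'I_q -> 'I_N, injective a -> \int[P]_w (F [tuple Zs (a i) w | i < q])%:E = c) ->
  'E_P[fun w => empirical (fun i => Zs i w) F] = c.
Proof.
move=> qN mZs bF cE.
have bFa (a : 'I_q -> 'I_N) : P.-integrable setT (fun w => (F [tuple Zs (a i) w | i < q])%:E).
  have [mF [M FM]] := bF; apply: (@bounded_integrable (fun w => F [tuple Zs (a i) w | i < q])).
  split; last by exists M => w; exact: FM.
  by apply: (measurableT_comp mF); apply: measurable_mktuple.
have wid_inj : injective (@widen_ord q N qN) by move=> x y /(congr1 val)/= /val_inj.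
have cfin : c \is a fin_num by rewrite -(cE _ wid_inj); exact: integrable_fin_num.
rewrite unlock /empirical.
transitivity (\int[P]_w (((N ^_ q)%:R^-1)%:E *
   \sum_(a : {ffun 'I_q -> 'I_N} | injectiveb a) (F [tuple Zs (a i) w | i < q])%:E)).
  by apply: eq_integral => w _; rewrite EFinM sumEFin.
rewrite integralZl//; last by apply: (integrable_sum measurableT) => a _; exact: bFa.
rewrite integral_sum// (eq_bigr (fun=> c)); last first.
  by move=> a /injectiveP ainj; exact: cE.
rewrite -(fineK cfin) sumEFin -EFinM; congr (_%:E).
rewrite sumr_const (_ : #|_| = (N ^_ q)%N); last first.
  rewrite -[in RHS](card_ord N) -[in RHS](card_ord q) -card_inj_ffuns.
  by apply: eq_card => a; rewrite inE.
rewrite -[X in (_ * X)%R]mulr_natl mulKf// pnatr_eq0 -lt0n ffact_gt0//.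
Qed.

Lemma cond_expectationM (f : O -> R) (A : set O) : meas_fun f -> measurable A ->
  cond_expectation P f A * P A = \int[P]_(w in A) (f w)%:E.
Proof.
move=> mf mA; rewrite /cond_expectation.
have PAfin : P A \is a fin_num by exact: fin_num_measure.
(* If the event is negligible, the product vanishes and so does the integral. *)
have [PA0|PA0] := eqVneq (P A) 0.
  rewrite PA0 mule0 null_set_integral//.
  by apply: measurableT_comp => //; exact: measurable_funTS.
rewrite -{2}(fineK PAfin) muleAC -EFinM mulVf ?mul1e//.
by rewrite fine_eq0.
Qed.

Variable L : O -> \bar R.
Hypothesis mL : meas_fun L.
Hypothesis LE : forall w, (exists n : nat, L w = n%:R%:E) \/ L w = +oo.

Let meq l : measurable [set w | L w = l%:R%:E].
Proof. by apply: (measurable_preim mL (A := [set l%:R%:E])). Qed.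

Let mge l : measurable [set w | l%:R%:E <= L w].
Proof. by apply: emeasurable_le_fun => //; exact: measurable_cst. Qed.

(** [L] may be infinite, and that value falls in the last set. *)
Lemma integral_levels (f : O -> R) n : meas_fun f ->
  \int[P]_w (f w)%:E =
  \sum_(l < n) \int[P]_(w in [set w | L w = l%:R%:E]) (f w)%:E +
  \int[P]_(w in [set w | n%:R%:E <= L w]) (f w)%:E.
Proof.
move=> mf; have mf' A : measurable_fun A (fun w => (f w)%:E).
  by apply: measurableT_comp => //; exact: measurable_funTS.
elim: n => [|n ->].
  rewrite big_ord0 add0e; congr (integral _ _ _); apply/esym/seteqP; split=> w //= _.
  by have [[n ->]|->] := LE w; rewrite ?lee_fin ?leey.
rewrite big_ord_recr/= -addeA; congr (_ + _).
rewrite -integral_setU//.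
  congr (integral _ _ _); apply/seteqP; split=> w /=.
    have [[m ->]|->] := LE w; rewrite ?leey ?lee_fin ?ler_nat; last by right.
    by rewrite leq_eqVlt => /orP[/eqP ->|]; [left|right].
  case=> [->//|]; apply: le_trans; by rewrite lee_fin ler_nat.
apply/disj_setPS => w [/= ->]; by rewrite lee_fin ler_nat ltnn.
Qed.

End averages.

Lemma counting_cases (R : realType) (A : set nat) :
  (exists n : nat, counting A = n%:R%:E :> \bar R) \/ counting A = +oo%E :> \bar R.
Proof. by rewrite /counting; case: ifP => _; [left; eexists|right]. Qed.

Section loop_counts.
Local Open Scope ereal_scope.
Variables (R : realType) (N q : nat) (Lambda T : R).
Context {dO : measure_display} {O : measurableType dO}.
Variables (U V : nat -> O -> R) (r j : nat -> O -> 'I_N).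
Hypothesis Lambda_gt0 : (0 < Lambda)%R.
Hypotheses (mU : forall k, meas_fun (U k)) (mV : forall k, meas_fun (V k)).
Hypotheses (mr : forall k, fin_measurable (r k)) (mj : forall k, fin_measurable (j k)).
Local Notation btime_ k w := (btime q Lambda T (U ^~ w) (V ^~ w) (r ^~ w) (j ^~ w) k).
Local Notation btime_old_ k w := (btime_old q Lambda T (U ^~ w) (V ^~ w) (r ^~ w) (j ^~ w) k).

Definition loop_at k : set O := [set w | btime_ k.+1 w <= T%:E /\ btime_ k.+1 w = btime_old_ k w].

Lemma measurable_loop_at k : measurable (loop_at k).
Proof.
have mb : meas_fun (fun w => btime_ k.+1 w).
  by apply: (@measurable_btime _ _ q Lambda T Lambda_gt0 _ _ U V r j k.+1).
have mo : meas_fun (fun w => btime_old_ k w).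
  by apply: (@measurable_btime_old _ _ q Lambda T Lambda_gt0 _ _ U V r j k).
apply: measurableI; first by apply: emeasurable_le_fun => //; exact: measurable_cst.
by rewrite -[X in measurable X]setTI; exact: measurable_eqe.
Qed.

Lemma loopsTE w : loopsT q Lambda T U V r j w = \sum_(0 <= k <oo) ind (loop_at k w).
Proof.
rewrite /loopsT /loops counting_dirac; apply: eq_eseriesr => k _.
by rewrite diracE /ind; congr (_%:R%:E); apply/idP/idP => [/set_mem/asboolP//|/asboolP/mem_set].
Qed.

Lemma measurable_loopsT : meas_fun (fun w => loopsT q Lambda T U V r j w).
Proof.
under eq_fun do rewrite loopsTE.
apply: ge0_emeasurable_sum => [k w _ _|k _]; first exact: ind_ge0.
exact: (measurable_ind (measurable_loop_at k)).
Qed.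

End loop_counts.

(** The bound on the mass turns the kernel into a finite one, as exchanging integrals requires. The
    equality of kernels lets the hypotheses be rewritten. *)
Lemma finite_kernel_bounded dX dY (X : measurableType dX) (Y : measurableType dY)
    (R : realType) (mu : R.-ker X ~> Y) (M : R) : (forall x, mu x setT <= M%:E)%E ->
  exists mu' : R.-fker X ~> Y, mu = mu'.
Proof.
case: mu => k [m] muM.
have uub : measure_fam_uub k.
  exists (M + 1)%R => x; apply: le_lt_trans (muM x) _.
  by rewrite lte_fin ltrDl ltr01.
pose H := @Kernel_isFinite.Axioms_ _ _ _ _ _ k m uub.
pose mu' : R.-fker X ~> Y := HB.pack k m H.
by exists mu'.
Qed.

Section expansion_terms.
Local Open Scope ereal_scope.
Variables (R : realType) (d N q : nat) (Lambda T : R).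
Local Notation E := 'rV[R]_d.
Variable mu : R.-ker (E * E)%type ~> (E * E)%type.
Variable Pi : R.-pker E ~> Dinf R d.
Variable P0 : probability E R.
Context {dO : measure_display} {O : measurableType dO}.
Variable P : probability O R.
Variables (U V : nat -> O -> R) (r j : nat -> O -> 'I_N) (Z : 'I_N -> O -> Dhor d T).
Hypotheses (Lambda_gt0 : (0 < Lambda)%R) (qN : (q <= N)%N) (N2 : (1 < N)%N).
Hypothesis HZ : backward_system q Lambda P Pi mu P0 U V r j Z.
Local Notation roots w := [tuple Z (widen_ord qN i) w | i < q].
Local Notation L := (loopsT q Lambda T U V r j).

Lemma measurable_roots : meas_fun (fun w => roots w).
Proof.
have [_ _ _ [tau [I [_ [Y [acc [HK [[_ _ mZ _] _ _ _]]]]]]]] := HZ.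
by apply: measurable_mktuple => i; exact: mZ.
Qed.

Lemma measurable_loops : meas_fun (fun w => L w).
Proof.
have [[mX _ _] [mr mj] _ _] := HZ.
by apply: measurable_loopsT => // k; [exact: (mX (true, k))|exact: (mX (false, k))].
Qed.

Lemma term_onE l A F : bounded_measurable F -> measurable A ->
  term_on P qN Z l A F = (N.-1%:R ^+ l)%:E * \int[P]_(w in A) (F (roots w))%:E.
Proof.
move=> [mF _] mA; rewrite /term_on -muleA cond_expectationM//.
exact: (measurableT_comp mF measurable_roots).
Qed.

Lemma expansion (n : nat) F : bounded_measurable F ->
  \int[P]_w (F (roots w))%:E =
  \sum_(l < n) (N.-1%:R ^+ l)^-1%:E * Delta P qN Lambda U V r j Z l F +
  (N.-1%:R ^+ n)^-1%:E * Deltabar P qN Lambda U V r j Z n F.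
Proof.
move=> bF; have N0 : (N.-1%:R != 0 :> R)%R by rewrite pnatr_eq0 -lt0n -subn1 subn_gt0.
have cancel l (x : \bar R) : (N.-1%:R ^+ l)^-1%:E * ((N.-1%:R ^+ l)%:E * x) = x.
  by rewrite muleA -EFinM mulVf ?mul1e// expf_neq0.
have [mF _] := bF.
rewrite (integral_levels P measurable_loops _ n); first last.
- exact: (measurableT_comp mF measurable_roots).
- by move=> w; exact: counting_cases.
congr (_ + _).
  apply: eq_bigr => l _; rewrite /Delta term_onE ?cancel//.
  by apply: (measurable_preim measurable_loops (A := [set _])).
rewrite /Deltabar term_onE ?cancel//.
by apply: emeasurable_le_fun; [exact: measurable_cst|exact: measurable_loops].
Qed.

End expansion_terms.

(** * The number of loops *)

Section levels.
Variables (R : realType) (N l : nat).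
Hypothesis N2 : (1 < N)%N.

Definition rising (K n : nat) : nat := \prod_(m < n) (K + m)%N.

Lemma rising_shift K n : (rising K.+1 n * K = rising K n * (K + n))%N.
Proof.
rewrite /rising; elim: n => [|n IH]; first by rewrite !big_ord0 addn0.
by rewrite !big_ord_recr/= mulnAC IH addSnnS.
Qed.

(* [c] loops have occurred and [K] particles are present. A loop, which occurs at rate
   at most [Lambda K^2 / (N-1)], multiplies [level] by at most [(N-1) / K^2]; a new
   particle, which arrives at rate at most [2 Lambda K], multiplies it by
   [1 + 2 (l - c) / K]. *)
Definition level (c K : nat) : R :=
  if (c <= l)%N then (rising K (2 * (l - c)))%:R / N.-1%:R ^+ (l - c) else 0.

Lemma level_ge0 c K : 0 <= level c K.
Proof. by rewrite /level; case: ifP => // _; rewrite divr_ge0// exprn_ge0. Qed.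

Lemma level_top K : level l K = 1.
Proof. by rewrite /level leqnn subnn muln0 /rising big_ord0 expr0 divr1. Qed.

Let M : R := N.-1%:R.

Let M_gt0 : 0 < M.
Proof. by rewrite ltr0n; lia. Qed.

Lemma level_new c K : (0 < K)%N -> (c < l)%N ->
  level c K.+1 = level c K + level c K * (2 * (l - c))%:R / K%:R.
Proof.
move=> K0 cl; rewrite /level (ltnW cl).
have := congr1 (fun n => n%:R : R) (rising_shift K (2 * (l - c))).
rewrite !natrM natrD natrM => e.
have K0' : K%:R != 0 :> R by rewrite pnatr_eq0 -lt0n.
have Mi : N.-1%:R ^+ (l - c) != 0 :> R by rewrite expf_neq0// gt_eqF.
apply: (mulIf K0'); rewrite mulrAC e; field.
by rewrite K0' Mi.
Qed.

(** A loop removes the last two factors of the rising factorial, each at least [K], and one power of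
    [N - 1]. *)
Lemma level_old c K : (0 < K)%N -> (c < l)%N -> level c.+1 K <= level c K * M / (K%:R * K%:R).
Proof.
move=> K0 cl; rewrite /level cl (ltnW cl).
have -> : (l - c = (l - c.+1).+1)%N by lia.
set i := (l - c.+1)%N.
have -> : (2 * i.+1 = (2 * i).+2)%N by lia.
rewrite /rising !big_ord_recr/= -/(rising K (2 * i)) !natrM exprS.
have K0' : K%:R != 0 :> R by rewrite pnatr_eq0 -lt0n.
have Mi : N.-1%:R ^+ i != 0 :> R by rewrite expf_neq0// gt_eqF.
have M0 : N.-1%:R != 0 :> R by rewrite gt_eqF.
rewrite [leRHS](_ : _ = (rising K (2 * i))%:R / N.-1%:R ^+ i *
    (((K + 2 * i)%:R / K%:R) * ((K + (2 * i).+1)%:R / K%:R))); last first.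
  by rewrite /M; field; rewrite K0' Mi M0.
apply: ler_peMr; first by rewrite divr_ge0// exprn_ge0.
have h n : 1 <= (K + n)%:R / K%:R :> R by rewrite ler_pdivlMr ?ltr0n// mul1r ler_nat leq_addr.
by rewrite -[leLHS]mulr1; apply: ler_pM.
Qed.

Lemma pair_weight_le1 (C : {set 'I_N}) p : pair_weight C p <= 1 :> R.
Proof.
rewrite /pair_weight; case: (p.1 \in C); case: (p.2 \in C); case: eqP => _ /=;
  rewrite ?(add0r, addr0, mul0r)//; lra.
Qed.

(** The generator bound that fixes the constant. With N particles to choose from, arrivals
    contribute at most Lambda / (N-1) times K N times 2 (l - c) / K, which is at most 4 l Lambda as
    N <= 2 (N-1). Loops contribute at most Lambda / (N-1) times K^2 times (N-1) / K^2 = Lambda. *)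
Lemma level_drift (C : {set 'I_N}) c Lambda : 0 < Lambda -> (c < l)%N ->
  \sum_p Lambda / M * pair_weight C p * level (c + (p.2 \in C)) #|p.2 |: C|%SET <=
  (Lambda / M * total_weight R C + (4 * l + 1)%:R * Lambda) * level c #|C|.
Proof.
move=> La0 cl; set K := #|C|; set g := level c K.
have g0 : 0 <= g by exact: level_ge0.
have e (Q : pred ('I_N * 'I_N)) : \sum_p (Q p)%:R = #|Q|%:R :> R.
  by rewrite -natr_sum -sum1_card [in RHS]big_mkcond.
pose i2 : R := (2 * (l - c))%:R.
have step p : pair_weight C p * level (c + (p.2 \in C)) #|p.2 |: C|%SET <=
    pair_weight C p * g + (p.1 \in C)%:R * (g * i2 / K%:R) +
      ((p.1 \in C) && (p.2 \in C))%:R * (g * M / (K%:R * K%:R)).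
  have [p1|p1] := boolP (p.1 \in C); last first.
    by rewrite /pair_weight (negbTE p1)/= !(mul0r, addr0).
  have K0 : (0 < K)%N by rewrite card_gt0; apply/set0Pn; exists p.1.
  have w0 : 0 <= pair_weight C p :> R by exact: pair_weight_ge0.
  have w1 := pair_weight_le1 C p.
  rewrite cardsU1; have [p2|p2] := boolP (p.2 \in C); rewrite /= !mul1r.
    rewrite add0n addn1; apply: (@le_trans _ _ (g * M / (K%:R * K%:R))).
      apply: le_trans (level_old K0 cl); apply: ler_piMl => //; exact: level_ge0.
    rewrite lerDr addr_ge0 ?mulr_ge0// ?invr_ge0//; exact: ler0n.
  rewrite add1n addn0 mul0r addr0 (level_new K0 cl) mulrDr lerD2l.
  by apply: ler_piMl => //; rewrite !mulr_ge0// ?invr_ge0 ?ler0n.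
apply: (@le_trans _ _ (Lambda / M * \sum_p (pair_weight C p * g +
    (p.1 \in C)%:R * (g * i2 / K%:R) +
    ((p.1 \in C) && (p.2 \in C))%:R * (g * M / (K%:R * K%:R))))).
  rewrite mulr_sumr; apply: ler_sum => p _; rewrite -mulrA; apply: ler_wpM2l; last exact: step.
  by rewrite divr_ge0// ltW.
rewrite !big_split/= -!mulr_suml sum_pair_weight -/(total_weight R C) !e.
rewrite (eq_card (B := finset.setX C [set: 'I_N]%SET)); last by move=> p; rewrite !inE andbT.
rewrite [X in _ * (_ + X%:R * _) <= _](eq_card (B := finset.setX C C)); last by move=> p; rewrite !inE.
rewrite !cardsX cardsT card_ord -/K.
have iM : i2 * N%:R <= 4 * l%:R * M.
  rewrite /i2 /M -!natrM ler_nat; nia.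
have KK : K%:R / K%:R <= 1 :> R.
  by have [->|K0] := eqVneq K 0; rewrite ?mul0r// divff// pnatr_eq0.
have KK0 : 0 <= K%:R / K%:R :> R by rewrite divr_ge0.
rewrite [leRHS](_ : _ = Lambda / M * (total_weight R C * g + (4 * l%:R * M + M) * g)); last first.
  by rewrite natrD natrM; field; rewrite gt_eqF.
apply: ler_wpM2l; first by rewrite divr_ge0// ltW.
rewrite -addrA lerD2l [leRHS]mulrDl; apply: lerD.
  rewrite [leLHS](_ : _ = (K%:R / K%:R) * ((i2 * N%:R) * g)); last by rewrite natrM; ring.
  apply: (@le_trans _ _ (1 * ((i2 * N%:R) * g))).
    by apply: ler_wpM2r => //; rewrite !mulr_ge0 ?ler0n.
  by rewrite mul1r; apply: ler_wpM2r.
rewrite [leLHS](_ : _ = ((K%:R / K%:R) * (K%:R / K%:R)) * (M * g)); last first.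
  by rewrite natrM invfM; ring.
apply: (@le_trans _ _ (1 * (M * g))); last by rewrite mul1r.
apply: ler_wpM2r; first by rewrite mulr_ge0// ltW.
by rewrite -[leRHS]mulr1; apply: ler_pM.
Qed.

End levels.

Lemma measurable_nat_fun dS (S : measurableType dS) dY (Y : measurableType dY)
    (c : S -> nat) (g : nat -> S -> Y) : (forall n, measurable [set w | c w = n]) ->
  (forall n, meas_fun (g n)) -> meas_fun (fun w => g (c w) w).
Proof.
move=> mc mg _ B mB; rewrite setTI.
rewrite (_ : _ @^-1` _ = \bigcup_n ([set w | c w = n] `&` g n @^-1` B)).
  apply: bigcup_measurable => n _; apply: measurableI; first exact: mc.
  exact: (measurable_preim (mg n) mB).
apply/seteqP; split=> w /=; first by move=> h; exists (c w).
by move=> [n _ [<-]].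
Qed.

(** The integral of a nonnegative function is a supremum over the simple functions below it, hence
    monotone for arbitrary functions. *)
Lemma le_ge0_integral d (T : measurableType d) (R : realType) (m : {measure set T -> \bar R})
    (f g : T -> \bar R) : (forall x, 0 <= f x)%E -> (forall x, f x <= g x)%E ->
  (\int[m]_x f x <= \int[m]_x g x)%E.
Proof.
move=> f0 fg; have g0 x : (0 <= g x)%E by exact: le_trans (f0 x) (fg x).
rewrite !ge0_integralTE//; apply: ereal_sup_le => _ [h hf <-]; exists h => // x.
exact: le_trans (hf x) (fg x).
Qed.

Lemma card_roots (q N : nat) : (q <= N)%N -> #|[set i : 'I_N | (i < q)%N]%SET| = q.
Proof.
move=> qN; have inj : injective (widen_ord qN) by move=> x y /(congr1 val)/= /val_inj.
rewrite -[RHS]card_ord -(card_imset _ inj); apply: eq_card => i; rewrite inE.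
apply/idP/imsetP => [iq|[x _ ->]]; last exact: (ltn_ord x).
by exists (Ordinal iq) => //; exact: val_inj.
Qed.

Section loop_bound.
Local Open Scope ereal_scope.
Context dO (O : measurableType dO) (R : realType) (P : probability O R).
Variables (N q l : nat) (Lambda T : R).
Variables (U V : nat -> O -> R) (r j : nat -> O -> 'I_N).
Hypotheses (Lambda_gt0 : (0 < Lambda)%R) (T_gt0 : (0 < T)%R) (N2 : (1 < N)%N) (l0 : (0 < l)%N).
Hypothesis qN : (q <= N)%N.
Local Notation X := (fun c : bool * nat => if c.1 then U c.2 else V c.2).
Hypothesis HX : iid_exponential P 1 X.
Hypotheses (mr : forall k, fin_measurable (r k)) (mj : forall k, fin_measurable (j k)).
Hypothesis draws : uniform_draws q Lambda T P U V r j.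
Local Notation btime_ k w := (btime q Lambda T (U ^~ w) (V ^~ w) (r ^~ w) (j ^~ w) k).
Local Notation bset_ k w := (bset q Lambda T (U ^~ w) (V ^~ w) (r ^~ w) (j ^~ w) k).
Local Notation btime_new_ k w := (btime_new q Lambda T (U ^~ w) (V ^~ w) (r ^~ w) (j ^~ w) k).
Local Notation btime_old_ k w := (btime_old q Lambda T (U ^~ w) (V ^~ w) (r ^~ w) (j ^~ w) k).
Local Notation clock k w := (fine (btime_ k w)).
Local Notation alive := (alive_at q Lambda T U V r j).
Local Notation hist := (hist U V r j).
Local Notation drawn := (drawn r j).
Local Notation rate := (Lambda / N.-1%:R)%R.
Local Notation loop := (loop_at q Lambda T U V r j).
Local Notation a := ((4 * l + 1)%:R * Lambda)%R.

Lemma ae_loop : {ae P, forall w, forall k, alive k.+1 w -> loop k w <-> j k w \in bset_ k w}.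
Proof.
apply: filterS2 (ae_history Lambda_gt0 HX mr mj draws) (ae_loop_draw Lambda_gt0 HX mr mj draws).
move=> w h1 h2 k al; split=> [[_ e]|jk]; first exact: h2.
have [_ _ le _] := h1 k al; split; first exact: ltW.
by rewrite btimeS; apply/min_idPr; rewrite ltW// ltNge le jk.
Qed.

(** Loops are recognised by the draws rather than by the times, which makes the count measurable for
    [hist k]. By [ae_loop] it agrees almost surely with the count by times. *)
Definition loop_count k w : nat := \sum_(m < k) (j m w \in bset_ m w).

Definition potential k w : R := (expR (a * (T - clock k w)) * level R N l (loop_count k w) #|bset_ k w|)%R.

Definition first_reached k : set O :=
  [set w | [/\ alive k.+1 w, (loop_count k w < l)%N & loop_count k.+1 w = l]].

Let refl k := @subset_refl _ (hist k).

Let hist_le m k : (m <= k)%N -> hist m `<=` hist k.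
Proof.
move=> mk; pose s (i : 'I_m) : 'I_k := widen_ord mk i.
by move=> A [[[]|]|] [i _ h]; [do 3 left|do 2 left; right|left; right|right]; exists (s i).
Qed.

Let mloop_count k n m : (m <= k)%N ->
  @measurable _ (sigma_of (hist k)) [set w | loop_count m w = n].
Proof.
pose S := sigma_of (hist k); rewrite /loop_count.
elim: m n => [|m IH] n mk.
  rewrite (_ : mkset _ = [set w | 0%N = n]); last first.
    by apply/seteqP; split=> w /=; rewrite big_ord0.
  have [<-|n0] := eqVneq 0%N n.
    by rewrite (_ : mkset _ = setT); [exact: (@measurableT _ S)|apply/seteqP; split].
  rewrite (_ : mkset _ = set0); first exact: (@measurable0 _ S).
  by apply/seteqP; split=> // w /= /eqP; rewrite (negbTE n0).
have mj' : @measurable _ S [set w | j m w \in bset_ m w].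
  rewrite (_ : mkset _ = [set w | forall x, j m w = x -> x \in bset_ m w]); last first.
    by apply/seteqP; split=> w /= h; [move=> _ <-|exact: h].
  apply: (@measurable_forall_fin _ S) => x; apply: (@measurable_imply _ S).
    apply: sub_sigma_algebra; right; exists (Ordinal mk) => //.
    by exists [set x] => //; rewrite setTI.
  have h := @fin_measurable_fun R _ S _ _ (fun C : {set 'I_N} => (x \in C)%:R)
    (hist_bset q T Lambda_gt0 (hist_le (ltnW mk))).
  have := measurable_preim h (measurable_set1 (1%R : R)).
  congr (@measurable _ S); apply/seteqP; split=> w /=; case: (x \in _) => //= /eqP;
    by rewrite eq_sym oner_eq0.
rewrite (_ : mkset _ =
    ([set w | j m w \in bset_ m w] `&` [set w | (\sum_(i < m) (j i w \in bset_ i w)).+1%N = n]) `|`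
    (~` [set w | j m w \in bset_ m w] `&` [set w | (\sum_(i < m) (j i w \in bset_ i w))%N = n])).
  apply: (@measurableU _ S); apply: (@measurableI _ S) => //.
  - case: n => [|n]; last first.
      have := IH n (ltnW mk); congr (@measurable _ S).
      by apply/seteqP; split=> w /= => [->|[]].
    rewrite (_ : mkset _ = set0); first exact: (@measurable0 _ S).
    by apply/seteqP; split.
  - exact: (@measurableC _ S).
  - exact: IH (ltnW mk).
apply/seteqP; split=> w /=; rewrite big_ord_recr/=.
  case: (boolP (j m w \in bset_ m w)) => h; rewrite ?addn1 ?addn0; first by left.
  by right; split=> //; exact/negP.
by case=> -[]; case: (boolP (j m w \in bset_ m w)) => //= _ _; rewrite ?addn1 ?addn0.
Qed.

Let mlevel k (f : nat -> {set 'I_N} -> R) :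
  measurable_fun (setT : set (sigma_of (hist k))) (fun w => f (loop_count k w) (bset_ k w)).
Proof.
pose S := sigma_of (hist k).
apply: (@measurable_nat_fun _ S _ R (loop_count k) (fun n w => f n (bset_ k w))).
  by move=> n; exact: mloop_count.
by move=> n; exact: (@fin_measurable_fun R _ S _ _ (f n) (hist_bset q T Lambda_gt0 (@refl k))).
Qed.

Let mclock k : measurable_fun (setT : set (sigma_of (hist k))) (fun w => clock k w).
Proof.
have hf : meas_fun (@fine R) by [].
exact: (measurableT_comp hf (hist_btime q T Lambda_gt0 (@refl k))).
Qed.

Let idh k : meas_fun (id : O -> sigma_of (hist k)).
Proof. exact: measurable_id_sub (hist_sub HX mr mj (k := k)). Qed.

Let malive k : measurable (alive k).
Proof. exact: (measurable_preim (@idh k) (hist_alive q T Lambda_gt0 (@refl k))). Qed.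

Let mcount k n : measurable [set w | loop_count k w = n].
Proof. exact: (measurable_preim (@idh k) (mloop_count n (leqnn k))). Qed.

Let mcount_lt k : measurable [set w | (loop_count k w < l)%N].
Proof.
have h := measurableT_comp (@mlevel k (fun c _ => (c < l)%N%:R)) (@idh k).
have := measurable_preim h (measurable_set1 (1%R : R)).
congr measurable; apply/seteqP; split=> w /=; case: (_ < l)%N => //= /eqP.
by rewrite eq_sym oner_eq0.
Qed.

Lemma measurable_potential k : meas_fun (potential k).
Proof.
have h : measurable_fun (setT : set (sigma_of (hist k))) (potential k).
  apply: measurable_funM; last exact: (@mlevel k (fun c C => level R N l c #|C|)).
  apply: measurableT_comp => //; apply: measurable_funM; first exact: measurable_cst.
  by apply: measurable_funB; [exact: measurable_cst|exact: mclock].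
exact: (measurableT_comp h (@idh k)).
Qed.

Lemma measurable_first_reached k : measurable (first_reached k).
Proof.
rewrite (_ : first_reached k = alive k.+1 `&` ([set w | (loop_count k w < l)%N] `&`
  [set w | loop_count k.+1 w = l])).
  by apply: measurableI => //; apply: measurableI.
by apply/seteqP; split=> w /= => [[]|[? []]].
Qed.

Lemma potential_ge0 k w : (0 <= potential k w)%R.
Proof. by rewrite mulr_ge0 ?expR_ge0 ?level_ge0. Qed.

Let active k w : Prop := alive k w /\ (loop_count k w < l)%N.

Let mactive k : measurable [set w | active k w].
Proof. exact (measurableI _ _ (@malive k) (@mcount_lt k)). Qed.

Let active_potential_ge0 k w : 0 <= ind (active k w) * (potential k w)%:E.
Proof. by rewrite mule_ge0// lee_fin potential_ge0. Qed.

Let mactive_potential k : meas_fun (fun w => ind (active k w) * (potential k w)%:E).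
Proof.
apply: emeasurable_funM; first exact: (measurable_ind (@mactive k)).
by apply/measurable_EFinP; exact: measurable_potential.
Qed.

(** One step of the supermartingale, restricted to the outcomes with fewer than [l] loops. When the
    l-th loop occurs the potential leaves the left integral with a value at least 1, which pays for
    the probability of this event. *)
Lemma potential_step k :
  \int[P]_w (ind (active k.+1 w) * (potential k.+1 w)%:E) + P (first_reached k) <=
  \int[P]_w (ind (active k w) * (potential k w)%:E).
Proof.
pose Phi (w : O) (s : R) (c : 'I_N * 'I_N) : \bar R :=
  ind (loop_count k w < l)%N *
  (expR (a * (T - clock k w - s)) *
   level R N l (loop_count k w + (c.2 \in bset_ k w)) #|c.2 |: bset_ k w|%SET)%:E.
have Phi0 w s c : 0 <= Phi w s c.
  by rewrite mule_ge0// lee_fin mulr_ge0 ?expR_ge0 ?level_ge0.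
have a0 : (0 <= a)%R by rewrite mulr_ge0// ltW.
have mPhi c : measurable_fun (setT : set (sigma_of (hist k) * R))
    (fun p => Phi p.1 p.2 c).
  pose S := sigma_of (hist k).
  have mfst : meas_fun (fst : S * R -> S) by exact: measurable_fst.
  apply: emeasurable_funM.
    apply: measurable_ind.
    have h := measurableT_comp (@mlevel k (fun c _ => (c < l)%N%:R)) mfst.
    have := measurable_preim h (measurable_set1 (1%R : R)).
    congr measurable; apply/seteqP; split=> w /=; case: (_ < l)%N => //= /eqP.
    by rewrite eq_sym oner_eq0.
  apply/measurable_EFinP; apply: measurable_funM; last first.
    exact: (measurableT_comp (@mlevel k (fun n C =>
      level R N l (n + (c.2 \in C)) #|c.2 |: C|%SET)) mfst).
  apply: measurableT_comp => //; apply: measurable_funM; first exact: measurable_cst.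
  apply: measurable_funB; last exact: measurable_snd.
  apply: measurable_funB; first exact: measurable_cst.
  exact: (measurableT_comp (@mclock k) mfst).
apply: (@le_trans _ _ (\int[P]_w (ind (alive k.+1 w) *
    Phi w (clock k.+1 w - clock k w)%R (drawn k w)))).
  rewrite -(integral_ind P (measurable_first_reached k)) -ge0_integralD//; last first.
    exact: (measurable_ind (measurable_first_reached k)).
  apply: ae_ge0_le_integral => //.
  - by move=> w _; rewrite adde_ge0.
  - apply: emeasurable_funD => //; exact: (measurable_ind (measurable_first_reached k)).
  - by move=> w _; rewrite mule_ge0.
  - apply: emeasurable_funM; first exact: (measurable_ind (malive k.+1)).
    apply: (measurable_fin_case (k := drawn k) (f := fun c w =>
      Phi w (clock k.+1 w - clock k w)%R c)) => [[x y]|c].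
      rewrite (_ : _ @^-1` _ = r k @^-1` [set x] `&` j k @^-1` [set y]).
        by apply: measurableI; [exact: mr|exact: mj].
      by apply/seteqP; split=> w; rewrite /drawn /preimage/= => -[-> ->].
    have m : meas_fun (fun w : O =>
        (w : sigma_of (hist k), (clock k.+1 w - clock k w)%R)).
      apply/measurable_fun_pairP; split; first exact: idh.
      apply: measurable_funB.
        exact: (measurableT_comp (@mclock k.+1) (@idh k.+1)).
      exact: (measurableT_comp (@mclock k) (@idh k)).
    exact: (measurableT_comp (mPhi c) m).
  apply: filterS (ae_history Lambda_gt0 HX mr mj draws) => w h _.
  have [al|nal] := pselect (alive k.+1 w); last first.
    by rewrite (indF nal) mul0e !indF ?mul0e ?adde0// => -[].
  have [_ _ _ bS] := h k al; rewrite (indT al) mul1e.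
  have cS : loop_count k.+1 w = (loop_count k w + (j k w \in bset_ k w))%N.
    by rewrite /loop_count big_ord_recr.
  have [cl|cl] := boolP (loop_count k w < l)%N; last first.
    rewrite !indF ?mul0e ?adde0//; first by case=> _ h1 _; rewrite h1 in cl.
    by case=> _; rewrite cS => h1; move: cl; rewrite (leq_ltn_trans _ h1)// leq_addr.
  have -> : Phi w (clock k.+1 w - clock k w)%R (drawn k w) = (potential k.+1 w)%:E.
    rewrite /Phi indT// mul1e /potential bS cS /drawn/=; congr ((expR (_ * _) * _)%:E); ring.
  have [cl'|cl'] := boolP (loop_count k.+1 w < l)%N.
    rewrite indT// mul1e indF ?adde0// => -[_ _ e]; by rewrite e ltnn in cl'.
  rewrite indF; last by case=> _; rewrite (negbTE cl').
  rewrite mul0e add0e; have e : loop_count k.+1 w = l.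
    by move: cl cl'; rewrite cS -leqNgt; case: (_ \in _) => /=; lia.
  (* At the l-th loop the level is 1, and the exponential factor is at least 1 before [T]. *)
  rewrite indT// lee_fin /potential e level_top mulr1 -[X in (X <= _)%R]expR0 ler_expR.
  apply: mulr_ge0 => //; rewrite subr_ge0 -lee_fin fineK ?ltW// ge0_fin_numE ?btime_ge0//.
  exact: lt_trans al (ltry _).
rewrite (one_step Lambda_gt0 HX mr mj draws)//.
have w0 C c : (0 <= rate * pair_weight C c :> R)%R.
  by rewrite mulr_ge0 ?pair_weight_ge0// divr_ge0// ltW.
apply: le_ge0_integral => w.
  rewrite mule_ge0//; apply: integral_ge0 => s _; rewrite !mule_ge0 ?lee_fin ?expR_ge0//.
  by apply: sume_ge0 => c _; rewrite mule_ge0// lee_fin.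
rewrite /active ind_and -muleA; apply: le_indM => al.
set C := bset_ k w; set g := level R N l (loop_count k w) #|C|.
have [cl|cl] := pselect (loop_count k w < l)%N; last first.
  rewrite indF// mul0e integral0_eq// => s _; rewrite big1 ?mule0// => c _.
  by rewrite /Phi indF// mul0e mule0.
rewrite indT// mul1e.
have u0 : (0 < T - clock k w)%R.
  rewrite subr_gt0 -lte_fin fineK// ge0_fin_numE ?btime_ge0//.
  exact: lt_trans al (ltry _).
set u := (T - clock k w)%R in u0 *.
pose rho : R := (rate * total_weight R C)%R.
have rho0 : (0 <= rho)%R.
  rewrite /rho mulr_ge0//; first by rewrite divr_ge0// ltW.
  by rewrite /total_weight -sum_pair_weight sumr_ge0// => c _; exact: pair_weight_ge0.
have ra0 : (0 < rho + a)%R.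
  by rewrite ltr_wpDl// mulr_gt0// ltr0n addn1.
(* The current potential is written as an integral against the exponential law of rate [rho + a],
   whose mass is 1. By [level_drift] its integrand dominates that of the next event. *)
have := integral_exp_law ra0 (f := cst (expR (a * u) * g)%:E) (measurable_cst _).
rewrite integral_cst// [X in _ * X](_ : _ = 1); last first.
  exact: (@probability_setT _ _ _ (exp_probability ra0)).
rewrite mule1 => -> //; last by move=> s; rewrite lee_fin mulr_ge0 ?expR_ge0 ?level_ge0.
apply: le_ge0_integral => s.
  rewrite !mule_ge0 ?lee_fin ?expR_ge0//.
  by apply: sume_ge0 => c _; rewrite mule_ge0// lee_fin.
have [/andP[s0 su]|ns] := pselect (0 < s < u)%R; last first.
  by rewrite indF// mul0e !mule_ge0// lee_fin !mulr_ge0 ?expR_ge0 ?level_ge0// ltW.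
rewrite !indT ?s0// !mul1e.
rewrite (eq_bigr (fun c => (expR (a * (u - s)) * (rate * pair_weight C c *
  level R N l (loop_count k w + (c.2 \in C)) #|c.2 |: C|%SET))%:E)); last first.
  move=> c _; rewrite /Phi indT// mul1e -EFinM; congr (_%:E); rewrite -/C; ring.
rewrite sumEFin -EFinM lee_fin -mulr_sumr.
have := level_drift N2 C Lambda_gt0 cl; rewrite -/rho => drift.
apply: (@le_trans _ _ (expR (- rho * s) * (expR (a * (u - s)) * ((rho + a) * g)))%R).
  by apply: ler_wpM2l; [exact: expR_ge0|apply: ler_wpM2l; [exact: expR_ge0|exact: drift]].
rewrite le_eqVlt; apply/orP; left; apply/eqP.
have -> : (expR (a * (u - s)) = expR (a * u) * expR (- a * s))%R.
  by rewrite -expRD; congr expR; ring.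
have -> : (expR (- (rho + a) * s) = expR (- rho * s) * expR (- a * s))%R.
  by rewrite -expRD; congr expR; ring.
by ring.
Qed.

Lemma first_reached_bound n :
  \sum_(k < n) P (first_reached k) <= \int[P]_w (ind (active 0%N w) * (potential 0 w)%:E).
Proof.
suff h : \int[P]_w (ind (active n w) * (potential n w)%:E) + \sum_(k < n) P (first_reached k) <=
    \int[P]_w (ind (active 0%N w) * (potential 0 w)%:E).
  apply: le_trans h; rewrite leeDr//; apply: integral_ge0 => w _.
  by rewrite mule_ge0// lee_fin potential_ge0.
elim: n => [|n IH]; first by rewrite big_ord0 adde0.
apply: le_trans IH; rewrite big_ord_recr/= [X in _ + X]addeC addeA.
by apply: leeD2r; exact: potential_step.
Qed.

Hypothesis ended_at_T : {ae P, forall w, forall k, btime_ k.+1 w < +oo -> alive k.+1 w}.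

(** A series of indicators that reaches [l] does so at a finite partial sum; the least such index is
    the event at which the l-th loop occurs. *)
Lemma ae_first_reached : {ae P, forall w, l%:R%:E <= loopsT q Lambda T U V r j w ->
  exists k, first_reached k w}.
Proof.
apply: filterS2 ae_loop ended_at_T => w hl he; rewrite loopsTE => lw.
pose s n := (\sum_(m < n) `[< loop m w >])%N.
have sE n : \sum_(0 <= m < n) ind (loop m w) = (s n)%:R%:E :> \bar R.
  by rewrite big_mkord /s natr_sum -sumEFin.
have [n ln] : exists n, (l <= s n)%N.
  apply: contrapT => nex.
  have : \sum_(0 <= m <oo) ind (loop m w) <= (l.-1)%:R%:E :> \bar R.
    apply: lime_le; first by apply: is_cvg_nneseries => m _ _; exact: ind_ge0.
    near=> n; rewrite sE lee_fin ler_nat -ltnS prednK//.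
    by rewrite ltnNge; apply/negP => h; apply: nex; exists n.
  move=> h; have := le_trans lw h; rewrite lee_fin ler_nat; lia.
have [m lm min] := ex_minnP (ex_intro (fun n => l <= s n)%N n ln).
have sS p : s p.+1 = (s p + `[<loop p w>])%N by rewrite /s big_ord_recr.
case: m lm min => [|k] lm min.
  by move: lm; rewrite /s big_ord0 leqNgt l0.
have sk : (s k < l)%N by rewrite ltnNge; apply/negP => /min; rewrite ltnn.
have lk : loop k w.
  by apply: contrapT => nl; move: lm; rewrite sS asboolF// addn0 leqNgt sk.
have al : alive k.+1 w by apply: he; rewrite (le_lt_trans lk.1) ?ltry.
have cE p : (p <= k.+1)%N -> loop_count p w = s p.
  move=> pk; apply: eq_bigr => i _; congr (nat_of_bool _); apply/idP/asboolP => /hl; apply;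
    exact: alive_mono (leq_trans (ltn_ord i) pk) al.
exists k; split=> //; first by rewrite cE.
by rewrite cE//; move: lm sk; rewrite sS; case: `[<_>] => /=; lia.
Unshelve. all: by end_near.
Qed.

Lemma loop_tail : P [set w | l%:R%:E <= loopsT q Lambda T U V r j w] <=
  (expR (a * T) * level R N l 0 q)%:E.
Proof.
have [mX _ _] := HX.
have mL : meas_fun (fun w => loopsT q Lambda T U V r j w).
  by apply: measurable_loopsT => // k; [exact: (mX (true, k))|exact: (mX (false, k))].
have mA : measurable [set w | l%:R%:E <= loopsT q Lambda T U V r j w].
  by apply: emeasurable_le_fun => //; exact: measurable_cst.
have mB k : meas_fun (fun w => @ind R (first_reached k w)).
  exact: (measurable_ind (measurable_first_reached k)).
rewrite -integral_ind//.
apply: (@le_trans _ _ (\int[P]_w \sum_(0 <= k <oo) ind (first_reached k w))).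
  apply: ae_ge0_le_integral => //.
  - exact: measurable_ind.
  - by move=> w _; apply: nneseries_ge0 => k _ _; exact: ind_ge0.
  - by apply: ge0_emeasurable_sum => [k w _ _|k _]; [exact: ind_ge0|exact: mB].
  apply: filterS ae_first_reached => w h _.
  have [lw|nlw] := pselect (l%:R%:E <= loopsT q Lambda T U V r j w); last first.
    by rewrite indF//; apply: nneseries_ge0 => k _ _; exact: ind_ge0.
  have [k hk] := h lw; rewrite (nneseries_split 0 k.+1)//.
  rewrite add0n big_nat_recr//= (indT hk) (le_trans (ind_le1 _))// -addeA addeC -addeA leeDl//.
  by rewrite adde_ge0//; [apply: nneseries_ge0 => i _ _|apply: sume_ge0 => i _]; exact: ind_ge0.
rewrite integral_nneseries//.
apply: lime_le.
  by apply: is_cvg_nneseries => k _ _; apply: integral_ge0 => w _; exact: ind_ge0.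
near=> n; rewrite big_mkord (eq_bigr (fun k : 'I_n => P (first_reached k))); last first.
  by move=> k _; rewrite integral_ind//; exact: measurable_first_reached.
apply: le_trans (first_reached_bound n) _.
apply: (@le_trans _ _ (\int[P]_w (expR (a * T) * level R N l 0 q)%:E)); last first.
  rewrite integral_cst// -[leRHS]mule1; apply: lee_wpmul2l; last exact: probability_le1.
  by rewrite lee_fin mulr_ge0 ?expR_ge0 ?level_ge0.
apply: le_ge0_integral => // w; rewrite /potential /loop_count big_ord0 bset0// subr0.
rewrite card_roots//.
rewrite -[leRHS]mul1e; apply: lee_wpmul2r; last exact: ind_le1.
by rewrite lee_fin mulr_ge0 ?expR_ge0 ?level_ge0.
Unshelve. all: by end_near.
Qed.

End loop_bound.

Section bounded_terms.
Local Open Scope ereal_scope.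
Variables (R : realType) (d N q : nat) (Lambda T : R).
Local Notation E := 'rV[R]_d.
Variable mu : R.-ker (E * E)%type ~> (E * E)%type.
Variable Pi : R.-pker E ~> Dinf R d.
Variable P0 : probability E R.
Context {dO : measure_display} {O : measurableType dO}.
Variable P : probability O R.
Variables (U V : nat -> O -> R) (r j : nat -> O -> 'I_N) (Z : 'I_N -> O -> Dhor d T).
Hypotheses (Lambda_gt0 : (0 < Lambda)%R) (T_gt0 : (0 < T)%R).
Hypotheses (qN : (q <= N)%N) (N2 : (1 < N)%N).
Hypothesis HZ : backward_system q Lambda P Pi mu P0 U V r j Z.
Local Notation roots w := [tuple Z (widen_ord qN i) w | i < q].
Local Notation L := (loopsT q Lambda T U V r j).

(** The powers of [N - 1] cancel between the scaling and the initial [level], which leaves a bound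
    free of [N]. *)
Definition tail_bound l : R := (expR ((4 * l + 1)%:R * Lambda * T) * (rising q (2 * l))%:R)%R.

Lemma scaled_loop_tail l : (N.-1%:R ^+ l)%:E * P [set w | l%:R%:E <= L w] <= (tail_bound l)%:E.
Proof.
case: l => [|l].
  rewrite expr0 mul1e; apply: (le_trans (probability_le1 P _)).
    by apply: emeasurable_le_fun; [exact: measurable_cst|exact: (measurable_loops Lambda_gt0 HZ)].
  rewrite lee_fin /tail_bound /rising muln0 big_ord0 mulr1 -[X in (X <= _)%R]expR0 ler_expR.
  by rewrite !mulr_ge0// ltW.
have [HX [mr mj] draws [tau [I [Hae _]]]] := HZ.
have ended : {ae P, forall w, forall k,
    btime q Lambda T (U ^~ w) (V ^~ w) (r ^~ w) (j ^~ w) k.+1 < +oo ->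
    alive_at q Lambda T U V r j k.+1 w}.
  by apply: filterS Hae => w en k; exact: (enumerates_alive en).
have N0 : (0 < N.-1%:R :> R)%R by rewrite ltr0n; lia.
have h := loop_tail Lambda_gt0 T_gt0 N2 (ltn0Sn l) qN HX mr mj draws ended.
apply: (@le_trans _ _ ((N.-1%:R ^+ l.+1)%:E * (expR ((4 * l.+1 + 1)%:R * Lambda * T) * level R N l.+1 0 q)%:E)).
  by apply: lee_wpmul2l => //; rewrite lee_fin exprn_ge0.
rewrite -EFinM lee_fin /tail_bound /level subn0 /= le_eqVlt; apply/orP; left; apply/eqP.
by rewrite mulrCA; congr (_ * _)%R; rewrite mulrCA divff ?mulr1// expf_neq0// gt_eqF.
Qed.

(** The measure is the law of the roots on [A], multiplied by (N-1)^l; its mass is controlled by the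
    scaled tail because at least [l] loops occur on [A]. *)
Lemma bounded_term l (A : set O) (C : R) : measurable A ->
  A `<=` [set w | l%:R%:E <= L w] -> (tail_bound l <= C)%R ->
  is_measure_bounded_by C (term_on P qN Z l A).
Proof.
move=> mA AL lC; have c0 : (0 <= N.-1%:R ^+ l :> R)%R by rewrite exprn_ge0.
have mroots := measurable_roots qN HZ.
have mL : measurable [set w | l%:R%:E <= L w].
  by apply: emeasurable_le_fun; [exact: measurable_cst|exact: (measurable_loops Lambda_gt0 HZ)].
pose m : {measure set (q.-tuple (Dhor d T)) -> \bar R} :=
  mscale (NngNum c0) (image_measure (mrestr P mA) mroots).
have key G : meas_fun G -> (forall x, 0 <= G x) ->
    \int[m]_x G x = (N.-1%:R ^+ l)%:E * \int[P]_(w in A) G (roots w).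
  move=> mG G0; rewrite ge0_integral_mscale//; congr (_ * _).
  rewrite integral_image// integral_mrestr//.
  exact: (measurableT_comp mG mroots).
exists m; split.
  have mT : m setT = (N.-1%:R ^+ l)%:E * P A.
    have := key (cst 1) (measurable_cst _) (fun=> lee01).
    by rewrite !integral_cst// !mul1e.
  apply: (@le_trans _ _ (tail_bound l)%:E); last by rewrite lee_fin.
  rewrite [leLHS]mT.
  apply: le_trans (scaled_loop_tail l); apply: lee_wpmul2l; first by rewrite lee_fin.
  by apply: le_measure => //; rewrite inE.
move=> F bF; have [mF _] := bF; rewrite (term_onE qN HZ)//.
have iA : P.-integrable A (fun w => (F (roots w))%:E).
  apply: integrableS (bounded_integrable P (bounded_measurable_comp bF mroots)) => //.
have mF' : meas_fun (EFin \o F) by exact: measurableT_comp.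
rewrite [in RHS]integralE (key _ (measurable_funepos mF') (funepos_ge0 _)).
rewrite (key _ (measurable_funeneg mF') (funeneg_ge0 _)).
rewrite [in LHS]integralE muleBr//; last first.
  exact: integrable_add_def.
congr (_ * _ - _ * _); apply: eq_integral => w _; first by rewrite !funeposE.
by rewrite !funenegE.
Qed.

End bounded_terms.

Theorem theorem2p4 (R : realType) (d : nat) (hd : (1 <= d)%N)
    (Lambda : R) (hLambda : 0 < Lambda)
    (Pi : R.-pker 'rV[R]_d ~> Dinf R d) (hPi : markov_process Pi)
    (DL : set ('rV[R]_d -> R)) (L : ('rV[R]_d -> R) -> 'rV[R]_d -> R)
    (hL : is_generator Pi DL L)
    (mu : R.-ker ('rV[R]_d * 'rV[R]_d) ~> ('rV[R]_d * 'rV[R]_d)%type)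
    (hmu_sym : symmetric_kernel mu)
    (hmu_le : (ereal_sup [set mu x setT | x in setT]
               <= Lambda%:E)%E)
    (P0 : probability 'rV[R]_d R)
    (q : nat) (hq : (1 <= q)%N) (T : R) (hT : 0 < T)
    (l0 : nat) (hl0 : (1 <= l0)%N) :
  (forall (N : nat) (hqN : (q <= N)%N) (hN : (2 <= N)%N)
      (F : q.-tuple (Dhor d T) -> R),
     bounded_measurable F -> symmetric_fun F ->
   forall (dO : measure_display) (O : measurableType dO) (P : probability O R)
      (Zbar : 'I_N -> O -> Dinf R d),
     particle_system Lambda Pi mu P0 P Zbar ->
   forall (dO' : measure_display) (O' : measurableType dO')
      (P' : probability O' R) (U V : nat -> O' -> R) (r j : nat -> O' -> 'I_N)
      (Z : 'I_N -> O' -> Dhor d T),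
     backward_system q Lambda P' Pi mu P0 U V r j Z ->
   ('E_P[fun w => empirical (fun i => restr T (Zbar i w)) F] =
    \sum_(l < l0.+1)
      (N.-1%:R ^+ l)^-1%:E * Delta P' hqN Lambda U V r j Z l F +
    (N.-1%:R ^+ l0.+1)^-1%:E * Deltabar P' hqN Lambda U V r j Z l0.+1 F)%E)
  /\
  (exists C : R,
   forall (N : nat) (hqN : (q <= N)%N) (hN : (2 <= N)%N)
      (dO' : measure_display) (O' : measurableType dO')
      (P' : probability O' R) (U V : nat -> O' -> R) (r j : nat -> O' -> 'I_N)
      (Z : 'I_N -> O' -> Dhor d T),
     backward_system q Lambda P' Pi mu P0 U V r j Z ->
     (forall l, (l <= l0)%N ->
        is_measure_bounded_by C (Delta P' hqN Lambda U V r j Z l)) /\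
     is_measure_bounded_by C (Deltabar P' hqN Lambda U V r j Z l0.+1)).
Proof.
have mu_le x : (mu x setT <= Lambda%:E)%E.
  by apply: le_trans hmu_le; apply: ereal_sup_ubound; exists x.
split.
  (* The kernel is replaced by its finite version throughout. *)
  have [mu' muE] := finite_kernel_bounded mu_le; rewrite muE in hmu_sym mu_le *.
  move=> N qN N2 F bF _ dO O P Zbar HZbar dO' O' P' U V r j Z HZ.
  rewrite -(expansion hLambda qN N2 HZ l0.+1 bF).
  apply: expectation_empirical => //.
    move=> i; have [X' [tau' [I' [_ _ [Y [acc [HK [[_ _ mZ _] _ _ _]]]]]]]] := HZbar.
    exact: (measurableT_comp (@measurable_restr R d T) (mZ i)).
  move=> a a_inj; have [mF _] := bF.
  exact: (integral_tuple hLambda mu_le hmu_sym hPi hT qN N2 HZbar HZ a_inj mF).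
(* One constant for the [l0 + 1] terms and the remainder: the sum of their nonnegative bounds, none
   of which depends on [N]. *)
exists (\sum_(l < l0.+2) tail_bound q Lambda T l) => N qN N2 dO' O' P' U V r j Z HZ.
have bl l : (l < l0.+2)%N -> tail_bound q Lambda T l <= \sum_(l < l0.+2) tail_bound q Lambda T l.
  move=> ll; rewrite (bigD1 (Ordinal ll))//= lerDl sumr_ge0// => i _.
  by rewrite mulr_ge0 ?expR_ge0.
have mL := measurable_loops hLambda HZ.
split=> [l ll|].
  apply: (bounded_term hLambda hT qN N2 HZ) => //; last by apply: bl; lia.
    by apply: (measurable_preim mL (A := [set _])).
  by move=> w /= ->.
apply: (bounded_term hLambda hT qN N2 HZ) => //; last by apply: bl; lia.
by apply: emeasurable_le_fun; [exact: measurable_cst|exact: mL].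
Qed.
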